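(* Let $\Omega\Subset\Sigma$ be open and relatively compact with $\mathrm{dist}(\Omega,\partial\Sigma)>C_\Omega(h\ln h^{-1})^{2/3}$ for some constant $C_\Omega>0$, let $\delta$ be the coupling constant of the context with $\kappa>0$ large enough, and let $\Psi_2(z;h,\delta)$, $\Theta(z;h,\delta)$ be the functions of the context. Then for $z\in\Omega$ with $|\mathrm{Im}\,z-\langle\mathrm{Im}\,g\rangle|>1/C$, with $C\gg1$ large enough, $$\Psi_2\,e^{-\Theta}=\left[\frac{|\partial_{\mathrm{Im}\,z}S|^2}{h^2}\,\Theta\,\Big(1+\mathcal O\big(d(z)^{-3/4}h^{1/2}\big)\Big)+\mathcal O\big(d(z)^{5/4}\big)\right]e^{-\Theta}.$$
   Context: Operator. $S^1=\mathbb R/2\pi\mathbb Z$, $D_x=\frac1i\frac{d}{dx}$, $0<h\ll1$. $g\in\mathcal C^\infty(S^1;\mathbb C)$ is such that $\mathrm{Im}\,g$ has exactly two critical points, a minimum at $a$ and a maximum at $b$, $a<b<a+2\pi$, with $0=\mathrm{Im}\,g(a)<\mathrm{Im}\,g(b)$, both nondegenerate. $P_h=hD_x+g(x)$ on $L^2(S^1)$ with domain the semiclassical Sobolev space $H^1(S^1)$. $p(x,\xi)=\xi+g(x)$ on $T^*S^1$, $\Sigma=\overline{p(T^*S^1)}$, $d(z)=\mathrm{dist}(z,\partial\Sigma)$. For $z$ in the interior of $\Sigma$ the equation $p=z$ has exactly two solutions $\rho_\pm(z)=(x_\pm(z),\xi_\pm(z))$, with $\mathrm{Im}\,g(x_\pm)=\mathrm{Im}\,z$,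 $\pm\mathrm{Im}\,g'(x_\pm)<0$, $\xi_\pm=\mathrm{Re}\,z-\mathrm{Re}\,g(x_\pm)$; $x_\pm$ are identified with real numbers such that $x_--2\pi<x_+<x_-$. $\{p,\overline p\}=p'_\xi\overline p'_x-p'_x\overline p'_\xi$. $\langle\mathrm{Im}\,g\rangle=\frac1{2\pi}\int_{S^1}\mathrm{Im}\,g$. $S(z)=\min\big(\mathrm{Im}\int_{x_+}^{x_-}(z-g(y))dy,\ \mathrm{Im}\int_{x_+}^{x_--2\pi}(z-g(y))dy\big)$ depends only on $\mathrm{Im}\,z$ (one also writes $S(y)$ for real $y=\mathrm{Im}\,z$); $\partial_{\mathrm{Im}\,z}S=x_--x_+$ if $\mathrm{Im}\,z\le\langle\mathrm{Im}\,g\rangle$ and $x_--2\pi-x_+$ if $\mathrm{Im}\,z>\langle\mathrm{Im}\,g\rangle$. Auxiliary operators. $Q(z)=(P_h-z)^*(P_h-z)$ and $\tilde Q(z)=(P_h-z)(P_h-z)^*$ (domains $H^2(S^1)$) have the same discrete spectrum $0\le t_0^2(z)\le t_1^2(z)\le\dots$. $e_0(z)$, $f_0(z)$ are normalized eigenfunctions of $Q(z)$, $\tilde Q(z)$ for the (simple) eigenvalue $t_0^2(z)$, depending smoothly on $z$. Random perturbation and coupling. $P_h^\delta=P_h+\delta Q_\omega$, $Q_\omega u=\sum_{|j|,|k|\le\lfloor C_1/h\rfloor}\alpha_{j,k}(u|e^k)e^j$, $C_1>0$ large enough, $e^k(x)=(2\pi)^{-1/2}e^{ikx}$, $\alpha=(\alpha_{j,k})\in\mathbb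 C^N$, $N=(2\lfloor C_1/h\rfloor+1)^2$, with i.i.d. $\mathcal N_{\mathbb C}(0,1)$ entries. $\delta=\sqrt h\,e^{-\epsilon_0(h)/h}$ with $(\kappa-\frac12)h\ln(h^{-1})+C_3h\le\epsilon_0(h)<S(\langle\mathrm{Im}\,g\rangle)$, $C_3>0$ large, the last inequality uniform in $h$. Average density. $\Xi=\sum_{z\in\sigma(P_h^\delta)}\delta_z$ counts the eigenvalues (with multiplicity). With $R=C/h$ and $C-C_1$ large enough, there is $C_2>0$ with $\mathbb E[\Xi(\varphi)\mathbf 1_{\{\alpha\in B(0,R)\}}]=\int\varphi D\,L(dz)+\mathcal O(\|\varphi\|_\infty e^{-C_2/h^2})$ for $\varphi\in\mathcal C_0(\Omega)$, where the average density is the smooth function $$D(z,h,\delta)=\frac{1+\mathcal O(\delta h^{-3/2}d(z)^{-1/4})}{\pi}\big(\Psi_1(z;h)+\Psi_2(z;h,\delta)\big)e^{-\Theta(z;h,\delta)},$$ $\Psi_1=\frac1h\big\{\frac{i}{\{p,\overline p\}(\rho_+)}+\frac{i}{\{\overline p,p\}(\rho_-)}\big\}+\mathcal O(d(z)^{-2})$, $\Psi_2=\delta^{-2}|(e_0|f_0)|^2(1+\mathcal O(d(z)^{-3/4}h^{1/2}))$, $\Theta=\frac{|([P_h,\chi]e_0|f_0)+\mathcal O(d(z)^{-1/4}h^{-5/2}\delta^2)|^2}{\delta^2(1+\mathcal O(h^\infty))}(1+\mathcal O(e^{-\tilde r/h}))$ with $\tilde r\asymp d(z)^{3/2}$; here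 $\chi\in\mathcal C_0^\infty(S^1)$ equals $1$ in a small neighborhood of $\overline{\{x_-(z):z\in\Omega\}}$ and vanishes near $\overline{\{x_+(z):z\in\Omega\}}$. $\mathcal O(\cdot)$ is uniform in $z$ and small $h$; $A\asymp B$ means $C^{-1}B\le A\le CB$ for some constant $C>0$. *)

(* Defs.v *)
From HB Require Import structures.
From mathcomp Require Import all_boot all_order all_algebra.
From mathcomp Require Import all_classical all_reals all_analysis.
From mathcomp Require Export complex.
Set Implicit Arguments.
Unset Strict Implicit.
Unset Printing Implicit Defensive.
Import Order.TTheory GRing.Theory Num.Theory numFieldNormedType.Exports.
Import Normc.
Local Open Scope classical_set_scope.
Local Open Scope ring_scope.
Local Open Scope complex_scope.

(* Functions on S^1 = R / 2 pi Z are represented by 2 pi-periodic functions on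
   R.  Complex numbers carry their usual topology through the alias R[i]^o, the
   real modulus is [normc], and the small parameter h is handled by the filter
   0^'+ . *)

(** ** Smooth and square-integrable functions on the circle *)

Definition smooth (R : realType) (f : R -> R) : Prop :=
  forall (n : nat) (x : R), derivable (derive1n n f) x 1.

Definition smooth_circle (R : realType) (f : R -> R) : Prop :=
  periodic f (2 * pi) /\ smooth f.

Definition csmooth_circle (R : realType) (f : R -> R[i]) : Prop :=
  smooth_circle (fun x => complex.Re (f x)) /\
  smooth_circle (fun x => complex.Im (f x)).

Definition cderive (R : realType) (f : R -> R[i]) (x : R) : R[i] :=
  derive1 (fun t => complex.Re (f t)) x +i* derive1 (fun t => complex.Im (f t)) x.

Definition cint (R : realType) (D : set R) (f : R -> R[i]) : R[i] :=
  (\int[lebesgue_measure]_(x in D) complex.Re (f x)) +i*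
  (\int[lebesgue_measure]_(x in D) complex.Im (f x)).

Definition oriented_int (R : realType) (a b : R) (f : R -> R[i]) : R[i] :=
  if a <= b then cint `[a, b] f else - cint `[b, a] f.

Definition L2 (R : realType) (u : R -> R[i]) : Prop :=
  [/\ periodic u (2 * pi),
      measurable_fun setT (fun x => complex.Re (u x)),
      measurable_fun setT (fun x => complex.Im (u x)) &
      lebesgue_measure.-integrable `[0, 2 * pi]
        (fun x => ((normc (u x)) ^+ 2)%:E)].

(* (u|v), linear in u. *)
Definition dotp (R : realType) (u v : R -> R[i]) : R[i] :=
  cint `[0, 2 * pi] (fun x => u x * conjc (v x)).

Definition L2norm (R : realType) (u : R -> R[i]) : R :=
  Num.sqrt (complex.Re (dotp u u)).

(* u belongs to H^1(S^1) and v represents D_x u = u' / i : the derivative is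
   taken in the sense of distributions. *)
Definition weakD (R : realType) (u v : R -> R[i]) : Prop :=
  [/\ L2 u, L2 v &
      forall phi : R -> R[i], csmooth_circle phi ->
        dotp u (fun x => (0 +i* 1)^-1 * cderive phi x) = dotp v phi].

(** ** Unbounded operators on L^2(S^1) *)

(* An operator is given by its graph; [A u w] means that u is in the domain of
   A and w represents A u.  Elements of L^2 are represented by functions, so
   graphs are relations that do not separate functions equal almost
   everywhere. *)
Definition operator (R : realType) : Type :=
  (R -> R[i]) -> (R -> R[i]) -> Prop.

Definition op_shift (R : realType) (A : operator R) (z : R[i]) : operator R :=
  fun u w => exists2 v, A u v & w = (fun x => v x - z * u x).

Definition op_adj (R : realType) (A : operator R) : operator R :=
  fun f w => [/\ L2 f, L2 w & forall u v, A u v -> dotp v f = dotp u w].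

Definition op_comp (R : realType) (B A : operator R) : operator R :=
  fun u w => exists2 v, A u v & B v w.

(* The commutator [A, chi] with the multiplication by chi. *)
Definition op_comm (R : realType) (A : operator R) (chi : R -> R) :
    operator R :=
  fun u w => exists v1 v2 : R -> R[i],
    [/\ A u v1, A (fun x => (chi x)%:C * u x) v2 &
        w = (fun x => v2 x - (chi x)%:C * v1 x)].

Definition eigenfunction (R : realType) (A : operator R) (t : R)
    (u : R -> R[i]) : Prop :=
  [/\ L2 u, L2norm u != 0 & A u (fun x => t%:C * u x)].

Definition lowest_simple_eigenvalue (R : realType) (A : operator R) (t : R) :
    Prop :=
  [/\ exists u, eigenfunction A t u,
      forall s u, eigenfunction A s u -> t <= s &
      forall u v, eigenfunction A t u -> eigenfunction A t v ->
        exists c : R[i], L2norm (fun x => v x - c * u x) = 0].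

(* P_h = h D_x + g(x) with domain H^1(S^1). *)
Definition P_op (R : realType) (g : R -> R[i]) (h : R) : operator R :=
  fun u w => exists2 v, weakD u v & w = (fun x => h%:C * v x + g x * u x).

Definition Q_op (R : realType) (g : R -> R[i]) (h : R) (z : R[i]) :
    operator R :=
  let A := op_shift (P_op g h) z in op_comp (op_adj A) A.

Definition Qt_op (R : realType) (g : R -> R[i]) (h : R) (z : R[i]) :
    operator R :=
  let A := op_shift (P_op g h) z in op_comp A (op_adj A).

(* [e] is a C^infinity map from the open set U of the complex plane to
   L^2(S^1); E j k is its partial derivative of order j in Re z and k in Im z. *)
Definition smooth_L2_family (R : realType) (U : set R[i]^o)
    (e : R[i] -> R -> R[i]) : Prop :=
  exists E : nat -> nat -> R[i] -> R -> R[i],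
    (forall z, U z -> E 0%N 0%N z = e z) /\
    forall (j k : nat) (z : R[i]^o), U z ->
    [/\ L2 (E j k z),
        L2norm (fun x => E j k w x - E j k z x) @[w --> z] --> (0 : R),
        L2norm (fun x => (E j k (z + s%:C) x - E j k z x) / s%:C
                         - E j.+1 k z x) @[s --> (0 : R)^'] --> (0 : R) &
        L2norm (fun x => (E j k (z + s*i) x - E j k z x) / s%:C
                         - E j k.+1 z x) @[s --> (0 : R)^'] --> (0 : R)].

(** ** The symbol, the classical spectrum and the action *)

(* Im g has exactly two critical points modulo 2 pi, a minimum at a and a
   maximum at b, both nondegenerate. *)
Definition admissible_symbol (R : realType) (g : R -> R[i]) (a b : R) : Prop :=
  let img x := complex.Im (g x) in
  [/\ csmooth_circle g,
      a < b < a + 2 * pi,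
      forall x, derive1 img x = 0 <->
        exists k : int, x = a + 2 * pi * k%:~R \/ x = b + 2 * pi * k%:~R,
      (img a = 0 /\ 0 < img b /\ forall x, img a <= img x <= img b) &
      (derive1n 2 img a != 0 /\ derive1n 2 img b != 0)].

Definition symbol (R : realType) (g : R -> R[i]) (x xi : R) : R[i] :=
  xi%:C + g x.

Definition Sigma (R : realType) (g : R -> R[i]) : set R[i]^o :=
  closure [set z : R[i]^o | exists x xi : R, z = symbol g x xi].

Definition boundary (T : topologicalType) (A : set T) : set T :=
  closure A `\` A°.

(* Equal to +oo if one of the sets is empty. *)
Definition set_dist (R : realType) (A B : set R[i]^o) : \bar R :=
  ereal_inf [set (normc (z - w))%:E | z in A & w in B].

Definition dist_bd (R : realType) (g : R -> R[i]) (z : R[i]) : R :=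
  fine (set_dist [set z] (boundary (Sigma g))).

Definition mean_Im (R : realType) (g : R -> R[i]) : R :=
  (2 * pi)^-1 *
  \int[lebesgue_measure]_(x in `[0, 2 * pi]) complex.Im (g x).

(* xp and xm are the base points x_+ and x_- , lifted to R. *)
Definition base_points (R : realType) (g : R -> R[i]) (xp xm : R[i] -> R) :
    Prop :=
  let img x := complex.Im (g x) in
  forall z : R[i]^o, (Sigma g)° z ->
  [/\ img (xp z) = complex.Im z, img (xm z) = complex.Im z,
      derive1 img (xp z) < 0, 0 < derive1 img (xm z) &
      xm z - 2 * pi < xp z < xm z].

Definition action (R : realType) (g : R -> R[i]) (xp xm : R[i] -> R)
    (z : R[i]) : R :=
  Num.min
    (complex.Im (oriented_int (xp z) (xm z) (fun y => z - g y)))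
    (complex.Im (oriented_int (xp z) (xm z - 2 * pi) (fun y => z - g y))).

(* The action depends only on Im z. *)
Definition dIm_action (R : realType) (g : R -> R[i]) (xp xm : R[i] -> R)
    (z : R[i]) : R :=
  derive1 (fun t : R => action g xp xm (complex.Re z +i* t)) (complex.Im z).

(** ** Asymptotics, uniform in z *)

Definition unif_O (R : realType) (Om : R -> set R[i]^o)
    (F G : R -> R[i] -> R) : Prop :=
  exists2 K : R, 0 < K &
    \forall h \near 0^'+, forall z, Om h z -> `|F h z| <= K * G h z.

Definition unif_asymp (R : realType) (Om : R -> set R[i]^o)
    (F G : R -> R[i] -> R) : Prop :=
  exists2 K : R, 0 < K &
    \forall h \near 0^'+, forall z, Om h z ->
      K^-1 * G h z <= F h z <= K * G h z.

(* Omega is allowed to depend on h, as it may approach the boundary of Sigma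
   when h tends to 0. *)
Definition admissible_domain (R : realType) (g : R -> R[i])
    (Om : R -> set R[i]^o) (COm : R) : Prop :=
  \forall h \near 0^'+,
  [/\ open (Om h), compact (closure (Om h)), closure (Om h) `<=` Sigma g &
      ((COm * (h * ln h^-1) `^ (2 / 3))%:E
         < set_dist (Om h) (boundary (Sigma g)))%E].

(* chi is 1 near x_-(z) and 0 near x_+(z), for z in Omega.  The radius of the
   neighborhoods is a fraction of d(z)^(1/2), which is the order of magnitude
   of the distance from x_+(z) to x_-(z) in S^1; when Omega does not depend on
   h, so that d is bounded below on Omega, these are arbitrary small
   neighborhoods of the closures of {x_-(z)} and {x_+(z)}. *)
Definition cutoff (R : realType) (g : R -> R[i]) (xp xm : R[i] -> R)
    (Om : R -> set R[i]^o) (chi : R -> R -> R) : Prop :=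
  exists M c : R, 0 < c /\
  \forall h \near 0^'+,
  [/\ smooth_circle (chi h), forall x, `|chi h x| <= M &
      forall z x, Om h z ->
        (`|x - xm z| < c * Num.sqrt (dist_bd g z) -> chi h x = 1) /\
        (`|x - xp z| < c * Num.sqrt (dist_bd g z) -> chi h x = 0)].

(* t0^2 is the lowest eigenvalue of Q(z) and of Qt(z), and e0, f0 are
   corresponding normalized eigenfunctions. *)
Definition ground_states (R : realType) (g : R -> R[i]) (Om : R -> set R[i]^o)
    (t0 : R -> R[i] -> R) (e0 f0 : R -> R[i] -> R -> R[i]) : Prop :=
  \forall h \near 0^'+,
  [/\ forall z, Om h z ->
      [/\ 0 <= t0 h z,
          lowest_simple_eigenvalue (Q_op g h z) (t0 h z ^+ 2),
          lowest_simple_eigenvalue (Qt_op g h z) (t0 h z ^+ 2),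
          eigenfunction (Q_op g h z) (t0 h z ^+ 2) (e0 h z) /\
            L2norm (e0 h z) = 1 &
          eigenfunction (Qt_op g h z) (t0 h z ^+ 2) (f0 h z) /\
            L2norm (f0 h z) = 1],
      smooth_L2_family (Om h) (e0 h) &
      smooth_L2_family (Om h) (f0 h)].

(** ** The coupling constant and the functions Psi_2 and Theta *)

(* The average density of eigenvalues of P_h + delta Q_omega is expressed
   through functions Psi_2 and Theta known up to error terms.  These functions
   are characterized here by their representations alone, whatever the
   functions realizing the error terms. *)

Definition coupling_exponent (R : realType) (g : R -> R[i])
    (xp xm : R[i] -> R) (kappa C3 : R) (eps0 : R -> R) : Prop :=
  (\forall h \near 0^'+,
     (kappa - 2^-1) * h * ln h^-1 + C3 * h <= eps0 h) /\
  exists2 c : R, 0 < c &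
    \forall h \near 0^'+, eps0 h <= action g xp xm ((mean_Im g)*i) - c.

Definition coupling (R : realType) (eps0 : R -> R) (h : R) : R :=
  Num.sqrt h * expR (- eps0 h / h).

Definition Psi2_form (R : realType) (g : R -> R[i]) (Om : R -> set R[i]^o)
    (e0 f0 : R -> R[i] -> R -> R[i]) (delta : R -> R)
    (Psi2 : R -> R[i] -> R) : Prop :=
  exists r : R -> R[i] -> R,
    unif_O Om r (fun h z => dist_bd g z `^ (- (3 / 4)) * h `^ (1 / 2)) /\
    \forall h \near 0^'+, forall z, Om h z ->
      Psi2 h z =
        (delta h) ^- 2 * normc (dotp (e0 h z) (f0 h z)) ^+ 2 * (1 + r h z).

Definition Theta_form (R : realType) (g : R -> R[i]) (Om : R -> set R[i]^o)
    (chi : R -> R -> R) (e0 f0 : R -> R[i] -> R -> R[i]) (delta : R -> R)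
    (Theta : R -> R[i] -> R) : Prop :=
  exists (r1 : R -> R[i] -> R[i]) (r2 r3 rt : R -> R[i] -> R),
  [/\ unif_O Om (fun h z => normc (r1 h z))
        (fun h z => dist_bd g z `^ (- (1 / 4)) * h `^ (- (5 / 2))
                    * delta h ^+ 2),
      forall n : nat, unif_O Om r2 (fun h _ => h ^+ n),
      unif_asymp Om rt (fun _ z => dist_bd g z `^ (3 / 2)),
      unif_O Om r3 (fun h z => expR (- rt h z / h)) &
      \forall h \near 0^'+, forall z, Om h z ->
        exists2 w, op_comm (P_op g h) (chi h) (e0 h z) w &
          Theta h z = normc (dotp w (f0 h z) + r1 h z) ^+ 2
                      / (delta h ^+ 2 * (1 + r2 h z)) * (1 + r3 h z)].

(* Main.v *)
(** After conjugation by the phase exp((i/h) \int Re(z - g)) and by sqrt W, where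
    W = exp((2/h) \int (Im z - Im g)), the ground states e of Q(z) and f of \tilde Q(z)
    solve the real system p' = - s W q, q' = s p / W with s = t_0/h and Floquet boundary
    conditions.  A trace argument bounds the lowest admissible s from above by the tunnelling
    integrals of W and 1/W, and for such s the function p is nearly constant on the half of
    the well where 1/W lives and q on the half where W lives.  Hence |e|^2 concentrates at
    x_+ and |f|^2 at x_-, within a distance of order (h/sqrt d)^(1/2).

    Two identities finish the argument.  First, up to a factor of modulus one,
    ([P,chi]e|f) = t_0 (\int chi |e|^2 - \int chi |f|^2), which is close to - t_0.  Second,
    (e \bar f)' = (i t_0/h)(|f|^2 - |e|^2), integrated against x over a period, shows that
    |(e|f)| is close to (t_0/h) |dS/dIm z|.  So |(e|f)|^2 is close to
    |dS/dIm z|^2 h^-2 |([P,chi]e|f)|^2.  The case Im z > <Im g> is obtained by exchanging the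
    roles of e and f and of the minimum and maximum of Im g. *)

Require Import Defs.
From HB Require Import structures.
From mathcomp Require Import all_boot all_order all_algebra.
From mathcomp Require Import all_classical all_reals all_analysis.
From mathcomp Require Import measurable_realfun ring lra.
Set Implicit Arguments.
Unset Strict Implicit.
Unset Printing Implicit Defensive.
Import Order.TTheory GRing.Theory Num.Theory numFieldNormedType.Exports.
Local Open Scope classical_set_scope.
Local Open Scope ring_scope.
Import Normc.
Local Open Scope complex_scope.

(** * Primitives *)

(** The obstacle is uniformity: d(z) may tend to 0 with h, so the well may shrink. All estimates use
    the scale [k], the square root of Im z or of its distance to max Im g, comparable with the half
    widths of the well, and the width [sg] = sqrt (h / k) of the peaks. The distance from x_+ to x_-
    and the radius of the cut-off are at least of order d^(1/2), so a displacement of size [sg]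
    costs a relative error O(d^(-3/4) h^(1/2)), the error of the statement; the assumption on the
    distance to the boundary of Sigma makes it small.

    No approximate eigenfunction is constructed. Every nontrivial Floquet solution with parameter s
    > 0 is an eigenfunction of Q(z) for (h s)^2, so t_0 / h is the least such s; this is what gives
    s^2 V Vo <= 4, with V and Vo the integrals of 1/W and W on the two halves of the well. The
    assumption on |Im z - <Im g>| makes the Floquet factor exponentially small, so that the circle
    can be cut where both ends are negligible. Finally kappa >= 5 gives delta <= h^5, and the
    additive error in Theta disappears in O(d^(5/4)). *)

Section Calculus.
Variable R : realType.
Implicit Types f g F G : R -> R.

(** A predicate rather than an operator: the rules of derivation then compose without side
    conditions, and [prim_eq] adapts the derivative to any equal expression. *)
Definition primitive F f := forall x : R, is_derive x (1 : R) F (f x).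

Lemma prim_continuous F f : primitive F f -> continuous F.
Proof.
move=> H x; apply: differentiable_continuous; apply/derivable1_diffP.
by have [] := H x.
Qed.

Lemma prim_derive1 F f : primitive F f -> derive1 F = f.
Proof. by move=> H; apply/funext => x; have [_] := H x; rewrite derive1E. Qed.

Lemma prim_eq F f g : primitive F f -> f =1 g -> primitive F g.
Proof. by move=> H fg x; rewrite -fg. Qed.

Lemma prim_cst (c : R) : primitive (fun _ => c) (fun _ => 0).
Proof. by move=> x; exact: is_derive_cst. Qed.

Lemma prim_id : primitive (fun x => x) (fun _ => 1).
Proof. by move=> x; exact: is_derive_id. Qed.

Lemma primD F f G g : primitive F f -> primitive G g ->
  primitive (fun x => F x + G x) (fun x => f x + g x).
Proof. by move=> HF HG x; have := HF x; have := HG x => ? ?; exact: is_deriveD. Qed.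

Lemma primN F f : primitive F f -> primitive (fun x => - F x) (fun x => - f x).
Proof. by move=> HF x; have := HF x => ?; exact: is_deriveN. Qed.

Lemma primB F f G g : primitive F f -> primitive G g ->
  primitive (fun x => F x - G x) (fun x => f x - g x).
Proof. by move=> HF HG; apply: primD => //; exact: primN. Qed.

Lemma primM F f G g : primitive F f -> primitive G g ->
  primitive (fun x => F x * G x) (fun x => f x * G x + F x * g x).
Proof.
move=> HF HG x; have := HF x; have := HG x => ? ?.
by apply: is_derive_eq; rewrite /GRing.scale /= addrC [G x * _]mulrC.
Qed.

Lemma primZ (c : R) F f : primitive F f ->
  primitive (fun x => c * F x) (fun x => c * f x).
Proof.
move=> H; apply: prim_eq (primM (prim_cst c) H) _ => x /=.
by rewrite mul0r add0r.
Qed.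

Lemma prim_comp F f G g : primitive F f -> primitive G g ->
  primitive (fun x => F (G x)) (fun x => f (G x) * g x).
Proof.
move=> HF HG x; have := HF (G x); have := HG x => ? ?.
exact: is_derive1_comp.
Qed.

Lemma prim_expR F f : primitive F f ->
  primitive (fun x => expR (F x)) (fun x => f x * expR (F x)).
Proof.
move=> H; apply: prim_eq (prim_comp (f := expR) _ H) _ => [x|x /=].
  exact: is_derive_expR.
by rewrite mulrC.
Qed.

Lemma prim_sin F f : primitive F f ->
  primitive (fun x => sin (F x)) (fun x => f x * cos (F x)).
Proof.
move=> H; apply: prim_eq (prim_comp (f := cos) _ H) _ => [x|x /=].
  exact: is_derive_sin.
by rewrite mulrC.
Qed.

Lemma prim_cos F f : primitive F f ->
  primitive (fun x => cos (F x)) (fun x => - (f x * sin (F x))).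
Proof.
move=> H; apply: prim_eq (prim_comp (f := fun t => - sin t) _ H) _ => [x|x /=].
  exact: is_derive_cos.
by rewrite mulNr mulrC.
Qed.

Lemma primV F f : primitive F f -> (forall x, F x != 0) ->
  primitive (fun x => (F x)^-1) (fun x => - (f x / F x ^+ 2)).
Proof.
move=> HF F0 x; have := HF x => ?.
have := is_deriveV (F0 x) (HF x).
by rewrite /GRing.scale /= mulNr [f x / _]mulrC.
Qed.

Lemma prim_shift F f (c : R) : primitive F f ->
  primitive (fun x => F (x + c)) (fun x => f (x + c)).
Proof.
move=> H; apply: prim_eq (prim_comp H (primD prim_id (prim_cst c))) _ => x /=.
by rewrite addr0 mulr1.
Qed.

(** The mean value theorem for [G - F]. It plays the role of monotonicity of the integral in the
    estimates below. *)
Lemma prim_le F f G g (a b : R) : primitive F f -> primitive G g -> a <= b ->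
  (forall x, a <= x <= b -> f x <= g x) -> F b - F a <= G b - G a.
Proof.
move=> HF HG ab fg.
have HD := primB HG HF.
have [|c|c /[!in_itv] /= cab] :=
  @MVT_segment _ (fun x => G x - F x) (fun x => g x - f x) _ _ ab.
- by move=> x _; exact: HD.
- exact: (@continuous_subspaceT _ _ _ _ (prim_continuous HD)).
move=> E; rewrite -subr_ge0.
have -> : G b - G a - (F b - F a) = (G b - F b) - (G a - F a) by ring.
by rewrite E mulr_ge0 ?subr_ge0 ?fg.
Qed.

Lemma prim_const F : primitive F (fun _ => 0) -> forall x y, F x = F y.
Proof. by move=> H x y; exact: is_derive_0_is_cst. Qed.

Lemma prim_unique F G f : primitive F f -> primitive G f ->
  forall x y, F x - F y = G x - G y.
Proof.
move=> HF HG x y.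
have H : primitive (fun x => F x - G x) (fun _ => 0).
  by apply: prim_eq (primB HF HG) _ => t /=; rewrite subrr.
by have := prim_const H x y; lra.
Qed.

Lemma prim_nondecreasing F f (a b : R) : primitive F f -> a <= b ->
  (forall x, a <= x <= b -> 0 <= f x) -> F a <= F b.
Proof.
move=> H ab f0; have := prim_le (prim_cst 0) H ab f0.
by rewrite subrr subr_ge0.
Qed.

Lemma prim_nonincreasing F f (a b : R) : primitive F f -> a <= b ->
  (forall x, a <= x <= b -> f x <= 0) -> F b <= F a.
Proof.
move=> H ab f0; have := prim_le H (prim_cst 0) ab f0.
by rewrite subrr subr_le0.
Qed.

Lemma prim_increasing F f (a b : R) : primitive F f -> a < b ->
  (forall x, a < x < b -> 0 < f x) -> F a < F b.
Proof.
move=> H ab f0.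
have [|c|c /[!in_itv] /= cab E] := @MVT _ F f _ _ ab.
- by move=> x _; exact: H.
- exact: (@continuous_subspaceT _ _ _ _ (prim_continuous H)).
by rewrite -subr_gt0 E mulr_gt0 ?subr_gt0 ?f0.
Qed.

Lemma prim_decreasing F f (a b : R) : primitive F f -> a < b ->
  (forall x, a < x < b -> f x < 0) -> F b < F a.
Proof.
move=> H ab f0; rewrite -ltrN2; apply: (prim_increasing (primN H)) => // x xab.
by rewrite oppr_gt0 f0.
Qed.

Lemma continuous_integrable f (a b : R) : continuous f ->
  lebesgue_measure.-integrable `[a, b] (EFin \o f).
Proof.
move=> cf; apply: continuous_compact_integrable; first exact: segment_compact.
exact: continuous_subspaceT.
Qed.

Lemma prim_Rintegral F f (a b : R) : primitive F f -> continuous f -> a <= b ->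
  \int[lebesgue_measure]_(x in `[a, b]) f x = F b - F a.
Proof.
move=> HF cf; rewrite le_eqVlt => /predU1P[->|ab].
  by rewrite set_itv1 Rintegral_set1 subrr.
rewrite /Rintegral (@continuous_FTC2 _ f F)//.
- exact: continuous_subspaceT.
- split; first by move=> x _; have [] := HF x.
  + by apply: cvg_at_right_filter; exact: prim_continuous HF a.
  + by apply: cvg_at_left_filter; exact: prim_continuous HF b.
- by move=> x _; rewrite (prim_derive1 HF).
Qed.

Lemma prim_exists f (a : R) : continuous f ->
  exists2 F, primitive F f & F a = 0.
Proof.
move=> cf.
pose G (b x : R) := \int[lebesgue_measure]_(t in `[b, x]) f t.
have dG (b x : R) : b < x -> is_derive x (1 : R) (G b) (f x).
  move=> bx.
  have xx1 : x < x + 1 by rewrite ltrDl.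
  have [d1 d2] := continuous_FTC1_closed xx1 (continuous_integrable b (x + 1) cf) bx (cf x).
  by rewrite derive1E in d2; exact: (DeriveDef d1 d2).
have chasles (b c x : R) : b <= c -> c <= x -> G b x = G b c + G c x.
  move=> bc cx.
  have := @Rintegral_itvB _ f (BLeft b) (BRight x) c (continuous_integrable b x cf).
  rewrite !bnd_simp => /(_ bc cx).
  rewrite Rintegral_itv_obnd_cbnd; last first.
    apply: integrableS (continuous_integrable b x cf) => //.
    by apply: subset_itv; rewrite bnd_simp.
  by rewrite -/(G b x) -/(G b c) -/(G c x) => <-; rewrite addrC subrK.
(* The integral over [[b, x]] is 0 for x < b, so the base point must lie below both [a] and [x]; by
   additivity [H] does not depend on it. The base point [m x - 1] then serves for all t at distance
   less than 1 from x. *)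
pose m (x : R) := Num.min a x - 1.
have mP (b x : R) : b <= m x -> b <= a /\ b <= x.
  by rewrite /m; case: (leP a x) => *; lra.
pose H (x : R) := G (m x) x - G (m x) a.
have HE (b x : R) : b <= m x -> H x = G b x - G b a.
  move=> bm; have [m1 m2] := mP (m x) x (lexx _).
  by rewrite /H (chasles b (m x) x)// (chasles b (m x) a)//; lra.
exists H; last by rewrite /H subrr.
move=> x.
have bx : m x - 1 < x by have := mP (m x) x (lexx _); lra.
have : is_derive x (1 : R) (fun t => G (m x - 1) t - G (m x - 1) a) (f x).
  have ? := dG _ _ bx.
  by apply: is_derive_eq; rewrite subr0.
apply: near_eq_is_derive.
near=> t; rewrite (HE (m x - 1)) //.
have : `|x - t| < 1 by near: t; apply: nbhsx_ballx.
rewrite ltr_norml /m; case: (leP a x); case: (leP a t) => *; lra.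
Unshelve. all: by end_near. Qed.

End Calculus.

(** * Limits of series, term by term *)

Section TermwiseLimits.
Variable R : realType.

Lemma geometric_tail (t : nat -> R) (M : R) :
  (forall i, `|t i| <= 2^-1 ^+ i * M) ->
  cvgn (series t) /\
  forall n, `|series t n - limn (series t)| <= 2 * 2^-1 ^+ n * M.
Proof.
move=> tM.
have M0 : 0 <= M by have := tM 0%N; rewrite expr0 mul1r; apply: le_trans.
have cv : cvgn (series t).
  apply: normed_cvg.
  apply: (@series_le_cvg _ _ (fun i => M * 2^-1 ^+ i)) => [i|i|i|].
  - exact: normr_ge0.
  - by rewrite mulr_ge0// exprn_ge0// invr_ge0.
  - by rewrite mulrC; exact: tM.
  - by apply: is_cvg_geometric_series; rewrite ger0_norm ?invr_ge0// invf_lt1 ?ltr1n.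
split=> // n.
have bnd (m : nat) : `|series t (n + m)%N - series t n| <=
    2 * (2^-1 ^+ n - 2^-1 ^+ (n + m)%N) * M.
  elim: m => [|m IH].
    by rewrite addn0 (subrr (series t n)) (subrr (2^-1 ^+ n)) normr0 mulr0 mul0r.
  rewrite addnS /series/= big_nat_recr //= addrAC.
  apply: le_trans (ler_normD _ _) _.
  apply: le_trans (lerD IH (tM _)) _.
  by rewrite exprS le_eqVlt; apply/orP; left; apply/eqP; field.
rewrite distrC.
have cvn : (fun m => `|series t m - series t n|) @ \oo -->
    `|limn (series t) - series t n|.
  by apply: cvg_norm; apply: cvgB => //; exact: cvg_cst.
apply: (cvgr_to_le cvn).
near=> m.
have nm : (n <= m)%N by near: m; exact: nbhs_infty_ge.
have := bnd (m - n)%N; rewrite subnKC // => /le_trans; apply.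
rewrite ler_wpM2r // ler_wpM2l // gerBl exprn_ge0 // invr_ge0 //.
Unshelve. all: by end_near. Qed.

Lemma half_exp_small (M e : R) : 0 < e -> exists n : nat, 2^-1 ^+ n * M < e.
Proof.
move=> e0.
have : (fun n : nat => M * 2^-1 ^+ n) @ \oo --> 0.
  apply: cvg_geometric; rewrite ger0_norm ?invr_ge0 // invf_lt1 ?ltr1n //.
move/cvgrPdist_lt => /(_ _ e0) [n _ /(_ n (leqnn n))] /=.
rewrite sub0r normrN => H; exists n; rewrite mulrC.
by apply: le_lt_trans H; exact: ler_norm.
Qed.

(** A bound 2^-n [M x] with [M] continuous is locally uniform, which is all that continuity of the
    limit requires. *)
Lemma locally_uniform_continuous (F_ : nat -> R -> R) (F M : R -> R) :
  (forall n, continuous (F_ n)) -> continuous M ->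
  (forall n x, `|F_ n x - F x| <= 2^-1 ^+ n * M x) -> continuous F.
Proof.
move=> cF cM FM x; apply/cvgrPdist_lt => e e0.
have [n ne] := @half_exp_small (M x + 1) (e / 3) ltac:(by rewrite divr_gt0).
have e30 : 0 < e / 3 by rewrite divr_gt0.
near=> y.
have My : M y < M x + 1.
  have : `|M x - M y| < 1 by near: y; exact: (@cvgr_dist_lt _ _ _ _ _ M (M x) (cM x) 1 ltr01).
  by rewrite ltr_norml; lra.
have Fy : `|F_ n x - F_ n y| < e / 3.
  by near: y; exact: (@cvgr_dist_lt _ _ _ _ _ (F_ n) (F_ n x) (cF n x) _ e30).
have H1 : `|F_ n x - F x| < e / 3.
  apply: le_lt_trans (FM n x) _; apply: le_lt_trans ne.
  by rewrite ler_wpM2l ?exprn_ge0 ?invr_ge0 //; lra.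
have H2 : `|F_ n y - F y| < e / 3.
  apply: le_lt_trans (FM n y) _; apply: le_lt_trans ne.
  by rewrite ler_wpM2l ?exprn_ge0 ?invr_ge0 //; lra.
move: Fy H1 H2; rewrite !ltr_norml; lra.
Unshelve. all: by end_near. Qed.

Lemma prim_abs_le (F f G g : R -> R) (a b : R) : primitive F f -> primitive G g ->
  a <= b -> (forall x, a <= x <= b -> `|f x| <= g x) -> `|F b - F a| <= G b - G a.
Proof.
move=> HF HG ab fg; rewrite ler_norml; apply/andP; split.
  rewrite lerNl; have := prim_le (primN HF) HG ab.
  rewrite opprB opprK addrC; apply=> x xab.
  by apply: le_trans (fg x xab); rewrite -normrN ler_norm.
by apply: prim_le => // x xab; apply: le_trans (fg x xab); exact: ler_norm.
Qed.

(** Termwise differentiation by way of integration: the increments of [F_ n] are integrals of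
    [f_ n], and differ from those of a primitive of [f] by at most 2^-n times an increment of a
    primitive of [M]. *)
Lemma prim_limit (F_ f_ : nat -> R -> R) (F f M : R -> R) :
  (forall n, primitive (F_ n) (f_ n)) -> (forall n, continuous (f_ n)) ->
  continuous M -> (forall n x, `|f_ n x - f x| <= 2^-1 ^+ n * M x) ->
  (forall x, F_ n x @[n --> \oo] --> F x) -> primitive F f.
Proof.
move=> HF cf cM fM FF x0.
have cff := locally_uniform_continuous cf cM fM.
have [G HG G0] := prim_exists x0 cff.
have [N HN N0] := prim_exists x0 cM.
suff FG x : F x = F x0 + G x.
  have -> : F = (fun x => F x0 + G x) by apply/funext.
  have := primD (prim_cst (F x0)) HG x0; by rewrite add0r.
have key n : `|(F_ n x - F_ n x0) - G x| <= 2^-1 ^+ n * `|N x|.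
  have HD := primB (HF n) HG.
  have HE := primZ (2^-1 ^+ n) HN.
  have e0 : 0 <= (2^-1 : R) ^+ n by rewrite exprn_ge0 // invr_ge0.
  have [le|le] := leP x0 x.
    have := prim_abs_le HD HE le (fun t _ => fM n t).
    rewrite G0 N0 mulr0 !subr0 addrAC => /le_trans; apply.
    by rewrite ler_wpM2l // ler_norm.
  have := prim_abs_le HD HE (ltW le) (fun t _ => fM n t).
  rewrite G0 N0 mulr0 !subr0 sub0r distrC addrAC => /le_trans; apply.
  by rewrite -mulrN ler_wpM2l // -normrN ler_norm.
have c1 : (fun n => (F_ n x - F_ n x0) - G x) @ \oo --> (F x - F x0) - G x.
  by apply: cvgB; [exact: cvgB|exact: cvg_cst].
have c2 : (fun n => (F_ n x - F_ n x0) - G x) @ \oo --> (0 : R).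
  apply/cvgrPdist_lt => e /(half_exp_small `|N x|) [n ne].
  exists n => // m /= nm; rewrite sub0r normrN.
  apply: le_lt_trans (key m) _; apply: le_lt_trans ne.
  by rewrite ler_wpM2r // ler_wiXn2l // ?invr_ge0 // invf_le1 ?ler1n.
have E : F x - F x0 - G x = 0 by exact: (cvg_unique (@Rhausdorff R) c1 c2).
by lra.
Qed.

End TermwiseLimits.

(** * A linear system with parameter *)

Section LinearSystem.
Variable R : realType.
Variables (u v : R -> R) (a : R).
Hypotheses (cu : continuous u) (cv : continuous v)
  (u0 : forall x, 0 <= u x) (v0 : forall x, 0 <= v x).

Definition weight (n : nat) : R -> R := if odd n then u else v.

(* [get] makes this meaningful for continuous [f] only. *)
Definition prim_from (f : R -> R) : R -> R :=
  get [set F | primitive F f /\ F a = 0].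

Lemma prim_fromP f : continuous f ->
  primitive (prim_from f) f /\ prim_from f a = 0.
Proof.
move=> cf; have [F HF F0] := prim_exists a cf.
exact: (@getPex _ [set F | primitive F f /\ F a = 0] (ex_intro _ F (conj HF F0))).
Qed.

Fixpoint iter_int (n : nat) : R -> R :=
  if n is m.+1 then prim_from (fun x => weight m x * iter_int m x)
  else fun _ => 1.

Lemma weight_cont n : continuous (weight n).
Proof. by rewrite /weight; case: odd. Qed.

Lemma mul_cont (f g : R -> R) : continuous f -> continuous g ->
  continuous (fun x => f x * g x).
Proof. by move=> cf cg x; apply: cvgM; [exact: cf|exact: cg]. Qed.

Lemma iter_int_cont n : continuous (iter_int n).
Proof.
elim: n => [|n IH]; first exact: cst_continuous.
by have [/prim_continuous] := prim_fromP (mul_cont (@weight_cont n) IH).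
Qed.

Lemma iter_intP n : primitive (iter_int n.+1) (fun x => weight n x * iter_int n x).
Proof. by have [] := prim_fromP (mul_cont (@weight_cont n) (@iter_int_cont n)). Qed.

Lemma iter_int_a n : iter_int n.+1 a = 0.
Proof. by have [] := prim_fromP (mul_cont (@weight_cont n) (@iter_int_cont n)). Qed.

Definition total_weight : R -> R := prim_from (fun x => u x + v x).

Lemma uv_cont : continuous (fun x => u x + v x).
Proof. by move=> x; apply: cvgD; [exact: cu|exact: cv]. Qed.

Lemma total_weightP : primitive total_weight (fun x => u x + v x).
Proof. by have [] := prim_fromP uv_cont. Qed.

Lemma total_weight_a : total_weight a = 0.
Proof. by have [] := prim_fromP uv_cont. Qed.

Definition growth (l x : R) : R :=
  expR (l * total_weight x) + expR (- (l * total_weight x)).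

(** [growth l] is twice the hyperbolic cosine of [l * total_weight]: one integration against [u + v]
    yields the hyperbolic sine and a factor 1 / l. As [l] is free, the choice l = 2 (|s| + 1) in
    [majorant] makes the n-th term of the series at most 2^-n times a function of x and s. *)
Lemma iter_int_bound (l : R) n x : 0 < l ->
  `|iter_int n x| <= l ^- n * growth l x.
Proof.
move=> l0.
elim: n x => [|n IH] x.
  rewrite /= normr1 expr0 invr1 mul1r /growth expRN.
  have := expR_gt0 (l * total_weight x); set e := expR _ => e0.
  rewrite -subr_ge0 (_ : _ - _ = ((e - 2^-1) ^+ 2 + 3 / 4) / e); last first.
    by field; rewrite gt_eqF.
  by rewrite divr_ge0 ?(ltW e0) // addr_ge0 ?sqr_ge0.
have HW := primZ l total_weightP.
have HG : primitive (fun x => l ^- n.+1 * (expR (l * total_weight x) - expR (- (l * total_weight x))))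
    (fun x => (u x + v x) * (l ^- n * growth l x)).
  apply: prim_eq (primZ _ (primB (prim_expR HW) (prim_expR (primN HW)))) _ => t.
  rewrite /growth exprS invfM; field.
  by rewrite expf_neq0 ?gt_eqF.
have wle t : `|weight n t * iter_int n t| <= (u t + v t) * (l ^- n * growth l t).
  rewrite normrM; apply: ler_pM => //; rewrite ger0_norm /weight.
    by case: odd; rewrite ?lerDl ?lerDr.
  by case: odd.
have gx : l ^- n.+1 * `|expR (l * total_weight x) - expR (- (l * total_weight x))|
    <= l ^- n.+1 * growth l x.
  apply: ler_wpM2l; first by rewrite invr_ge0 exprn_ge0 // ltW.
  apply: le_trans (ler_normB _ _) _.
  by rewrite !ger0_norm ?expR_ge0.
have ln0 : 0 <= l ^- n.+1 by rewrite invr_ge0 exprn_ge0 // ltW.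
apply: le_trans gx.
have [le|le] := leP a x.
  have := prim_abs_le (@iter_intP n) HG le (fun t _ => wle t).
  rewrite iter_int_a total_weight_a mulr0 oppr0 subrr mulr0 ?subr0 ?addr0 => /le_trans; apply.
  by rewrite ler_wpM2l // ler_norm.
have := prim_abs_le (@iter_intP n) HG (ltW le) (fun t _ => wle t).
rewrite iter_int_a total_weight_a mulr0 oppr0 subrr mulr0 !sub0r normrN => /le_trans; apply.
by rewrite -mulrN ler_wpM2l // -normrN ler_norm.
Qed.

Definition cos_sign (n : nat) : R := if odd n then 0 else (-1) ^+ n./2.
Definition sin_sign (n : nat) : R := if odd n then (-1) ^+ n./2 else 0.

Lemma cos_signS n : cos_sign n.+1 = - sin_sign n.
Proof.
rewrite /cos_sign /sin_sign /=; case: (boolP (odd n)) => o /=; last by rewrite oppr0.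
by rewrite uphalf_half o add1n exprS mulN1r.
Qed.

Lemma sin_signS n : sin_sign n.+1 = cos_sign n.
Proof.
rewrite /cos_sign /sin_sign /=; case: (boolP (odd n)) => //= o.
by rewrite uphalf_half (negbTE o).
Qed.

Lemma cos_sign_le n : `|cos_sign n| <= 1.
Proof. by rewrite /cos_sign; case: odd; rewrite ?normr0 // normrX normrN1 expr1n. Qed.

Lemma sin_sign_le n : `|sin_sign n| <= 1.
Proof. by rewrite /sin_sign; case: odd; rewrite ?normr0 // normrX normrN1 expr1n. Qed.

(* Picard iteration for p' = - s u q, q' = s v p alternates the two weights, so the
   solutions are series of cosine and sine type in s. *)
Definition psol (s x : R) := limn (series (fun n => cos_sign n * s ^+ n * iter_int n x)).
Definition qsol (s x : R) := limn (series (fun n => sin_sign n * s ^+ n * iter_int n x)).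
Definition majorant (s x : R) := growth (2 * (`|s| + 1)) x.

Lemma term_bound (c : nat -> R) (s x : R) n : (forall n, `|c n| <= 1) ->
  `|c n * s ^+ n * iter_int n x| <= 2^-1 ^+ n * majorant s x.
Proof.
move=> c1; rewrite !normrM.
have l0 : 0 < 2 * (`|s| + 1) by rewrite mulr_gt0 // ltr_wpDl.
have := @iter_int_bound _ n x l0; rewrite -/(majorant s x) => H.
have M0 : 0 <= majorant s x by rewrite addr_ge0 ?expR_ge0.
have : `|c n| * `|s ^+ n| <= (`|s| + 1) ^+ n.
  rewrite -[leRHS]mul1r ler_pM // normrX lerXn2r ?nnegrE ?addr_ge0 //.
  by rewrite lerDl.
move=> H2; apply: le_trans (ler_pM _ _ H2 H) _; rewrite ?mulr_ge0 //.
rewrite exprMn exprVn.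
have : (`|s| + 1) ^+ n != 0 by rewrite expf_neq0 // gt_eqF // ltr_wpDl.
have : (2 : R) ^+ n != 0 by rewrite expf_neq0.
set A := _ ^+ n => A0; set B := _ ^+ n => B0.
by rewrite le_eqVlt; apply/orP; left; apply/eqP; field; rewrite A0 B0.
Qed.

Lemma growth_cont l : continuous (growth l).
Proof.
have HW := primZ l total_weightP.
exact: prim_continuous (primD (prim_expR HW) (prim_expR (primN HW))).
Qed.

Lemma expR_cont (f : R -> R) : continuous f -> continuous (fun t => expR (f t)).
Proof.
by move=> cf t; apply: continuous_comp; [exact: cf|exact: continuous_expR].
Qed.

Lemma majorant_cont x : continuous (majorant ^~ x).
Proof.
have c1 : continuous (fun t : R => (2 * (`|t| + 1)) * total_weight x).
  move=> s; apply: cvgMr_tmp; apply: cvgMl_tmp.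
  by apply: cvgD; [exact: norm_continuous|exact: cvg_cst].
move=> s; apply: cvgD; first exact: expR_cont c1 s.
by apply: (@expR_cont (fun t => - _)) => t; apply: cvgN; exact: c1.
Qed.

Lemma cos_series s x : cvgn (series (fun n => cos_sign n * s ^+ n * iter_int n x)) /\
  forall n, `|series (fun n => cos_sign n * s ^+ n * iter_int n x) n - psol s x| <=
    2^-1 ^+ n * (2 * majorant s x).
Proof.
have [c1 c2] := geometric_tail (fun n => @term_bound _ s x n cos_sign_le).
by split=> // n; rewrite mulrCA mulrA; exact: c2.
Qed.

Lemma sin_series s x : cvgn (series (fun n => sin_sign n * s ^+ n * iter_int n x)) /\
  forall n, `|series (fun n => sin_sign n * s ^+ n * iter_int n x) n - qsol s x| <=
    2^-1 ^+ n * (2 * majorant s x).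
Proof.
have [c1 c2] := geometric_tail (fun n => @term_bound _ s x n sin_sign_le).
by split=> // n; rewrite mulrCA mulrA; exact: c2.
Qed.

(** Differentiation lowers the degree by one, hence [n.+1] terms on the left against [n] on the
    right. *)
Lemma series_cos_prim s n :
  primitive (fun x => series (fun i => cos_sign i * s ^+ i * iter_int i x) n.+1)
            (fun x => - (s * u x) * series (fun i => sin_sign i * s ^+ i * iter_int i x) n).
Proof.
elim: n => [|n IH].
  apply: prim_eq (_ : primitive _ (fun _ => 0)) _ => [|x].
    rewrite (_ : (fun x => _) = (fun _ => 1)); first exact: prim_cst.
    by apply/funext => x; rewrite /series /= big_nat1 /cos_sign /= !mul1r.
  by rewrite /series /= big_geq // mulr0.
rewrite (_ : (fun x => _) = (fun x => series (fun i => cos_sign i * s ^+ i * iter_int i x) n.+1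
    + cos_sign n.+1 * s ^+ n.+1 * iter_int n.+1 x)); last first.
  by apply/funext => x; rewrite /series /= [in LHS]big_nat_recr.
apply: prim_eq (primD IH (primZ _ (@iter_intP n))) _ => x.
rewrite /series /= [in RHS]big_nat_recr //= mulrDr; congr (_ + _).
rewrite cos_signS exprS /sin_sign /weight; case: odd; last by rewrite oppr0 !mul0r mulr0.
ring.
Qed.

Lemma series_sin_prim s n :
  primitive (fun x => series (fun i => sin_sign i * s ^+ i * iter_int i x) n.+1)
            (fun x => s * v x * series (fun i => cos_sign i * s ^+ i * iter_int i x) n).
Proof.
elim: n => [|n IH].
  apply: prim_eq (_ : primitive _ (fun _ => 0)) _ => [|x].
    rewrite (_ : (fun x => _) = (fun _ => 0)); first exact: prim_cst.
    by apply/funext => x; rewrite /series /= big_nat1 /sin_sign /= !mul0r.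
  by rewrite /series /= big_geq // mulr0.
rewrite (_ : (fun x => _) = (fun x => series (fun i => sin_sign i * s ^+ i * iter_int i x) n.+1
    + sin_sign n.+1 * s ^+ n.+1 * iter_int n.+1 x)); last first.
  by apply/funext => x; rewrite /series /= [in LHS]big_nat_recr.
apply: prim_eq (primD IH (primZ _ (@iter_intP n))) _ => x.
rewrite /series /= [in RHS]big_nat_recr //= mulrDr; congr (_ + _).
rewrite sin_signS exprS /cos_sign /weight; case: odd; first by rewrite !mul0r mulr0.
ring.
Qed.

Lemma series_cont (c : nat -> R) s n :
  continuous (fun x => series (fun i => c i * s ^+ i * iter_int i x) n).
Proof.
elim: n => [|n IH].
  rewrite (_ : (fun x => _) = (fun _ => 0)); first exact: cst_continuous.
  by apply/funext => x; rewrite /series /= big_geq.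
rewrite (_ : (fun x => _) = (fun x => series (fun i => c i * s ^+ i * iter_int i x) n
    + c n * s ^+ n * iter_int n x)); last first.
  by apply/funext => x; rewrite /series /= big_nat_recr.
move=> x; apply: cvgD; first exact: IH.
by apply: cvgMl_tmp; exact: iter_int_cont.
Qed.

Lemma abs_cont (f : R -> R) : continuous f -> continuous (fun x => `|f x|).
Proof. by move=> cf x; apply: cvg_norm; exact: cf. Qed.

Lemma psol_prim s : primitive (psol s) (fun x => - (s * u x) * qsol s x).
Proof.
apply: (@prim_limit _ _ _ _ _ (fun x => `|s * u x| * (2 * majorant s x)) (series_cos_prim s)).
- move=> n; apply: mul_cont; last exact: series_cont.
  by move=> x; apply: cvgN; apply: cvgMl_tmp; exact: cu.
- apply: mul_cont.
    by apply: abs_cont => x; apply: cvgMl_tmp; exact: cu.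
  by move=> x; apply: cvgMl_tmp; exact: growth_cont.
- move=> n x; rewrite -mulrBr normrM normrN mulrCA.
  by apply: ler_wpM2l => //; have [_] := sin_series s x.
- move=> x; have [+ _] := cos_series s x => /cvg_ex [l cl].
  rewrite /psol (cvg_lim (@Rhausdorff R) cl).
  by move: cl; rewrite -cvg_shiftS.
Qed.

Lemma qsol_prim s : primitive (qsol s) (fun x => s * v x * psol s x).
Proof.
apply: (@prim_limit _ _ _ _ _ (fun x => `|s * v x| * (2 * majorant s x)) (series_sin_prim s)).
- move=> n; apply: mul_cont; last exact: series_cont.
  by move=> x; apply: cvgMl_tmp; exact: cv.
- apply: mul_cont.
    by apply: abs_cont => x; apply: cvgMl_tmp; exact: cv.
  by move=> x; apply: cvgMl_tmp; exact: growth_cont.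
- move=> n x; rewrite -mulrBr normrM mulrCA.
  by apply: ler_wpM2l => //; have [_] := cos_series s x.
- move=> x; have [+ _] := sin_series s x => /cvg_ex [l cl].
  rewrite /qsol (cvg_lim (@Rhausdorff R) cl).
  by move: cl; rewrite -cvg_shiftS.
Qed.

Lemma series_at_a (c : nat -> R) s n :
  series (fun i => c i * s ^+ i * iter_int i a) n.+1 = c 0%N.
Proof.
elim: n => [|n IH]; first by rewrite /series /= big_nat1 /= expr0 !mulr1.
by rewrite /series /= big_nat_recr // -[LHS]/(series _ n.+1 + _ * iter_int n.+1 a) IH iter_int_a mulr0 addr0.
Qed.

Lemma lim_at_a (c : nat -> R) s :
  limn (series (fun i => c i * s ^+ i * iter_int i a)) = c 0%N.
Proof.
apply: (cvg_lim (@Rhausdorff R)); rewrite -cvg_shiftS /=.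
rewrite (_ : (fun n => _) = fun _ => c 0%N); first exact: cvg_cst.
by apply/funext => n; exact: series_at_a.
Qed.

Lemma series_cont_param (c : nat -> R) x n :
  continuous (fun s : R => series (fun i => c i * s ^+ i * iter_int i x) n).
Proof.
elim: n => [|n IH].
  rewrite (_ : (fun x => _) = (fun _ => 0)); first exact: cst_continuous.
  by apply/funext => s; rewrite /series /= big_geq.
rewrite (_ : (fun x => _) = (fun s => series (fun i => c i * s ^+ i * iter_int i x) n
    + c n * s ^+ n * iter_int n x)); last first.
  by apply/funext => s; rewrite /series /= big_nat_recr.
move=> s; apply: cvgD; first exact: IH.
by apply: cvgMr_tmp; apply: cvgMl_tmp; exact: exprn_continuous.
Qed.

(** Continuity in [s] is recorded because an intermediate value argument in [s] produces the Floquet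
    solutions. *)
Lemma linear_system_solution : exists p q : R -> R -> R,
  [/\ forall s, primitive (p s) (fun x => - (s * u x) * q s x),
      forall s, primitive (q s) (fun x => s * v x * p s x),
      forall s, p s a = 1 /\ q s a = 0 &
      forall x, continuous (p ^~ x) /\ continuous (q ^~ x)].
Proof.
exists psol, qsol; split.
- exact: psol_prim.
- exact: qsol_prim.
- by move=> s; split; rewrite [LHS]lim_at_a.
- move=> x; split.
    apply: (@locally_uniform_continuous _ _ _ (fun s => 2 * majorant s x)
      (fun n => @series_cont_param cos_sign x n)).
      by move=> s; apply: cvgMl_tmp; exact: (@majorant_cont x s).
    by move=> n s; have [_] := cos_series s x.
  apply: (@locally_uniform_continuous _ _ _ (fun s => 2 * majorant s x)
      (fun n => @series_cont_param sin_sign x n)).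
    by move=> s; apply: cvgMl_tmp; exact: (@majorant_cont x s).
  by move=> n s; have [_] := sin_series s x.
Qed.

End LinearSystem.

(** * Smooth and periodic functions *)

Section Smoothness.
Variable R : realType.
Implicit Types f g : R -> R.

(** C^n by recursion on primitives: the product and chain rules then deal with one derivative at a
    time. *)
Fixpoint diff_class (n : nat) f : Prop :=
  if n is m.+1 then exists2 f', primitive f f' & diff_class m f'
  else continuous f.

Lemma diff_classW n f : diff_class n.+1 f -> diff_class n f.
Proof.
elim: n f => [|n IH] f [f' Hf] //=; first by move=> _; exact: prim_continuous Hf.
by move=> /IH H; exists f'.
Qed.

Lemma smooth_primitive f : smooth f -> primitive f (derive1 f).
Proof.
move=> sf x; rewrite derive1E; have := sf 0%N x; rewrite derive1n0.
by move=> d; exact: DeriveDef.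
Qed.

Lemma smooth_derive1 f : smooth f -> smooth (derive1 f).
Proof. by move=> sf n x; rewrite -derive1Sn; exact: sf. Qed.

Lemma smoothP f : smooth f <-> forall n, diff_class n f.
Proof.
split=> [sf n|H n x].
  elim: n f sf => [|n IH] f sf; first exact: prim_continuous (smooth_primitive sf).
  exists (derive1 f); first exact: smooth_primitive.
  exact: IH (smooth_derive1 sf).
have {H} := H n.+1.
elim: n f => [|n IH] f [f' Hf Hf']; first by have [] := Hf x.
by rewrite derive1Sn (prim_derive1 Hf); exact: IH.
Qed.

Lemma diff_class_eq n f g : f =1 g -> diff_class n f -> diff_class n g.
Proof. by move=> /funext ->. Qed.

Lemma diff_class_cst n (c : R) : diff_class n (fun _ => c).
Proof.
elim: n c => [|n IH] c; first exact: cst_continuous.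
by exists (fun _ => 0); [exact: prim_cst|exact: IH].
Qed.

Lemma diff_class_id n : diff_class n (fun x : R => x).
Proof.
case: n => [|n]; first by move=> x; exact: cvg_id.
by exists (fun _ => 1); [exact: prim_id|exact: diff_class_cst].
Qed.

Lemma diff_classD n f g : diff_class n f -> diff_class n g ->
  diff_class n (fun x => f x + g x).
Proof.
elim: n f g => [|n IH] f g; first by move=> cf cg x; apply: cvgD; [exact: cf|exact: cg].
move=> [f' Hf Hf'] [g' Hg Hg']; exists (fun x => f' x + g' x); first exact: primD.
exact: IH.
Qed.

Lemma diff_classN n f : diff_class n f -> diff_class n (fun x => - f x).
Proof.
elim: n f => [|n IH] f; first by move=> cf x; apply: cvgN; exact: cf.
move=> [f' Hf Hf']; exists (fun x => - f' x); first exact: primN.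
exact: IH.
Qed.

Lemma diff_classM n f g : diff_class n f -> diff_class n g ->
  diff_class n (fun x => f x * g x).
Proof.
elim: n f g => [|n IH] f g; first exact: mul_cont.
move=> Hf Hg; have Hf0 := diff_classW Hf; have Hg0 := diff_classW Hg.
move: Hf Hg => [f' Hf Hf'] [g' Hg Hg'].
exists (fun x => f' x * g x + f x * g' x); first exact: primM.
by apply: diff_classD; exact: IH.
Qed.

Lemma diff_class_expR n f : diff_class n f -> diff_class n (fun x => expR (f x)).
Proof.
elim: n f => [|n IH] f; first exact: expR_cont.
move=> Hf; have Hf0 := diff_classW Hf; move: Hf => [f' Hf Hf'].
exists (fun x => f' x * expR (f x)); first exact: prim_expR.
by apply: diff_classM => //; exact: IH.
Qed.

Lemma diff_class_trig n f : diff_class n f ->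
  diff_class n (fun x => cos (f x)) /\ diff_class n (fun x => sin (f x)).
Proof.
elim: n f => [|n IH] f.
  move=> cf; split=> x; apply: continuous_comp; try exact: cf.
    exact: continuous_cos.
  exact: continuous_sin.
move=> Hf; have [c s] := IH _ (diff_classW Hf); move: Hf => [f' Hf Hf']; split.
  exists (fun x => - (f' x * sin (f x))); first exact: prim_cos.
  by apply: diff_classN; exact: diff_classM.
exists (fun x => f' x * cos (f x)); first exact: prim_sin.
exact: diff_classM.
Qed.

Lemma diff_classV n f : (forall x, f x != 0) -> diff_class n f ->
  diff_class n (fun x => (f x)^-1).
Proof.
move=> f0; elim: n f f0 => [|n IH] f f0.
  by move=> cf x; apply: cvgV; [exact: f0|exact: cf].
move=> Hf; have V := IH f f0 (diff_classW Hf); move: Hf => [f' Hf Hf'].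
exists (fun x => - (f' x / f x ^+ 2)); first exact: primV.
apply: diff_classN; apply: (@diff_class_eq _ (fun x => f' x * ((f x)^-1 * (f x)^-1))).
  by move=> x; rewrite expr2 invfM.
by do 2!apply: diff_classM => //.
Qed.

Lemma smooth_continuous f : smooth f -> continuous f.
Proof. by move=> /smooth_primitive /prim_continuous. Qed.

Lemma smooth_prim f f' : primitive f f' -> smooth f' -> smooth f.
Proof.
move=> H /smoothP s; apply/smoothP => -[|n]; first exact: prim_continuous H.
by exists f'.
Qed.

Lemma smoothD f g : smooth f -> smooth g -> smooth (fun x => f x + g x).
Proof. by move=> /smoothP Hf /smoothP Hg; apply/smoothP => n; exact: diff_classD. Qed.

Lemma smoothN f : smooth f -> smooth (fun x => - f x).
Proof. by move=> /smoothP Hf; apply/smoothP => n; exact: diff_classN. Qed.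

Lemma smoothB f g : smooth f -> smooth g -> smooth (fun x => f x - g x).
Proof. by move=> Hf Hg; exact: smoothD Hf (smoothN Hg). Qed.

Lemma smoothM f g : smooth f -> smooth g -> smooth (fun x => f x * g x).
Proof. by move=> /smoothP Hf /smoothP Hg; apply/smoothP => n; exact: diff_classM. Qed.

Lemma smooth_cst (c : R) : smooth (fun _ => c).
Proof. by apply/smoothP => n; exact: diff_class_cst. Qed.

Lemma smooth_id : smooth (fun x : R => x).
Proof. by apply/smoothP => n; exact: diff_class_id. Qed.

Lemma smooth_expR f : smooth f -> smooth (fun x => expR (f x)).
Proof. by move=> /smoothP Hf; apply/smoothP => n; exact: diff_class_expR. Qed.

Lemma smooth_cos f : smooth f -> smooth (fun x => cos (f x)).
Proof. by move=> /smoothP Hf; apply/smoothP => n; have [] := diff_class_trig (Hf n). Qed.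

Lemma smooth_sin f : smooth f -> smooth (fun x => sin (f x)).
Proof. by move=> /smoothP Hf; apply/smoothP => n; have [] := diff_class_trig (Hf n). Qed.

Lemma smoothV f : (forall x, f x != 0) -> smooth f -> smooth (fun x => (f x)^-1).
Proof. by move=> f0 /smoothP Hf; apply/smoothP => n; exact: diff_classV. Qed.

End Smoothness.

Section Periodicity.
Variable R : realType.
Implicit Types f g F : R -> R.
Notation T := (2 * pi : R).

Lemma two_pi_gt0 : 0 < T.
Proof. by rewrite mulr_gt0 // pi_gt0. Qed.

Lemma periodic_int f (k : int) : periodic f T -> forall x, f (x + T * k%:~R) = f x.
Proof.
move=> pf x; have nat_case (n : nat) y : f (y + T * n%:R) = f y.
  by rewrite mulr_natr periodicn.
case: k => n; first exact: nat_case.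
by rewrite NegzE mulrNz mulrN -[X in _ = f X](subrK (T * n.+1%:R) x) nat_case.
Qed.

Lemma periodic_prim f f' : primitive f f' -> periodic f T -> periodic f' T.
Proof.
move=> H p x; have := prim_derive1 (prim_shift T H).
rewrite (_ : (fun x => f (x + T)) = f); last by apply/funext => t; exact: p.
by rewrite (prim_derive1 H) => /(congr1 (@^~ x)).
Qed.

Lemma prim_periodic_shift F f : primitive F f -> periodic f T ->
  forall x y, F (x + T) - F x = F (y + T) - F y.
Proof.
move=> HF pf x y.
have := prim_unique (prim_shift T HF) (prim_eq HF (fun x => esym (pf x))) x y.
by lra.
Qed.

Lemma Rintegral_shift f (x : R) F : primitive F f -> continuous f -> periodic f T ->
  \int[lebesgue_measure]_(t in `[0, T]) f t = F (x + T) - F x.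
Proof.
move=> HF cf pf; rewrite (prim_Rintegral HF cf (ltW two_pi_gt0)).
by have := prim_periodic_shift HF pf 0 x; rewrite add0r => ->.
Qed.

End Periodicity.

(** * Lebesgue integrals and the lemma of du Bois-Reymond *)

Section IntegralTools.
Variable R : realType.
Notation mu := (@lebesgue_measure R).

Lemma dominated_Rintegral (D : set R) (f_ : nat -> R -> R) (f G : R -> R) :
  measurable D -> (forall n, measurable_fun D (f_ n)) -> measurable_fun D f ->
  {ae mu, forall x, D x -> f_ n x @[n --> \oo] --> f x} ->
  mu.-integrable D (EFin \o G) ->
  (forall n x, D x -> `|f_ n x| <= G x) ->
  \int[mu]_(x in D) f_ n x @[n --> \oo] --> \int[mu]_(x in D) f x.
Proof.
move=> mD mf_ mf cf iG fG.
have [] := @dominated_convergence _ _ _ mu D mD (fun n => EFin \o f_ n) (EFin \o f) (EFin \o G).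
- by move=> n; apply/measurable_EFinP; exact: mf_.
- by apply/measurable_EFinP.
- apply: (filterS (F := almost_everywhere mu) _ cf) => x H Dx.
  by apply/fine_cvgP; split; [exact: nearW|exact: H].
- exact: iG.
- by apply: aeW => x n Dx /=; rewrite lee_fin fG.
move=> fi _ cv; rewrite /Rintegral.
apply: fine_cvg; rewrite fineK; first exact: cv.
exact: integrable_fin_num.
Qed.

Lemma ae_mono (P Q : R -> Prop) : (forall x, P x -> Q x) ->
  {ae mu, forall x, P x} -> {ae mu, forall x, Q x}.
Proof. by move=> PQ H; exact: (filterS (F := almost_everywhere mu) PQ H). Qed.

Lemma ae_and (P Q : R -> Prop) : {ae mu, forall x, P x} -> {ae mu, forall x, Q x} ->
  {ae mu, forall x, P x /\ Q x}.
Proof. by move=> HP HQ; exact: (@filterI _ (almost_everywhere mu) _ _ _ HP HQ). Qed.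

Lemma rintegrable_le (D : set R) (f g : R -> R) : measurable D -> measurable_fun D f ->
  (forall x, D x -> `|f x| <= g x) ->
  mu.-integrable D (EFin \o g) -> mu.-integrable D (EFin \o f).
Proof.
move=> mD mf fg; apply: (@le_integrable _ _ _ mu D mD (EFin \o f) (EFin \o g)).
  exact/measurable_EFinP.
by move=> x Dx /=; rewrite lee_fin (le_trans (fg x Dx)) // ler_norm.
Qed.

Lemma rintegrableZ (D : set R) (c : R) (f : R -> R) : measurable D ->
  mu.-integrable D (EFin \o f) -> mu.-integrable D (EFin \o (fun x => c * f x)).
Proof. by move=> mD; exact: (@integrableZl _ _ _ mu D mD c (EFin \o f)). Qed.

Lemma rintegrableD (D : set R) (f g : R -> R) : measurable D ->
  mu.-integrable D (EFin \o f) -> mu.-integrable D (EFin \o g) ->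
  mu.-integrable D (EFin \o (fun x => f x + g x)).
Proof. by move=> mD; exact: (@integrableD _ _ _ mu D mD (EFin \o f) (EFin \o g)). Qed.

Lemma rintegrable_abs (D : set R) (f : R -> R) :
  mu.-integrable D (EFin \o f) -> mu.-integrable D (EFin \o (fun x => `|f x|)).
Proof. exact: integrable_norm. Qed.

Lemma rintegrable_measurable (D : set R) (f : R -> R) :
  mu.-integrable D (EFin \o f) -> measurable_fun D f.
Proof. by move=> /measurable_int /measurable_EFinP. Qed.

Lemma integrable_sub (f : R -> R) (a b c d : R) : a <= c -> d <= b ->
  mu.-integrable `[a, b] (EFin \o f) -> mu.-integrable `[c, d] (EFin \o f).
Proof.
move=> ac db; apply: integrableS => //.
by apply: subset_itv; rewrite bnd_simp.
Qed.

Lemma Rintegral_split (f : R -> R) (a b c : R) : a <= b -> b <= c ->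
  mu.-integrable `[a, c] (EFin \o f) ->
  \int[mu]_(t in `[a, c]) f t =
  \int[mu]_(t in `[a, b]) f t + \int[mu]_(t in `[b, c]) f t.
Proof.
move=> ab bc fi.
have := @Rintegral_itvB _ f (BLeft a) (BRight c) b fi.
rewrite !bnd_simp => /(_ ab bc).
rewrite Rintegral_itv_obnd_cbnd; last first.
  apply: integrableS fi => //.
  by apply: subset_itv; rewrite bnd_simp.
by move=> <-; rewrite addrC subrK.
Qed.

Lemma le_normr_Rintegral_itv (f : R -> R) (a b : R) :
  mu.-integrable `[a, b] (EFin \o f) ->
  `|\int[mu]_(t in `[a, b]) f t| <= \int[mu]_(t in `[a, b]) `|f t|.
Proof. by move=> fi; exact: le_normr_Rintegral. Qed.

Lemma cont_measurable (f : R -> R) (D : set R) : measurable D -> continuous f -> measurable_fun D f.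
Proof. by move=> mD cf; apply: measurable_funTS; exact: continuous_measurable_fun. Qed.

Lemma integrable_mul_cont (f k : R -> R) (a b : R) : continuous k ->
  mu.-integrable `[a, b] (EFin \o f) ->
  mu.-integrable `[a, b] (EFin \o (fun x => f x * k x)).
Proof.
move=> ck fi.
have [M HM] : exists M, forall x, a <= x <= b -> `|k x| <= M.
  have [ab|ba] := leP a b; last by exists 0 => x /andP[ax xb]; lra.
  have [c _ cM] := EVT_max ab (continuous_subspaceT (abs_cont ck)).
  by exists `|k c| => x xab; apply: cM; rewrite in_itv.
have mf := rintegrable_measurable fi.
apply: (@rintegrable_le _ _ (fun x => M * `|f x|)) => //.
- by apply: measurable_funM => //; exact: cont_measurable.
- move=> x /=; rewrite in_itv /= => xab; rewrite normrM mulrC.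
  by rewrite ler_wpM2r // HM.
- by apply: rintegrableZ => //; exact: rintegrable_abs.
Qed.

(* A primitive of [|f|] controls the increments, so the sum of the errors over
   a partition of mesh r is O(r). *)
Lemma small_increments_const (H N : R -> R) (C a b : R) : a <= b ->
  (forall x y, a <= x -> x <= y -> y <= b ->
     `|H y - H x| <= C * (y - x) * (N y - N x)) -> H b = H a.
Proof.
move=> ab HN.
have key (n : nat) : `|H b - H a| <= (C * (b - a) * (N b - N a)) / n.+1%:R.
  pose p (i : nat) := a + (b - a) * i%:R / n.+1%:R.
  have n0 : (n.+1%:R : R) != 0 by [].
  have p0 : p 0%N = a by rewrite /p mulr0 mul0r addr0.
  have pn : p n.+1 = b by rewrite /p mulfK // addrC subrK.
  have pS i : p i.+1 - p i = (b - a) / n.+1%:R by rewrite /p -natr1; field.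
  have pmono i j : (i <= j)%N -> p i <= p j.
    move=> ij; rewrite lerD2l ler_wpM2r ?invr_ge0 // ler_wpM2l ?subr_ge0 //.
    by rewrite ler_nat.
  have step (m : nat) : (m <= n.+1)%N ->
      `|H (p m) - H a| <= C * ((b - a) / n.+1%:R) * (N (p m) - N a).
    elim: m => [|m IH] mn; first by rewrite p0 !subrr normr0 mulr0.
    have := HN (p m) (p m.+1); rewrite -{1}p0 -{1}pn !pmono // pS => /(_ isT isT isT) H1.
    have {IH}H2 := IH (ltnW mn).
    rewrite (_ : H _ - H a = (H (p m.+1) - H (p m)) + (H (p m) - H a)); last by ring.
    by apply: le_trans (ler_normD _ _) _; move: H1 H2; set D := C * (_ / _); lra.
  by have := step n.+1 (leqnn _); rewrite pn => /le_trans; apply; rewrite mulrA mulrAC.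
apply/eqP; rewrite -subr_eq0 -normr_le0; apply/ler_addgt0Pl => e e0; rewrite addr0.
set K := C * _ * _ in key.
have [m /= mK] : exists m : nat, `|K| / e < m.+1%:R.
  by exists (Num.truncn (`|K| / e)); apply: truncnS_gt.
apply: le_trans (key m) _; rewrite ler_pdivrMr ?ltr0Sn //.
rewrite ltr_pdivrMr // mulrC in mK; exact: le_trans (ler_norm K) (ltW mK).
Qed.

Lemma Rintegral_primitive_cont (g : R -> R) (b : R) : 0 <= b ->
  mu.-integrable `[0, b] (EFin \o g) ->
  exists2 G : R -> R, continuous G &
    forall x, 0 <= x <= b -> G x = \int[mu]_(t in `[0, x]) g t.
Proof.
move=> b0 gi.
have cG := parameterized_integral_continuous b0 gi.
(* [cl] is the projection of R onto [[0, b]]; it extends to R the integral function, whose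
   continuity is known on the segment. *)
pose cl (x : R) : R := (`|x| - `|x - b| + b) / 2.
have ccl : continuous cl.
  move=> x; apply: cvgMr_tmp; apply: cvgD; last exact: cvg_cst.
  apply: cvgB; first exact: norm_continuous.
  by apply: cvg_norm; apply: cvgB; [exact: cvg_id|exact: cvg_cst].
exists (fun x => \int[mu]_(t in `[0, cl x]) g t).
  move=> x.
  have cin y : `[0, b]%classic (cl y).
    rewrite /= in_itv /= /cl; have := ler_normB y b; have := ler_normD (y - b) b.
    by rewrite subrK (ger0_norm b0); lra.
  have /subspace_continuousP /(_ _ (cin x)) H := cG.
  apply: cvg_trans H => P [e /= e0 eP].
  have [d d0 dP] := (cvgrPdist_lt _ _).1 (ccl x) e e0.
  exists d => // y yd; apply: eP => //; last exact: cin.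
  exact: dP.
move=> x /andP[x0 xb]; rewrite /cl (_ : _ / 2 = x) // ger0_norm // ler0_norm; last by lra.
by field.
Qed.

(** As [g] is merely integrable, the product rule cannot be used pointwise. Instead the difference
    [H] of the two sides has increments O((y - x) (N y - N x)), with [N] the integral of |g|, so it
    is constant. *)
Lemma integration_by_parts_integrable (g K k : R -> R) (b : R) : 0 <= b ->
  mu.-integrable `[0, b] (EFin \o g) -> primitive K k -> continuous k ->
  exists2 G : R -> R, continuous G /\
    (forall x, 0 <= x <= b -> G x = \int[mu]_(t in `[0, x]) g t) &
  \int[mu]_(t in `[0, b]) (g t * K t) =
    G b * K b - \int[mu]_(t in `[0, b]) (G t * k t).
Proof.
move=> b0 gi HK ck.
have [G cG GE] := Rintegral_primitive_cont b0 gi; exists G => //.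
have cK := prim_continuous HK.
have gKi := integrable_mul_cont cK gi.
have cGk := mul_cont cG ck.
have [L HL L0] := prim_exists 0 cGk.
have absi := rintegrable_abs gi.
pose N (x : R) := \int[mu]_(t in `[0, x]) `|g t|.
pose H (x : R) := \int[mu]_(t in `[0, x]) (g t * K t) - G x * K x + L x.
have [M M0 kM] : exists2 M, 0 <= M & forall x, 0 <= x <= b -> `|k x| <= M.
  have [c _ cM] := EVT_max b0 (continuous_subspaceT (abs_cont ck)).
  by exists `|k c| => // x xab; apply: cM; rewrite in_itv.
have incr (f : R -> R) x y : 0 <= x -> x <= y -> y <= b -> mu.-integrable `[0, b] (EFin \o f) ->
    \int[mu]_(t in `[0, y]) f t - \int[mu]_(t in `[0, x]) f t = \int[mu]_(t in `[x, y]) f t.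
  move=> x0 xy yb fi; rewrite (@Rintegral_split f 0 x y) //; first by ring.
  exact: integrable_sub fi.
have Kincr x y : 0 <= x -> x <= y -> y <= b -> forall t, x <= t <= y -> `|K t - K x| <= M * (y - x).
  move=> x0 xy yb t /andP[xt ty].
  have := prim_abs_le HK (primZ M (prim_id (R := R))) xt.
  rewrite -mulrBr => H1; apply: le_trans (H1 _) _; last by rewrite ler_wpM2l // lerD2r.
  by move=> z /andP[z1 z2]; rewrite mulr1; apply: kM; lra.
have G0 : G 0 = 0 by rewrite GE ?lexx ?b0 // set_itv1 Rintegral_set1.
suff : H b = H 0.
  rewrite /H set_itv1 Rintegral_set1 L0 G0 mul0r subr0 addr0.
  by rewrite (prim_Rintegral HL cGk b0) L0 subr0; lra.
apply: (@small_increments_const H N (2 * M)) => // x y x0 xy yb.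
have Nincr z w : 0 <= z -> z <= w -> w <= b -> `|G w - G z| <= N w - N z.
  move=> z0 zw wb.
  rewrite !GE ?z0 ?(le_trans z0) ?(le_trans zw) // ?(le_trans zw wb) //.
  rewrite (incr g) // /N (incr (fun t => `|g t|)) //.
  by apply: le_normr_Rintegral_itv; exact: integrable_sub gi.
have ty : `|(L y - G y * K y) - (L x - G y * K x)| <= M * (N y - N x) * (y - x).
  have HD := primB HL (primZ (G y) HK).
  have := prim_abs_le HD (primZ (M * (N y - N x)) (prim_id (R := R))) xy.
  rewrite -mulrBr; apply => t /andP[xt ty].
  rewrite -mulrBl normrM distrC mulr1 mulrC; apply: ler_pM => //.
    by apply: kM; lra.
  apply: le_trans (Nincr t y _ _ _) _ => //; first lra.
  have := Nincr x t x0 xt (le_trans ty yb).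
  by have := normr_ge0 (G t - G x); clear => *; lra.
have gi' := integrable_sub x0 yb gi.
have cKx : continuous (fun t => K t - K x).
  by move=> t; apply: cvgB; [exact: cK|exact: cvg_cst].
have t1 : `|\int[mu]_(t in `[x, y]) (g t * (K t - K x))| <= M * (y - x) * (N y - N x).
  apply: le_trans (le_normr_Rintegral_itv _) _; first exact: integrable_mul_cont.
  rewrite /N (incr (fun t => `|g t|)) // -RintegralZl //; last exact: rintegrable_abs.
  apply: le_Rintegral => //.
  - by apply: rintegrable_abs; exact: integrable_mul_cont.
  - by apply: rintegrableZ => //; exact: rintegrable_abs.
  move=> t /=; rewrite in_itv /= => xty; rewrite normrM mulrC ler_wpM2r //.
  exact: Kincr.
have E : \int[mu]_(t in `[x, y]) (g t * K t) =
    \int[mu]_(t in `[x, y]) (g t * (K t - K x)) + K x * (G y - G x).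
  rewrite (GE y); last by rewrite yb (le_trans x0 xy).
  rewrite (GE x); last by rewrite x0 (le_trans xy yb).
  have RZ : K x * \int[mu]_(t in `[x, y]) g t = \int[mu]_(t in `[x, y]) (K x * g t).
    by rewrite RintegralZl.
  rewrite (incr g x y x0 xy yb gi) RZ.
  rewrite -RintegralD; [|by []|exact: integrable_mul_cont|exact: rintegrableZ].
  by apply: eq_Rintegral => t _; ring.
have -> : H y - H x = \int[mu]_(t in `[x, y]) (g t * (K t - K x)) +
    ((L y - G y * K y) - (L x - G y * K x)).
  have I1 := incr (fun t => g t * K t) x y x0 xy yb gKi.
  by move: I1; rewrite E /H; set u := Rintegral _ _ _; set v := Rintegral _ _ _; set w := Rintegral _ _ _; clear => *; lra.
apply: le_trans (ler_normD _ _) _; move: t1 ty; clear => *; lra.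
Qed.

End IntegralTools.

Section DuBoisReymond.
Variable R : realType.
Notation mu := (@lebesgue_measure R).
Notation T := (2 * pi : R).

(* [arc_bump x n] is smooth and periodic, hence an admissible test function, and
   tends to the indicator of ]0, x[ as n grows, because [arc_sign x] is positive on
   ]0, x[ and negative on ]x, 2 pi[. *)
Definition arc_sign (x t : R) := 2 * (sin (t / 2) * sin ((x - t) / 2)).
Definition arc_bump (x : R) (n : nat) (t : R) := (1 + expR (- (n.+1%:R * arc_sign x t)))^-1.

Lemma arc_sign_smooth x : smooth (arc_sign x).
Proof.
apply: smoothM; first exact: smooth_cst.
have s2 : smooth (fun t : R => t / 2).
  by apply: smoothM; [exact: smooth_id|exact: smooth_cst].
apply: smoothM; first exact: smooth_sin.
apply: smooth_sin; apply: smoothM; last exact: smooth_cst.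
by apply: smoothB; [exact: smooth_cst|exact: smooth_id].
Qed.

Lemma arc_bump_smooth x n : smooth_circle (arc_bump x n).
Proof.
split=> [t|].
  rewrite /arc_bump /arc_sign.
  have -> : (t + T) / 2 = t / 2 + pi by field.
  have -> : (x - (t + T)) / 2 = (x - t) / 2 - pi by field.
  have e : sin ((x - t) / 2 - pi) = - sin ((x - t) / 2).
    by rewrite -[in RHS](subrK pi ((x - t) / 2)) sinDpi opprK.
  by rewrite sinDpi e mulrNN.
apply: smoothV => [t|]; first by rewrite gt_eqF // addr_gt0 // expR_gt0.
apply: smoothD; first exact: smooth_cst.
apply: smooth_expR; apply: smoothN.
by apply: smoothM; [exact: smooth_cst|exact: arc_sign_smooth].
Qed.

Lemma arc_bump_bound x n t : `|arc_bump x n t| <= 1.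
Proof.
have e0 := expR_gt0 (- (n.+1%:R * arc_sign x t)).
rewrite ger0_norm /arc_bump; last by rewrite invr_ge0 addr_ge0 // ltW.
by rewrite invf_le1 ?lerDl ?ltW // addr_gt0.
Qed.

Lemma arc_bump_cvg x t : 0 < x < T -> 0 < t < T -> t != x ->
  arc_bump x n t @[n --> \oo] --> ((t < x)%R%:R : R).
Proof.
move=> /andP[x0 xT] /andP[t0 tT] tx.
have key (c : R) : 0 < c -> (fun n : nat => (n.+1%:R * c)^-1) @ \oo --> (0 : R).
  move=> c0; rewrite [X in X @ \oo --> _](_ : _ = (fun n => c^-1 * harmonic n)); last first.
    by apply/funext => n; rewrite invfM mulrC.
  by rewrite -[X in _ --> X](mulr0 c^-1); apply: cvgMl_tmp; exact: cvg_harmonic.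
have st : 0 < sin (t / 2) by apply: sin_gt0_pi; lra.
have expo (c : R) (n : nat) : 0 < c -> expR (- (n.+1%:R * c)) <= (n.+1%:R * c)^-1.
  move=> c0; rewrite expRN lef_pV2 ?posrE ?expR_gt0 ?mulr_gt0 //.
  by apply: le_trans (expR_ge1Dx _); rewrite lerDr.
apply/cvgrPdist_le => e e0.
case: (ltgtP t x) tx => // tx _.
- have c0 : 0 < arc_sign x t.
    by rewrite /arc_sign !mulr_gt0 // sin_gt0_pi //; lra.
  near=> n.
  rewrite /arc_bump; set E := expR _.
  have E0 : 0 < E by exact: expR_gt0.
  rewrite (_ : 1%:R - _ = E / (1 + E)); last by field; rewrite gt_eqF // addr_gt0.
  rewrite ger0_norm; last by rewrite divr_ge0 // ?addr_ge0 // ltW.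
  apply: (@le_trans _ _ E); first by rewrite ler_pdivrMr ?addr_gt0 // mulrDr mulr1 lerDl mulr_ge0 // ltW.
  apply: le_trans (expo _ _ c0) _.
  have : `|0 - (n.+1%:R * arc_sign x t)^-1| <= e.
    by near: n; apply: (cvgrPdist_le _ _).1 (key _ c0) e e0.
  by apply: le_trans; rewrite sub0r normrN ler_norm.
- have c0 : 0 < - arc_sign x t.
    rewrite /arc_sign -mulrN mulr_gt0 // -mulrN mulr_gt0 // -sinN sin_gt0_pi //; lra.
  near=> n.
  rewrite sub0r normrN /arc_bump ger0_norm; last by rewrite invr_ge0 addr_ge0 // expR_ge0.
  have := expo _ n c0; rewrite mulrN opprK => H.
  have : `|0 - (n.+1%:R * - arc_sign x t)^-1| <= e.
    by near: n; apply: (cvgrPdist_le _ _).1 (key _ c0) e e0.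
  rewrite sub0r normrN => /(le_trans (ler_norm _)); apply: le_trans.
  apply: le_trans (expo _ n c0).
  rewrite mulrN opprK -[X in _ <= expR X]opprK [X in _ <= X]expRN.
  by rewrite lef_pV2 ?posrE ?addr_gt0 ?expR_gt0 // lerDr.
Unshelve. all: by end_near. Qed.

Lemma ae_neq (x : R) (D : set R) : {ae mu, forall t, D t -> t != x}.
Proof.
exists [set x]; split => //; first exact: lebesgue_measure_set1.
by move=> t /=; rewrite not_implyE => -[_ /negP]; rewrite negbK => /eqP.
Qed.

(** Lebesgue's differentiation theorem for the extension [F1] of [F] by zero, whose integral
    function vanishes on ]0, b[. *)
Lemma ae_zero_of_intervals (F : R -> R) (b : R) :
  mu.-integrable `[0, b] (EFin \o F) ->
  (forall x, 0 < x < b -> \int[mu]_(t in `[0, x]) F t = 0) ->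
  {ae mu, forall x, 0 < x < b -> F x = 0}.
Proof.
move=> Fi F0; pose F1 := F \_ `[0, b].
have F1i : mu.-integrable setT (EFin \o F1).
  by move/integrable_mkcond : Fi; rewrite restrict_EFin; apply.
have H1 y : mu.-integrable `]-oo, y] (EFin \o F1) by exact: integrableS F1i.
have H2 : locally_integrable setT F1 by apply: open_integrable_locally => //; exact: openT.
apply: (filterS (F := almost_everywhere mu) _ (FTC1Ny H1 H2)) => x /= [_ E] /andP[x0 xb].
have <- : F1 x = F x by rewrite /F1 patchE mem_set //= in_itv /= !ltW.
rewrite -E derive1E.
rewrite (_ : 'D_1 _ x = 'D_1 (fun=> (0 : R)) x); last first.
  apply: near_eq_derive; near=> y.
  have y0 : 0 < y by near: y; exact: lt_nbhsr.
  have yb : y < b by near: y; exact: lt_nbhsl.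
  rewrite -(F0 y) ?y0 // /F1 -Rintegral_mkcondr; congr (Rintegral _ _ _).
  apply/seteqP; split=> t /=; rewrite !in_itv /=; first by move=> [ty /andP[-> _]].
  by move=> /andP[-> ty]; split => //; apply: le_trans ty (ltW yb).
by rewrite derive_cst.
Unshelve. all: by end_near. Qed.

(** The functions [arc_bump x n] are bounded by 1 and tend almost everywhere to the indicator of
    [0, x], so dominated convergence reduces the claim to intervals. *)
Lemma ae_zero_of_smooth (F : R -> R) :
  mu.-integrable `[0, T] (EFin \o F) ->
  (forall phi, smooth_circle phi -> \int[mu]_(t in `[0, T]) (F t * phi t) = 0) ->
  {ae mu, forall x, 0 < x < T -> F x = 0}.
Proof.
move=> Fi F0; apply: ae_zero_of_intervals (Fi) _ => x /andP[x0 xT].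
have mF := rintegrable_measurable Fi.
have mi : measurable_fun setT (fun t : R => (t <= x)%R%:R : R).
  rewrite [X in measurable_fun _ X](_ : _ = \1_(`]-oo, x]%classic)); first exact: measurable_indic.
  by apply/funext => t; rewrite indicE mem_setE in_itv.
have : (fun n => \int[mu]_(t in `[0, T]) (F t * arc_bump x n t)) @ \oo -->
    \int[mu]_(t in `[0, T]) (F t * (t <= x)%R%:R).
  apply: (@dominated_Rintegral _ `[0, T]%classic _ _ (fun t => `|F t|)).
- by [].
- move=> n; apply: measurable_funM => //; apply: cont_measurable => //.
  by have [_ /smooth_continuous] := arc_bump_smooth x n.
- by apply: measurable_funM => //; exact: measurable_funTS.
- have h1 := ae_neq x `[0, T]; have h2 := ae_neq 0 `[0, T]; have h3 := ae_neq T `[0, T].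
  apply: ae_mono (ae_and (ae_and h1 h2) h3) => t [[n1 n2] n3] It.
  have := It; rewrite /= in_itv /= => /andP[t0 tT].
  have {}n1 := n1 It; have {}n2 := n2 It; have {}n3 := n3 It.
  apply: cvgMl_tmp; rewrite le_eqVlt (negbTE n1) /=; apply: arc_bump_cvg => //.
    by rewrite x0.
  by rewrite !lt_neqAle eq_sym n2 n3 t0.
- exact: rintegrable_abs.
- by move=> n t _; rewrite normrM ler_piMr // arc_bump_bound.
rewrite [X in X @ \oo --> _](_ : _ = fun=> 0); last first.
  by apply/funext => n; apply: F0; exact: arc_bump_smooth.
move=> /(cvg_unique (@Rhausdorff R) (cvg_cst _)) E.
rewrite [RHS]E [X in _ = Rintegral _ _ X](_ : _ = F \_ `]-oo, x]).
  rewrite -Rintegral_mkcondr; congr (Rintegral _ _ _).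
  apply/seteqP; split=> t /=; rewrite !in_itv /=.
    by move=> /andP[-> tx]; rewrite tx (le_trans tx (ltW xT)).
  by move=> [/andP[-> _] ->].
apply/funext => t; rewrite patchE mem_setE in_itv /=.
by case: (t <= x); rewrite ?mulr1 ?mulr0.
Qed.

Lemma periodic_mean_zero_primitive (psi : R -> R) : smooth_circle psi ->
  \int[mu]_(t in `[0, T]) psi t = 0 ->
  exists2 phi, smooth_circle phi & primitive phi psi.
Proof.
move=> [pp sp] m0; have cp := smooth_continuous sp.
have [phi Hphi _] := prim_exists 0 cp; exists phi; last exact: Hphi.
split.
  by move=> x; have := Rintegral_shift x Hphi cp pp; rewrite m0 => /eqP; rewrite eq_sym subr_eq0 => /eqP.
exact: smooth_prim Hphi sp.
Qed.

(** The constant test function shows that [g] has mean 0, so its integral [G] closes up over a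
    period. Then [f - G] is orthogonal to all derivatives of test functions, that is, to all test
    functions of mean 0, and must equal its own mean [c]. *)
Lemma du_bois_reymond (f g : R -> R) :
  mu.-integrable `[0, T] (EFin \o f) -> mu.-integrable `[0, T] (EFin \o g) ->
  (forall phi, smooth_circle phi ->
     \int[mu]_(t in `[0, T]) (f t * derive1 phi t) =
     - \int[mu]_(t in `[0, T]) (g t * phi t)) ->
  exists2 G : R -> R, [/\ continuous G, G 0 = G T &
      forall x, 0 <= x <= T -> G x = G 0 + \int[mu]_(t in `[0, x]) g t] &
    {ae mu, forall x, 0 < x < T -> f x = G x}.
Proof.
move=> fi gi fg.
have T0 : 0 <= T by exact: ltW (two_pi_gt0 R).
have [G cG GE] := Rintegral_primitive_cont T0 gi.
have one_smooth : smooth_circle (fun _ : R => 1 : R) by split => //; exact: smooth_cst.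
have G0 : G 0 = 0 by rewrite GE ?lexx ?T0 // set_itv1 Rintegral_set1.
have GT : G T = 0.
  have := fg _ one_smooth; rewrite (prim_derive1 (@prim_cst R 1)).
  rewrite (@eq_Rintegral _ _ _ mu _ (fun _ => 0)); last by move=> t _; rewrite mulr0.
  rewrite Rintegral_cst // mul0r => /esym /eqP; rewrite oppr_eq0 => /eqP E.
  rewrite GE ?lexx ?T0 //= -[RHS]E; apply: eq_Rintegral => t _; by rewrite mulr1.
have weak phi : smooth_circle phi ->
    \int[mu]_(t in `[0, T]) ((f t - G t) * derive1 phi t) = 0.
  move=> sphi; have [pphi s] := sphi.
  have Hphi := smooth_primitive s; have cd := smooth_continuous (smooth_derive1 s).
  have [G' [cG' GE'] IBP] := integration_by_parts_integrable T0 gi Hphi cd.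
  have GG' x : 0 <= x <= T -> G' x = G x by move=> xT; rewrite GE // GE'.
  have I1 := integrable_mul_cont cd fi.
  have I2 : mu.-integrable `[0, T] (EFin \o (fun t => G t * derive1 phi t)).
    by apply: continuous_integrable; exact: mul_cont.
  have -> : \int[mu]_(t in `[0, T]) ((f t - G t) * derive1 phi t) =
      \int[mu]_(t in `[0, T]) (f t * derive1 phi t) - \int[mu]_(t in `[0, T]) (G t * derive1 phi t).
    by rewrite -RintegralB //; apply: eq_Rintegral => t _; rewrite mulrBl.
  rewrite fg // IBP GG' ?T0 ?lexx // GT mul0r sub0r opprK.
  rewrite (@eq_Rintegral _ _ _ mu _ (fun t => G t * derive1 phi t)) ?subrr // => t /[!inE] /=.
  by rewrite in_itv /= => tT; rewrite GG'.
have Di : mu.-integrable `[0, T] (EFin \o (fun t => f t - G t)).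
  rewrite (_ : (fun t => f t - G t) = (fun t => f t + (-1) * G t)).
    apply: rintegrableD => //; apply: rintegrableZ => //; exact: continuous_integrable.
  by apply/funext => t; rewrite mulN1r.
pose c := T^-1 * \int[mu]_(t in `[0, T]) (f t - G t).
have cst_int (k : R) : \int[mu]_(t in `[0, T]) k = k * T.
  rewrite (prim_Rintegral (F := fun t => k * t)) //; first by rewrite mulr0 subr0.
    by apply: prim_eq (primZ k (@prim_id R)) _ => t; rewrite mulr1.
  exact: cst_continuous.
have Dci : mu.-integrable `[0, T] (EFin \o (fun t => f t - G t - c)).
  apply: rintegrableD => //; apply: continuous_integrable; exact: cst_continuous.
have : {ae mu, forall x, 0 < x < T -> f x - G x - c = 0}.
  apply: ae_zero_of_smooth Dci _ => phi sphi.
  have [pphi s] := sphi; have cphi := smooth_continuous s.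
  pose m := T^-1 * \int[mu]_(t in `[0, T]) phi t.
  have T1 : T != 0 by rewrite gt_eqF // two_pi_gt0.
  have spsi : smooth_circle (fun t => phi t - m).
    split; first by move=> t; rewrite pphi.
    by apply: smoothB; [exact: s|exact: smooth_cst].
  have phii : mu.-integrable `[0, T] (EFin \o phi) by exact: continuous_integrable.
  have ci (k : R) : mu.-integrable `[0, T] (EFin \o (fun=> k)).
    by apply: continuous_integrable; exact: cst_continuous.
  have [Phi sPhi HPhi] : exists2 Phi, smooth_circle Phi & primitive Phi (fun t => phi t - m).
    apply: periodic_mean_zero_primitive => //.
    by rewrite RintegralB // cst_int /m mulrAC mulVf // mul1r subrr.
  have := weak _ sPhi; rewrite (prim_derive1 HPhi) => W.
  have Dphi := integrable_mul_cont cphi Di.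
  have E1 : \int[mu]_(t in `[0, T]) ((f t - G t) * (phi t - m)) =
    \int[mu]_(t in `[0, T]) ((f t - G t) * phi t) - m * \int[mu]_(t in `[0, T]) (f t - G t).
    rewrite -RintegralZl // -RintegralB //; last exact: rintegrableZ.
    by apply: eq_Rintegral => t _; ring.
  have E2 : \int[mu]_(t in `[0, T]) ((f t - G t - c) * phi t) =
    \int[mu]_(t in `[0, T]) ((f t - G t) * phi t) - c * \int[mu]_(t in `[0, T]) phi t.
    rewrite -RintegralZl // -RintegralB //; last exact: rintegrableZ.
    by apply: eq_Rintegral => t _; ring.
  by move: E1; rewrite W E2 => /esym /subr0_eq ->; rewrite /c /m mulrAC subrr.
move=> H; exists (fun x => G x + c).
  split; [|by rewrite G0 GT|by move=> x xT; rewrite G0 add0r addrC -GE].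
  by move=> x; apply: cvgD; [exact: cG|exact: cvg_cst].
apply: ae_mono H => x + xT => /(_ xT) /eqP; rewrite subr_eq0 => /eqP <-; by rewrite addrC subrK.
Qed.

End DuBoisReymond.

(** * Weak derivatives in L2 of the circle *)

Section SquareIntegrable.
Variable R : realType.
Notation mu := (@lebesgue_measure R).
Notation T := (2 * pi : R).
Notation I := (`[0, 2 * pi : R]%classic).
Implicit Types (u v w : R -> R[i]) (c : R[i]).

Lemma normc_sqr (c : R[i]) : normc c ^+ 2 = complex.Re c ^+ 2 + complex.Im c ^+ 2.
Proof. by case: c => a b /=; rewrite sqr_sqrtr // addr_ge0 // sqr_ge0. Qed.

Lemma L2_sqr u : L2 u ->
  mu.-integrable I (EFin \o (fun x => complex.Re (u x) ^+ 2)) /\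
  mu.-integrable I (EFin \o (fun x => complex.Im (u x) ^+ 2)).
Proof.
move=> [_ mr mi ui]; split; apply: rintegrable_le ui => //.
- exact: measurable_funTS (measurable_funX 2 mr).
- by move=> x _; rewrite normc_sqr ger0_norm ?sqr_ge0 // lerDl sqr_ge0.
- exact: measurable_funTS (measurable_funX 2 mi).
- by move=> x _; rewrite normc_sqr ger0_norm ?sqr_ge0 // lerDr sqr_ge0.
Qed.

Lemma L2_of_sqr u : periodic u T ->
  measurable_fun setT (fun x => complex.Re (u x)) ->
  measurable_fun setT (fun x => complex.Im (u x)) ->
  mu.-integrable I (EFin \o (fun x => complex.Re (u x) ^+ 2)) ->
  mu.-integrable I (EFin \o (fun x => complex.Im (u x) ^+ 2)) -> L2 u.
Proof.
move=> pu mr mi ir ii; split => //.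
have := rintegrableD (measurable_itv _) ir ii.
by apply: eq_integrable => // x _; rewrite /= normc_sqr.
Qed.

Lemma square_mul_integrable (f g : R -> R) :
  measurable_fun setT f -> measurable_fun setT g ->
  mu.-integrable I (EFin \o (fun x => f x ^+ 2)) ->
  mu.-integrable I (EFin \o (fun x => g x ^+ 2)) ->
  mu.-integrable I (EFin \o (fun x => f x * g x)).
Proof.
move=> mf mg fi gi.
apply: rintegrable_le (rintegrableD (measurable_itv _) fi gi) => //.
  exact: measurable_funTS (measurable_funM mf mg).
move=> x _; rewrite ler_norml.
have := sqr_ge0 (f x + g x); have := sqr_ge0 (f x - g x).
by have := sqr_ge0 (f x); have := sqr_ge0 (g x); rewrite !expr2; lra.
Qed.

Lemma L2D u v : L2 u -> L2 v -> L2 (fun x => u x + v x).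
Proof.
move=> Hu Hv; have [ur ui] := L2_sqr Hu; have [vr vi] := L2_sqr Hv.
case: Hu => pu mur mui _; case: Hv => pv mvr mvi _.
have ReD x : complex.Re (u x + v x) = complex.Re (u x) + complex.Re (v x) by case: (u x); case: (v x).
have ImD x : complex.Im (u x + v x) = complex.Im (u x) + complex.Im (v x) by case: (u x); case: (v x).
have sq (f g : R -> R) : measurable_fun setT f -> measurable_fun setT g ->
    mu.-integrable I (EFin \o (fun x => f x ^+ 2)) ->
    mu.-integrable I (EFin \o (fun x => g x ^+ 2)) ->
    mu.-integrable I (EFin \o (fun x => (f x + g x) ^+ 2)).
  move=> mf mg fi gi.
  have mI : measurable I by [].
  have := rintegrableD mI (rintegrableD mI fi gi) (rintegrableZ 2 mI (square_mul_integrable mf mg fi gi)).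
  by apply: eq_integrable => // x _ /=; congr (_%:E); ring.
apply: L2_of_sqr.
- by move=> x; rewrite pu pv.
- rewrite (funext ReD); exact: measurable_funD.
- rewrite (funext ImD); exact: measurable_funD.
- rewrite (_ : (fun x => _) = fun x => (complex.Re (u x) + complex.Re (v x)) ^+ 2); first exact: sq.
  by apply/funext => x; rewrite ReD.
- rewrite (_ : (fun x => _) = fun x => (complex.Im (u x) + complex.Im (v x)) ^+ 2); first exact: sq.
  by apply/funext => x; rewrite ImD.
Qed.

Lemma L2_of_parts u v w : periodic u T -> L2 v -> L2 w ->
  measurable_fun setT (fun x => complex.Re (u x)) ->
  measurable_fun setT (fun x => complex.Im (u x)) ->
  (exists C : R, forall x, normc (u x) ^+ 2 <= C * (normc (v x) ^+ 2 + normc (w x) ^+ 2)) -> L2 u.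
Proof.
move=> pu Lv Lw mr mi [C HC].
have [[vr vi] [wr wi]] := (L2_sqr Lv, L2_sqr Lw).
have mI : measurable I by [].
have bi := rintegrableZ C mI (rintegrableD mI (rintegrableD mI vr vi) (rintegrableD mI wr wi)).
apply: L2_of_sqr => //.
- apply: rintegrable_le bi => //; first exact: measurable_funTS (measurable_funX 2 mr).
  move=> x _; rewrite ger0_norm ?sqr_ge0 //; have := HC x; rewrite !normc_sqr => /(le_trans _); apply.
  by rewrite lerDl sqr_ge0.
- apply: rintegrable_le bi => //; first exact: measurable_funTS (measurable_funX 2 mi).
  move=> x _; rewrite ger0_norm ?sqr_ge0 //; have := HC x; rewrite !normc_sqr => /(le_trans _); apply.
  by rewrite lerDr sqr_ge0.
Qed.

Lemma periodic_reduce (x : R) : exists k : int, 0 <= x + T * k%:~R < T.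
Proof.
have T0 := two_pi_gt0 R.
exists (- Num.floor (x / T)); rewrite mulrNz mulrN.
have h1 : (Num.floor (x / T))%:~R <= x / T by exact: floor_le.
have h2 : x / T < (Num.floor (x / T))%:~R + 1 by rewrite -intrD1 floorD1_gt.
rewrite subr_ge0 ltrBlDr; rewrite ler_pdivlMr // mulrC in h1.
rewrite ltr_pdivrMr // mulrDl mul1r mulrC in h2.
by rewrite h1 addrC.
Qed.

Lemma periodic_bounded (k : R -> R) : continuous k -> periodic k T ->
  exists2 M, 0 <= M & forall x, `|k x| <= M.
Proof.
move=> ck pk.
have [c _ cM] := EVT_max (ltW (two_pi_gt0 R)) (continuous_subspaceT (abs_cont ck)).
exists `|k c| => // x; have [n /andP[n1 n2]] := periodic_reduce x.
by rewrite -(periodic_int n pk); apply: cM; rewrite in_itv /= n1 ltW.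
Qed.

Lemma ReM (a b : R[i]) : complex.Re (a * b) = complex.Re a * complex.Re b - complex.Im a * complex.Im b.
Proof. by case: a; case: b. Qed.

Lemma ImM (a b : R[i]) : complex.Im (a * b) = complex.Re a * complex.Im b + complex.Im a * complex.Re b.
Proof. by case: a; case: b. Qed.

Lemma ReD (a b : R[i]) : complex.Re (a + b) = complex.Re a + complex.Re b.
Proof. by case: a; case: b. Qed.

Lemma ImD (a b : R[i]) : complex.Im (a + b) = complex.Im a + complex.Im b.
Proof. by case: a; case: b. Qed.

Lemma ReN (a : R[i]) : complex.Re (- a) = - complex.Re a.
Proof. by case: a. Qed.

Lemma ImN (a : R[i]) : complex.Im (- a) = - complex.Im a.
Proof. by case: a. Qed.

Lemma ReJ (a : R[i]) : complex.Re (conjc a) = complex.Re a.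
Proof. by case: a. Qed.

Lemma ImJ (a : R[i]) : complex.Im (conjc a) = - complex.Im a.
Proof. by case: a. Qed.

Lemma cplx_eq (a b : R[i]) : complex.Re a = complex.Re b -> complex.Im a = complex.Im b -> a = b.
Proof. by case: a; case: b => ? ? ? ? /= -> ->. Qed.

Lemma ReIE (x y : R) : (complex.Re (x +i* y) = x) * (complex.Im (x +i* y) = y).
Proof. by []. Qed.

Definition cparts := (ReM, ImM, ReD, ImD, ReN, ImN, ReJ, ImJ, ReIE).

Lemma conj_add (a b : R[i]) : conjc (a + b) = conjc a + conjc b.
Proof. by apply: cplx_eq; rewrite !cparts ?opprD. Qed.

Lemma conj_mul (a b : R[i]) : conjc (a * b) = conjc a * conjc b.
Proof. by apply: cplx_eq; rewrite !cparts; ring. Qed.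

Definition cperiodic_cont u := [/\ periodic u T, continuous (fun x => complex.Re (u x))
  & continuous (fun x => complex.Im (u x))].

Lemma measurable_cont (f : R -> R) : continuous f -> measurable_fun setT f.
Proof. by move=> cf; exact: cont_measurable. Qed.

Lemma cperiodic_bound u : cperiodic_cont u -> exists2 M, 0 <= M & forall x, normc (u x) ^+ 2 <= M.
Proof.
move=> [pu cr ci].
have [M1 M10 H1] := periodic_bounded cr (fun x => congr1 (@complex.Re R) (pu x)).
have [M2 M20 H2] := periodic_bounded ci (fun x => congr1 (@complex.Im R) (pu x)).
exists (M1 ^+ 2 + M2 ^+ 2); first by rewrite addr_ge0 // sqr_ge0.
move=> x; rewrite normc_sqr -(real_normK (num_real (complex.Re _))) -(real_normK (num_real (complex.Im _))).
by rewrite lerD // lerXn2r // nnegrE.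
Qed.

Lemma L2M k u : cperiodic_cont k -> L2 u -> L2 (fun x => k x * u x).
Proof.
move=> Hk Lu; have [M M0 HM] := cperiodic_bound Hk; case: Hk => pk cr ci.
have [pu mr mi _] := Lu.
apply: (L2_of_parts (v := u) (w := u)) => //.
- by move=> x; rewrite pk pu.
- rewrite (_ : (fun x => _) = fun x => complex.Re (k x) * complex.Re (u x) - complex.Im (k x) * complex.Im (u x)).
    by apply: measurable_funB; apply: measurable_funM => //; exact: measurable_cont.
  by apply/funext => x; rewrite cparts.
- rewrite (_ : (fun x => _) = fun x => complex.Re (k x) * complex.Im (u x) + complex.Im (k x) * complex.Re (u x)).
    by apply: measurable_funD; apply: measurable_funM => //; exact: measurable_cont.
  by apply/funext => x; rewrite cparts.
exists M => x; rewrite normcM exprMn; apply: ler_pM; rewrite ?sqr_ge0 //.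
by rewrite lerDl sqr_ge0.
Qed.

Lemma cperiodic_cst c : cperiodic_cont (fun _ => c).
Proof. by split => //; exact: cst_continuous. Qed.

Lemma L2_cst c : L2 (fun _ => c).
Proof.
apply: L2_of_sqr => //.
- by apply: continuous_integrable; exact: cst_continuous.
- by apply: continuous_integrable; exact: cst_continuous.
Qed.

Lemma L2_cont u : cperiodic_cont u -> L2 u.
Proof.
move=> H; have := L2M H (L2_cst 1).
by rewrite (_ : (fun x => _) = u) //; apply/funext => x; rewrite mulr1.
Qed.

Lemma L2Z c u : L2 u -> L2 (fun x => c * u x).
Proof. exact: L2M (cperiodic_cst c). Qed.

Lemma L2B u v : L2 u -> L2 v -> L2 (fun x => u x - v x).
Proof.
move=> Lu Lv; have := L2D Lu (L2Z (-1) Lv).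
by rewrite (_ : (fun x => _) = (fun x => u x - v x)) //; apply/funext => x; rewrite mulN1r.
Qed.

Definition cintegrable u :=
  mu.-integrable I (EFin \o (fun x => complex.Re (u x))) /\
  mu.-integrable I (EFin \o (fun x => complex.Im (u x))).

Lemma cintegrable_dot u v : L2 u -> L2 v -> cintegrable (fun x => u x * conjc (v x)).
Proof.
move=> Lu Lv; have [ur ui] := L2_sqr Lu; have [vr vi] := L2_sqr Lv.
case: Lu => _ mur mui _; case: Lv => _ mvr mvi _; have mI : measurable I by [].
split.
- rewrite (_ : (fun x => _) = fun x => complex.Re (u x) * complex.Re (v x) + complex.Im (u x) * complex.Im (v x)).
    by apply: rintegrableD => //; exact: square_mul_integrable.
  by apply/funext => x; rewrite !cparts mulrN opprK.
- rewrite (_ : (fun x => _) = fun x => (-1) * (complex.Re (u x) * complex.Im (v x)) + complex.Im (u x) * complex.Re (v x)).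
    by apply: rintegrableD => //; [apply: rintegrableZ => //|]; exact: square_mul_integrable.
  by apply/funext => x; rewrite !cparts mulrN mulN1r.
Qed.

Lemma rintN (f : R -> R) : mu.-integrable I (EFin \o f) ->
  \int[mu]_(x in I) (- f x) = - \int[mu]_(x in I) f x.
Proof.
move=> fi; rewrite -[RHS]mulN1r -RintegralZl //.
by apply: eq_Rintegral => x _; rewrite mulN1r.
Qed.

Lemma cintD u v : cintegrable u -> cintegrable v ->
  cint I (fun x => u x + v x) = cint I u + cint I v.
Proof.
move=> [ur ui] [vr vi]; apply: cplx_eq; rewrite /cint !cparts -RintegralD //;
by apply: eq_Rintegral => x _; rewrite cparts.
Qed.

Lemma cintZ c u : cintegrable u -> cint I (fun x => c * u x) = c * cint I u.
Proof.
move=> [ur ui]; have mI : measurable I by [].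
have Zr k := rintegrableZ k mI ur; have Zi k := rintegrableZ k mI ui.
apply: cplx_eq; rewrite /cint !cparts -!RintegralZl // -?RintegralB -?RintegralD //;
by apply: eq_Rintegral => x _; rewrite cparts.
Qed.

Lemma cintB u v : cintegrable u -> cintegrable v ->
  cint I (fun x => u x - v x) = cint I u - cint I v.
Proof.
move=> [ur ui] [vr vi]; apply: cplx_eq; rewrite /cint !cparts -RintegralB //;
by apply: eq_Rintegral => x _; rewrite !cparts.
Qed.

Lemma cint_conj u : cintegrable u -> cint I (fun x => conjc (u x)) = conjc (cint I u).
Proof.
move=> [ur ui]; apply: cplx_eq; rewrite cparts /cint /=.
  by apply: eq_Rintegral => x _; rewrite cparts.
rewrite -mulN1r -RintegralZl //; apply: eq_Rintegral => x _.
by rewrite cparts mulN1r.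
Qed.

Lemma eq_cint u v : u =1 v -> cint I u = cint I v.
Proof. by move=> /funext ->. Qed.

Lemma dotpC u v : L2 u -> L2 v -> dotp v u = conjc (dotp u v).
Proof.
move=> Lu Lv; rewrite /dotp -cint_conj; last exact: cintegrable_dot.
apply: eq_cint => x; apply: cplx_eq; rewrite !cparts; ring.
Qed.

Lemma dotpDl u v w : L2 u -> L2 v -> L2 w ->
  dotp (fun x => u x + v x) w = dotp u w + dotp v w.
Proof.
move=> Lu Lv Lw; rewrite /dotp -cintD; try exact: cintegrable_dot.
by apply: eq_cint => x; rewrite mulrDl.
Qed.

Lemma dotpZl c u v : L2 u -> L2 v -> dotp (fun x => c * u x) v = c * dotp u v.
Proof.
move=> Lu Lv; rewrite /dotp -cintZ; last exact: cintegrable_dot.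
by apply: eq_cint => x; rewrite mulrA.
Qed.

Lemma dotpBl u v w : L2 u -> L2 v -> L2 w ->
  dotp (fun x => u x - v x) w = dotp u w - dotp v w.
Proof.
move=> Lu Lv Lw; rewrite -mulN1r -dotpZl // -dotpDl //; last exact: L2Z.
by apply: eq_cint => x; rewrite mulN1r.
Qed.

Lemma dotpDr u v w : L2 u -> L2 v -> L2 w ->
  dotp u (fun x => v x + w x) = dotp u v + dotp u w.
Proof.
move=> Lu Lv Lw; have L := L2D Lv Lw.
by rewrite (dotpC L Lu) dotpDl // conj_add -(dotpC Lv Lu) -(dotpC Lw Lu).
Qed.

Lemma dotpZr c u v : L2 u -> L2 v -> dotp u (fun x => c * v x) = conjc c * dotp u v.
Proof.
move=> Lu Lv; have L := L2Z c Lv.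
by rewrite (dotpC L Lu) dotpZl // conj_mul -(dotpC Lv Lu).
Qed.

Lemma dotp_move k u v : dotp (fun x => k x * u x) v = dotp u (fun x => conjc (k x) * v x).
Proof. by apply: eq_cint => x; apply: cplx_eq; rewrite !cparts; ring. Qed.

(** The endpoints are left out: they are negligible, and [du_bois_reymond] identifies functions
    inside the period only. *)
Definition aeq u v := {ae mu, forall x, 0 < x < T -> u x = v x}.

Lemma aeq_map (F : R -> R[i] -> R[i]) u v : aeq u v -> aeq (fun x => F x (u x)) (fun x => F x (v x)).
Proof. by apply: ae_mono => x H xT; rewrite H. Qed.

Lemma Rintegral_ae (f g : R -> R) : measurable_fun I f -> measurable_fun I g ->
  {ae mu, forall x, 0 < x < T -> f x = g x} ->
  \int[mu]_(x in I) f x = \int[mu]_(x in I) g x.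
Proof.
move=> mf mg H; rewrite /Rintegral; congr fine.
apply: ae_eq_integral => //; try exact/measurable_EFinP.
apply: ae_mono (ae_and (ae_and (ae_neq 0 I) (ae_neq T I)) H) => x [[n0 nT] E] Ix.
have := Ix; rewrite /= in_itv /= => /andP[x0 xT].
by rewrite E // !lt_neqAle eq_sym n0 // nT // x0.
Qed.

Lemma dotp_ael u v w : L2 u -> L2 v -> L2 w -> aeq u v -> dotp u w = dotp v w.
Proof.
move=> Lu Lv Lw uv.
have [ur ui] := cintegrable_dot Lu Lw; have [vr vi] := cintegrable_dot Lv Lw.
by apply: cplx_eq; apply: Rintegral_ae; try exact: rintegrable_measurable;
  apply: ae_mono uv => x H xT; rewrite H.
Qed.

Lemma dotp_aer u v w : L2 u -> L2 v -> L2 w -> aeq v w -> dotp u v = dotp u w.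
Proof.
by move=> Lu Lv Lw vw; rewrite (dotpC Lv Lu) (dotp_ael Lv Lw) // -(dotpC Lw Lu).
Qed.

Lemma dotp_self u : L2 u -> dotp u u = (\int[mu]_(x in I) normc (u x) ^+ 2)%:C.
Proof.
move=> Lu; apply: cplx_eq => /=.
  by apply: eq_Rintegral => x _; rewrite normc_sqr !cparts !expr2; ring.
rewrite (@eq_Rintegral _ _ _ mu _ (fun _ => 0)) ?Rintegral_cst ?mul0r // => x _.
by rewrite !cparts; ring.
Qed.

Lemma L2norm_sqr u : L2 u -> L2norm u ^+ 2 = \int[mu]_(x in I) normc (u x) ^+ 2.
Proof.
move=> Lu; rewrite /L2norm dotp_self //= sqr_sqrtr //.
by apply: Rintegral_ge0 => x _; exact: sqr_ge0.
Qed.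

Lemma L2norm_ge0 u : 0 <= L2norm u.
Proof. exact: sqrtr_ge0. Qed.

Lemma L2norm0_ae u : L2 u -> L2norm u = 0 -> aeq u (fun _ => 0).
Proof.
move=> Lu u0.
have E : \int[mu]_(x in I) normc (u x) ^+ 2 = 0 by rewrite -L2norm_sqr // u0 expr0n.
have ui : mu.-integrable I (EFin \o (fun x => normc (u x) ^+ 2)) by case: Lu.
have mui := rintegrable_measurable ui.
have mE : measurable_fun I (EFin \o (fun x => normc (u x) ^+ 2)) by exact/measurable_EFinP.
have [H _] := ae_eq_integral_abs mu (measurable_itv `[0, T]) mE.
have : (\int[mu]_(x in I) `|(EFin \o (fun y => (normc (u y) ^+ 2)%R)) x| = 0)%E.
  have fi : (\int[mu]_(x in I) (EFin \o (fun y => (normc (u y) ^+ 2)%R)) x)%E \is a fin_num.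
    exact: integrable_fin_num.
  rewrite [LHS](_ : _ = \int[mu]_(x in I) (EFin \o (fun y => (normc (u y) ^+ 2)%R)) x)%E.
    by rewrite -[LHS]fineK //; congr (_%:E); exact: E.
  by apply: eq_integral => x _ /=; rewrite ger0_norm // sqr_ge0.
move=> /H; apply: ae_mono => x H0 /andP[x0 xT].
have Ix : I x by rewrite /= in_itv /= !ltW.
have [] := H0 Ix.
by move=> /eqP; rewrite sqrf_eq0 => /eqP /eq0_normc.
Qed.

Lemma L2norm_eq_ae u v : L2 u -> L2 v -> aeq u v -> L2norm u = L2norm v.
Proof. by move=> Lu Lv uv; rewrite /L2norm (dotp_ael Lu Lv) // (dotp_aer Lv Lu Lv). Qed.

End SquareIntegrable.

(** * Uniqueness, superposition and translation for the system p' = - s W q, q' = s p / W *)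

Section SystemUniqueness.
Variable R : realType.

Definition sol (s : R) (W p q : R -> R) :=
  primitive p (fun x => - (s * W x) * q x) /\ primitive q (fun x => s * (W x)^-1 * p x).

Lemma const_on_itv (F f : R -> R) (a b x y : R) : primitive F f ->
  (forall t, a <= t <= b -> f t = 0) -> a <= x <= b -> a <= y <= b -> F x = F y.
Proof.
move=> HF f0.
wlog xy : x y / x <= y.
  by move=> H xab yab; have [xy|/ltW yx] := leP x y; [exact: H|symmetry; exact: H].
move=> /andP[ax xb] /andP[ay yb]; apply/eqP; rewrite eq_le.
have z0 t : x <= t <= y -> f t = 0.
  by move=> /andP[xt ty]; apply: f0; rewrite (le_trans ax xt) (le_trans ty yb).
apply/andP; split.
  by apply: (prim_nondecreasing HF xy) => t /z0 ->.
by apply: (prim_nonincreasing HF xy) => t /z0 ->.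
Qed.

(** The Wronskians of (p, q) with the two fundamental solutions are constant, and the Wronskian 1 of
    the latter inverts the relation. The equations are assumed on [[a, b]] only, because
    representatives of L2 functions satisfy them on a single period. *)
Lemma sol_unique (s a b : R) (W P1 Q1 P2 Q2 p q p' q' : R -> R) :
  sol s W P1 Q1 -> P1 0 = 1 -> Q1 0 = 0 ->
  sol s W P2 Q2 -> P2 0 = 0 -> Q2 0 = 1 ->
  primitive p p' -> primitive q q' -> a <= 0 <= b ->
  (forall x, a <= x <= b -> p' x = - (s * W x) * q x) ->
  (forall x, a <= x <= b -> q' x = s * (W x)^-1 * p x) ->
  forall x, a <= x <= b ->
    p x = p 0 * P1 x + q 0 * P2 x /\ q x = p 0 * Q1 x + q 0 * Q2 x.
Proof.
move=> [hP1 hQ1] P10 Q10 [hP2 hQ2] P20 Q20 hp hq ab0 Ep Eq x xab.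
have w1 : P1 x * Q2 x - P2 x * Q1 x = 1.
  have Hw := primB (primM hP1 hQ2) (primM hP2 hQ1).
  have -> := const_on_itv Hw _ xab ab0; last by move=> t _ /=; ring.
  by rewrite P10 Q20 P20 Q10; ring.
have A : p x * Q2 x - q x * P2 x = p 0.
  have HA := primB (primM hp hQ2) (primM hq hP2).
  have -> := const_on_itv HA _ xab ab0; first by rewrite P20 Q20; ring.
  by move=> t tab /=; rewrite Ep // Eq //; ring.
have B : q x * P1 x - p x * Q1 x = q 0.
  have HB := primB (primM hq hP1) (primM hp hQ1).
  have -> := const_on_itv HB _ xab ab0; first by rewrite P10 Q10; ring.
  by move=> t tab /=; rewrite Ep // Eq //; ring.
rewrite -A -B; split.
  by rewrite -[LHS]mulr1 -w1; ring.
by rewrite -[LHS]mulr1 -w1; ring.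
Qed.

Lemma sol_exists (s : R) (W : R -> R) : continuous W -> (forall x, 0 < W x) ->
  exists P1 Q1 P2 Q2, [/\ sol s W P1 Q1, P1 0 = 1 /\ Q1 0 = 0,
     sol s W P2 Q2 & P2 0 = 0 /\ Q2 0 = 1].
Proof.
move=> cW W0.
have cV : continuous (fun x => (W x)^-1).
  by move=> x; apply: cvgV; [rewrite gt_eqF|exact: cW].
have W0' x : 0 <= W x by exact: ltW.
have V0 x : 0 <= (W x)^-1 by rewrite invr_ge0.
have [p [q [hp hq init _]]] := linear_system_solution 0 cW cV W0' V0.
(* The system with W and 1 / W exchanged: if (p, q) solves it, then (-q, p) solves the original one,
   which gives the second fundamental solution. *)
have [p2 [q2 [hp2 hq2 init2 _]]] := linear_system_solution 0 cV cW V0 W0'.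
have [i1 i2] := init s; have [j1 j2] := init2 s.
exists (p s), (q s), (fun x => - q2 s x), (p2 s); split.
- by split; [exact: (hp s)|exact: (hq s)].
- by [].
- split.
    by apply: prim_eq (primN (hq2 s)) _ => x; rewrite mulNr.
  by apply: prim_eq (hp2 s) _ => x; rewrite mulrN mulNr.
- by rewrite j2 oppr0.
Qed.

Lemma sol_comb (s : R) (W p q p' q' : R -> R) (a b : R) : sol s W p q -> sol s W p' q' ->
  sol s W (fun x => a * p x + b * p' x) (fun x => a * q x + b * q' x).
Proof.
move=> [h1 h2] [h3 h4]; split.
  by apply: prim_eq (primD (primZ a h1) (primZ b h3)) _ => x; ring.
by apply: prim_eq (primD (primZ a h2) (primZ b h4)) _ => x; ring.
Qed.

Lemma sol_eq (s : R) (W p q p' q' : R -> R) : (forall x, 0 < W x) -> continuous W ->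
  sol s W p q -> sol s W p' q' -> p 0 = p' 0 -> q 0 = q' 0 -> p =1 p' /\ q =1 q'.
Proof.
move=> W0 cW [h1 h2] [h3 h4] E1 E2.
have [P1 [Q1 [P2 [Q2 [s1 [i1 i2] s2 [j1 j2]]]]]] := sol_exists s cW W0.
have U (x : R) := @sol_unique s (Num.min x 0) (Num.max x 0) W P1 Q1 P2 Q2 p q _ _ s1 i1 i2 s2 j1 j2 h1 h2.
have U' (x : R) := @sol_unique s (Num.min x 0) (Num.max x 0) W P1 Q1 P2 Q2 p' q' _ _ s1 i1 i2 s2 j1 j2 h3 h4.
have mm (x : R) : Num.min x 0 <= 0 <= Num.max x 0 by case: (leP x 0) => h; apply/andP; split; lra.
have mx (x : R) : Num.min x 0 <= x <= Num.max x 0 by case: (leP x 0) => h; apply/andP; split; lra.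
have A (x : R) := U x (mm x) (fun _ _ => erefl) (fun _ _ => erefl) x (mx x).
have B (x : R) := U' x (mm x) (fun _ _ => erefl) (fun _ _ => erefl) x (mx x).
by split=> x; have [a1 a2] := A x; have [b1 b2] := B x; rewrite ?a1 ?b1 ?a2 ?b2 E1 E2.
Qed.

(** Translation by a period multiplies W by [m ^+ 2]; dividing p by m and multiplying q by m
    restores the system. *)
Lemma sol_shift (s m T : R) (W p q : R -> R) : m != 0 ->
  (forall x, W (x + T) = m ^+ 2 * W x) -> sol s W p q ->
  sol s W (fun x => p (x + T) / m) (fun x => m * q (x + T)).
Proof.
move=> m0 Wm [h1 h2]; split.
  apply: prim_eq (primM (prim_shift T h1) (prim_cst m^-1)) _ => x /=.
  by rewrite Wm mulr0 addr0; field.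
apply: prim_eq (primZ m (prim_shift T h2)) _ => x /=.
by rewrite Wm invfM; move: ((W x)^-1) => V; field.
Qed.

End SystemUniqueness.

(** * Continuous representatives of weakly differentiable functions *)

Section WeakDerivatives.
Variable R : realType.
Notation mu := (@lebesgue_measure R).
Notation T := (2 * pi : R).
Notation I := (`[0, 2 * pi : R]%classic).
Implicit Types (u v w : R -> R[i]).

Lemma inv_i : (0 +i* 1)^-1 = (0 -i* 1) :> R[i].
Proof.
have i0 : (0 +i* 1 : R[i]) != 0 by apply/eqP => -[] /eqP; rewrite oner_eq0.
apply: (mulfI i0); rewrite mulfV //; apply: cplx_eq; rewrite !cparts /=; ring.
Qed.

Lemma csmooth_prim (phi : R -> R[i]) : csmooth_circle phi ->
  primitive (fun x => complex.Re (phi x)) (fun x => complex.Re (cderive phi x)) /\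
  primitive (fun x => complex.Im (phi x)) (fun x => complex.Im (cderive phi x)).
Proof. by move=> [[_ s1] [_ s2]]; split; exact: smooth_primitive. Qed.

Lemma csmooth_cont (phi : R -> R[i]) : csmooth_circle phi -> cperiodic_cont phi.
Proof.
move=> [[p1 s1] [p2 s2]]; split; [|exact: smooth_continuous s1|exact: smooth_continuous s2].
by move=> x; apply: cplx_eq; [exact: p1|exact: p2].
Qed.

Lemma cderive_cont (phi : R -> R[i]) : csmooth_circle phi -> cperiodic_cont (cderive phi).
Proof.
move=> H; have [h1 h2] := csmooth_prim H; case: H => [[p1 s1] [p2 s2]]; split.
- move=> x; apply: cplx_eq; [exact: (periodic_prim h1 p1)|exact: (periodic_prim h2 p2)].
- exact: smooth_continuous (smooth_derive1 s1).
- exact: smooth_continuous (smooth_derive1 s2).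
Qed.

Definition Dx (phi : R -> R[i]) : R -> R[i] := fun x => (0 +i* 1)^-1 * cderive phi x.

Lemma L2_Dx phi : csmooth_circle phi -> L2 (Dx phi).
Proof. by move=> H; apply: L2Z; apply: L2_cont; exact: cderive_cont. Qed.

Lemma cint_prim (F f : R -> R[i]) : cperiodic_cont f -> periodic F T ->
  primitive (fun x => complex.Re (F x)) (fun x => complex.Re (f x)) ->
  primitive (fun x => complex.Im (F x)) (fun x => complex.Im (f x)) ->
  cint I f = 0.
Proof.
move=> [pf cr ci] pF h1 h2; have T0 := ltW (two_pi_gt0 R).
have FT : F T = F 0 by rewrite -[T in LHS]add0r pF.
by apply: cplx_eq; rewrite /cint /= ?(prim_Rintegral h1 cr T0) ?(prim_Rintegral h2 ci T0) FT subrr.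
Qed.

(** The difference of the two integrands is, up to sign, the derivative of the periodic function
    [F], so it integrates to 0 over a period. *)
Lemma csmooth_weakD phi : csmooth_circle phi -> weakD phi (Dx phi).
Proof.
move=> H; split; [exact: L2_cont (csmooth_cont H)|exact: L2_Dx|].
move=> psi H'; apply/eqP; rewrite -subr_eq0; apply/eqP.
have [h1 h2] := csmooth_prim H; have [k1 k2] := csmooth_prim H'.
have Lp := L2_cont (csmooth_cont H); have Lp' := L2_cont (csmooth_cont H').
have [pphi c1 c2] := csmooth_cont H; have [ppsi d1 d2] := csmooth_cont H'.
have [pdphi e1 e2] := cderive_cont H; have [pdpsi f1 f2] := cderive_cont H'.
pose F x := (0 -i* 1) * (phi x * conjc (psi x)).
pose f x := Dx phi x * conjc (psi x) - phi x * conjc (Dx psi x).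
have -> : dotp phi (Dx psi) - dotp (Dx phi) psi = - cint I f.
  by rewrite cintB ?opprB //; apply: cintegrable_dot => //; exact: L2_Dx.
rewrite (@cint_prim F f) ?oppr0 //.
- split.
  + by move=> x; rewrite /f /Dx pphi ppsi pdphi pdpsi.
  + rewrite (_ : (fun x => _) = fun x => complex.Im (cderive phi x) * complex.Re (psi x)
      - complex.Re (cderive phi x) * complex.Im (psi x) +
      (complex.Im (phi x) * complex.Re (cderive psi x)
       - complex.Re (phi x) * complex.Im (cderive psi x))).
      by move=> x; apply: cvgD; apply: cvgB; [exact: (mul_cont e2 d1)|exact: (mul_cont e1 d2)|exact: (mul_cont c2 f1)|exact: (mul_cont c1 f2)].
    by apply/funext => x; rewrite /f /Dx inv_i !cparts; ring.
  + rewrite (_ : (fun x => _) = fun x => - (complex.Re (cderive phi x) * complex.Re (psi x)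
      + complex.Im (cderive phi x) * complex.Im (psi x) +
      (complex.Re (phi x) * complex.Re (cderive psi x)
       + complex.Im (phi x) * complex.Im (cderive psi x)))).
      by move=> x; apply: cvgN; apply: cvgD; apply: cvgD; [exact: (mul_cont e1 d1)|exact: (mul_cont e2 d2)|exact: (mul_cont c1 f1)|exact: (mul_cont c2 f2)].
    by apply/funext => x; rewrite /f /Dx inv_i !cparts; ring.
- by move=> x; rewrite /F pphi ppsi.
- rewrite (_ : (fun x => complex.Re (F x)) = fun x => complex.Im (phi x) * complex.Re (psi x)
     - complex.Re (phi x) * complex.Im (psi x)); last first.
    by apply/funext => x; rewrite /F !cparts; ring.
  apply: prim_eq (primB (primM h2 k1) (primM h1 k2)) _ => x.
  by rewrite /f /Dx inv_i !cparts; ring.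
- rewrite (_ : (fun x => complex.Im (F x)) = fun x => - (complex.Re (phi x) * complex.Re (psi x)
     + complex.Im (phi x) * complex.Im (psi x))); last first.
    by apply/funext => x; rewrite /F !cparts; ring.
  apply: prim_eq (primN (primD (primM h1 k1) (primM h2 k2))) _ => x.
  by rewrite /f /Dx inv_i !cparts; ring.
Qed.

Lemma weakD_ae u v v' : weakD u v -> L2 v' -> aeq v v' -> weakD u v'.
Proof.
move=> [Lu Lv H] Lv' vv'; split => // phi Hphi.
by rewrite (H phi Hphi) (dotp_ael Lv Lv' (L2_cont (csmooth_cont Hphi)) vv').
Qed.

Lemma real_csmooth (phi : R -> R) : smooth_circle phi -> csmooth_circle (fun x => (phi x)%:C).
Proof. by move=> H; split; [exact: H|split; [by []|exact: smooth_cst]]. Qed.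

Lemma cderive_real (phi : R -> R) x : cderive (fun x => (phi x)%:C) x = (derive1 phi x)%:C.
Proof. by rewrite /cderive /= (prim_derive1 (@prim_cst R 0)). Qed.

(** Real test functions suffice: they separate the identity into one du Bois-Reymond statement for
    Re u and one for Im u. The densities - Im v and Re v come from u' = i v. *)
Lemma weakD_continuous u v : weakD u v -> exists Gr Gi : R -> R,
  [/\ continuous Gr, continuous Gi, Gr T = Gr 0 & Gi T = Gi 0] /\
  [/\ forall x, 0 <= x <= T -> Gr x = Gr 0 + \int[mu]_(t in `[0, x]) (- complex.Im (v t)),
      forall x, 0 <= x <= T -> Gi x = Gi 0 + \int[mu]_(t in `[0, x]) complex.Re (v t) &
      aeq u (fun x => Gr x +i* Gi x)].
Proof.
move=> [Lu Lv H]; have mI : measurable I by [].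
have L1 := L2_cst (1 : R[i]).
have int1 w : L2 w -> mu.-integrable I (EFin \o (fun x => complex.Re (w x))) /\
    mu.-integrable I (EFin \o (fun x => complex.Im (w x))).
  move=> Lw; have E : w = (fun x => w x * conjc 1).
    by apply/funext => x; apply: cplx_eq; rewrite !cparts /=; ring.
  by rewrite E; exact: cintegrable_dot Lw L1.
have [uri uii] := int1 _ Lu; have [vri vii] := int1 _ Lv.
have nvii := rintegrableZ (-1) mI vii.
have key (phi : R -> R) : smooth_circle phi ->
   (\int[mu]_(t in I) (complex.Re (u t) * derive1 phi t) =
     - (\int[mu]_(t in I) (-1 * complex.Im (v t) * phi t))) /\
   (\int[mu]_(t in I) (complex.Im (u t) * derive1 phi t) =
     - (\int[mu]_(t in I) (complex.Re (v t) * phi t))).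
  move=> Hphi; have := H _ (real_csmooth Hphi).
  have cphi := smooth_continuous Hphi.2.
  rewrite /dotp /cint => -[E1 E2]; split.
    transitivity (\int[mu]_(x in I) complex.Im (u x * conjc ((0 +i* 1)^-1 * cderive (fun y => (phi y)%:C) x))).
      by apply: eq_Rintegral => x _; rewrite cderive_real inv_i !cparts /=; ring.
    rewrite E2 -rintN; last exact: integrable_mul_cont.
    by apply: eq_Rintegral => x _; rewrite !cparts /=; ring.
  transitivity (- (\int[mu]_(x in I) complex.Re (u x * conjc ((0 +i* 1)^-1 * cderive (fun y => (phi y)%:C) x)))).
    rewrite -rintN.
      by apply: eq_Rintegral => x _; rewrite cderive_real inv_i !cparts /=; ring.
    by have [] := cintegrable_dot Lu (L2_Dx (real_csmooth Hphi)).
  rewrite E1; congr (- _).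
  by apply: eq_Rintegral => x _; rewrite !cparts /=; ring.
have [Gr [cGr GrT GrE] ur] := du_bois_reymond uri nvii (fun phi h => (key phi h).1).
have [Gi [cGi GiT GiE] ui] := du_bois_reymond uii vri (fun phi h => (key phi h).2).
exists Gr, Gi; split; first by split.
split => //.
- move=> x xT; rewrite GrE //; congr (_ + _); apply: eq_Rintegral => t _; exact: mulN1r.
- by apply: ae_mono (ae_and ur ui) => x [h1 h2] xT; apply: cplx_eq; rewrite cparts ?h1 ?h2.
Qed.

End WeakDerivatives.

(** * Reduction to a real Floquet system *)

Section ClassicalPair.
Variable R : realType.
Notation mu := (@lebesgue_measure R).
Notation T := (2 * pi : R).
Notation I := (`[0, 2 * pi : R]%classic).
Variables (g : R -> R[i]) (h : R) (z : R[i]).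
Hypotheses (hg : csmooth_circle g) (h0 : 0 < h).

Definition re_pot (x : R) := complex.Re z - complex.Re (g x).
Definition im_pot (x : R) := complex.Im z - complex.Im (g x).
Definition phase := prim_from 0 (fun x => h^-1 * re_pot x).
Definition lweight := prim_from 0 (fun x => h^-1 * im_pot x).
Definition sq_weight (x : R) := expR (2 * lweight x).

Lemma g_cont : cperiodic_cont g.
Proof. exact: csmooth_cont. Qed.

Lemma re_pot_cont : continuous re_pot.
Proof. by have [_ c _] := g_cont => x; apply: cvgB; [exact: cvg_cst|exact: c]. Qed.

Lemma im_pot_cont : continuous im_pot.
Proof. by have [_ _ c] := g_cont => x; apply: cvgB; [exact: cvg_cst|exact: c]. Qed.

Lemma phaseP : primitive phase (fun x => h^-1 * re_pot x) /\ phase 0 = 0.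
Proof. by apply: prim_fromP => x; apply: cvgMl_tmp; exact: re_pot_cont. Qed.

Lemma lweightP : primitive lweight (fun x => h^-1 * im_pot x) /\ lweight 0 = 0.
Proof. by apply: prim_fromP => x; apply: cvgMl_tmp; exact: im_pot_cont. Qed.

Lemma pot_periodic : periodic re_pot T /\ periodic im_pot T.
Proof. by have [p _ _] := g_cont; split=> x; rewrite /re_pot /im_pot p. Qed.

Lemma phase_shift x : phase (x + T) = phase x + phase T.
Proof.
have [hp p0] := phaseP; have [pr _] := pot_periodic.
have := prim_periodic_shift hp (_ : periodic _ T) x 0; rewrite add0r p0 subr0.
by move=> <-; [rewrite [RHS]addrC subrK|move=> y; rewrite pr].
Qed.

Lemma lweight_shift x : lweight (x + T) = lweight x + lweight T.
Proof.
have [hp p0] := lweightP; have [_ pr] := pot_periodic.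
have := prim_periodic_shift hp (_ : periodic _ T) x 0; rewrite add0r p0 subr0.
by move=> <-; [rewrite [RHS]addrC subrK|move=> y; rewrite pr].
Qed.

Lemma sq_weight_gt0 x : 0 < sq_weight x. Proof. exact: expR_gt0. Qed.

Lemma sq_weight_cont : continuous sq_weight.
Proof.
apply: expR_cont => x; apply: cvgMl_tmp.
by have [hp _] := lweightP; exact: prim_continuous hp x.
Qed.

Lemma sq_weight_shift x : sq_weight (x + T) = expR (lweight T) ^+ 2 * sq_weight x.
Proof. by rewrite /sq_weight lweight_shift mulrDr addrC expRD -expRM_natl. Qed.

(* With U = exp (i phase) and W = sq_weight, the system (P - z) e = t f,
   (P - z)^* f = t e for e = U p / sqrt W, f = i U sqrt W q becomes
   p' = - s W q, q' = s p / W with s = t / h, separately for real and imaginary parts. *)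
Definition e_of (p1 p2 : R -> R) (x : R) : R[i] :=
  (cos (phase x) +i* sin (phase x)) * (p1 x +i* p2 x) * (expR (- lweight x))%:C.

Definition f_of (q1 q2 : R -> R) (x : R) : R[i] :=
  (0 +i* 1) * ((cos (phase x) +i* sin (phase x)) * (q1 x +i* q2 x) * (expR (lweight x))%:C).

(** The condition for [e_of p1 p2] and [f_of q1 q2] to be 2 pi-periodic: over a period their
    prefactors gain the rotation of angle [phase T] and the factors 1 / m and m respectively. *)
Definition floquet (p1 p2 q1 q2 : R -> R) :=
  forall x, let C := cos (phase T) in let S := sin (phase T) in let m := expR (lweight T) in
  [/\ C * p1 (x + T) - S * p2 (x + T) = m * p1 x,
      C * p2 (x + T) + S * p1 (x + T) = m * p2 x,
      m * (C * q1 (x + T) - S * q2 (x + T)) = q1 x &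
      m * (C * q2 (x + T) + S * q1 (x + T)) = q2 x].

Lemma Rintegral_ae_upto (f k : R -> R) (x : R) : x <= T ->
  measurable_fun I f -> measurable_fun I k ->
  {ae mu, forall t, 0 < t < T -> f t = k t} ->
  \int[mu]_(t in `[0, x]) f t = \int[mu]_(t in `[0, x]) k t.
Proof.
move=> xT mf mk H; rewrite /Rintegral; congr fine.
have sub : `[0, x]%classic `<=` I by apply: subset_itv; rewrite bnd_simp.
apply: ae_eq_integral => //.
- by apply/measurable_EFinP; exact: measurable_funS mf.
- by apply/measurable_EFinP; exact: measurable_funS mk.
apply: ae_mono (ae_and (ae_and (ae_neq 0 I) (ae_neq T I)) H) => t [[n0 nT] E] Ix.
have Ix' := sub _ Ix; have := Ix'; rewrite /= in_itv /= => /andP[t0 tT].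
by rewrite E // !lt_neqAle eq_sym n0 // nT // t0.
Qed.

(** Bootstrap: once the density of an absolutely continuous function agrees almost everywhere with a
    continuous function, it may be replaced by it and the function is C^1. *)
Lemma integral_eq_primitive (G k c : R -> R) : continuous c -> measurable_fun I k ->
  (forall x, 0 <= x <= T -> G x = G 0 + \int[mu]_(t in `[0, x]) k t) ->
  {ae mu, forall t, 0 < t < T -> k t = c t} ->
  exists2 F, primitive F c & forall x, 0 <= x <= T -> F x = G x.
Proof.
move=> cc mk GE H; have [F HF F0] := prim_exists 0 cc.
exists (fun x => G 0 + F x).
  by apply: prim_eq (primD (prim_cst (G 0)) HF) _ => x; rewrite add0r.
move=> x /andP[x0 xT]; rewrite (GE x) ?x0 //; congr (_ + _).
rewrite (Rintegral_ae_upto (k := c)) //; last exact: cont_measurable.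
by rewrite (prim_Rintegral HF cc x0) F0 subr0.
Qed.

(** The continuous representatives satisfy the system on one period. There they are combinations of
    fundamental solutions, and these combinations define p and q on all of R; equality of the
    representatives at 0 and 2 pi becomes a Floquet relation at 0, which uniqueness propagates to
    every x. *)
Lemma classical_pair (t : R) (e f : R -> R[i]) :
  weakD e (fun x => (h^-1)%:C * (t%:C * f x - (g x - z) * e x)) ->
  weakD f (fun x => (h^-1)%:C * (t%:C * e x - conjc (g x - z) * f x)) ->
  exists p1 q1 p2 q2 : R -> R,
  [/\ sol (t / h) sq_weight p1 q1, sol (t / h) sq_weight p2 q2, floquet p1 p2 q1 q2,
      aeq e (e_of p1 p2) & aeq f (f_of q1 q2)].
Proof.
move=> De Df.
have [[_ [_ mer mei _] _] [_ [_ mfr mfi _] _]] := (De, Df).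
have [Er [Ei [[cEr cEi ErT EiT] [ErE EiE eE]]]] := weakD_continuous De.
have [Fr [Fi [[cFr cFi FrT FiT] [FrE FiE fE]]]] := weakD_continuous Df.
have crl := re_pot_cont; have cbe := im_pot_cont.
(* The common form of the four right-hand sides, so that their continuity is proved once. *)
pose c (al : R) A be B ga C x := h^-1 * (al * (im_pot x * A x) + be * (re_pot x * B x) + ga * C x).
have cc al A be B ga C : continuous A -> continuous B -> continuous C -> continuous (c al A be B ga C).
  move=> cA cB cC x; apply: cvgMl_tmp; apply: cvgD; last by apply: cvgMl_tmp; exact: cC.
  by apply: cvgD; apply: cvgMl_tmp; [exact: (mul_cont cbe cA)|exact: (mul_cont crl cB)].
have ae2 : {ae mu, forall x, 0 < x < T -> e x = Er x +i* Ei x /\ f x = Fr x +i* Fi x}.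
  by apply: ae_mono (ae_and eE fE) => x [h1 h2] xT; rewrite h1 ?h2.
have mNI (k : R -> R) : measurable_fun setT k -> measurable_fun I (fun x => - k x).
  by move=> mk; apply: measurable_funTS; exact: measurable_funN.
have [er Her erE] : exists2 F, primitive F (c (-1) Er (-1) Ei (- t) Fi) & forall x, 0 <= x <= T -> F x = Er x.
  apply: (integral_eq_primitive (cc _ _ _ _ _ _ cEr cEi cFi) (mNI _ mei) ErE).
  apply: ae_mono ae2 => x H xT; have [-> ->] := H xT.
  by rewrite /c /re_pot /im_pot !cparts /=; ring.
have [ei Hei eiE] : exists2 F, primitive F (c (-1) Ei 1 Er t Fr) & forall x, 0 <= x <= T -> F x = Ei x.
  apply: (integral_eq_primitive (cc _ _ _ _ _ _ cEi cEr cFr) (measurable_funTS mer) EiE).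
  apply: ae_mono ae2 => x H xT; have [-> ->] := H xT.
  by rewrite /c /re_pot /im_pot !cparts /=; ring.
have [fr Hfr frE] : exists2 F, primitive F (c 1 Fr (-1) Fi (- t) Ei) & forall x, 0 <= x <= T -> F x = Fr x.
  apply: (integral_eq_primitive (cc _ _ _ _ _ _ cFr cFi cEi) (mNI _ mfi) FrE).
  apply: ae_mono ae2 => x H xT; have [-> ->] := H xT.
  by rewrite /c /re_pot /im_pot !cparts /=; ring.
have [fi Hfi fiE] : exists2 F, primitive F (c 1 Fi 1 Fr t Er) & forall x, 0 <= x <= T -> F x = Fi x.
  apply: (integral_eq_primitive (cc _ _ _ _ _ _ cFi cFr cEr) (measurable_funTS mfr) FiE).
  apply: ae_mono ae2 => x H xT; have [-> ->] := H xT.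
  by rewrite /c /re_pot /im_pot !cparts /=; ring.
have [Hps ps0] := phaseP; have [Hlw lw0] := lweightP.
have Hc := prim_cos Hps; have Hs := prim_sin Hps.
have Hrho := prim_expR Hlw; have Hrho' := prim_expR (primN Hlw).
pose rho x := expR (lweight x); pose rho' x := expR (- lweight x).
have rr x : rho x * rho' x = 1 by rewrite /rho /rho' expRN mulfV // gt_eqF // expR_gt0.
have Wr x : sq_weight x = rho x * rho x by rewrite /sq_weight /rho -expRD; congr expR; ring.
have Wr' x : (sq_weight x)^-1 = rho' x * rho' x by rewrite /sq_weight /rho' -expRD -expRN; congr expR; ring.
pose cs x := cos (phase x); pose sn x := sin (phase x).
have cs2 x : cs x ^+ 2 + sn x ^+ 2 = 1 by exact: cos2Dsin2.
(* [a1], [a2], [b1], [b2] invert the formulas of [e_of] and [f_of]: they are p and q on the first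
   period. *)
pose a1 x := rho x * (cs x * er x + sn x * ei x).
pose a2 x := rho x * (cs x * ei x - sn x * er x).
pose b1 x := rho' x * (cs x * fi x - sn x * fr x).
pose b2 x := rho' x * (- (cs x * fr x) - sn x * fi x).
have Ha1 := primM Hrho (primD (primM Hc Her) (primM Hs Hei)).
have Ha2 := primM Hrho (primB (primM Hc Hei) (primM Hs Her)).
have Hb1 := primM Hrho' (primB (primM Hc Hfi) (primM Hs Hfr)).
have Hb2 := primM Hrho' (primB (primN (primM Hc Hfr)) (primM Hs Hfi)).
have [P1 [Q1 [P2 [Q2 [s1 [i1 i2] s2 [j1 j2]]]]]] := sol_exists (t / h) sq_weight_cont sq_weight_gt0.
have T0 := ltW (two_pi_gt0 R).
have zT : 0 <= (0 : R) <= T by rewrite lexx.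
have U1 := sol_unique s1 i1 i2 s2 j1 j2 Ha1 Hb1 zT.
have U2 := sol_unique s1 i1 i2 s2 j1 j2 Ha2 Hb2 zT.
have hne : h != 0 by rewrite gt_eqF.
have {}U1 : forall x, 0 <= x <= T -> a1 x = a1 0 * P1 x + b1 0 * P2 x /\ b1 x = a1 0 * Q1 x + b1 0 * Q2 x.
  apply: U1 => x xT.
    rewrite /c -(erE x) // -(eiE x) // -(fiE x) // -(frE x) // Wr.
    rewrite -/(rho x) -/(rho' x) -/(cs x) -/(sn x).
    transitivity (- (t / h * rho x) * (rho x * rho' x) * (cs x * fi x - sn x * fr x)); last by ring.
    by rewrite rr; field.
  rewrite /c -(erE x) // -(eiE x) // -(fiE x) // -(frE x) // Wr'.
  rewrite -/(rho x) -/(rho' x) -/(cs x) -/(sn x).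
  transitivity (t / h * rho' x * (rho x * rho' x) * (cs x * er x + sn x * ei x)); last by ring.
  by rewrite rr; field.
have {}U2 : forall x, 0 <= x <= T -> a2 x = a2 0 * P1 x + b2 0 * P2 x /\ b2 x = a2 0 * Q1 x + b2 0 * Q2 x.
  apply: U2 => x xT.
    rewrite /c -(erE x) // -(eiE x) // -(fiE x) // -(frE x) // Wr.
    rewrite -/(rho x) -/(rho' x) -/(cs x) -/(sn x).
    transitivity (- (t / h * rho x) * (rho x * rho' x) * (- (cs x * fr x) - sn x * fi x)); last by ring.
    by rewrite rr; field.
  rewrite /c -(erE x) // -(eiE x) // -(fiE x) // -(frE x) // Wr'.
  rewrite -/(rho x) -/(rho' x) -/(cs x) -/(sn x).
  transitivity (t / h * rho' x * (rho x * rho' x) * (cs x * ei x - sn x * er x)); last by ring.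
  by rewrite rr; field.
pose p1 x := a1 0 * P1 x + b1 0 * P2 x; pose q1 x := a1 0 * Q1 x + b1 0 * Q2 x.
pose p2 x := a2 0 * P1 x + b2 0 * P2 x; pose q2 x := a2 0 * Q1 x + b2 0 * Q2 x.
have S1 : sol (t / h) sq_weight p1 q1 by exact: sol_comb s1 s2.
have S2 : sol (t / h) sq_weight p2 q2 by exact: sol_comb s1 s2.
exists p1, q1, p2, q2; split.
- exact: S1.
- exact: S2.
- have [m Em m0] : exists2 m, m = expR (lweight T) & m != 0.
    by exists (expR (lweight T)) => //; rewrite gt_eqF // expR_gt0.
  have SW x : sq_weight (x + T) = m ^+ 2 * sq_weight x by rewrite Em; exact: sq_weight_shift.
  have S1' := sol_shift m0 SW S1; have S2' := sol_shift m0 SW S2.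
  pose C := cos (phase T); pose S := sin (phase T).
  have V1 := sol_comb C (- S) S1' S2'; have V2 := sol_comb S C S1' S2'.
  have TT : 0 <= T <= T by rewrite T0 lexx.
  have [A1 B1] := U1 _ TT; have [A2 B2] := U2 _ TT.
  have [A10 B10] := U1 _ zT; have [A20 B20] := U2 _ zT.
  have aT : a1 T = m * (C * er 0 + S * ei 0) /\ a2 T = m * (C * ei 0 - S * er 0).
    rewrite /a1 /a2 /rho /cs /sn -Em -/C -/S (erE T) // (eiE T) // ErT EiT.
    by rewrite (erE 0) // (eiE 0).
  have bT : b1 T = m^-1 * (C * fi 0 - S * fr 0) /\ b2 T = m^-1 * (- (C * fr 0) - S * fi 0).
    rewrite /b1 /b2 /rho' /cs /sn expRN -Em -/C -/S (frE T) // (fiE T) // FrT FiT.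
    by rewrite (frE 0) // (fiE 0).
  have a0 : [/\ a1 0 = er 0, a2 0 = ei 0, b1 0 = fi 0 & b2 0 = - fr 0].
    by rewrite /a1 /a2 /b1 /b2 /rho /rho' /cs /sn lw0 ps0 oppr0 expR0 cos0 sin0; split; ring.
  have [E1 E2 E3 E4] := a0; have [aT1 aT2] := aT; have [bT1 bT2] := bT.
  have CS : C * C + S * S = 1 by rewrite -!expr2; exact: cos2Dsin2.
  have K1 := sol_eq sq_weight_gt0 sq_weight_cont V1 S1.
  have K2 := sol_eq sq_weight_gt0 sq_weight_cont V2 S2.
  have {K1}[K1 K1'] : (forall x, C * (p1 (x + T) / m) + - S * (p2 (x + T) / m) = p1 x) /\
     (forall x, C * (m * q1 (x + T)) + - S * (m * q2 (x + T)) = q1 x).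
    apply: K1; rewrite add0r.
      rewrite -[p1 T]A1 -[p2 T]A2 -[p1 0]A10 aT1 aT2 E1.
      transitivity ((C * C + S * S) * er 0); last by rewrite CS mul1r.
      by field.
    rewrite -[q1 T]B1 -[q2 T]B2 -[q1 0]B10 bT1 bT2 E3.
    transitivity ((C * C + S * S) * fi 0); last by rewrite CS mul1r.
    by field.
  have {K2}[K2 K2'] : (forall x, S * (p1 (x + T) / m) + C * (p2 (x + T) / m) = p2 x) /\
     (forall x, S * (m * q1 (x + T)) + C * (m * q2 (x + T)) = q2 x).
    apply: K2; rewrite add0r.
      rewrite -[p1 T]A1 -[p2 T]A2 -[p2 0]A20 aT1 aT2 E2.
      transitivity ((C * C + S * S) * ei 0); last by rewrite CS mul1r.
      by field.
    rewrite -[q1 T]B1 -[q2 T]B2 -[q2 0]B20 bT1 bT2 E4.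
    transitivity ((C * C + S * S) * - fr 0); last by rewrite CS mul1r.
    by field.
  move=> x /=; rewrite -Em -/C -/S; split.
  + by rewrite -(K1 x); field.
  + by rewrite -(K2 x); field.
  + by rewrite -(K1' x); ring.
  + by rewrite -(K2' x); ring.
- apply: ae_mono eE => x H xT; rewrite (H xT).
  have xT' : 0 <= x <= T by move/andP: xT => [/ltW -> /ltW ->].
  have [A1 B1] := U1 _ xT'; have [A2 B2] := U2 _ xT'.
  rewrite /e_of -[p1 x]A1 -[p2 x]A2 /a1 /a2 -(erE x) // -(eiE x) //.
  rewrite -/(rho' x) -/(cs x) -/(sn x).
  apply: cplx_eq; rewrite !cparts /=.
    transitivity ((cs x ^+ 2 + sn x ^+ 2) * (rho x * rho' x) * er x); last by ring.
    by rewrite cs2 rr; ring.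
  transitivity ((cs x ^+ 2 + sn x ^+ 2) * (rho x * rho' x) * ei x); last by ring.
  by rewrite cs2 rr; ring.
- apply: ae_mono fE => x H xT; rewrite (H xT).
  have xT' : 0 <= x <= T by move/andP: xT => [/ltW -> /ltW ->].
  have [A1 B1] := U1 _ xT'; have [A2 B2] := U2 _ xT'.
  rewrite /f_of -[q1 x]B1 -[q2 x]B2 /b1 /b2 -(frE x) // -(fiE x) //.
  rewrite -/(rho x) -/(cs x) -/(sn x).
  apply: cplx_eq; rewrite !cparts /=.
    transitivity ((cs x ^+ 2 + sn x ^+ 2) * (rho x * rho' x) * fr x); last by ring.
    by rewrite cs2 rr; ring.
  transitivity ((cs x ^+ 2 + sn x ^+ 2) * (rho x * rho' x) * fi x); last by ring.
  by rewrite cs2 rr; ring.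
Qed.

End ClassicalPair.

(** * Eigenfunctions of Q(z) and solutions of the real system *)

Section Eigenfunctions.
Variable R : realType.
Notation mu := (@lebesgue_measure R).
Notation T := (2 * pi : R).
Notation I := (`[0, 2 * pi : R]%classic).
Variables (g : R -> R[i]) (h : R) (z : R[i]).
Hypotheses (hg : csmooth_circle g) (h0 : 0 < h).

Lemma pot_cperiodic : cperiodic_cont (fun x => g x - z).
Proof.
have [p c1 c2] := g_cont hg; split; first by move=> x; rewrite p.
- rewrite (_ : (fun x => _) = fun x => complex.Re (g x) - complex.Re z).
    by move=> x; apply: cvgB; [exact: c1|exact: cvg_cst].
  by apply/funext => x; rewrite !cparts.
- rewrite (_ : (fun x => _) = fun x => complex.Im (g x) - complex.Im z).
    by move=> x; apply: cvgB; [exact: c2|exact: cvg_cst].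
  by apply/funext => x; rewrite !cparts.
Qed.

Lemma conj_cperiodic (k : R -> R[i]) : cperiodic_cont k -> cperiodic_cont (fun x => conjc (k x)).
Proof.
move=> [p c1 c2]; split; first by move=> x; rewrite p.
- rewrite (_ : (fun x => _) = fun x => complex.Re (k x)) //.
  by apply/funext => x; rewrite !cparts.
- rewrite (_ : (fun x => _) = fun x => - complex.Im (k x)).
    by move=> x; apply: cvgN; exact: c2.
  by apply/funext => x; rewrite !cparts.
Qed.

Lemma hCV : (h^-1)%:C * h%:C = 1 :> R[i].
Proof. by apply: cplx_eq; rewrite !cparts /= ?mulVf ?gt_eqF //; ring. Qed.

Lemma realCM (a b : R) : (a * b)%:C = a%:C * b%:C :> R[i].
Proof. by apply: cplx_eq; rewrite !cparts /=; ring. Qed.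

Lemma conj_realC (a : R) : conjc (a%:C) = a%:C :> R[i].
Proof. by apply: cplx_eq; rewrite !cparts /= ?oppr0. Qed.

Lemma shift_smooth phi : csmooth_circle phi ->
  op_shift (P_op g h) z phi (fun x => h%:C * Dx phi x + g x * phi x - z * phi x).
Proof.
move=> H; exists (fun x => h%:C * Dx phi x + g x * phi x) => //.
by exists (Dx phi); first exact: csmooth_weakD.
Qed.

(** Testing the adjoint relation on smooth functions alone already places the domain of the adjoint
    in H^1, with the action h D_x + conj (g - z). *)
Lemma adjoint_weakD f w : op_adj (op_shift (P_op g h) z) f w ->
  weakD f (fun x => (h^-1)%:C * (w x - conjc (g x - z) * f x)).
Proof.
move=> [Lf Lw H].
have Lcf := L2M (conj_cperiodic pot_cperiodic) Lf.
have Ld := L2B Lw Lcf.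
split; [exact: Lf|exact: L2Z|].
move=> phi Hphi.
have Lp := L2_cont (csmooth_cont Hphi).
have LD := L2_Dx Hphi.
have := H _ _ (shift_smooth Hphi).
rewrite (_ : dotp _ f = h%:C * dotp (Dx phi) f + dotp phi (fun x => conjc (g x - z) * f x)); last first.
  rewrite -dotp_move -dotpZl // -dotpDl //; [|exact: L2Z|exact: L2M pot_cperiodic Lp].
  by apply: eq_cint => x; congr (_ * _); rewrite [in RHS]mulrBl addrA.
move=> E.
have E2 : dotp (Dx phi) f = (h^-1)%:C * dotp phi (fun x => w x - conjc (g x - z) * f x).
  rewrite (_ : dotp phi (fun x => _ - _) = dotp phi w - dotp phi (fun x => conjc (g x - z) * f x)).
    by rewrite -E addrK mulrA hCV mul1r.
  rewrite (dotpC Ld Lp) dotpBl // (dotpC Lw Lp) (dotpC Lcf Lp).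
  by apply: cplx_eq; rewrite !cparts; ring.
by rewrite [dotp f _](dotpC LD Lf) E2 conj_mul conj_realC dotpZl // -(dotpC Lp Ld).
Qed.

Lemma shift_weakD u v : L2 v -> op_shift (P_op g h) z u v ->
  weakD u (fun x => (h^-1)%:C * (v x - (g x - z) * u x)).
Proof.
move=> Lv [v1 [w Hw Ev1] Ev].
rewrite (_ : (fun x => _) = w) //; apply/funext => x; rewrite Ev Ev1.
rewrite (_ : _ - _ = h%:C * w x); last by apply: cplx_eq; rewrite !cparts; ring.
by rewrite mulrA hCV mul1r.
Qed.

Lemma weakD_scale (c : R[i]) u v : weakD u v -> weakD (fun x => c * u x) (fun x => c * v x).
Proof.
move=> [Lu Lv H]; split; [exact: L2Z|exact: L2Z|] => phi Hphi.
rewrite !dotpZl //; first by rewrite H.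
  exact: L2_cont (csmooth_cont Hphi).
exact: L2_Dx.
Qed.

(** [v] represents (P - z) e0 and [f] is v / t: the second-order eigenvalue equation becomes a pair
    of first-order ones. *)
Lemma eigen_weak_pair (t : R) e0 : 0 <= t ->
  eigenfunction (Q_op g h z) (t ^+ 2) e0 -> exists v,
  [/\ L2 v, op_shift (P_op g h) z e0 v,
      forall u w, op_shift (P_op g h) z u w -> dotp w v = dotp u (fun x => (t ^+ 2)%:C * e0 x),
      L2norm v ^+ 2 = t ^+ 2 * L2norm e0 ^+ 2 &
      let f := fun x => (t^-1)%:C * v x in
      [/\ weakD e0 (fun x => (h^-1)%:C * (t%:C * f x - (g x - z) * e0 x)),
          weakD f (fun x => (h^-1)%:C * (t%:C * e0 x - conjc (g x - z) * f x)) &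
          op_adj (op_shift (P_op g h) z) v (fun x => (t ^+ 2)%:C * e0 x)]].
Proof.
move=> t0 [Le ene [v Av Ad]]; exists v; have [Lv Lw H] := Ad.
have nv : L2norm v ^+ 2 = t ^+ 2 * L2norm e0 ^+ 2.
  have := H _ _ Av; rewrite dotpZr // !dotp_self // conj_realC.
  by rewrite !L2norm_sqr // => -[] ->; rewrite !mul0r subr0.
have De := shift_weakD Lv Av; have Dv := adjoint_weakD Ad.
split; [exact: Lv|exact: Av|exact: H|exact: nv|split; [| |exact: Ad]].
- apply: weakD_ae De _ _.
    apply: L2Z; apply: L2B; last exact: L2M pot_cperiodic Le.
    by apply: L2Z; exact: L2Z.
  (* For t = 0 the inverse of t is 0 by convention and [f] is 0; this is consistent, since the norm
     of [v] is then 0. *)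
  have [t1|tne] := eqVneq t 0.
    have v0 : L2norm v = 0 by apply/eqP; rewrite -sqrf_eq0 nv t1 expr0n mul0r.
    apply: ae_mono (L2norm0_ae Lv v0) => x Hx xT; rewrite (Hx xT).
    by rewrite !mulr0.
  by apply: aeW => x _; congr (_ * (_ - _)); rewrite mulrA -realCM mulfV // mul1r.
- have E x : (t^-1)%:C * ((h^-1)%:C * ((t ^+ 2)%:C * e0 x - conjc (g x - z) * v x)) =
      (h^-1)%:C * (t%:C * e0 x - conjc (g x - z) * ((t^-1)%:C * v x)).
    rewrite mulrCA; congr (_ * _); rewrite mulrBr; congr (_ - _); last by rewrite mulrCA.
    rewrite mulrA -realCM; congr (_%:C * _).
    by have [->|tne] := eqVneq t 0; [rewrite invr0 mul0r|field].
  by rewrite -(funext E); exact: weakD_scale Dv.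
Qed.

Lemma smooth_prim_from (f : R -> R) : smooth f -> smooth (prim_from 0 f).
Proof.
move=> sf; have [H _] := prim_fromP 0 (smooth_continuous sf).
exact: smooth_prim H sf.
Qed.

Lemma re_pot_smooth : smooth (re_pot g z).
Proof. by case: hg => [[_ s] _]; apply: smoothB; [exact: smooth_cst|exact: s]. Qed.

Lemma im_pot_smooth : smooth (im_pot g z).
Proof. by case: hg => [_ [_ s]]; apply: smoothB; [exact: smooth_cst|exact: s]. Qed.

Lemma phase_smooth : smooth (phase g h z).
Proof. by apply: smooth_prim_from; apply: smoothM; [exact: smooth_cst|exact: re_pot_smooth]. Qed.

Lemma lweight_smooth : smooth (lweight g h z).
Proof. by apply: smooth_prim_from; apply: smoothM; [exact: smooth_cst|exact: im_pot_smooth]. Qed.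

Lemma sol_smooth (s : R) (W p q : R -> R) : smooth W -> (forall x, W x != 0) -> sol s W p q ->
  smooth p /\ smooth q.
Proof.
move=> /smoothP sW W0 [hp hq].
suff H n : diff_class n p /\ diff_class n q by split; apply/smoothP => n; have [] := H n.
elim: n => [|n [Hp Hq]]; first by split; [exact: prim_continuous hp|exact: prim_continuous hq].
split.
  exists (fun x => - (s * W x) * q x) => //; apply: diff_classM => //.
  by apply: diff_classN; apply: diff_classM => //; exact: diff_class_cst.
exists (fun x => s * (W x)^-1 * p x) => //; apply: diff_classM => //.
by apply: diff_classM; [exact: diff_class_cst|exact: diff_classV].
Qed.

(** Uniqueness for the Cauchy problem at x, transported to 0 by a translation. *)
Lemma sol_zero (s : R) (W p q : R -> R) (x : R) : continuous W -> (forall x, 0 < W x) ->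
  sol s W p q -> p x = 0 -> q x = 0 -> p 0 = 0 /\ q 0 = 0.
Proof.
move=> cW W0 [hp hq] p0 q0.
have cW' : continuous (fun y => W (y + x)).
  move=> y; apply: (@continuous_comp _ _ _ (fun y => y + x) W); last exact: cW.
  by apply: cvgD; [exact: cvg_id|exact: cvg_cst].
have S1 : sol s (fun y => W (y + x)) (fun y => p (y + x)) (fun y => q (y + x)).
  by split; [exact: prim_shift x hp|exact: prim_shift x hq].
have S0 : sol s (fun y => W (y + x)) (fun=> 0) (fun=> 0).
  by split; apply: prim_eq (prim_cst 0) _ => y; rewrite mulr0.
have [E1 E2] : (fun y => p (y + x)) =1 (fun=> 0) /\ (fun y => q (y + x)) =1 (fun=> 0).
  by apply: sol_eq cW' S1 S0 _ _; rewrite ?add0r.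
by have := E1 (- x); have := E2 (- x); rewrite addNr.
Qed.

(** [N] is nondecreasing with equal values at both ends, hence constant in between. *)
Lemma prim_flat (N n : R -> R) (b : R) : primitive N n -> (forall x, 0 <= n x) -> N b = N 0 ->
  forall x, 0 < x < b -> n x = 0.
Proof.
move=> HN n0 Nb x /andP[x0 xb].
have flat y : 0 <= y <= b -> N y = N 0.
  move=> /andP[y0 yb]; apply/eqP; rewrite eq_le -{1}Nb.
  by rewrite (prim_nondecreasing HN yb) // (prim_nondecreasing HN y0).
rewrite -(prim_derive1 HN) derive1E.
rewrite (_ : 'D_1 _ x = 'D_1 (fun=> N 0) x); last first.
  apply: near_eq_derive; near=> y; apply: flat.
  by apply/andP; split; apply: ltW; near: y; [exact: lt_nbhsr|exact: lt_nbhsl].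
by rewrite derive_cst.
Unshelve. all: by end_near. Qed.

Lemma shift_L2 u v : op_shift (P_op g h) z u v -> L2 u /\ L2 v.
Proof.
move=> [v1 [w [Lu Lw _] ->] ->]; split; [exact: Lu|].
by apply: L2B; [apply: L2D; [exact: L2Z|exact: L2M (g_cont hg) Lu]|exact: L2Z].
Qed.

Lemma shift_adjoint F u v : csmooth_circle F -> op_shift (P_op g h) z u v ->
  dotp v F = dotp u (fun x => h%:C * Dx F x + conjc (g x - z) * F x).
Proof.
move=> HF [v1 [w Hw ->] ->].
have [Lu Lw Hw'] := Hw.
have Lf := L2_cont (csmooth_cont HF).
have Lgu := L2M pot_cperiodic Lu.
have LDf := L2_Dx HF.
rewrite dotpDr; [|exact: Lu|exact: L2Z|exact: L2M (conj_cperiodic pot_cperiodic) Lf].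
rewrite dotpZr // conj_realC [dotp u (Dx F)](Hw' _ HF) -dotp_move -dotpZl // -dotpDl //; last exact: L2Z.
by apply: eq_cint => x; congr (_ * _); rewrite [in RHS]mulrBl addrA.
Qed.

(** * Floquet solutions are eigenfunctions of Q(z) *)

Section Converse.
Variables (t : R) (p1 q1 p2 q2 : R -> R).
Hypotheses (t0 : 0 < t) (S1 : sol (t / h) (sq_weight g h z) p1 q1)
  (S2 : sol (t / h) (sq_weight g h z) p2 q2) (Fl : floquet g h z p1 p2 q1 q2)
  (nontriv : ~ [/\ p1 0 = 0, q1 0 = 0, p2 0 = 0 & q2 0 = 0]).

Let e := e_of g h z p1 p2.
Let f := f_of g h z q1 q2.

Lemma e_of_periodic : periodic e T.
Proof.
move=> x; have /= [E1 E2 _ _] := Fl x; rewrite /e /e_of (phase_shift h z hg) (lweight_shift h z hg).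
rewrite cosD sinD opprD expRD [expR (- lweight g h z T)]expRN.
have m0 : expR (lweight g h z T) != 0 by rewrite gt_eqF // expR_gt0.
move: E1 E2 m0; set C := cos (phase g h z T); set S := sin (phase g h z T).
set m := expR (lweight _ _ _ _) => E1 E2 m0.
set c := cos _; set s := sin _; set r := expR _.
apply: cplx_eq; rewrite !cparts /=.
  transitivity ((c * (C * p1 (x + T) - S * p2 (x + T)) - s * (C * p2 (x + T) + S * p1 (x + T))) * r / m).
    by ring.
  by rewrite E1 E2; field.
transitivity ((c * (C * p2 (x + T) + S * p1 (x + T)) + s * (C * p1 (x + T) - S * p2 (x + T))) * r / m).
  by ring.
by rewrite E1 E2; field.
Qed.

Lemma f_of_periodic : periodic f T.
Proof.
move=> x; have /= [_ _ E1 E2] := Fl x; rewrite /f /f_of (phase_shift h z hg) (lweight_shift h z hg).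
rewrite cosD sinD expRD.
move: E1 E2; set C := cos (phase g h z T); set S := sin (phase g h z T).
set m := expR (lweight _ _ _ T) => E1 E2.
set c := cos _; set s := sin _; set r := expR _.
apply: cplx_eq; rewrite !cparts /=.
  transitivity (- (c * (m * (C * q2 (x + T) + S * q1 (x + T))) + s * (m * (C * q1 (x + T) - S * q2 (x + T)))) * r).
    by ring.
  by rewrite E1 E2; ring.
transitivity ((c * (m * (C * q1 (x + T) - S * q2 (x + T))) - s * (m * (C * q2 (x + T) + S * q1 (x + T)))) * r).
  by ring.
by rewrite E1 E2; ring.
Qed.

Let W0 x : sq_weight g h z x != 0.
Proof. by rewrite gt_eqF // sq_weight_gt0. Qed.

Let sW : smooth (sq_weight g h z).
Proof. by apply: smooth_expR; apply: smoothM; [exact: smooth_cst|exact: lweight_smooth]. Qed.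

Lemma e_of_smooth : csmooth_circle e.
Proof.
have [s1 r1] := sol_smooth sW W0 S1; have [s2 r2] := sol_smooth sW W0 S2.
have sc := smooth_cos phase_smooth; have ss := smooth_sin phase_smooth.
have sr := smooth_expR (smoothN lweight_smooth).
split; split.
- by move=> x; rewrite e_of_periodic.
- rewrite (_ : (fun x => _) = fun x => (cos (phase g h z x) * p1 x - sin (phase g h z x) * p2 x) * expR (- lweight g h z x)).
    by apply: smoothM sr; apply: smoothB; [exact: smoothM sc s1|exact: smoothM ss s2].
  by apply/funext => x; rewrite /e /e_of !cparts /=; ring.
- by move=> x; rewrite e_of_periodic.
- rewrite (_ : (fun x => _) = fun x => (cos (phase g h z x) * p2 x + sin (phase g h z x) * p1 x) * expR (- lweight g h z x)).
    by apply: smoothM sr; apply: smoothD; [exact: smoothM sc s2|exact: smoothM ss s1].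
  by apply/funext => x; rewrite /e /e_of !cparts /=; ring.
Qed.

Lemma f_of_smooth : csmooth_circle f.
Proof.
have [s1 r1] := sol_smooth sW W0 S1; have [s2 r2] := sol_smooth sW W0 S2.
have sc := smooth_cos phase_smooth; have ss := smooth_sin phase_smooth.
have sr := smooth_expR lweight_smooth.
split; split.
- by move=> x; rewrite f_of_periodic.
- rewrite (_ : (fun x => _) = fun x => - (cos (phase g h z x) * q2 x + sin (phase g h z x) * q1 x) * expR (lweight g h z x)).
    by apply: smoothM sr; apply: smoothN; apply: smoothD; [exact: smoothM sc r2|exact: smoothM ss r1].
  by apply/funext => x; rewrite /f /f_of !cparts /=; ring.
- by move=> x; rewrite f_of_periodic.
- rewrite (_ : (fun x => _) = fun x => (cos (phase g h z x) * q1 x - sin (phase g h z x) * q2 x) * expR (lweight g h z x)).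
    by apply: smoothM sr; apply: smoothB; [exact: smoothM sc r1|exact: smoothM ss r2].
  by apply/funext => x; rewrite /f /f_of !cparts /=; ring.
Qed.

Lemma e_of_eq x : h%:C * Dx e x + g x * e x - z * e x = t%:C * f x.
Proof.
have hne : h != 0 by rewrite gt_eqF.
have [Hp _] := phaseP h z hg; have [Hl _] := lweightP h z hg.
have Hc := prim_cos Hp; have Hs := prim_sin Hp; have Hr := prim_expR (primN Hl).
have [H1 K1] := S1; have [H2 K2] := S2.
have D1 := prim_derive1 (primM (primB (primM Hc H1) (primM Hs H2)) Hr).
have D2 := prim_derive1 (primM (primD (primM Hc H2) (primM Hs H1)) Hr).
have E1 : (fun x => complex.Re (e x)) = fun x => (cos (phase g h z x) * p1 x - sin (phase g h z x) * p2 x) * expR (- lweight g h z x).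
  by apply/funext => y; rewrite /e /e_of !cparts /=; ring.
have E2 : (fun x => complex.Im (e x)) = fun x => (cos (phase g h z x) * p2 x + sin (phase g h z x) * p1 x) * expR (- lweight g h z x).
  by apply/funext => y; rewrite /e /e_of !cparts /=; ring.
have WE : sq_weight g h z x * expR (- lweight g h z x) = expR (lweight g h z x).
  by rewrite /sq_weight -expRD; congr expR; ring.
rewrite /Dx /cderive E1 E2 D1 D2 inv_i.
have R1 := congr1 (fun F : R -> R => F x) E1; have R2 := congr1 (fun F : R -> R => F x) E2.
rewrite /= in R1 R2.
rewrite /f /f_of -WE /re_pot /im_pot.
apply: cplx_eq; rewrite !cparts R1 R2 /=;
set c := cos _; set s := sin _; set r := expR _; set W := sq_weight _ _ _ _; field; exact: hne.
Qed.

Lemma f_of_eq x : h%:C * Dx f x + conjc (g x - z) * f x = t%:C * e x.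
Proof.
have hne : h != 0 by rewrite gt_eqF.
have [Hp _] := phaseP h z hg; have [Hl _] := lweightP h z hg.
have Hc := prim_cos Hp; have Hs := prim_sin Hp; have Hr := prim_expR Hl.
have [H1 K1] := S1; have [H2 K2] := S2.
have D1 := prim_derive1 (primM (primN (primD (primM Hc K2) (primM Hs K1))) Hr).
have D2 := prim_derive1 (primM (primB (primM Hc K1) (primM Hs K2)) Hr).
have E1 : (fun x => complex.Re (f x)) = fun x => - (cos (phase g h z x) * q2 x + sin (phase g h z x) * q1 x) * expR (lweight g h z x).
  by apply/funext => y; rewrite /f /f_of !cparts /=; ring.
have E2 : (fun x => complex.Im (f x)) = fun x => (cos (phase g h z x) * q1 x - sin (phase g h z x) * q2 x) * expR (lweight g h z x).
  by apply/funext => y; rewrite /f /f_of !cparts /=; ring.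
have WE : (sq_weight g h z x)^-1 * expR (lweight g h z x) = expR (- lweight g h z x).
  by rewrite /sq_weight -expRN -expRD; congr expR; ring.
rewrite /Dx /cderive E1 E2 D1 D2 inv_i.
have R1 := congr1 (fun F : R -> R => F x) E1; have R2 := congr1 (fun F : R -> R => F x) E2.
rewrite /= in R1 R2.
rewrite /e /e_of -WE /re_pot /im_pot.
apply: cplx_eq; rewrite !cparts R1 R2 /=;
set c := cos _; set s := sin _; set r := expR _; set W := (sq_weight _ _ _ _)^-1; field; exact: hne.
Qed.

(** If e vanished, so would p on the period, then q by the first equation since t > 0, and finally
    the Cauchy data at 0. *)
Lemma e_of_nonzero : L2norm e != 0.
Proof.
have [_ c1 c2] := csmooth_cont e_of_smooth.
have Le := L2_cont (csmooth_cont e_of_smooth).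
apply/eqP => n0; apply: nontriv.
have cn : continuous (fun x => normc (e x) ^+ 2).
  rewrite (_ : (fun x => _) = fun x => complex.Re (e x) * complex.Re (e x) + complex.Im (e x) * complex.Im (e x)).
    by move=> x; apply: cvgD; [exact: (mul_cont c1 c1)|exact: (mul_cont c2 c2)].
  by apply/funext => x; rewrite normc_sqr !expr2.
have [N HN N0] := prim_exists 0 cn.
have T0 := two_pi_gt0 R.
have NT : N T = N 0.
  have := L2norm_sqr Le; rewrite n0 expr0n (prim_Rintegral HN cn (ltW T0)) => /esym /eqP.
  by rewrite subr_eq0 => /eqP.
have z0 x : 0 < x < T -> p1 x = 0 /\ p2 x = 0.
  move=> xT; have /eqP := prim_flat HN (fun x => sqr_ge0 _) NT xT.
  rewrite sqrf_eq0 => /eqP /eq0_normc; rewrite /e /e_of => E.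
  have r0 : expR (- lweight g h z x) != 0 by rewrite gt_eqF // expR_gt0.
  have cs := cos2Dsin2 (phase g h z x).
  move: E r0 cs; set c := cos _; set s := sin _; set r := expR _ => E r0 cs.
  have E1 : (c * p1 x - s * p2 x) * r = 0.
    by have := congr1 (@complex.Re R) E; rewrite !cparts /= => <-; ring.
  have E2 : (c * p2 x + s * p1 x) * r = 0.
    by have := congr1 (@complex.Im R) E; rewrite !cparts /= => <-; ring.
  move/eqP: E1; rewrite mulf_eq0 (negbTE r0) orbF => /eqP E1.
  move/eqP: E2; rewrite mulf_eq0 (negbTE r0) orbF => /eqP E2.
  split.
    by rewrite -[LHS]mul1r -cs; transitivity (c * (c * p1 x - s * p2 x) + s * (c * p2 x + s * p1 x)); [ring|rewrite E1 E2; ring].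
  by rewrite -[LHS]mul1r -cs; transitivity (c * (c * p2 x + s * p1 x) - s * (c * p1 x - s * p2 x)); [ring|rewrite E1 E2; ring].
have q0 (p q : R -> R) x : sol (t / h) (sq_weight g h z) p q -> (forall y, 0 < y < T -> p y = 0) ->
    0 < x < T -> q x = 0.
  move=> [hp _] pz /andP[x0 xT].
  have : derive1 p x = 0.
    rewrite derive1E (_ : 'D_1 _ x = 'D_1 (fun=> (0 : R)) x); last first.
      apply: near_eq_derive; near=> y; apply: pz.
      by apply/andP; split; near: y; [exact: lt_nbhsr|exact: lt_nbhsl].
    by rewrite derive_cst.
  rewrite (prim_derive1 hp) => /eqP; rewrite mulf_eq0 oppr_eq0 mulf_eq0 (negbTE (W0 x)) orbF.
  by rewrite gt_eqF ?divr_gt0 //= => /eqP.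
have pT : 0 < (pi : R) < T.
  have p0 := pi_gt0 R; apply/andP; split; lra.
have [z1 z2] := z0 _ pT.
have y1 : q1 pi = 0 by apply: (q0 p1 q1 pi S1 _ pT) => y /z0 [].
have y2 : q2 pi = 0 by apply: (q0 p2 q2 pi S2 _ pT) => y /z0 [].
have cW : continuous (sq_weight g h z) by exact: sq_weight_cont.
have Wp := sq_weight_gt0 g h z.
have [A1 A2] := sol_zero cW Wp S1 z1 y1; have [A3 A4] := sol_zero cW Wp S2 z2 y2.
by split.
Unshelve. all: by end_near. Qed.

(** This converse makes every nontrivial Floquet solution a competitor for the lowest eigenvalue,
    and thereby bounds t_0 from above. *)
Lemma e_of_eigenfunction : eigenfunction (Q_op g h z) (t ^+ 2) e.
Proof.
have Ce := csmooth_cont e_of_smooth; have Cf := csmooth_cont f_of_smooth.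
have Le := L2_cont Ce; have Lf := L2_cont Cf.
split; [exact: Le|exact: e_of_nonzero|].
exists (fun x => t%:C * f x).
  exists (fun x => h%:C * Dx e x + g x * e x).
    by exists (Dx e); [exact: csmooth_weakD e_of_smooth|].
  by apply/funext => x; rewrite e_of_eq.
split; [exact: L2Z|exact: L2Z|].
move=> u v Av; have [Lu Lv] := shift_L2 Av.
rewrite dotpZr; [|exact: Lv|exact: Lf].
rewrite (shift_adjoint f_of_smooth Av) (_ : (fun x => _ + _) = fun x => t%:C * e x); last first.
  by apply/funext => x; rewrite f_of_eq.
rewrite !dotpZr //; rewrite !conj_realC mulrA -realCM; congr (_%:C * _); by rewrite expr2.
Qed.

End Converse.

End Eigenfunctions.

(** * Estimates on half of the well *)

Section OrientedIntegral.
Variable R : realType.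
Implicit Types f k F : R -> R.

(* An oriented integral: [integ f b a = - integ f a b]. *)
Definition integ (f : R -> R) (a b : R) : R := prim_from a f b.

Lemma integ_prim f F a b : continuous f -> primitive F f -> integ f a b = F b - F a.
Proof.
move=> cf HF; have [HP P0] := prim_fromP a cf.
by have := prim_unique HP HF b a; rewrite P0 subr0.
Qed.

Lemma prim_integ f a : continuous f -> primitive (integ f a) f.
Proof. by move=> cf; have [] := prim_fromP a cf. Qed.

Lemma integ_aa f a : continuous f -> integ f a a = 0.
Proof. by move=> cf; have [] := prim_fromP a cf. Qed.

Lemma integ_split f a b c : continuous f -> integ f a c = integ f a b + integ f b c.
Proof.
move=> cf; have HF := prim_integ a cf.
by rewrite (integ_prim b c cf HF); ring.
Qed.

Lemma integ_le f k a b : continuous f -> continuous k -> a <= b ->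
  (forall x, a <= x <= b -> f x <= k x) -> integ f a b <= integ k a b.
Proof.
move=> cf ck ab fk; have := prim_le (prim_integ a cf) (prim_integ a ck) ab fk.
by rewrite !integ_aa // !subr0.
Qed.

Lemma integ_le_prim f F k a b : continuous f -> primitive F k -> a <= b ->
  (forall x, a <= x <= b -> f x <= k x) -> integ f a b <= F b - F a.
Proof.
move=> cf HF ab fk; have := prim_le (prim_integ a cf) HF ab fk.
by rewrite !integ_aa // !subr0.
Qed.

Lemma integ_ge_prim f F k a b : continuous f -> primitive F k -> a <= b ->
  (forall x, a <= x <= b -> k x <= f x) -> F b - F a <= integ f a b.
Proof.
move=> cf HF ab fk; have := prim_le HF (prim_integ a cf) ab fk.
by rewrite !integ_aa // !subr0.
Qed.

Lemma integ_ge0 f a b : continuous f -> a <= b ->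
  (forall x, a <= x <= b -> 0 <= f x) -> 0 <= integ f a b.
Proof. by move=> cf ab f0; have := integ_ge_prim cf (prim_cst 0) ab f0; rewrite subrr. Qed.

Lemma integ_le_cst f a b (M : R) : continuous f -> a <= b ->
  (forall x, a <= x <= b -> f x <= M) -> integ f a b <= M * (b - a).
Proof.
move=> cf ab fM; have HM := primZ M (@prim_id R).
have := integ_le_prim cf HM ab; rewrite -mulrBr; apply => x /fM; by rewrite mulr1.
Qed.

Lemma integZ (c : R) f a b : continuous f -> integ (fun x => c * f x) a b = c * integ f a b.
Proof.
move=> cf; rewrite (integ_prim a b _ (primZ c (prim_integ a cf))).
  by rewrite integ_aa // mulr0 subr0.
by move=> x; apply: cvgMl_tmp; exact: cf.
Qed.

Lemma integD f k a b : continuous f -> continuous k ->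
  integ (fun x => f x + k x) a b = integ f a b + integ k a b.
Proof.
move=> cf ck; rewrite (integ_prim a b _ (primD (prim_integ a cf) (prim_integ a ck))).
  by rewrite !integ_aa // addr0 subr0.
by move=> x; apply: cvgD; [exact: cf|exact: ck].
Qed.

(** Gaussians are estimated from above by Lorentzians, whose primitives are explicit. *)
Lemma prim_atan f F : primitive F f -> primitive (fun x => atan (F x)) (fun x => f x / (1 + F x ^+ 2)).
Proof.
move=> H; apply: prim_eq (prim_comp (f := fun x => (1 + x ^+ 2)^-1) _ H) _ => [x|x /=].
  exact: is_derive1_atan.
by rewrite mulrC.
Qed.

Lemma atan_bound (x : R) : `|atan x| <= 2.
Proof.
have h1 := atan_gtNpi2 x; have h2 := atan_ltpi2 x; have h3 := pihalf_lt2 R.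
rewrite ler_norml; apply/andP; split; lra.
Qed.

End OrientedIntegral.

(** * Integrals of the weight and of its inverse on the half of the well around [xp] *)

Section HalfWell.
Variable R : realType.
Variables (lam be : R -> R) (h k sg c C x0 xp a : R).
Hypotheses (hlam : primitive lam (fun x => be x / h))
  (h0 : 0 < h) (k0 : 0 < k) (sg0 : 0 < sg) (hsg : sg ^+ 2 * k = h)
  (c0 : 0 < c) (c1 : c <= 1) (cC : 1 <= C) (sgk : sg <= c * k)
  (h1 : forall x, x0 <= x <= xp -> be x <= - (c * (xp - x) * (k + (xp - x))))
  (h2 : forall x, xp <= x <= a -> c * k * (x - xp) <= be x <= C * k * (x - xp))
  (h4 : c * k <= a - xp <= C * k) (h5 : c <= xp - x0 <= C).

Definition wt (x : R) := expR (2 * lam x).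
Notation W := wt.

(** W decreases up to [xp] and increases from there to [a], so this is the mass of a peak of 1 / W
    at [xp]. *)
Definition vol (x : R) := integ (fun t => (W t)^-1) x0 x.
Notation V := vol.

Lemma wt_gt0 x : 0 < W x. Proof. exact: expR_gt0. Qed.

Lemma wt_cont : continuous W.
Proof. exact: prim_continuous (prim_expR (primZ 2 hlam)). Qed.

Lemma wtV_cont : continuous (fun x => (W x)^-1).
Proof. by move=> x; apply: cvgV; [rewrite gt_eqF // wt_gt0|exact: wt_cont]. Qed.

Lemma wtV_ge0 x : 0 <= (W x)^-1. Proof. by rewrite invr_ge0 ltW // wt_gt0. Qed.

Lemma vol_prim : primitive V (fun x => (W x)^-1).
Proof. exact: prim_integ wtV_cont. Qed.

Lemma vol_cont : continuous V. Proof. exact: prim_continuous vol_prim. Qed.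

Lemma vol0 : V x0 = 0. Proof. exact: integ_aa wtV_cont. Qed.

Lemma vol_le x y : x <= y -> V x <= V y.
Proof. by move=> xy; apply: (prim_nondecreasing vol_prim xy) => t _; exact: wtV_ge0. Qed.

Lemma vol_ge0 x : x0 <= x -> 0 <= V x.
Proof. by move=> xx; rewrite -vol0; exact: vol_le. Qed.

Let x0p : x0 <= xp. Proof. by case/andP: h5 => ? _; have := c0; lra. Qed.
Let xpa : xp <= a.
Proof. by case/andP: h4 => H _; rewrite -subr_ge0 (le_trans _ H) // mulr_ge0 // ltW. Qed.

Lemma prim_square (s b : R) : primitive (fun t => s * (t - b) ^+ 2) (fun t => 2 * s * (t - b)).
Proof.
have H := primB (@prim_id R) (prim_cst b).
by apply: prim_eq (primZ s (primM H H)) _ => x; ring.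
Qed.

(** By [sg ^+ 2 * k = h] the slope of [lam] at distance r to the right of [xp] is at least c r /
    sg^2, which identifies [sg] as the width of the peak of 1 / W. *)
Lemma lam_right_lo x : xp <= x <= a -> c / (2 * sg ^+ 2) * (x - xp) ^+ 2 <= lam x - lam xp.
Proof.
move=> /andP[px xa].
have := prim_le (prim_square (c / (2 * sg ^+ 2)) xp) hlam px.
rewrite subrr expr0n mulr0 subr0; apply=> t /andP[pt tx].
have /andP[H _] := h2 (x := t) ltac:(by rewrite pt (le_trans tx xa)).
rewrite ler_pdivlMr //; apply: le_trans H; rewrite -hsg le_eqVlt; apply/orP; left; apply/eqP.
by field; rewrite gt_eqF.
Qed.

Lemma lam_right_hi x : xp <= x <= a -> lam x - lam xp <= C / (2 * sg ^+ 2) * (x - xp) ^+ 2.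
Proof.
move=> /andP[px xa].
have := prim_le hlam (prim_square (C / (2 * sg ^+ 2)) xp) px.
rewrite subrr expr0n mulr0 subr0; apply=> t /andP[pt tx].
have /andP[_ H] := h2 (x := t) ltac:(by rewrite pt (le_trans tx xa)).
rewrite ler_pdivrMr //; apply: le_trans H _; rewrite -hsg le_eqVlt; apply/orP; left; apply/eqP.
by field; rewrite gt_eqF.
Qed.

Lemma lam_left y x : x0 <= y -> y <= x -> x <= xp ->
  c / (2 * sg ^+ 2) * (x - y) ^+ 2 <= lam y - lam x.
Proof.
move=> xy yx xxp.
have := prim_le hlam (prim_square (c / (2 * sg ^+ 2)) x) yx.
rewrite subrr expr0n mulr0 sub0r => H.
have {H} : lam x - lam y <= - (c / (2 * sg ^+ 2) * (y - x) ^+ 2).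
  apply: H => t /andP[yt tx].
  have H := h1 (x := t) ltac:(by rewrite (le_trans xy yt) (le_trans tx xxp)).
  rewrite ler_pdivrMr //; apply: le_trans H _.
  have -> : 2 * (c / (2 * sg ^+ 2)) * (t - x) * h = - (c * (x - t) * k).
    by rewrite -hsg; field; rewrite gt_eqF.
  have xt : 0 <= x - t by rewrite subr_ge0.
  have xpt : x - t <= xp - t by rewrite lerD2r.
  rewrite lerN2; apply: ler_pM; rewrite ?mulr_ge0 ?(ltW c0) ?(ltW k0) //.
    by rewrite ler_wpM2l // ltW.
  by rewrite lerDl (le_trans xt xpt).
have -> : (y - x) ^+ 2 = (x - y) ^+ 2 by ring.
lra.
Qed.

(** Here the quadratic part of the lower bound on - be is used: left of x the slope of [lam] is at
    least c (xp - x)^2 / h in modulus, which is stronger than the linear part once xp - x exceeds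
    k. *)
Lemma lam_left2 y x : x0 <= y -> y <= x -> x <= xp ->
  c * (xp - x) ^+ 2 / h * (x - y) <= lam y - lam x.
Proof.
move=> xy yx xxp.
have H : lam x - lam y <= - (c * (xp - x) ^+ 2 / h) * x - - (c * (xp - x) ^+ 2 / h) * y.
  apply: (prim_le hlam (primZ (- (c * (xp - x) ^+ 2 / h)) (@prim_id R)) yx) => t /andP[yt tx].
  have H := h1 (x := t) ltac:(by rewrite (le_trans xy yt) (le_trans tx xxp)).
  rewrite mulr1 -mulNr ler_pM2r ?invr_gt0 //; apply: le_trans H _.
  have xpx : 0 <= xp - x by rewrite subr_ge0.
  have xpt : xp - x <= xp - t by rewrite lerB.
  rewrite lerN2 expr2 mulrA; apply: ler_pM => //.
  - by rewrite mulr_ge0 // ltW.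
  - by rewrite ler_wpM2l // ltW.
  - by rewrite (le_trans xpt) // lerDr ltW.
lra.
Qed.

Lemma expRN_le (v : R) : 0 <= v -> expR (- v) <= (1 + v)^-1.
Proof.
move=> v0; rewrite expRN lef_pV2 ?posrE ?expR_gt0 ?ltr_wpDr //; exact: expR_ge1Dx.
Qed.

Lemma expRN_sq_le (v : R) : expR (- (c * v ^+ 2)) <= c^-1 / (1 + v ^+ 2).
Proof.
have v2 := sqr_ge0 v.
apply: le_trans (expRN_le _) _; first by rewrite mulr_ge0 // ltW.
have d0 : 0 < c * (1 + v ^+ 2) by rewrite mulr_gt0 // ltr_wpDr.
have e0 : 0 < 1 + c * v ^+ 2 by rewrite ltr_wpDr // mulr_ge0 // ltW.
rewrite -invfM lef_pV2 ?posrE // mulrDr mulr1 lerD2r; exact: c1.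
Qed.

Lemma wt_ratio x y : W x / W y = expR (- (2 * (lam y - lam x))).
Proof. by rewrite /wt -expRN -expRD; congr expR; ring. Qed.

Lemma wt_vol_integ x : W x * V x = integ (fun t => W x / W t) x0 x.
Proof. by rewrite /vol -integZ //; exact: wtV_cont. Qed.

Let ratio_cont x : continuous (fun t => W x / W t).
Proof. by move=> t; apply: cvgMl_tmp; exact: wtV_cont. Qed.

(** As a function of t, the ratio W(x) / W(t) is dominated by a Gaussian of width [sg] centred at x,
    and the Gaussian by a Lorentzian. *)
Lemma wt_vol_bound x : x0 <= x <= xp -> W x * V x <= 2 / c * sg.
Proof.
move=> /andP[x0x xxp]; rewrite wt_vol_integ.
have HG : primitive (fun y => sg / c * atan ((y - x) / sg)) (fun y => c^-1 / (1 + ((y - x) / sg) ^+ 2)).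
  have H := primM (primB (@prim_id R) (prim_cst x)) (prim_cst sg^-1).
  apply: prim_eq (primZ (sg / c) (prim_atan H)) _ => y /=.
  rewrite mulr0 addr0 subr0 mul1r mulrA; congr (_ / _).
  by field; rewrite !gt_eqF.
apply: le_trans (integ_le_prim (@ratio_cont x) HG x0x _) _.
  move=> y /andP[x0y yx]; rewrite wt_ratio.
  apply: le_trans (expRN_sq_le _); rewrite ler_expR lerN2.
  have := lam_left x0y yx xxp; rewrite -[(y - x) / sg]opprK -mulNr opprB sqrrN expr_div_n => H.
  apply: le_trans (ler_wpM2l _ H) => //; rewrite le_eqVlt; apply/orP; left; apply/eqP.
  by field; rewrite gt_eqF.
rewrite subrr mul0r atan0 mulr0 sub0r -mulrN.
have : - atan ((x0 - x) / sg) <= 2.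
  by apply: le_trans (atan_bound ((x0 - x) / sg)); rewrite -normrN ler_norm.
have sc : 0 <= sg / c by rewrite divr_ge0 // ltW.
move=> /(ler_wpM2l sc) /le_trans; apply.
by rewrite le_eqVlt; apply/orP; left; apply/eqP; ring.
Qed.

Lemma wt_vol_bound2 x : x0 <= x -> x < xp -> W x * V x <= h / (2 * c * (xp - x) ^+ 2).
Proof.
move=> x0x xxp; rewrite wt_vol_integ.
have u0 : 0 < xp - x by rewrite subr_gt0.
set u := xp - x in u0 *; pose r := 2 * c * u ^+ 2 / h.
have r0 : 0 < r by rewrite divr_gt0 // !mulr_gt0 // exprn_gt0.
have HG : primitive (fun y => r^-1 * expR (r * (y - x))) (fun y => expR (r * (y - x))).
  have H := primZ r (primB (@prim_id R) (prim_cst x)).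
  apply: prim_eq (primZ r^-1 (prim_expR H)) _ => y /=.
  by rewrite subr0 mulr1 mulKf // gt_eqF.
apply: le_trans (integ_le_prim (@ratio_cont x) HG x0x _) _.
  move=> y /andP[x0y yx]; rewrite wt_ratio ler_expR.
  have := lam_left2 x0y yx (ltW xxp); rewrite -/u => H.
  rewrite -[r * _]opprK lerN2; apply: le_trans (ler_wpM2l _ H) => //.
  by rewrite le_eqVlt /r; apply/orP; left; apply/eqP; ring.
rewrite subrr mulr0 expR0 mulr1.
have -> : h / (2 * c * u ^+ 2) = r^-1 by rewrite /r; field; rewrite !gt_eqF.
by rewrite gerDl oppr_le0 mulr_ge0 ?expR_ge0 // invr_ge0 ltW.
Qed.

(** A single Lorentzian of width [k] covers both regimes: [wt_vol_bound] for xp - x <= k and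
    [wt_vol_bound2] beyond. Its integral is of order M / k, that is, sg k + sg^2. *)
Let M := 4 / c * sg * k ^+ 2 + h / c.

Lemma wt_vol_bound3 x : x0 <= x <= xp -> W x * V x <= M / (k ^+ 2 + (x - xp) ^+ 2).
Proof.
move=> /andP[x0x xxp].
have k2 : 0 < k ^+ 2 by rewrite exprn_gt0.
have u2 := sqr_ge0 (x - xp).
have d0 : 0 < k ^+ 2 + (x - xp) ^+ 2 by rewrite ltr_wpDr.
rewrite ler_pdivlMr //.
have sc : 0 < sg / c by rewrite divr_gt0.
have hc : 0 < h / c by rewrite divr_gt0.
have [le|lt] := leP (xp - x) k.
  have B : (x - xp) ^+ 2 <= k ^+ 2.
    by rewrite -sqrrN opprB lerXn2r // ?nnegrE ?subr_ge0 // ltW.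
  have H := wt_vol_bound (x := x) ltac:(by rewrite x0x).
  have := ler_wpM2r (ltW d0) H => /le_trans; apply.
  apply: (@le_trans _ _ (2 / c * sg * (2 * k ^+ 2))); last by rewrite /M; lra.
  apply: ler_wpM2l; last by lra.
  by rewrite mulr_ge0 ?(ltW sg0) // divr_ge0 // ltW.
have xp' : x < xp by rewrite -subr_gt0 (lt_trans k0 lt).
have B : k ^+ 2 <= (xp - x) ^+ 2.
  by rewrite lerXn2r // ?nnegrE ?subr_ge0 // ltW.
have u0 : 0 < (xp - x) ^+ 2 by rewrite exprn_gt0 // subr_gt0.
have := ler_wpM2r (ltW d0) (wt_vol_bound2 x0x xp') => /le_trans; apply.
rewrite -[(x - xp) ^+ 2]sqrrN opprB.
apply: (@le_trans _ _ (h / (2 * c * (xp - x) ^+ 2) * (2 * (xp - x) ^+ 2))).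
  apply: ler_wpM2l; last by lra.
  by rewrite divr_ge0 ?(ltW h0) // mulr_ge0 ?(ltW u0) // mulr_ge0 // ltW.
rewrite /M (_ : h / (2 * c * _) * _ = h / c); last by field; rewrite !gt_eqF // subr_gt0.
by rewrite lerDr !mulr_ge0 ?invr_ge0 ?ltW.
Qed.

Lemma prim_wtvol_cont : continuous (fun x => W x * V x).
Proof. exact: mul_cont wt_cont vol_cont. Qed.

Lemma wt_mono_right x y : xp <= x -> x <= y -> y <= a -> W x <= W y.
Proof.
move=> px xy ya; rewrite /wt ler_expR ler_wpM2l //.
apply: (prim_nondecreasing hlam xy) => t /andP[xt ty].
have /andP[H _] := h2 (x := t) ltac:(by rewrite (le_trans px xt) (le_trans ty ya)).
by rewrite divr_ge0 ?(ltW h0) // (le_trans _ H) // !mulr_ge0 ?(ltW c0) ?(ltW k0) // subr_ge0 (le_trans px).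
Qed.

Lemma wt_mono_left x y : x0 <= x -> x <= y -> y <= xp -> W y <= W x.
Proof.
move=> px xy ya; rewrite /wt ler_expR ler_wpM2l //.
apply: (prim_nonincreasing hlam xy) => t /andP[xt ty].
have H := h1 (x := t) ltac:(by rewrite (le_trans px xt) (le_trans ty ya)).
have tp : 0 <= xp - t by rewrite subr_ge0 (le_trans ty).
rewrite ler_pdivrMr // mul0r (le_trans H) // oppr_le0 !mulr_ge0 ?(ltW c0) //.
by rewrite addr_ge0 // ltW.
Qed.

(** [s ^+ 2] times this integral is the relative variation of p caused by its own feedback through
    q; it is the quantity that must stay small. *)
Lemma half_off_diagonal : integ (fun x => W x * V x) x0 a <=
  16 / c * sg * k + 4 / c * sg ^+ 2 + C * k * W a * V a.
Proof.
rewrite (integ_split x0 xp a prim_wtvol_cont); apply: lerD.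
  have HG : primitive (fun x => M / k * atan ((x - xp) / k)) (fun x => M / (k ^+ 2 + (x - xp) ^+ 2)).
    have H := primM (primB (@prim_id R) (prim_cst xp)) (prim_cst k^-1).
    apply: prim_eq (primZ (M / k) (prim_atan H)) _ => x /=.
    have d0 : k ^+ 2 + (x - xp) ^+ 2 != 0 by rewrite gt_eqF // ltr_wpDr ?sqr_ge0 // exprn_gt0.
    have k1 : k != 0 by rewrite gt_eqF.
    rewrite mulr0 addr0 subr0 mul1r expr_div_n.
    have -> : 1 + (x - xp) ^+ 2 / k ^+ 2 = (k ^+ 2 + (x - xp) ^+ 2) / k ^+ 2 by field.
    by field; rewrite k1 d0.
  apply: le_trans (integ_le_prim prim_wtvol_cont HG x0p _) _.
    by move=> x; exact: wt_vol_bound3.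
  rewrite subrr mul0r atan0 mulr0 sub0r -mulrN.
  have : - atan ((x0 - xp) / k) <= 2.
    by apply: le_trans (atan_bound ((x0 - xp) / k)); rewrite -normrN ler_norm.
  have M0 : 0 <= M / k.
    by rewrite divr_ge0 ?ltW // addr_gt0 ?divr_gt0 // !mulr_gt0 ?invr_gt0 // exprn_gt0.
  move=> /(ler_wpM2l M0) /le_trans; apply.
  have s2 := sqr_ge0 sg; have := c0; rewrite -invr_gt0 => ci0.
  have -> : M / k * 2 = 8 / c * sg * k + 2 / c * sg ^+ 2.
    by rewrite /M -hsg; field; rewrite !gt_eqF.
  have sk : 0 <= c^-1 * sg * k by rewrite !mulr_ge0 // ltW.
  have ss : 0 <= c^-1 * sg ^+ 2 by rewrite mulr_ge0 // ltW.
  lra.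
apply: le_trans (integ_le_cst (M := W a * V a) prim_wtvol_cont xpa _) _.
  move=> x /andP[px xa]; apply: ler_pM; rewrite ?(ltW (wt_gt0 _)) //.
  - by apply: vol_ge0; rewrite (le_trans x0p).
  - exact: wt_mono_right.
  - exact: vol_le.
have WV : 0 <= W a * V a by rewrite mulr_ge0 ?(ltW (wt_gt0 _)) // vol_ge0 // (le_trans x0p).
by case/andP: h4 => _ H; rewrite -(mulrA (C * k)) [leRHS]mulrC ler_wpM2l.
Qed.

(** Only the interval of length [sg] to the right of [xp] is kept, where W is at most e^C W(xp). *)
Lemma vol_lower : expR (- C) * sg / W xp <= V a.
Proof.
have xpsg : xp + sg <= a by case/andP: h4 => H _; have := sgk; lra.
have px : xp <= xp + sg by rewrite lerDl ltW.
have HV : V a = V xp + (integ (fun t => (W t)^-1) xp (xp + sg) + integ (fun t => (W t)^-1) (xp + sg) a).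
  by rewrite /vol (integ_split x0 xp a wtV_cont) (integ_split xp (xp + sg) a wtV_cont).
have p1 : 0 <= V xp by exact: vol_ge0.
have p2 : 0 <= integ (fun t => (W t)^-1) (xp + sg) a by apply: integ_ge0 => //; [exact: wtV_cont|move=> *; exact: wtV_ge0].
have : expR (- C) / W xp * (xp + sg) - expR (- C) / W xp * xp <= integ (fun t => (W t)^-1) xp (xp + sg).
  apply: (integ_ge_prim wtV_cont (primZ _ (@prim_id R)) px) => x /andP[p xx].
  have xa := le_trans xx xpsg.
  have H := lam_right_hi (x := x) ltac:(by rewrite p).
  rewrite mulr1 ler_pdivrMr ?wt_gt0 // mulrC wt_ratio ler_expR lerN2.
  have B : (x - xp) ^+ 2 <= sg ^+ 2 by rewrite lerXn2r // ?nnegrE ?subr_ge0 ?(ltW sg0) // lerBlDl.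
  have C0 : 0 <= C by rewrite (le_trans _ cC).
  have Cs : 0 <= C / (2 * sg ^+ 2) by rewrite divr_ge0 // mulr_ge0 // sqr_ge0.
  apply: (@le_trans _ _ (2 * (C / (2 * sg ^+ 2) * sg ^+ 2))).
    by rewrite ler_wpM2l // (le_trans H) // ler_wpM2l.
  by rewrite le_eqVlt; apply/orP; left; apply/eqP; field; rewrite gt_eqF.
lra.
Qed.

(** Although W(a) / W(xp) is exponentially large in (k / sg)^2, the linear bound 1 + v <= e^v gives
    enough. *)
Lemma wt_ratio_lower : c ^+ 3 * (k / sg) ^+ 2 * W xp <= W a.
Proof.
have aa : xp <= a <= a by rewrite xpa lexx.
have H := lam_right_lo aa.
rewrite -ler_pdivlMr ?wt_gt0 // wt_ratio.
have -> : - (2 * (lam xp - lam a)) = 2 * (lam a - lam xp) by ring.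
apply: le_trans (expR_ge1Dx _); rewrite -[leLHS]add0r; apply: lerD => //.
have B : (c * k) ^+ 2 <= (a - xp) ^+ 2.
  by case/andP: h4 => B _; rewrite lerXn2r // ?nnegrE ?subr_ge0 // mulr_ge0 // ltW.
have Cs : 0 <= c / (2 * sg ^+ 2) by rewrite divr_ge0 ?mulr_ge0 ?sqr_ge0 // ltW.
apply: le_trans (ler_wpM2l _ H) => //.
apply: le_trans (ler_wpM2l _ (ler_wpM2l Cs B)) => //.
by rewrite le_eqVlt; apply/orP; left; apply/eqP; field; rewrite gt_eqF.
Qed.

Lemma half_first_moment : integ (fun x => `|x - xp| * (W x)^-1) x0 a <= sg ^+ 2 / c / W xp.
Proof.
have cc : continuous (fun x => `|x - xp| * (W x)^-1).
  apply: mul_cont wtV_cont; apply: abs_cont => x; apply: cvgB; [exact: cvg_id|exact: cvg_cst].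
(* [E] dominates W(xp) / W on both sides of [xp], and (x - xp) [E] has an explicit primitive. *)
pose E x := expR (- (c / sg ^+ 2 * (x - xp) ^+ 2)).
have HE : primitive E (fun x => - (2 * (c / sg ^+ 2) * (x - xp)) * E x).
  exact: prim_expR (primN (prim_square _ _)).
have E1 x : E x <= 1 by rewrite -expR0 ler_expR oppr_le0 mulr_ge0 ?sqr_ge0 // divr_ge0 ?sqr_ge0 // ltW.
have E0 x : 0 <= E x by exact: expR_ge0.
have Wp := wt_gt0 xp; have Wpi : 0 <= (W xp)^-1 by rewrite invr_ge0 ltW.
pose s := sg ^+ 2 / (2 * c) / W xp.
have s0 : 0 <= s by rewrite divr_ge0 ?(ltW Wp) // divr_ge0 ?sqr_ge0 // mulr_ge0 // ltW.
have sE x : s * (- (2 * (c / sg ^+ 2) * (x - xp)) * E x) = - ((x - xp) * (E x / W xp)).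
  by rewrite /s; field; rewrite !gt_eqF.
rewrite (integ_split x0 xp a cc).
have -> : sg ^+ 2 / c / W xp = s + s by rewrite /s; field; rewrite !gt_eqF.
apply: lerD.
  apply: le_trans (integ_le_prim cc (primZ s HE) x0p _) _.
    move=> x /andP[x0x xxp]; rewrite sE ler0_norm ?subr_le0 // -mulNr ler_wpM2l ?oppr_ge0 ?subr_le0 //.
    rewrite ler_pdivlMr // mulrC wt_ratio ler_expR lerN2.
    have := lam_left x0x xxp (lexx _).
    have -> : (xp - x) ^+ 2 = (x - xp) ^+ 2 by ring.
    move=> H.
    apply: le_trans (ler_wpM2l _ H) => //.
    by rewrite le_eqVlt; apply/orP; left; apply/eqP; field; rewrite gt_eqF.
  have := mulr_ge0 s0 (E0 x0); have := ler_wpM2l s0 (E1 xp); lra.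
have HE' := primN (primZ s HE).
apply: le_trans (integ_le_prim cc HE' xpa _) _.
  move=> x /andP[px xa]; rewrite sE opprK ger0_norm ?subr_ge0 // ler_wpM2l ?subr_ge0 //.
  rewrite ler_pdivlMr // mulrC wt_ratio ler_expR lerN2.
  have H := lam_right_lo (x := x) ltac:(by rewrite px).
  apply: le_trans (ler_wpM2l _ H) => //.
  by rewrite le_eqVlt; apply/orP; left; apply/eqP; field; rewrite gt_eqF.
have := mulr_ge0 s0 (E0 a); have := ler_wpM2l s0 (E1 xp); lra.
Qed.

Lemma wt_prim : primitive W (fun x => 2 * (be x / h) * W x).
Proof. exact: prim_expR (primZ 2 hlam). Qed.

(** On [x0, x0 + c/2] the weight decays at a rate of order 1 / h, so its integral there is O(h
    W(x0)). Monotonicity then gives W(x0 + c/2) = O(h W(x0)), which controls the piece up to [xp];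
    on [xp, a] the largest value is W(a). *)
Lemma half_wt_integral : integ W x0 a <= 10 * C / c ^+ 4 * h * W x0 + C * k * W a.
Proof.
have cp : x0 + c / 2 <= xp by case/andP: h5; have := c0; lra.
have xc : x0 <= x0 + c / 2 by have := c0; lra.
have W0 := wt_gt0 x0.
have c3 : 0 < c ^+ 3 by rewrite exprn_gt0.
have c4 : 0 < c ^+ 4 by rewrite exprn_gt0.
have A1 : integ W x0 (x0 + c / 2) <= 2 * h / c ^+ 3 * W x0.
  have HN := primZ (- (2 * h / c ^+ 3)) wt_prim.
  apply: le_trans (integ_le_prim wt_cont HN xc _) _.
    move=> x /andP[x0x xx].
    have H := h1 (x := x) ltac:(by rewrite x0x (le_trans xx cp)).
    have u : c / 2 <= xp - x by case/andP: h5; lra.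
    have B : be x <= - (c ^+ 3 / 4).
      apply: le_trans H _; rewrite lerN2.
      have -> : c ^+ 3 / 4 = (c * (c / 2)) * (c / 2) by field.
      apply: ler_pM; rewrite ?mulr_ge0 ?divr_ge0 ?(ltW c0) //.
        by rewrite ler_wpM2l // ltW.
      by rewrite (le_trans u) // lerDr ltW.
    have -> : - (2 * h / c ^+ 3) * (2 * (be x / h) * W x) = (- be x * (4 / c ^+ 3)) * W x.
      by field; rewrite !gt_eqF.
    rewrite ler_peMl ?(ltW (wt_gt0 _)) // mulrA ler_pdivlMr // mul1r; lra.
  have Wp := wt_gt0 (x0 + c / 2).
  have hc : 0 <= 2 * h / c ^+ 3 by rewrite divr_ge0 ?mulr_ge0 // ltW.
  have := mulr_ge0 hc (ltW Wp); lra.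
have A2 : W (x0 + c / 2) <= 4 * h / c ^+ 4 * W x0.
  have HN := primZ (W (x0 + c / 2)) (@prim_id R).
  have P x : x0 <= x <= x0 + c / 2 -> W (x0 + c / 2) * 1 <= W x.
    by move=> /andP[xx xc']; rewrite mulr1; exact: wt_mono_left.
  have H := integ_ge_prim wt_cont HN xc P.
  have H2 : W (x0 + c / 2) * (c / 2) <= 2 * h / c ^+ 3 * W x0 by lra.
  rewrite -ler_pdivlMr ?divr_gt0 // in H2; apply: le_trans H2 _.
  by rewrite le_eqVlt; apply/orP; left; apply/eqP; field; rewrite gt_eqF.
have A3 : integ W (x0 + c / 2) xp <= W (x0 + c / 2) * C.
  apply: le_trans (integ_le_cst (M := W (x0 + c / 2)) wt_cont cp _) _.
    by move=> x /andP[xx xxp]; exact: wt_mono_left.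
  rewrite ler_wpM2l ?(ltW (wt_gt0 _)) //; case/andP: h5; have := c0; lra.
have A4 : integ W xp a <= C * k * W a.
  apply: le_trans (integ_le_cst (M := W a) wt_cont xpa _) _.
    by move=> x /andP[px xa]; exact: wt_mono_right.
  by case/andP: h4 => _ H; rewrite mulrC ler_wpM2r // ltW // wt_gt0.
rewrite (integ_split x0 xp a wt_cont) (integ_split x0 (x0 + c / 2) xp wt_cont).
apply: lerD A4; apply: le_trans (lerD A1 A3) _.
have C0 : 0 <= C by rewrite (le_trans _ cC).
have := ler_wpM2r C0 A2.
have hW : 0 <= h * W x0 by rewrite mulr_ge0 ?(ltW h0) ?(ltW W0).
have E : 2 * h / c ^+ 3 * W x0 <= 6 * C / c ^+ 4 * h * W x0.
  have -> : 2 * h / c ^+ 3 * W x0 = 2 * c / c ^+ 4 * (h * W x0) by field; rewrite gt_eqF.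
  rewrite -[6 * C / c ^+ 4 * h * W x0]mulrA ler_wpM2r // ler_pM2r ?invr_gt0 //; have := c1; have := cC; lra.
move=> H; apply: le_trans (lerD E H) _.
by rewrite le_eqVlt; apply/orP; left; apply/eqP; field; rewrite gt_eqF.
Qed.

(** The growing part of |q|^2 W is of order s^2 W V^2. Left of [xp] one writes W V^2 = (W V)^2 / W
    with W V = O(sg), which leads back to moments of 1 / W. *)
Lemma half_tail (D : R) : 0 <= D ->
  integ (fun x => (`|x - xp| + D) * (W x * V x ^+ 2)) x0 a <=
  4 / c ^+ 2 * sg ^+ 2 * (sg ^+ 2 / c / W xp + D * V a) + C * k * ((C * k + D) * (W a * V a ^+ 2)).
Proof.
move=> D0.
have cn : continuous (fun x => `|x - xp|).
  by apply: abs_cont => x; apply: cvgB; [exact: cvg_id|exact: cvg_cst].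
have cnD : continuous (fun x => `|x - xp| + D).
  by move=> x; apply: cvgD; [exact: cn|exact: cvg_cst].
have cWV : continuous (fun x => W x * V x ^+ 2).
  apply: mul_cont wt_cont _; rewrite (_ : (fun x => _) = fun x => V x * V x).
    exact: mul_cont vol_cont vol_cont.
  by apply/funext => x; rewrite expr2.
have cc := mul_cont cnD cWV.
rewrite (integ_split x0 xp a cc); apply: lerD.
  have ci := mul_cont cnD wtV_cont.
  have ci' : continuous (fun x => 4 / c ^+ 2 * sg ^+ 2 * ((`|x - xp| + D) * (W x)^-1)).
    by move=> x; apply: cvgMl_tmp; exact: ci.
  apply: le_trans (integ_le cc ci' x0p _) _.
    move=> x /andP[x0x xxp].
    have B := wt_vol_bound (x := x) ltac:(by rewrite x0x).
    have WV0 : 0 <= W x * V x by rewrite mulr_ge0 ?(ltW (wt_gt0 _)) // vol_ge0.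
    have -> : (`|x - xp| + D) * (W x * V x ^+ 2) = (`|x - xp| + D) / W x * (W x * V x) ^+ 2.
      by field; rewrite gt_eqF // wt_gt0.
    have -> : 4 / c ^+ 2 * sg ^+ 2 * ((`|x - xp| + D) / W x) = (`|x - xp| + D) / W x * (2 / c * sg) ^+ 2.
      by field; rewrite !gt_eqF // wt_gt0.
    rewrite ler_wpM2l ?divr_ge0 ?addr_ge0 ?(ltW (wt_gt0 _)) // lerXn2r // ?nnegrE //.
    by rewrite !mulr_ge0 ?invr_ge0 ?ltW.
  rewrite integZ // ler_wpM2l; first by [].
    by rewrite mulr_ge0 ?sqr_ge0 // divr_ge0 // sqr_ge0.
  have -> : (fun x => (`|x - xp| + D) * (W x)^-1) = fun x => `|x - xp| * (W x)^-1 + D * (W x)^-1.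
    by apply/funext => x; rewrite mulrDl.
  have cD : continuous (fun x => D * (W x)^-1) by move=> x; apply: cvgMl_tmp; exact: wtV_cont.
  have cN := mul_cont cn wtV_cont.
  rewrite integD // integZ //; last exact: wtV_cont.
  apply: lerD; last by rewrite ler_wpM2l //; exact: vol_le.
  apply: le_trans half_first_moment; rewrite (integ_split x0 xp a cN) lerDl.
  by apply: integ_ge0 => // x _; rewrite mulr_ge0 ?wtV_ge0.
apply: le_trans (integ_le_cst (M := (C * k + D) * (W a * V a ^+ 2)) cc xpa _) _.
  move=> x /andP[px xa].
  have Vx : 0 <= V x by apply: vol_ge0; rewrite (le_trans x0p).
  apply: ler_pM; rewrite ?addr_ge0 ?mulr_ge0 ?sqr_ge0 ?(ltW (wt_gt0 _)) //.
    rewrite lerD2r ger0_norm ?subr_ge0 //; case/andP: h4 => _; lra.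
  apply: ler_pM; rewrite ?sqr_ge0 ?(ltW (wt_gt0 _)) //; first exact: wt_mono_right.
  by rewrite lerXn2r // ?nnegrE ?vol_le // vol_ge0 // (le_trans x0p).
rewrite mulrC ler_wpM2r //; last by case/andP: h4.
have Va : 0 <= V a by rewrite vol_ge0 // (le_trans x0p).
rewrite mulr_ge0 ?addr_ge0 ?mulr_ge0 ?sqr_ge0 ?(ltW (wt_gt0 _)) ?(ltW k0) //.
by rewrite (le_trans _ cC).
Qed.

End HalfWell.

(** * The Euclidean norm of (p1, p2) and (q1, q2), pairs of real and imaginary parts *)

Section PlaneNorm.
Variable R : realType.
Implicit Types u v a b : R.

Definition nrm u v : R := Num.sqrt (u ^+ 2 + v ^+ 2).

Lemma nrm_ge0 u v : 0 <= nrm u v. Proof. exact: sqrtr_ge0. Qed.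

Lemma nrm_sqr u v : nrm u v ^+ 2 = u ^+ 2 + v ^+ 2.
Proof. by rewrite sqr_sqrtr // addr_ge0 // sqr_ge0. Qed.

Lemma le_of_sqr u v : 0 <= v -> u ^+ 2 <= v ^+ 2 -> u <= v.
Proof.
move=> v0 H; have [u0|/ltW u0] := leP 0 u; last exact: le_trans u0 v0.
by move: H; rewrite ler_sqr ?nnegrE.
Qed.

Lemma nrm_dot u v a b : u * a + v * b <= nrm u v * nrm a b.
Proof.
apply: le_of_sqr; first by rewrite mulr_ge0 ?nrm_ge0.
rewrite exprMn !nrm_sqr; have := sqr_ge0 (u * b - v * a); rewrite !expr2; lra.
Qed.

Lemma nrmD u v a b : nrm (u + a) (v + b) <= nrm u v + nrm a b.
Proof.
apply: le_of_sqr; first by rewrite addr_ge0 ?nrm_ge0.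
have := nrm_dot u v a b; have := nrm_sqr u v; have := nrm_sqr a b.
rewrite !sqrrD => E1 E2 E3; rewrite nrm_sqr !sqrrD; lra.
Qed.

Lemma nrmZ c u v : nrm (c * u) (c * v) = `|c| * nrm u v.
Proof. by rewrite /nrm !exprMn -mulrDr sqrtrM ?sqr_ge0 // sqrtr_sqr. Qed.

Lemma nrmN u v : nrm (- u) (- v) = nrm u v.
Proof. by rewrite /nrm !sqrrN. Qed.

Lemma nrm0 u v : nrm u v = 0 -> u = 0 /\ v = 0.
Proof.
move=> H; have := nrm_sqr u v; rewrite H expr0n /= => /esym/eqP.
by rewrite paddr_eq0 ?sqr_ge0 // !sqrf_eq0 => /andP[/eqP -> /eqP ->].
Qed.

Lemma nrm_r0 u : nrm u 0 = `|u|.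
Proof. by rewrite /nrm expr0n addr0 sqrtr_sqr. Qed.

Lemma nrm_cont (f k : R -> R) : continuous f -> continuous k -> continuous (fun x => nrm (f x) (k x)).
Proof.
move=> cf ck x; apply: (@continuous_comp _ _ _ (fun x => f x ^+ 2 + k x ^+ 2) (@Num.sqrt R)); last exact: sqrt_continuous.
by apply: cvgD; rewrite expr2; apply: cvgM; [exact: cf|exact: cf|exact: ck|exact: ck].
Qed.

(** Taking the scalar product with the increment itself reduces the claim to a comparison of real
    primitives. *)
Lemma nrm_mean_value (P1 P2 f1 f2 G k : R -> R) (x y : R) :
  primitive P1 f1 -> primitive P2 f2 -> primitive G k -> x <= y ->
  (forall t, x <= t <= y -> nrm (f1 t) (f2 t) <= k t) ->
  nrm (P1 y - P1 x) (P2 y - P2 x) <= G y - G x.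
Proof.
move=> H1 H2 HG xy fk.
set d1 := P1 y - P1 x; set d2 := P2 y - P2 x; set n := nrm d1 d2.
have n0 : 0 <= n by exact: nrm_ge0.
have : n ^+ 2 <= n * (G y - G x).
  have K t : x <= t <= y -> d1 * f1 t + d2 * f2 t <= n * k t.
    by move=> /fk H; apply: le_trans (nrm_dot _ _ _ _) _; rewrite ler_wpM2l.
  have := prim_le (primD (primZ d1 H1) (primZ d2 H2)) (primZ n HG) xy K.
  rewrite -mulrBr; apply: le_trans.
  by rewrite nrm_sqr le_eqVlt /d1 /d2; apply/orP; left; apply/eqP; ring.
have [->|nn] := eqVneq n 0.
  by move=> _; have := prim_nondecreasing HG xy; rewrite subr_ge0; apply=> t /fk; apply: le_trans; exact: nrm_ge0.
by rewrite expr2 ler_pM2l // lt_neqAle eq_sym nn.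
Qed.

Lemma max_on_segment (f : R -> R) (a b : R) : continuous f -> a <= b ->
  exists2 t, a <= t <= b & forall x, a <= x <= b -> f x <= f t.
Proof.
move=> cf ab; have [t tab H] := EVT_max ab (continuous_subspaceT cf).
by exists t => [|x xab]; [move: tab; rewrite in_itv|apply: H; rewrite in_itv].
Qed.

End PlaneNorm.

(** * The system driven across one half of the well *)

Section HalfSystem.
Variable R : realType.
Variables (W : R -> R) (s x0 a : R).
Hypotheses (W0 : forall x, 0 < W x) (cW : continuous W) (s0 : 0 <= s) (xa : x0 <= a).
Notation V := (integ (fun t => (W t)^-1) x0).
Notation J := (integ W x0).
Notation O := (integ (fun x => W x * integ (fun t => (W t)^-1) x0 x) x0).

Let cWV : continuous (fun t => (W t)^-1).
Proof. by move=> x; apply: cvgV; [rewrite gt_eqF|exact: cW]. Qed.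

Let hV : primitive V (fun x => (W x)^-1). Proof. exact: prim_integ. Qed.
Let hJ : primitive J W. Proof. exact: prim_integ. Qed.
Let cO : continuous (fun x => W x * V x). Proof. exact: mul_cont cW (prim_continuous hV). Qed.
Let hO : primitive O (fun x => W x * V x). Proof. exact: prim_integ. Qed.
Let V0 : V x0 = 0. Proof. exact: integ_aa. Qed.
Let J0 : J x0 = 0. Proof. exact: integ_aa. Qed.
Let O0 : O x0 = 0. Proof. exact: integ_aa. Qed.
Let Vge x : x0 <= x -> 0 <= V x.
Proof. by move=> xx; apply: integ_ge0 => // t _; rewrite invr_ge0 ltW. Qed.

Let Jge x : x0 <= x -> 0 <= J x.
Proof. by move=> xx; apply: integ_ge0 => // t _; rewrite ltW. Qed.

Let Jle x : x <= a -> J x <= J a.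
Proof. by move=> xx; apply: (prim_nondecreasing hJ xx) => t _; rewrite ltW. Qed.

Let Ole x : x0 <= x -> x <= a -> O x <= O a.
Proof.
move=> x0x xx; apply: (prim_nondecreasing hO xx) => t /andP[xt _].
by rewrite mulr_ge0 ?Vge ?(le_trans x0x) // ltW.
Qed.

Section Pair.
Variables (p1 q1 p2 q2 : R -> R).
Hypotheses (hs1 : sol s W p1 q1) (hs2 : sol s W p2 q2).

Lemma half_q_bound (Mp x : R) : x0 <= x ->
  (forall t, x0 <= t <= x -> nrm (p1 t) (p2 t) <= Mp) ->
  nrm (q1 x - q1 x0) (q2 x - q2 x0) <= s * Mp * V x.
Proof.
move=> xx Hp; have [_ hq1] := hs1; have [_ hq2] := hs2.
have := nrm_mean_value hq1 hq2 (primZ (s * Mp) hV) xx _; rewrite V0 mulr0 subr0; apply=> t /Hp H.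
by rewrite nrmZ ger0_norm ?divr_ge0 ?(ltW (W0 _)) // [leRHS]mulrAC ler_wpM2l // divr_ge0 // ltW.
Qed.

Lemma half_p_bound (Mp Mq x : R) : x0 <= x -> nrm (q1 x0) (q2 x0) <= Mq ->
  (forall t, x0 <= t <= x -> nrm (p1 t) (p2 t) <= Mp) ->
  nrm (p1 x - p1 x0) (p2 x - p2 x0) <= s * Mq * J x + s ^+ 2 * Mp * O x.
Proof.
move=> xx Hq Hp; have [hp1 _] := hs1; have [hp2 _] := hs2.
have := nrm_mean_value hp1 hp2 (primD (primZ (s * Mq) hJ) (primZ (s ^+ 2 * Mp) hO)) xx _.
rewrite J0 O0 !mulr0 addr0 subr0; apply=> t /andP[xt tx].
have Hqt : nrm (q1 t) (q2 t) <= Mq + s * Mp * V t.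
  have := half_q_bound xt (fun t' tt => Hp t' ltac:(case/andP: tt => a1 a2; by rewrite a1 (le_trans a2 tx))).
  have := nrmD (q1 t - q1 x0) (q2 t - q2 x0) (q1 x0) (q2 x0); rewrite !subrK; lra.
rewrite nrmZ normrN ger0_norm ?mulr_ge0 ?(ltW (W0 _)) //.
have sW : 0 <= s * W t by rewrite mulr_ge0 // ltW.
have := ler_wpM2l sW Hqt => /le_trans; apply.
by rewrite le_eqVlt; apply/orP; left; apply/eqP; ring.
Qed.

(** The maximum M of |p| satisfies M <= A + et + M / 25, which can be solved for M. The constant
    25^-1 is 4 / 100: later s^2 V Vo <= 4, and the off-diagonal integral is at most V Vo / 100. *)
Lemma half_pair (A Mq et x : R) : s ^+ 2 * O a <= 25^-1 -> nrm (p1 x0) (p2 x0) <= A ->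
  nrm (q1 x0) (q2 x0) <= Mq -> s * Mq * J a <= et -> x0 <= x <= a ->
  nrm (p1 x - p1 x0) (p2 x - p2 x0) <= A / 24 + 25 / 24 * et /\
  nrm (q1 x) (q2 x) <= Mq + s * (25 / 24 * (A + et)) * V x.
Proof.
move=> HO HA HMq Het.
have [hp1 _] := hs1; have [hp2 _] := hs2.
have cn := nrm_cont (prim_continuous hp1) (prim_continuous hp2).
have [t /andP[xt ta] Mt] := max_on_segment cn xa; set M := nrm (p1 t) (p2 t) in Mt.
have M0 : 0 <= M by exact: nrm_ge0.
have Mq0 : 0 <= Mq by apply: le_trans HMq; exact: nrm_ge0.
have B y : x0 <= y <= a -> nrm (p1 y - p1 x0) (p2 y - p2 x0) <= et + M / 25.
  move=> /andP[xy ya].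
  have H := half_p_bound xy HMq (fun t' tt => Mt t' ltac:(case/andP: tt => a1 a2; by rewrite a1 (le_trans a2 ya))).
  apply: le_trans H _; apply: lerD.
    by apply: le_trans Het; rewrite ler_wpM2l ?mulr_ge0 ?Jle.
  have H1 := ler_wpM2l (sqr_ge0 s) (Ole xy ya).
  have H2 := ler_wpM2l M0 (le_trans H1 HO).
  by rewrite (_ : s ^+ 2 * M * O y = M * (s ^+ 2 * O y)) //; ring.
have HM : M <= 25 / 24 * (A + et).
  have := B t ltac:(by rewrite xt ta); have := nrmD (p1 t - p1 x0) (p2 t - p2 x0) (p1 x0) (p2 x0).
  rewrite !subrK -/M; lra.
move=> /andP[xx xxa]; split; first by have := B x ltac:(by rewrite xx xxa); lra.
have H := half_q_bound xx (fun t' tt => Mt t' ltac:(case/andP: tt => a1 a2; by rewrite a1 (le_trans a2 xxa))).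
have := nrmD (q1 x - q1 x0) (q2 x - q2 x0) (q1 x0) (q2 x0); rewrite !subrK.
have sV : 0 <= s * V x by rewrite mulr_ge0 ?Vge.
have := ler_wpM2l sV HM.
rewrite (_ : s * V x * M = s * M * V x); last by ring.
rewrite (_ : s * V x * _ = s * (25 / 24 * (A + et)) * V x); last by ring.
lra.
Qed.

End Pair.

(* The second column is controlled through the Wronskian: since p1 is close to
   1, q2 = (1 + p2 q1) / p1, which makes the equation for p2 a small
   perturbation of p2' = - s W. *)
Lemma half_fundamental (p1 q1 p2 q2 : R -> R) :
  sol s W p1 q1 -> p1 x0 = 1 -> q1 x0 = 0 ->
  sol s W p2 q2 -> p2 x0 = 0 -> q2 x0 = 1 -> s ^+ 2 * O a <= 25^-1 ->
  [/\ `|p1 a - 1| <= 24^-1, 23 / 24 * (s * V a) <= q1 a <= 25 / 24 * (s * V a),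
      `|p2 a| <= 5 / 4 * (s * J a) & `|q2 a| <= 24 / 23 * (1 + 4 / 3 * (s ^+ 2 * V a * J a))].
Proof.
move=> hs1 p10 q10 hs2 p20 q20 HO.
have hz : sol s W (fun=> 0) (fun=> 0).
  by split; apply: prim_eq (prim_cst 0) _ => x; rewrite mulr0.
have F x : x0 <= x <= a -> `|p1 x - 1| <= 24^-1 /\ `|q1 x| <= 25 / 24 * (s * V x).
  move=> xx; have := half_pair hs1 hz (A := 1) (Mq := 0) (et := 0) HO _ _ _ xx.
  rewrite p10 q10 !nrm_r0 normr1 normr0 mulr0 mul0r subrr !nrm_r0 !mulr0 !addr0 !add0r.
  by move=> /(_ (lexx _) (lexx _) (lexx _)) [H1 H2]; split; lra.
have [hp1 hq1] := hs1; have [hp2 hq2] := hs2.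
have wr x : p1 x * q2 x - p2 x * q1 x = 1.
  have Hw : primitive (fun x => p1 x * q2 x - p2 x * q1 x) (fun=> 0).
    by apply: prim_eq (primB (primM hp1 hq2) (primM hp2 hq1)) _ => t /=; ring.
  have := prim_unique Hw (prim_cst 0) x x0; rewrite subrr p10 q20 p20 q10; lra.
have Va := Vge xa; have Ja := Jge xa.
have q2b x : x0 <= x <= a -> `|q2 x| <= 24 / 23 * (1 + 25 / 24 * (s * V x) * `|p2 x|).
  move=> xx; have [/ler_normlP[H1 H2] H3] := F x xx.
  have p1p : 23 / 24 <= `|p1 x| by apply: le_trans (ler_norm _); lra.
  have E : `|p1 x| * `|q2 x| <= 1 + 25 / 24 * (s * V x) * `|p2 x|.
    rewrite -normrM (_ : p1 x * q2 x = 1 + p2 x * q1 x); last by have := wr x; lra.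
    apply: le_trans (ler_normD _ _) _; rewrite normr1 lerD2l normrM mulrC.
    by rewrite ler_wpM2r.
  have := ler_wpM2r (normr_ge0 (q2 x)) p1p; lra.
have [t /andP[xt ta] Mt] := max_on_segment (abs_cont (prim_continuous hp2)) xa; set M := `|p2 t| in Mt.
have M0 : 0 <= M by exact: normr_ge0.
have HM : M <= 5 / 4 * (s * J a).
  have B : `|p2 t - p2 x0| <= 24 / 23 * (s * J t) + 25 / 23 * M * (s ^+ 2 * O t).
    have := nrm_mean_value hp2 (prim_cst 0)
      (primD (primZ (24 / 23 * s) hJ) (primZ (25 / 23 * M * s ^+ 2) hO)) xt _.
    rewrite J0 O0 !mulr0 addr0 !subr0 nrm_r0 !mulrA; apply=> y /andP[xy yt].
    have xya : x0 <= y <= a by rewrite xy (le_trans yt ta).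
    have sW : 0 <= s * W y by rewrite mulr_ge0 // ltW.
    rewrite nrm_r0 normrM normrN (ger0_norm sW) -?[_ * s * s]mulrA -?expr2.
    have H := q2b y xya; have sV : 0 <= 25 / 24 * (s * V y) by rewrite !mulr_ge0 ?Vge.
    have H2 := ler_wpM2l sV (Mt y xya).
    have {H2 H} H : `|q2 y| <= 24 / 23 * (1 + 25 / 24 * (s * V y) * M) by lra.
    have := ler_wpM2l sW H => /le_trans; apply.
    by rewrite le_eqVlt; apply/orP; left; apply/eqP; field.
  have H1 := ler_wpM2l (sqr_ge0 s) (Ole xt ta).
  have H2 := ler_wpM2l M0 (le_trans H1 HO).
  have H3 := ler_wpM2l s0 (Jle ta).
  move: B; rewrite p20 subr0 -/M; have sJ := mulr_ge0 s0 Ja; lra.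
have aa : x0 <= a <= a by rewrite xa lexx.
have [P1 Q1] := F a aa; split => //.
- apply/andP; split; last by apply: le_trans Q1; exact: ler_norm.
  have HG := primZ (23 / 24 * s) hV.
  have := prim_le HG hq1 xa; rewrite V0 mulr0 q10 !subr0 mulrA; apply=> y yy.
  have [/ler_normlP[H1 _] _] := F y yy.
  have sWV : 0 <= s * (W y)^-1 by rewrite divr_ge0 // ltW.
  have := ler_wpM2l sWV (_ : 23 / 24 <= p1 y); lra.
- exact: le_trans (Mt a aa) HM.
have H := q2b a aa; have sV : 0 <= s * V a by rewrite mulr_ge0.
have := ler_wpM2l sV (le_trans (Mt a aa) HM).
have sJ : 0 <= s ^+ 2 * V a * J a by rewrite !mulr_ge0 ?sqr_ge0.
rewrite (_ : s * V a * (5 / 4 * (s * J a)) = 5 / 4 * (s ^+ 2 * V a * J a)); last by ring.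
lra.
Qed.

End HalfSystem.

(** * The half well in terms of one large parameter *)

Section HalfSummary.
Variable R : realType.

(* [be] models Im z - Im g to the left of the minimum [a] of Im g, [xp] being its
   zero; [k] is of size sqrt (Im z) and [sg = sqrt (h / k)] is the width on which a
   ground state concentrates at [xp]. *)
Record half_well (lam be : R -> R) (h k sg c C x0 xp a : R) : Prop := HalfWell {
  hw_lam : primitive lam (fun x => be x / h);
  hw_h : 0 < h; hw_k : 0 < k; hw_sg : 0 < sg; hw_scale : sg ^+ 2 * k = h;
  hw_out : forall x, x0 <= x <= xp -> be x <= - (c * (xp - x) * (k + (xp - x)));
  hw_in : forall x, xp <= x <= a -> c * k * (x - xp) <= be x <= C * k * (x - xp);
  hw_bottom : c * k <= a - xp <= C * k;
  hw_exit : c <= xp - x0 <= C }.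

(** The product of the constants of [vol_lower] and [wt_ratio_lower]. *)
Definition kap (c C : R) := expR (- C) * c ^+ 3.

Lemma kap_gt0 c C : 0 < c -> 0 < kap c C.
Proof. by move=> c0; rewrite mulr_gt0 ?expR_gt0 ?exprn_gt0. Qed.

(** The two lower bounds multiply to kap k^2 / sg, which is k y for y = kap k / sg. This [y]
    measures the depth of the well and absorbs the constants of the error terms when it is large. *)
Lemma half_depth (c C h k sg y x0 xp a : R) (lam be : R -> R) :
  0 < c -> c <= 1 -> 1 <= C ->
  half_well lam be h k sg c C x0 xp a -> sg * y = kap c C * k -> kap c C / c <= y ->
  k * y <= vol lam x0 a * wt lam a.
Proof.
move=> c0 c1 C1 [hl h0 k0 s0 sk H1 H2 H4 H5] Ey Yy.
have sgk : sg <= c * k.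
  have : sg * (kap c C / c) <= kap c C * k by rewrite -Ey ler_wpM2l // ltW.
  have K := kap_gt0 C c0.
  by rewrite mulrCA ler_pM2l // ler_pdivrMr // mulrC.
have A1 : expR (- C) * sg / wt lam xp <= vol lam x0 a by exact: (vol_lower hl h0 s0 sk c0 C1 sgk H2 H4 H5).
have A2 : c ^+ 3 * (k / sg) ^+ 2 * wt lam xp <= wt lam a by exact: (wt_ratio_lower hl h0 k0 s0 sk c0 H2 H4).
have Wp := wt_gt0 lam xp.
have : expR (- C) * sg / wt lam xp * (c ^+ 3 * (k / sg) ^+ 2 * wt lam xp) <= vol lam x0 a * wt lam a.
  apply: ler_pM A1 A2.
    by rewrite divr_ge0 ?mulr_ge0 ?expR_ge0 ?(ltW s0) // ltW.
  by rewrite mulr_ge0 ?(ltW Wp) // mulr_ge0 ?sqr_ge0 // exprn_ge0 // ltW.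
apply: le_trans; rewrite le_eqVlt; apply/orP; left; apply/eqP.
have -> : y = kap c C * k / sg by rewrite -Ey mulrAC mulfV ?mul1r // gt_eqF.
by rewrite /kap; field; rewrite !gt_eqF.
Qed.

(** [Vo] stands for the integral of W on the other half, known only through the lower bound k y
    W(a). Against it the errors gain negative powers of y, so a threshold [Y] makes them at most one
    hundredth; [m] converts the value of W at the entry x0 into W(a). *)
Lemma half_summary (c C : R) : 0 < c -> c <= 1 -> 1 <= C ->
  exists Y K : R, [/\ 1 <= Y, 1 <= K, kap c C / c <= Y, kap c C <= Y &
  forall (lam be : R -> R) (h k sg y x0 xp a Vo m : R),
  half_well lam be h k sg c C x0 xp a -> sg * y = kap c C * k -> Y <= y -> k <= C ->
  0 < m <= 1 -> m * wt lam x0 = wt lam a -> k * y * wt lam a <= Vo ->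
  [/\ integ (fun x => wt lam x * vol lam x0 x) x0 a <= vol lam x0 a * Vo / 100,
      m * integ (wt lam) x0 a <= Vo / 100,
      integ (fun x => `|x - xp| * (wt lam x)^-1) x0 a <= K * sg * vol lam x0 a &
      integ (fun x => (`|x - xp| + 2 * C * k) * (wt lam x * vol lam x0 x ^+ 2)) x0 a
        <= K * sg * (vol lam x0 a ^+ 2 * Vo)]].
Proof.
move=> c0 c1 C1; have C0 : 0 < C by exact: lt_le_trans C1.
have kp := kap_gt0 C c0; move: (kap c C) kp (@half_depth c C) => ka kp HD.
have [K1 EK1] : exists K1 : R, K1 = 10 * C ^+ 3 * ka ^+ 2 / c ^+ 4 + C by eexists.
have [K2 EK2] : exists K2 : R, K2 = expR C / c by eexists.
have [K3 EK3] : exists K3 : R, K3 = 4 / c ^+ 2 * (K2 + 2 * C) * ka + 3 * C ^+ 2 / ka by eexists.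
have p300 : 0 < 300 :> R by rewrite ltr0n.
have K1p : 0 < K1.
  rewrite EK1 addr_gt0 // divr_gt0 ?exprn_gt0 // mulr_gt0 ?exprn_gt0 //.
  by rewrite mulr_gt0 ?exprn_gt0.
have K2p : 0 < K2 by rewrite EK2 divr_gt0 ?expR_gt0.
have K3p : 0 < K3.
  have c2 : 0 < 4 / c ^+ 2 by rewrite divr_gt0 ?exprn_gt0.
  have C3 : 0 < 3 * C ^+ 2 by rewrite mulr_gt0 ?exprn_gt0.
  have C2 : 0 < K2 + 2 * C by rewrite addr_gt0 // mulr_gt0.
  by rewrite EK3 addr_gt0 // ?divr_gt0 // mulr_gt0 // mulr_gt0.
(* A sum of thresholds: the constants with 300 serve the two parts of the off-diagonal integral, 100
   [K1] serves the integral of W. *)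
have [Y [Y1 Y2 Y3 Y4 [Y5 Y6]]] : exists Y : R, [/\ 1 <= Y, ka <= Y, ka / c <= Y, 20 * (300 * ka) / c <= Y &
    300 * C <= Y /\ 100 * K1 <= Y].
  have k1 : 0 <= ka / c by rewrite ltW // divr_gt0.
  have k6 : 0 <= 20 * (300 * ka) / c by apply: divr_ge0 (ltW c0); apply: mulr_ge0 (ler0n _ _) (mulr_ge0 (ltW p300) (ltW kp)).
  have k3 : 0 <= 300 * C by rewrite mulr_ge0 ?(ltW p300) // ltW.
  have k4 : 0 <= 100 * K1 by rewrite mulr_ge0 ?ler0n // ltW.
  exists (1 + ka + ka / c + 20 * (300 * ka) / c + 300 * C + 100 * K1).
  move: (ka / c) (20 * (300 * ka) / c) (300 * C) (100 * K1) k1 k6 k3 k4 kp => A1 A2 A3 A4 *.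
  by split; [lra|lra|lra|lra|split; lra].
exists Y, (1 + K2 + K3); split => //; first by lra.
move=> lam be h k sg y x0 xp a Vo m HW Ey Yy kC /andP[m0 m1] Hm HVo.
have D := HD _ _ _ _ _ _ _ _ _ c0 c1 C1 HW Ey (le_trans Y3 Yy).
have [hl h0 k0 s0 sk H1 H2 H4 H5] := HW.
have y1 : 1 <= y by exact: le_trans Y1 Yy.
have y0 : 0 < y by exact: lt_le_trans y1.
have y2 : 1 <= y ^+ 2 by exact: exprn_ege1.
have Es : sg = ka * k / y by rewrite -Ey mulfK // gt_eqF.
have sgk : sg <= c * k.
  rewrite Es ler_pdivrMr // mulrC [leRHS]mulrAC [leRHS]mulrC ler_pM2l // mulrC -ler_pdivrMr //.
  exact: le_trans Yy.
have sgk1 : sg <= k by apply: le_trans sgk _; rewrite ler_piMl // ltW.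
have V0 : 0 <= vol lam x0 a.
  apply: (vol_ge0 hl); case/andP: H4 => H4 _; case/andP: H5 => H5 _.
  by have := mulr_ge0 (ltW c0) (ltW k0); move: H4 H5 c0; clear => *; lra.
have Wa := wt_gt0 lam a.
set V := vol lam x0 a in D V0 *; set w := wt lam a in Wa HVo D Hm *.
have Vp : 0 < V by rewrite -(pmulr_lgt0 _ Wa); apply: lt_le_trans D; rewrite mulr_gt0.
have kyw : 0 < k * y * w by rewrite !mulr_gt0.
have Vo0 : 0 < Vo by apply: lt_le_trans HVo.
have VV1 : k * y * (V * w) <= V * Vo by rewrite mulrCA; exact: ler_wpM2l.
have VV2 : (k * y) ^+ 2 <= V * Vo.
  by apply: le_trans VV1; rewrite expr2 ler_wpM2l // mulr_ge0 // ltW.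
have m1' : sg ^+ 2 / c / wt lam xp <= K2 * sg * V.
  have A1 : expR (- C) * sg / wt lam xp <= vol lam x0 a by exact: (vol_lower hl h0 s0 sk c0 C1 sgk H2 H4 H5).
  have cs : 0 <= K2 * sg by rewrite mulr_ge0 ?ler0n // ltW.
  have := ler_wpM2l cs A1; rewrite -/V => /(le_trans _); apply.
  have e0 : expR C != 0 by rewrite gt_eqF // expR_gt0.
  have w0 : wt lam xp != 0 by rewrite gt_eqF // wt_gt0.
  have c0' : c != 0 by rewrite gt_eqF.
  rewrite EK2 expRN le_eqVlt; apply/orP; left; apply/eqP.
  by move: (wt lam xp) (expR C) w0 e0 => t e t0 e0; field; rewrite t0 e0 c0'.
have m2 : integ (fun x => `|x - xp| * (wt lam x)^-1) x0 a <= K2 * sg * V.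
  exact: le_trans (half_first_moment hl h0 k0 s0 sk c0 H1 H2 H4 H5) _.
have sV : 0 <= sg * V by rewrite mulr_ge0 ?ler0n // ltW.
split.
- apply: le_trans (half_off_diagonal hl h0 k0 s0 sk c0 c1 H1 H2 H4 H5) _; rewrite -/V -/w.
  have T2 : C * k * w * V <= V * Vo / 300.
    rewrite ler_pdivlMr ?p300 //; apply: le_trans VV1.
    have : 300 * C * (k * (V * w)) <= y * (k * (V * w)) by rewrite ler_wpM2r ?mulr_ge0 ?(ltW k0) ?(ltW Wa) //; exact: le_trans Yy.
    by clear => *; lra.
  have T1 : 16 / c * sg * k + 4 / c * sg ^+ 2 <= V * Vo / 300.
    rewrite ler_pdivlMr ?p300 //; apply: le_trans VV2.
    have S : sg ^+ 2 <= sg * k by rewrite expr2 ler_wpM2l // ltW.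
    have c4 : 0 <= 4 / c by rewrite divr_ge0 // ltW.
    have := ler_wpM2l c4 S => S'.
    apply: (@le_trans _ _ (20 * (300 / c) * (sg * k))).
      have E : 20 / c * (sg * k) = 16 / c * sg * k + 4 / c * (sg * k) by field; rewrite gt_eqF.
      by move: S' E; move: (20 / c) => q; clear => *; lra.
    rewrite Es (_ : 20 * (300 / c) * (ka * k / y * k) = k ^+ 2 * (20 * (300 * ka) / c / y)); last by field; rewrite !gt_eqF.
    rewrite exprMn ler_wpM2l ?sqr_ge0 // ler_pdivrMr //.
    apply: (@le_trans _ _ y); first exact: le_trans Yy.
    by rewrite ler_peMl ?(ltW y0).
  have VVo : 0 < V * Vo by rewrite mulr_gt0.
  by move: T1 T2 VVo; clear => *; lra.
- have := ler_wpM2l (ltW m0) (half_wt_integral hl h0 k0 c0 c1 C1 H1 H2 H4 H5) => /le_trans; apply.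
  rewrite -/w mulrDr (_ : m * (10 * C / c ^+ 4 * h * wt lam x0) = 10 * C / c ^+ 4 * h * w); last by rewrite -Hm; ring.
  have hk : h <= ka ^+ 2 * C ^+ 2 * k.
    rewrite -sk Es ler_wpM2r ?(ltW k0) // exprMn exprVn ler_pdivrMr ?exprn_gt0 // exprMn.
    apply: (@le_trans _ _ (ka ^+ 2 * C ^+ 2)).
      by rewrite ler_wpM2l ?sqr_ge0 // lerXn2r // ?nnegrE ltW.
    by rewrite ler_peMr // mulr_ge0 // sqr_ge0.
  have B1 : 10 * C / c ^+ 4 * h * w <= 10 * C ^+ 3 * ka ^+ 2 / c ^+ 4 * (k * w).
    rewrite mulrA ler_wpM2r ?(ltW Wa) //.
    have cc : 0 <= 10 * C / c ^+ 4 by rewrite divr_ge0 ?mulr_ge0 ?exprn_ge0 // ltW.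
    apply: le_trans (ler_wpM2l cc hk) _.
    by rewrite le_eqVlt; apply/orP; left; apply/eqP; field; rewrite gt_eqF.
  have B2 : m * (C * k * w) <= C * (k * w) by rewrite [leRHS]mulrA ler_piMl // !mulr_ge0 // ltW.
  have B3 : 100 * K1 * (k * w) <= Vo.
    apply: le_trans HVo; rewrite (_ : k * y * w = y * (k * w)); last by ring.
    rewrite ler_wpM2r ?mulr_ge0 ?(ltW k0) ?(ltW Wa) //; exact: le_trans Yy.
  by move: B1 B2 B3; rewrite EK1; clear => *; lra.
- apply: le_trans m2 _; rewrite -!mulrA ler_wpM2r //.
  by move: K3p; clear => *; lra.
have D0 : 0 <= 2 * C * k by rewrite !mulr_ge0 // ltW.
apply: le_trans (half_tail hl h0 k0 s0 sk c0 c1 C1 H1 H2 H4 H5 D0) _; rewrite -/V -/w.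
have V2Vo : 0 <= sg * (V ^+ 2 * Vo) by rewrite !mulr_ge0 ?sqr_ge0 // ltW.
have E1 : sg ^+ 2 * k * V <= ka * (sg * (V ^+ 2 * Vo)).
  rewrite (_ : sg ^+ 2 * k * V = sg * V * ka * (k ^+ 2 / y)); last by rewrite expr2 {1}Es; field; rewrite gt_eqF.
  rewrite (_ : ka * (sg * (V ^+ 2 * Vo)) = sg * V * ka * (V * Vo)); last by ring.
  apply: ler_wpM2l; first exact: mulr_ge0 sV (ltW kp).
  apply: le_trans VV2.
  rewrite exprMn ler_wpM2l ?sqr_ge0 // (@le_trans _ _ 1) //.
  by rewrite invf_le1.
have E2 : k ^+ 2 * (w * V ^+ 2) <= ka^-1 * (sg * (V ^+ 2 * Vo)).
  have Ek : k = ka^-1 * sg * y by rewrite -mulrA Ey mulKf // gt_eqF.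
  rewrite expr2 {1}Ek (_ : ka^-1 * sg * y * k * (w * V ^+ 2) = ka^-1 * sg * V ^+ 2 * (k * y * w)); last by ring.
  rewrite (_ : ka^-1 * (sg * (V ^+ 2 * Vo)) = ka^-1 * sg * V ^+ 2 * Vo); last by ring.
  by rewrite ler_wpM2l // !mulr_ge0 ?invr_ge0 ?(ltW kp) ?(ltW s0) ?sqr_ge0.
have E3 : sg ^+ 2 / c / wt lam xp + 2 * C * k * V <= (K2 + 2 * C) * (k * V).
  have : K2 * (sg * V) <= K2 * (k * V) by rewrite ler_wpM2l ?(ltW K2p) // ler_wpM2r.
  by move: m1'; clear => *; lra.
have cs : 0 <= 4 / c ^+ 2 * sg ^+ 2 by rewrite mulr_ge0 ?sqr_ge0 // divr_ge0 // sqr_ge0.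
have F1 := ler_wpM2l cs E3.
have cK : 0 <= 4 / c ^+ 2 * (K2 + 2 * C).
  by rewrite mulr_ge0 ?divr_ge0 ?sqr_ge0 // addr_ge0 ?mulr_ge0 // ltW.
have F2 := ler_wpM2l cK E1.
have F3 : 4 / c ^+ 2 * sg ^+ 2 * ((K2 + 2 * C) * (k * V)) = 4 / c ^+ 2 * (K2 + 2 * C) * (sg ^+ 2 * k * V) by ring.
have C3 : 0 <= 3 * C ^+ 2 by rewrite mulr_ge0 ?sqr_ge0.
have F4 := ler_wpM2l C3 E2.
have F5 : C * k * ((C * k + 2 * C * k) * (w * V ^+ 2)) = 3 * C ^+ 2 * (k ^+ 2 * (w * V ^+ 2)) by ring.
have F6 : 0 <= (1 + K2) * (sg * (V ^+ 2 * Vo)) by rewrite mulr_ge0 // addr_ge0 // ltW.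
rewrite F5; apply: (@le_trans _ _ (K3 * (sg * (V ^+ 2 * Vo)))); last first.
  by move: F6; clear => *; lra.
by move: F1 F2 F3 F4; rewrite EK3; clear => *; lra.
Qed.

End HalfSummary.

(** * Reflection of the line, which exchanges the two halves of the well *)

Section Reflection.
Variable R : realType.

Lemma prim_reflect (F f : R -> R) : primitive F f -> primitive (fun y => - F (- y)) (fun y => f (- y)).
Proof.
move=> HF; apply: prim_eq (primN (prim_comp HF (primN (@prim_id R)))) _ => x /=; ring.
Qed.

Lemma cont_reflect (f : R -> R) : continuous f -> continuous (fun y => f (- y)).
Proof.
by move=> cf x; apply: (@continuous_comp _ _ _ (fun y : R => - y) f); [exact: opp_continuous|exact: cf].
Qed.

Lemma integ_reflect (f : R -> R) (a b : R) : continuous f ->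
  integ (fun y => f (- y)) (- b) (- a) = integ f a b.
Proof.
move=> cf; have HF := prim_integ a cf.
rewrite (integ_prim _ _ (cont_reflect cf) (prim_reflect HF)) (integ_prim _ _ cf HF) !opprK; ring.
Qed.

(** The map x -> -x together with W -> 1 / W exchanges p and q, so estimates of p on the left half
    become estimates of q on the right half. *)
Lemma sol_reflect (s : R) (W p q : R -> R) : sol s W p q ->
  sol s (fun y => (W (- y))^-1) (fun y => q (- y)) (fun y => p (- y)).
Proof.
move=> [hp hq]; split.
  rewrite (_ : (fun y => q (- y)) = fun y => - - q (- y)); last by apply/funext => x; rewrite opprK.
  by apply: prim_eq (primN (prim_reflect hq)) _ => x /=; ring.
rewrite (_ : (fun y => p (- y)) = fun y => - - p (- y)); last by apply/funext => x; rewrite opprK.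
by apply: prim_eq (primN (prim_reflect hp)) _ => x /=; rewrite invrK; ring.
Qed.

Definition reflect_fun (f : R -> R) (y : R) := - f (- y).

Lemma wt_reflect lam y : wt (reflect_fun lam) y = (wt lam (- y))^-1.
Proof. by rewrite /wt /reflect_fun -expRN mulrN. Qed.

End Reflection.

(** * Amplitudes and moments on one half, given the amplitude on the other *)

Section Coupling.
Variable R : realType.

Section OneHalf.
Variables (W : R -> R) (s x0 a m Vo : R).
Hypotheses (W0 : forall x, 0 < W x) (cW : continuous W) (s0 : 0 <= s) (xa : x0 <= a).
Notation V := (integ (fun t => (W t)^-1) x0).
Hypotheses (HO : integ (fun x => W x * V x) x0 a <= V a * Vo / 100)
  (HJ : m * integ W x0 a <= Vo / 100) (HV : s ^+ 2 * (V a * Vo) <= 4) (m0 : 0 <= m).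
Variables (p1 q1 p2 q2 : R -> R) (B : R).
Hypotheses (hs1 : sol s W p1 q1) (hs2 : sol s W p2 q2) (B0 : 0 <= B)
  (hq : nrm (q1 x0) (q2 x0) <= m * B).
Notation A := (nrm (p1 x0) (p2 x0)).

Let A0 : 0 <= A. Proof. exact: nrm_ge0. Qed.

(** [half_pair] with entry value m B for q: by [HJ] its contribution to p is at most s Vo B /
    100. *)
Lemma half_coupled x : x0 <= x <= a ->
  nrm (p1 x - p1 x0) (p2 x - p2 x0) <= A / 24 + 25 / 24 * (s * Vo * B / 100) /\
  nrm (q1 x) (q2 x) <= m * B + s * (25 / 24 * (A + s * Vo * B / 100)) * V x.
Proof.
move=> xx; apply: (half_pair W0 cW s0 xa hs1 hs2 _ (lexx _) hq _ xx).
  by have := ler_wpM2l (sqr_ge0 s) HO; have := HV; lra.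
by have := ler_wpM2l (mulr_ge0 s0 B0) HJ; lra.
Qed.
Hypothesis hA : B <= 7 / 6 * (s * V a * A).

(** With B <= 7/6 s V A, the feedback s Vo B / 100 is at most 7/150 A because s^2 V Vo <= 4, and
    1/24 + 25/24 * 7/150 is less than 1/10. *)
Lemma half_amplitude x : x0 <= x <= a ->
  9 / 10 * A <= nrm (p1 x) (p2 x) <= 11 / 10 * A /\
  nrm (q1 x) (q2 x) <= m * B + s * (11 / 10 * A) * V x.
Proof.
move=> xx; have [H1 H2] := half_coupled xx; have A0' := A0; have B0' := B0; have hA' := hA; have HV' := HV.
have Vx : 0 <= V x.
  apply: integ_ge0; first by move=> t; apply: cvgV; [rewrite gt_eqF|exact: cW].
    by case/andP: xx.
  by move=> t _; rewrite invr_ge0 ltW.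
have Va : 0 <= V a.
  apply: integ_ge0 => //; first by move=> t; apply: cvgV; [rewrite gt_eqF|exact: cW].
  by move=> t _; rewrite invr_ge0 ltW.
have E : s * Vo * B / 100 <= 7 / 150 * A.
  have [Vo0|Vo0] := leP 0 Vo.
    have := ler_wpM2l (mulr_ge0 s0 Vo0) hA; have := ler_wpM2r A0 HV; lra.
  have : s * Vo * B <= 0.
    by rewrite -mulrA mulr_ge0_le0 // mulr_le0_ge0 // ltW.
  lra.
have N1 := nrmD (p1 x - p1 x0) (p2 x - p2 x0) (p1 x0) (p2 x0); rewrite !subrK in N1.
have N2 := nrmD (p1 x) (p2 x) (- (p1 x - p1 x0)) (- (p2 x - p2 x0)); rewrite nrmN !subKr in N2.
split; first by apply/andP; split; lra.
have sV : 0 <= s * V x by rewrite mulr_ge0.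
have := ler_wpM2l sV (_ : 25 / 24 * (A + s * Vo * B / 100) <= 11 / 10 * A); lra.
Qed.

Let cV : continuous (fun t => (W t)^-1).
Proof. by move=> x; apply: cvgV; [rewrite gt_eqF|exact: cW]. Qed.

Let cp : continuous (fun x => nrm (p1 x) (p2 x) ^+ 2).
Proof.
have [h1 _] := hs1; have [h2 _] := hs2.
have c := nrm_cont (prim_continuous h1) (prim_continuous h2).
by rewrite (_ : (fun x => _) = fun x => nrm (p1 x) (p2 x) * nrm (p1 x) (p2 x)); [exact: mul_cont|apply/funext => x; rewrite expr2].
Qed.

Let cq : continuous (fun x => nrm (q1 x) (q2 x) ^+ 2).
Proof.
have [_ h1] := hs1; have [_ h2] := hs2.
have c := nrm_cont (prim_continuous h1) (prim_continuous h2).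
by rewrite (_ : (fun x => _) = fun x => nrm (q1 x) (q2 x) * nrm (q1 x) (q2 x)); [exact: mul_cont|apply/funext => x; rewrite expr2].
Qed.

Lemma half_norm_lower : 81 / 100 * A ^+ 2 * V a <= integ (fun x => nrm (p1 x) (p2 x) ^+ 2 * (W x)^-1) x0 a.
Proof.
rewrite -integZ //; apply: integ_le => //.
- by move=> x; apply: cvgMl_tmp; exact: cV.
- exact: mul_cont cp cV.
move=> x /half_amplitude[/andP[H _] _]; rewrite ler_wpM2r ?invr_ge0 ?(ltW (W0 _)) //.
rewrite (_ : 81 / 100 * A ^+ 2 = (9 / 10 * A) ^+ 2); last by field.
by rewrite ler_sqr ?nnegrE ?nrm_ge0 // mulr_ge0.
Qed.

Lemma half_moment_p (w : R -> R) (K : R) : continuous w -> (forall x, 0 <= w x) ->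
  A ^+ 2 * V a <= 5 / 4 -> 0 <= K -> integ (fun x => w x * (W x)^-1) x0 a <= K * V a ->
  integ (fun x => w x * (nrm (p1 x) (p2 x) ^+ 2 * (W x)^-1)) x0 a <= 2 * K.
Proof.
move=> cw w0 AV K0 HK.
have cwV := mul_cont cw cV.
have cA : continuous (fun x => 121 / 100 * A ^+ 2 * (w x * (W x)^-1)).
  by move=> x; apply: cvgMl_tmp; exact: cwV.
apply: le_trans (integ_le (mul_cont cw (mul_cont cp cV)) cA xa _) _.
  move=> x /half_amplitude[/andP[_ H] _].
  rewrite [leRHS]mulrCA ler_wpM2l // ler_wpM2r ?invr_ge0 ?(ltW (W0 _)) //.
  rewrite (_ : 121 / 100 * A ^+ 2 = (11 / 10 * A) ^+ 2); last by field.
  by rewrite ler_sqr ?nnegrE ?nrm_ge0 // mulr_ge0.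
rewrite integZ //; have := ler_wpM2l (sqr_ge0 A) HK; have := ler_wpM2l K0 AV; lra.
Qed.

(** The square of |q| splits into the entry value m B, weighted by the supremum [L] of [w], and the
    growth along V, weighted by the majorant [w'] for which a tail bound is available. *)
Lemma half_moment_q (w w' : R -> R) (K L sg : R) : continuous w -> continuous w' -> (forall x, 0 <= w x) ->
  (forall x, x0 <= x <= a -> w x <= L) -> (forall x, x0 <= x <= a -> w x <= w' x) ->
  A ^+ 2 * V a <= 5 / 4 -> B ^+ 2 * Vo <= 5 / 4 -> 0 <= K -> 0 <= L -> m <= sg ->
  integ (fun x => w' x * (W x * V x ^+ 2)) x0 a <= K * sg * (V a ^+ 2 * Vo) ->
  integ (fun x => w x * (nrm (q1 x) (q2 x) ^+ 2 * W x)) x0 a <= (L + 13 * K) * sg.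
Proof.
move=> cw cw' w0 wL ww' AV BV K0 L0 msg HT.
have sg0 : 0 <= sg by exact: le_trans msg.
have cVx : continuous V := prim_continuous (prim_integ x0 cV).
have cV2 : continuous (fun x => V x ^+ 2).
  rewrite (_ : (fun x => V x ^+ 2) = (fun x => V x * V x)); first exact: mul_cont.
  by apply/funext => x; rewrite expr2.
have cT : continuous (fun x => w' x * (W x * V x ^+ 2)) by exact: mul_cont cw' (mul_cont cW cV2).
have cU : continuous (fun x => 2 * L * (m * B) ^+ 2 * W x) by move=> x; apply: cvgMl_tmp; exact: cW.
have cT' : continuous (fun x => 2 * (s * (11 / 10 * A)) ^+ 2 * (w' x * (W x * V x ^+ 2))).
  by move=> x; apply: cvgMl_tmp; exact: cT.
have cUT : continuous (fun x => 2 * L * (m * B) ^+ 2 * W x + 2 * (s * (11 / 10 * A)) ^+ 2 * (w' x * (W x * V x ^+ 2))).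
  by move=> x; apply: cvgD; [exact: cU|exact: cT'].
apply: le_trans (integ_le (mul_cont cw (mul_cont cq cW)) cUT xa _) _.
  move=> x xx; have [_ H] := half_amplitude xx.
  have Vx : 0 <= V x.
    by case/andP: (xx) => x0x _; apply: integ_ge0 => // t _; rewrite invr_ge0 ltW.
  set b := m * B in H *; set d := s * (11 / 10 * A) in H *.
  have b0 : 0 <= b by rewrite mulr_ge0.
  have d0 : 0 <= d by rewrite !mulr_ge0.
  have Wx := W0 x.
  have Q : nrm (q1 x) (q2 x) ^+ 2 <= 2 * b ^+ 2 + 2 * (d ^+ 2 * V x ^+ 2).
    apply: (@le_trans _ _ ((b + d * V x) ^+ 2)).
      by rewrite ler_sqr ?nnegrE ?nrm_ge0 // addr_ge0 // mulr_ge0.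
    have := sqr_ge0 (b - d * V x); rewrite sqrrB sqrrD exprMn; lra.
  have wW : 0 <= w x * W x by rewrite mulr_ge0 ?(ltW Wx).
  have E1 := ler_wpM2l wW Q.
  have E2 : w x * (W x * b ^+ 2) <= L * (W x * b ^+ 2) by rewrite ler_wpM2r ?wL // mulr_ge0 ?sqr_ge0 // ltW.
  have E3 : w x * (W x * (d ^+ 2 * V x ^+ 2)) <= w' x * (W x * (d ^+ 2 * V x ^+ 2)).
    by rewrite ler_wpM2r ?ww' // mulr_ge0 ?(ltW Wx) // mulr_ge0 ?sqr_ge0.
  lra.
rewrite integD // !integZ //.
have T1 : 2 * L * (m * B) ^+ 2 * integ W x0 a <= L * sg.
  have E := ler_wpM2l (mulr_ge0 (mulr_ge0 L0 m0) (sqr_ge0 B)) HJ.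
  have E2 := ler_wpM2l (mulr_ge0 L0 m0) BV.
  have E3 := ler_wpM2l L0 msg.
  rewrite exprMn expr2; have := mulr_ge0 L0 m0; lra.
have T2 : 2 * (s * (11 / 10 * A)) ^+ 2 * integ (fun x => w' x * (W x * V x ^+ 2)) x0 a <= 13 * K * sg.
  have d0 : 0 <= 2 * (s * (11 / 10 * A)) ^+ 2 by rewrite mulr_ge0 // sqr_ge0.
  apply: le_trans (ler_wpM2l d0 HT) _.
  have KA : 0 <= K * sg * (A ^+ 2 * V a).
    rewrite mulr_ge0 ?mulr_ge0 ?sqr_ge0 //; apply: integ_ge0 => // t _; by rewrite invr_ge0 ltW.
  have E1 := ler_wpM2l KA HV.
  have E2 := ler_wpM2l (mulr_ge0 K0 sg0) AV.
  (* The constant 13 arises here: 2 (11/10)^2 = 242/100, and 242/100 * 4 * 5/4 is less than 13. *)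
  rewrite (_ : 2 * (s * (11 / 10 * A)) ^+ 2 * (K * sg * (V a ^+ 2 * Vo)) =
    242 / 100 * (K * sg * (A ^+ 2 * V a) * (s ^+ 2 * (V a * Vo)))); last by field.
  have := mulr_ge0 K0 sg0; lra.
lra.
Qed.

End OneHalf.

End Coupling.

(** * The double well and its lowest Floquet eigenvalue *)

Section DoubleWell.
Variable R : realType.

(* The window [x0, xe] is one period; its ends are placed so that the weight drops by
   the same factor [m] on both sides, which makes [m ^ 2] the Floquet factor of the weight. *)
Record double_well (lam be : R -> R) (h k sg c C x0 xp a xm xe m : R) : Prop := DoubleWell {
  dw_left : half_well lam be h k sg c C x0 xp a;
  dw_right : half_well (reflect_fun lam) (fun y => be (- y)) h k sg c C (- xe) (- xm) (- a);
  dw_width : k <= C;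
  dw_m : 0 < m; dw_msg : m <= sg; dw_small : m <= 100^-1;
  dw_entry : m * wt lam x0 = wt lam a;
  dw_exit : wt lam xe = m * wt lam a }.

Lemma double_well_reflect lam be h k sg c C x0 xp a xm xe m :
  double_well lam be h k sg c C x0 xp a xm xe m ->
  double_well (reflect_fun lam) (fun y => be (- y)) h k sg c C (- xe) (- xm) (- a) (- xp) (- x0) m.
Proof.
move=> [l r kC m0 ms m1 e1 e2].
have E : (fun y => be (- - y)) = be by apply/funext => y; rewrite opprK.
have E' : reflect_fun (reflect_fun lam) = lam by apply/funext => y; rewrite /reflect_fun !opprK.
have wa := wt_gt0 lam a; have w0 := wt_gt0 lam x0; have we := wt_gt0 lam xe.
split; [exact: r|by rewrite !opprK E E'|exact: kC|exact: m0|exact: ms|exact: m1|..];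
  rewrite !wt_reflect !opprK.
  by rewrite e2; field; rewrite !gt_eqF.
by rewrite -e1; field; rewrite !gt_eqF.
Qed.

(** Reflection inverts the weight, so the depth of the reflected half is exactly the lower bound on
    [Vo] that [half_summary] requires. *)
Lemma double_well_bounds (c C : R) : 0 < c -> c <= 1 -> 1 <= C ->
  exists Y K : R, [/\ 1 <= Y, 1 <= K &
  forall lam be h k sg y x0 xp a xm xe m,
  double_well lam be h k sg c C x0 xp a xm xe m -> sg * y = kap c C * k -> Y <= y ->
  let V := vol lam x0 a in let Vo := vol (reflect_fun lam) (- xe) (- a) in
  [/\ 0 < V, 0 < Vo,
      integ (fun x => wt lam x * vol lam x0 x) x0 a <= V * Vo / 100,
      m * integ (wt lam) x0 a <= Vo / 100 &
      integ (fun x => `|x - xp| * (wt lam x)^-1) x0 a <= K * sg * V /\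
      integ (fun x => (`|x - xp| + 2 * C * k) * (wt lam x * vol lam x0 x ^+ 2)) x0 a
        <= K * sg * (V ^+ 2 * Vo)]].
Proof.
move=> c0 c1 C1; have [Y [K [Y1 K1 Y2 Y3 H]]] := half_summary c0 c1 C1.
exists Y, K; split => // lam be h k sg y x0 xp a xm xe m D Ey Yy V Vo.
have [l r kC m0 ms m1 e1 e2] := D.
have yk : kap c C / c <= y by exact: le_trans Yy.
have Dl := half_depth c0 c1 C1 l Ey yk.
have Dr := half_depth c0 c1 C1 r Ey yk.
have wa := wt_gt0 lam a.
have HVo : k * y * wt lam a <= Vo.
  by move: Dr; rewrite wt_reflect opprK ler_pdivlMr.
have ky : 0 < k * y by rewrite mulr_gt0 ?(lt_le_trans ltr01 (le_trans Y1 Yy)) //; case: l.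
have V0 : 0 < V by rewrite -(pmulr_lgt0 _ wa); exact: lt_le_trans Dl.
have Vo0 : 0 < Vo by apply: lt_le_trans HVo; rewrite mulr_gt0.
have m01 : 0 < m <= 1.
  by rewrite m0 (le_trans m1) // invf_le1 ?ler1n // ltr0n.
by have [B1 B2 B3 B4] := H _ _ _ _ _ _ _ _ _ _ _ l Ey Yy kC m01 e1 HVo; split.
Qed.

(** [n] is the size of q at the bottom, computed from the left, and [d] its variation on the right
    half. The coefficients of B on the right add up to 1/100 + 1/24 + 1/24, and 25/24 * 101/100
    divided by what remains on the left is below 7/6. *)
Lemma pair_balance (s V Vo A B m : R) : 0 <= s -> 0 <= V -> 0 <= Vo -> 0 <= A -> 0 <= B -> 0 <= m <= 100^-1 ->
  s ^+ 2 * (V * Vo) <= 4 -> forall n d : R,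
  n <= m * B + s * (25 / 24 * (A + s * Vo * B / 100)) * V ->
  d <= B / 24 + 25 / 24 * (s * V * A / 100) -> B <= n + d -> B <= 7 / 6 * (s * V * A).
Proof.
move=> s0 V0 Vo0 A0 B0 /andP[m0 m1] HV n d Hn Hd Hnd.
have E := ler_wpM2l B0 HV; have mB := ler_wpM2r B0 m1.
have sVA : 0 <= s * V * A by rewrite !mulr_ge0.
have Hn' : n <= m * B + 25 / 24 * (s * V * A) + 25 / 2400 * (B * (s ^+ 2 * (V * Vo))).
  by apply: le_trans Hn _; rewrite le_eqVlt; apply/orP; left; apply/eqP; field.
move: (B * (s ^+ 2 * (V * Vo))) E Hn' => X E Hn'.
lra.
Qed.

(* |e|^2 = |p|^2 / W and |f|^2 = |q|^2 W for the functions of [e_of], [f_of]. *)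
Lemma pair_concentration (c C : R) : 0 < c -> c <= 1 -> 1 <= C -> exists Y K : R, [/\ 1 <= Y, 0 < K &
  forall lam be h k sg y x0 xp a xm xe m (s : R) p1 q1 p2 q2,
  double_well lam be h k sg c C x0 xp a xm xe m -> sg * y = kap c C * k -> Y <= y ->
  0 <= s -> s ^+ 2 * (vol lam x0 a * vol (reflect_fun lam) (- xe) (- a)) <= 4 ->
  sol s (wt lam) p1 q1 -> sol s (wt lam) p2 q2 ->
  nrm (p1 xe) (p2 xe) = m * nrm (p1 x0) (p2 x0) ->
  nrm (q1 x0) (q2 x0) = m * nrm (q1 xe) (q2 xe) ->
  integ (fun x => nrm (p1 x) (p2 x) ^+ 2 * (wt lam x)^-1) x0 xe = 1 ->
  integ (fun x => nrm (q1 x) (q2 x) ^+ 2 * wt lam x) x0 xe = 1 ->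
  [/\ 0 < s,
      integ (fun x => `|x - xp| * (nrm (p1 x) (p2 x) ^+ 2 * (wt lam x)^-1)) x0 xe <= K * sg,
      integ (fun x => `|x - xm| * (nrm (q1 x) (q2 x) ^+ 2 * wt lam x)) x0 xe <= K * sg &
      nrm (p1 x0) (p2 x0) * nrm (q1 x0) (q2 x0) <= K * s * sg]].
Proof.
move=> c0 c1 C1; have [Y [K [Y1 K1 HB]]] := double_well_bounds c0 c1 C1.
have C0 : 0 < C by exact: lt_le_trans C1.
have K0 : 0 <= K by exact: le_trans K1.
have L0 : 0 <= C + 2 * C ^+ 2 by rewrite addr_ge0 ?mulr_ge0 ?sqr_ge0 // ltW.
(* [C + 2 * C ^+ 2] bounds the distance to the far peak: |x - xm| on the left half, |x - xp| on the
   right half. *)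
exists Y, (2 * K + (C + 2 * C ^+ 2) + 13 * K); split => //; first by lra.
move=> lam be h k sg y x0 xp a xm xe m s p1 q1 p2 q2 D Ey Yy s0 HV hs1 hs2 fp fq np nq.
have D' := double_well_reflect D.
have [V0 Vo0 O1 J1 [M1 T1]] := HB _ _ _ _ _ _ _ _ _ _ _ _ D Ey Yy.
have [_ _ O2 J2 [M2 T2]] := HB _ _ _ _ _ _ _ _ _ _ _ _ D' Ey Yy.
have E' : reflect_fun (reflect_fun lam) = lam by apply/funext => t; rewrite /reflect_fun !opprK.
have EV : vol (reflect_fun (reflect_fun lam)) (- - x0) (- - a) = vol lam x0 a by rewrite E' !opprK.
rewrite EV in O2 J2 T2.
set V := vol lam x0 a in HV V0 O1 J1 M1 T1 O2 J2 M2 T2 *.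
set Vo := vol (reflect_fun lam) (- xe) (- a) in HV Vo0 O1 J1 M1 T1 O2 J2 M2 T2 *.
have [[hl h0 k0 sg0 sk H1 H2 H4 H5] [hl' _ _ _ _ H1' H2' H4' H5'] kC m0 ms m1 e1 e2] := D.
have W0 := wt_gt0 lam; have W0' := wt_gt0 (reflect_fun lam).
have cW := wt_cont hl; have cW' := wt_cont hl'.
have xa : x0 <= a by case/andP: H4; case/andP: H5; have := mulr_ge0 (ltW c0) (ltW k0); move: c0; clear => *; lra.
have xa' : - xe <= - a by case/andP: H4'; case/andP: H5'; have := mulr_ge0 (ltW c0) (ltW k0); move: c0; clear => *; lra.
have ae : a <= xe by rewrite -lerN2.
have Wr t : (wt lam (- t))^-1 = wt (reflect_fun lam) t by rewrite wt_reflect.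
have Wr' t : (wt (reflect_fun lam) t)^-1 = wt lam (- t) by rewrite wt_reflect invrK.
have rs1 : sol s (wt (reflect_fun lam)) (fun t => q1 (- t)) (fun t => p1 (- t)).
  have := sol_reflect hs1; congr (sol s _ _ _); apply/funext => t; exact: Wr.
have rs2 : sol s (wt (reflect_fun lam)) (fun t => q2 (- t)) (fun t => p2 (- t)).
  have := sol_reflect hs2; congr (sol s _ _ _); apply/funext => t; exact: Wr.
set A := nrm (p1 x0) (p2 x0) in fp *; set B := nrm (q1 xe) (q2 xe) in fq *.
have A0 : 0 <= A by exact: nrm_ge0.
have B0 : 0 <= B by exact: nrm_ge0.
have hq : nrm (q1 x0) (q2 x0) <= m * B by rewrite fq.
have hq' : nrm (p1 (- - xe)) (p2 (- - xe)) <= m * A by rewrite opprK fp.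
have HV' : s ^+ 2 * (Vo * V) <= 4 by rewrite (mulrC Vo).
have m0' := ltW m0.
have m01 : 0 <= m <= 100^-1 by rewrite m0'.
have cl := half_coupled W0 cW s0 xa O1 J1 HV hs1 hs2 B0 hq.
have cr := half_coupled W0' cW' s0 xa' O2 J2 HV' rs1 rs2 A0 hq'.
have aa : x0 <= a <= a by rewrite xa lexx.
have aa' : - xe <= - a <= - a by rewrite xa' lexx.
have [l1 l2] := cl a aa; have [r1 r2] := cr (- a) aa'.
rewrite /= !opprK -/B in r1 r2; rewrite -/A in l1 l2.
(* Each amplitude is bounded by the other: comparing q at the bottom from both ends bounds B by A,
   and the same for p bounds A by B. *)
have hB : B <= 7 / 6 * (s * V * A).
  apply: (pair_balance s0 (ltW V0) (ltW Vo0) A0 B0 m01 HV l2 r1).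
  have := nrmD (q1 a) (q2 a) (- (q1 a - q1 xe)) (- (q2 a - q2 xe)); rewrite nrmN !subKr; exact.
have hA : A <= 7 / 6 * (s * Vo * B).
  apply: (pair_balance s0 (ltW Vo0) (ltW V0) B0 A0 m01 HV' r2 l1).
  have := nrmD (p1 a) (p2 a) (- (p1 a - p1 x0)) (- (p2 a - p2 x0)); rewrite nrmN !subKr; exact.
have al := half_amplitude W0 cW s0 xa O1 J1 HV hs1 hs2 B0 hq hB.
have hA' : A <= 7 / 6 * (s * Vo * nrm (q1 (- - xe)) (q2 (- - xe))) by rewrite opprK.
have ar := half_amplitude W0' cW' s0 xa' O2 J2 HV' rs1 rs2 A0 hq' hA'.
have nl := half_norm_lower W0 cW s0 xa O1 J1 HV hs1 hs2 B0 hq hB.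
have nr := half_norm_lower W0' cW' s0 xa' O2 J2 HV' rs1 rs2 A0 hq' hA'.
have [hp1 hq1] := hs1; have [hp2 hq2] := hs2.
have cp2 : continuous (fun x => nrm (p1 x) (p2 x) ^+ 2).
  have cn := nrm_cont (prim_continuous hp1) (prim_continuous hp2).
  rewrite (_ : (fun x => _) = fun x => nrm (p1 x) (p2 x) * nrm (p1 x) (p2 x)); first exact: mul_cont.
  by apply/funext => x; rewrite expr2.
have cq2 : continuous (fun x => nrm (q1 x) (q2 x) ^+ 2).
  have cn := nrm_cont (prim_continuous hq1) (prim_continuous hq2).
  rewrite (_ : (fun x => _) = fun x => nrm (q1 x) (q2 x) * nrm (q1 x) (q2 x)); first exact: mul_cont.
  by apply/funext => x; rewrite expr2.
have cWV := wtV_cont hl.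
pose e2f x := nrm (p1 x) (p2 x) ^+ 2 * (wt lam x)^-1.
pose f2f x := nrm (q1 x) (q2 x) ^+ 2 * wt lam x.
have ce : continuous e2f := mul_cont cp2 cWV.
have cf : continuous f2f := mul_cont cq2 cW.
have e0 x : 0 <= e2f x by rewrite mulr_ge0 ?sqr_ge0 // invr_ge0 ltW.
have f0 x : 0 <= f2f x by rewrite mulr_ge0 ?sqr_ge0 // ltW.
(* The left half carries at most mass 1, so 81/100 A^2 V <= 1, and 100/81 is less than 5/4. *)
have AV : A ^+ 2 * V <= 5 / 4.
  have : integ e2f a xe >= 0 by apply: integ_ge0.
  have := np; rewrite -/e2f (integ_split x0 a xe ce) => H0 H1''.
  have : 81 / 100 * A ^+ 2 * V <= integ e2f x0 a by exact: nl.
  move: H0 H1''; rewrite -mulrA; move: (A ^+ 2 * V) (integ e2f a xe) (integ e2f x0 a); clear => *; lra.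
have BV : B ^+ 2 * Vo <= 5 / 4.
  have : integ f2f x0 a >= 0 by apply: integ_ge0.
  have := nq; rewrite -/f2f (integ_split x0 a xe cf) => H0 H1''.
  have : 81 / 100 * B ^+ 2 * Vo <= integ f2f a xe.
    rewrite -(integ_reflect a xe cf); move: nr; rewrite opprK -/B.
    by congr (_ <= integ _ _ _); apply/funext => x; rewrite Wr'.
  move: H0 H1''; rewrite -mulrA; move: (B ^+ 2 * Vo) (integ f2f a xe) (integ f2f x0 a); clear => *; lra.
have cabs (b : R) : continuous (fun x => `|x - b|).
  by apply: abs_cont => x; apply: cvgB; [exact: cvg_id|exact: cvg_cst].
have cabsD (b d : R) : continuous (fun x => `|x - b| + d).
  by move=> x; apply: cvgD; [exact: cabs|exact: cvg_cst].
have Ck : C * k <= C ^+ 2 by rewrite expr2 ler_wpM2l // ltW.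
have ck0 : 0 <= c * k by rewrite mulr_ge0 // ltW.
have Dpm : 0 <= xm - xp <= 2 * C * k.
  case/andP: H4 => a1 a2; case/andP: H4' => b1 b2; move: a1 a2 b1 b2 ck0; clear => *; apply/andP; split; lra.
have Ksg : 0 <= K * sg by rewrite mulr_ge0 // ltW.
have Lsg : 0 <= (C + 2 * C ^+ 2) * sg by rewrite mulr_ge0 // ltW.
have P1 := half_moment_p W0 cW s0 xa O1 J1 HV hs1 hs2 B0 hq hB (cabs xp) (fun x => normr_ge0 _) AV Ksg M1.
have BV' : nrm (q1 (- - xe)) (q2 (- - xe)) ^+ 2 * Vo <= 5 / 4 by rewrite opprK.
have P2 := half_moment_p W0' cW' s0 xa' O2 J2 HV' rs1 rs2 A0 hq' hA' (cabs (- xm)) (fun x => normr_ge0 _) BV' Ksg M2.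
have Q1 : integ (fun x => `|x - xm| * (nrm (q1 x) (q2 x) ^+ 2 * wt lam x)) x0 a <= ((C + 2 * C ^+ 2) + 13 * K) * sg.
  apply: (half_moment_q W0 cW s0 xa O1 J1 HV m0' hs1 hs2 B0 hq hB (cabs xm) (cabsD xp (2 * C * k)) _ _ _ AV BV K0 L0 ms T1) => [x //|x /andP[x1 x2]|x /andP[x1 x2]].
    case/andP: H4 => a1 a2; case/andP: H4' => b1 b2; case/andP: H5 => d1 d2.
    rewrite ler_norml; move: a1 a2 b1 b2 ck0 d1 d2 x1 x2 Ck C0; clear => *; apply/andP; split; lra.
  have := ler_normD (x - xp) (xp - xm); rewrite subrKA => /le_trans; apply; rewrite lerD2l distrC ger0_norm; by case/andP: Dpm.
have Q2 := half_moment_q W0' cW' s0 xa' O2 J2 HV' m0' rs1 rs2 A0 hq' hA' (cabs (- xp)) (cabsD (- xm) (2 * C * k)) (fun x => normr_ge0 _) _ _ BV' AV K0 L0 ms T2.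
have {}Q2 : integ (fun x => `|x + xp| * (nrm (p1 (- x)) (p2 (- x)) ^+ 2 * wt (reflect_fun lam) x)) (- xe) (- a) <= ((C + 2 * C ^+ 2) + 13 * K) * sg.
  move: Q2; rewrite opprK; apply => x /andP[x1 x2].
    case/andP: H4 => a1 a2; case/andP: H4' => b1 b2; case/andP: H5' => d1 d2.
    rewrite ler_norml; move: a1 a2 b1 b2 ck0 d1 d2 x1 x2 Ck C0; clear => *; apply/andP; split; lra.
  have := ler_normD (x - - xm) (- xm + xp); rewrite opprK addrA addrK => /le_trans; apply.
  by rewrite lerD2l -normrN opprD opprK ger0_norm; case/andP: Dpm.
split.
(* For s = 0 both amplitudes vanish, hence p does, against the normalisation. *)
- rewrite lt_neqAle s0 andbT; apply/eqP => s00.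
  have Az : A = 0 by apply/eqP; rewrite eq_le A0 andbT (le_trans hA) // -s00 !mul0r mulr0.
  have Bz : B = 0 by apply/eqP; rewrite eq_le B0 andbT (le_trans hB) // -s00 !mul0r mulr0.
  have z x : x0 <= x <= xe -> e2f x <= 0.
    move=> /andP[x1 x2]; suff Z0 : nrm (p1 x) (p2 x) ^+ 2 = 0 :> R by rewrite /e2f Z0 mul0r.
    suff Z : nrm (p1 x) (p2 x) <= 0.
      have /eqP -> : nrm (p1 x) (p2 x) == 0 by rewrite eq_le Z nrm_ge0.
      by rewrite expr0n.
    have [xxa|/ltW axx] := leP x a.
      by have [/andP[_ H] _] := al x ltac:(by rewrite x1); move: H; rewrite -/A Az mulr0.
    have [_ H] := ar (- x) ltac:(by rewrite !lerN2 x2).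
    by move: H; rewrite !opprK -/B Az Bz !mulr0 !mul0r addr0.
  by have := integ_le_cst ce (le_trans xa ae) z; rewrite np mul0r ler10.
- rewrite (integ_split x0 a xe (mul_cont (cabs xp) ce)).
  have E : integ (fun x => `|x - xp| * e2f x) a xe <= ((C + 2 * C ^+ 2) + 13 * K) * sg.
    rewrite -(integ_reflect a xe (mul_cont (cabs xp) ce)); move: Q2.
    congr (integ _ _ _ <= _); apply/funext => x.
    by rewrite /e2f Wr -[in LHS]normrN opprD.
  have : integ (fun x => `|x - xp| * e2f x) x0 a <= 2 * (K * sg) by exact: P1.
  move: E; clear => *; lra.
- rewrite (integ_split x0 a xe (mul_cont (cabs xm) cf)).
  have E : integ (fun x => `|x - xm| * f2f x) a xe <= 2 * (K * sg).
    rewrite -(integ_reflect a xe (mul_cont (cabs xm) cf)); move: P2.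
    congr (integ _ _ _ <= _); apply/funext => x.
    by rewrite /f2f Wr' -[in LHS]normrN opprD opprK.
  have : integ (fun x => `|x - xm| * f2f x) x0 a <= ((C + 2 * C ^+ 2) + 13 * K) * sg by exact: Q1.
  move: E; clear => *; lra.
(* At the end x0 of the window the product is m A B, with A B <= 2 s and m <= sg. *)
rewrite fq.
have AB : A * B <= 2 * s.
  have := ler_wpM2l A0 hB; have := ler_wpM2l s0 AV; move: s0; clear => *; lra.
have mAB := ler_wpM2l m0' AB.
have ss := ler_wpM2r s0 ms.
have : 2 * (s * sg) <= (2 * K + (C + 2 * C ^+ 2) + 13 * K) * (s * sg).
  rewrite ler_wpM2r ?mulr_ge0 ?(ltW sg0) //; move: K1 L0; clear => *; lra.
move: mAB ss; clear => *; lra.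
Qed.

End DoubleWell.

(** * The trace of the monodromy at the threshold s^2 V Vo = 4 *)

Section Trace.
Variable R : realType.

Lemma wronskian (s : R) (W p q p' q' : R -> R) (x y : R) : sol s W p q -> sol s W p' q' ->
  p x * q' x - p' x * q x = p y * q' y - p' y * q y.
Proof.
move=> [h1 h2] [h3 h4].
have Hw : primitive (fun x => p x * q' x - p' x * q x) (fun=> 0).
  by apply: prim_eq (primB (primM h1 h4) (primM h3 h2)) _ => t /=; ring.
have := prim_unique Hw (prim_cst 0) x y; lra.
Qed.

(** As [sol_exists], but started at x0 and with continuity in s for the two entries that form the
    trace. *)
Lemma sol_from (s x0 : R) (W : R -> R) : continuous W -> (forall x, 0 < W x) ->
  exists P1 Q1 P2 Q2 : R -> R -> R,
  [/\ forall s, [/\ sol s W (P1 s) (Q1 s), P1 s x0 = 1 & Q1 s x0 = 0],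
      forall s, [/\ sol s W (P2 s) (Q2 s), P2 s x0 = 0 & Q2 s x0 = 1],
      forall x, continuous (P1 ^~ x) & forall x, continuous (Q2 ^~ x)].
Proof.
move=> cW W0.
have cV : continuous (fun x => (W x)^-1).
  by move=> x; apply: cvgV; [rewrite gt_eqF|exact: cW].
have W0' x : 0 <= W x by exact: ltW.
have V0 x : 0 <= (W x)^-1 by rewrite invr_ge0.
have [p [q [hp hq i1 c1]]] := linear_system_solution x0 cW cV W0' V0.
have [p' [q' [hp' hq' i2 c2]]] := linear_system_solution x0 cV cW V0 W0'.
exists p, q, (fun s x => - q' s x), p'; split.
- by move=> t; have [a b] := i1 t; split => //; split.
- move=> t; have [a b] := i2 t; split; rewrite ?b ?oppr0 //; split.
    by apply: prim_eq (primN (hq' t)) _ => x; ring.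
  by apply: prim_eq (hp' t) _ => x; ring.
- by move=> x; have [] := c1 x.
by move=> x; have [] := c2 x.
Qed.

(* The trace of the monodromy on [x0, xe] factors through the bottom a; the
   dominant term is (1 - s^2 V Vo) / m. *)
Lemma fundamental_trace (c C : R) : 0 < c -> c <= 1 -> 1 <= C ->
  exists2 Y : R, 1 <= Y &
  forall lam be h k sg y x0 xp a xm xe m (s : R) p1 q1 p2 q2,
  double_well lam be h k sg c C x0 xp a xm xe m -> sg * y = kap c C * k -> Y <= y ->
  0 <= s -> s ^+ 2 * (vol lam x0 a * vol (reflect_fun lam) (- xe) (- a)) = 4 ->
  sol s (wt lam) p1 q1 -> p1 x0 = 1 -> q1 x0 = 0 ->
  sol s (wt lam) p2 q2 -> p2 x0 = 0 -> q2 x0 = 1 ->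
  p1 xe / m + m * q2 xe <= - 2.
Proof.
move=> c0 c1 C1; have [Y [K [Y1 K1 HB]]] := double_well_bounds c0 c1 C1.
exists Y => // lam be h k sg y x0 xp a xm xe m s p1 q1 p2 q2 D Ey Yy s0 HV hs1 p10 q10 hs2 p20 q20.
have D' := double_well_reflect D.
have [V0 Vo0 O1 J1 _] := HB _ _ _ _ _ _ _ _ _ _ _ _ D Ey Yy.
have [_ _ O2 J2 _] := HB _ _ _ _ _ _ _ _ _ _ _ _ D' Ey Yy.
have E' : reflect_fun (reflect_fun lam) = lam by apply/funext => t; rewrite /reflect_fun !opprK.
have EV : vol (reflect_fun (reflect_fun lam)) (- - x0) (- - a) = vol lam x0 a by rewrite E' !opprK.
rewrite EV in O2 J2.
set V := vol lam x0 a in HV V0 O1 J1 O2 J2 *.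
set Vo := vol (reflect_fun lam) (- xe) (- a) in HV Vo0 O1 J1 O2 J2 *.
have [[hl h0 k0 sg0 sk H1 H2 H4 H5] [hl' _ _ _ _ H1' H2' H4' H5'] kC m0 ms m1 e1 e2] := D.
have W0 := wt_gt0 lam; have W0' := wt_gt0 (reflect_fun lam).
have cW := wt_cont hl; have cW' := wt_cont hl'.
have ck0 := mulr_ge0 (ltW c0) (ltW k0).
have xa : x0 <= a by case/andP: H4; case/andP: H5; move: c0 ck0; clear => *; lra.
have xa' : - xe <= - a by case/andP: H4'; case/andP: H5'; move: c0 ck0; clear => *; lra.
have s2 := sqr_ge0 s.
have o1 : s ^+ 2 * integ (fun x => wt lam x * vol lam x0 x) x0 a <= 25^-1.
  have := ler_wpM2l s2 O1; move: HV; rewrite -/V; clear => HV.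
  by rewrite mulrA HV => /le_trans; apply; lra.
have o2 : s ^+ 2 * integ (fun x => wt (reflect_fun lam) x * vol (reflect_fun lam) (- xe) x) (- xe) (- a) <= 25^-1.
  have := ler_wpM2l s2 O2; move: HV; rewrite -/Vo; clear => HV.
  by rewrite mulrA (mulrC Vo) HV => /le_trans; apply; lra.
have [P1 [Q1 [P2 [Q2 [Z1 Z2 _ _]]]]] := sol_from s (- xe) cW' W0'.
have [Hs1 P10 Q10] := Z1 s; have [Hs2 P20 Q20] := Z2 s.
have [L1 L2 L3 L4] := half_fundamental W0 cW s0 xa hs1 p10 q10 hs2 p20 q20 o1.
have [R1 R2 R3 R4] := half_fundamental W0' cW' s0 xa' Hs1 P10 Q10 Hs2 P20 Q20 o2.
have back P Q : sol s (wt (reflect_fun lam)) P Q -> sol s (wt lam) (fun x => Q (- x)) (fun x => P (- x)).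
  move/sol_reflect; congr (sol s _ _ _); apply/funext => t.
  by rewrite wt_reflect opprK invrK.
(* The Wronskian of a solution started at x0 with one started at [xe] is the same at [xe], where it
   is the wanted entry, and at the bottom [a], where both are estimated. *)
have F1 : p1 xe = p1 a * P1 s (- a) - Q1 s (- a) * q1 a.
  by rewrite -(wronskian xe a hs1 (back _ _ Hs1)) P10 Q10 mulr1 mul0r subr0.
have F2 : q2 xe = Q2 s (- a) * q2 a - p2 a * P2 s (- a).
  have := wronskian xe a hs2 (back _ _ Hs2); rewrite P20 Q20 mulr0 mul1r sub0r => H.
  by rewrite -[LHS]opprK H opprB.
have Vi : integ (fun t => (wt lam t)^-1) x0 a = V by [].
have Voi : integ (fun t => (wt (reflect_fun lam) t)^-1) (- xe) (- a) = Vo by [].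
rewrite Vi in L2 L4; rewrite Voi in R2 R4.
set J := integ (wt lam) x0 a in J1 L3 L4; set Jo := integ _ (- xe) (- a) in J2 R3 R4.
have J0 : 0 <= J by apply: integ_ge0 => // t _; exact: ltW.
have Jo0 : 0 <= Jo by apply: integ_ge0 => // t _; exact: ltW.
rewrite F1 F2.
move: (p1 a) (q1 a) (p2 a) (q2 a) (P1 s (- a)) (Q1 s (- a)) (P2 s (- a)) (Q2 s (- a)) L1 L2 L3 L4 R1 R2 R3 R4 => {F1 F2}.
move: V0 Vo0 J1 J2 J0 Jo0 m0 m1 s0 HV; clear.
move: V Vo J Jo => V Vo J Jo V0 Vo0 J1 J2 J0 Jo0 m0 m1 s0 HV p1 q1 p2 q2 P1 Q1 P2 Q2.
move=> /ler_normlP[L1 L1'] /andP[L2 _] L3 L4 /ler_normlP[R1 R1'] /andP[R2 _] R3 R4.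
have s2 := sqr_ge0 s.
(* Main terms: p1 P1 is at most (25/24)^2 and Q1 q1 at least 4 (23/24)^2, so m times their
   difference over m is below -5/2; the other entry adds at most 2/100. *)
have A1 : p1 * P1 <= 25 / 24 * (25 / 24).
  by apply: ler_pM; move: L1 L1' R1 R1'; clear => *; lra.
have A2 : 23 / 24 * (23 / 24) * 4 <= Q1 * q1.
  have : 23 / 24 * (s * Vo) * (23 / 24 * (s * V)) <= Q1 * q1.
    by apply: ler_pM => //; rewrite !mulr_ge0 ?invr_ge0 // ltW.
  by rewrite -HV; apply: le_trans; rewrite le_eqVlt; apply/orP; left; apply/eqP; field.
have mb : m * (s ^+ 2 * V * J) <= 25^-1.
  have := ler_wpM2l (mulr_ge0 s2 (ltW V0)) J1; move: HV; clear; rewrite (mulrA _ V Vo) => HV.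
  have -> : s ^+ 2 * V * (Vo / 100) = 25^-1 by rewrite mulrA HV; field.
  by rewrite mulrCA.
have mb' : m * (s ^+ 2 * Vo * Jo) <= 25^-1.
  have := ler_wpM2l (mulr_ge0 s2 (ltW Vo0)) J2; move: HV; clear; rewrite (mulrC V) (mulrA _ Vo V) => HV.
  have -> : s ^+ 2 * Vo * (V / 100) = 25^-1 by rewrite mulrA HV; field.
  by rewrite mulrCA.
have B1 : m * `|q2| <= 24 / 23 * (m + 4 / 75).
  have := ler_wpM2l (ltW m0) L4; move: mb; clear => *; lra.
have B2 : m * `|Q2| <= 24 / 23 * (m + 4 / 75).
  have := ler_wpM2l (ltW m0) R4; move: mb'; clear => *; lra.
have m1' : m <= 100^-1 := m1.
have B : (m * `|Q2|) * (m * `|q2|) <= 1 / 100.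
  apply: (@le_trans _ _ (24 / 23 * (m + 4 / 75) * (24 / 23 * (m + 4 / 75)))).
    by apply: ler_pM; rewrite ?mulr_ge0 ?normr_ge0 ?(ltW m0).
  apply: (@le_trans _ _ (7 / 100 * (7 / 100))); last by clear => *; lra.
  by apply: ler_pM; move: m1' m0; clear => *; lra.
have E : (m * `|p2|) * (m * `|P2|) <= 1 / 100.
  have E1 : (m * `|p2|) * (m * `|P2|) <= (m * (5 / 4 * (s * J))) * (m * (5 / 4 * (s * Jo))).
    by apply: ler_pM; rewrite ?mulr_ge0 ?normr_ge0 ?(ltW m0) // ler_wpM2l // ltW.
  have E2 : (m * J) * (m * Jo) <= Vo / 100 * (V / 100).
    by apply: ler_pM; rewrite ?mulr_ge0 ?(ltW m0).
  have := ler_wpM2l s2 E2; move: E1 HV; clear => E1 HV E3.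
  apply: le_trans E1 _.
  have -> : m * (5 / 4 * (s * J)) * (m * (5 / 4 * (s * Jo))) = 25 / 16 * (s ^+ 2 * (m * J * (m * Jo))) by field.
  have E4 : s ^+ 2 * (Vo / 100 * (V / 100)) = 4 / 10000 by rewrite -HV; field.
  by move: E3; rewrite E4; clear => *; lra.
have X1 : m * (m * (Q2 * q2 - p2 * P2)) <= 2 / 100.
  have := ler_norm (Q2 * q2); have := ler_norm (- (p2 * P2)); rewrite normrN !normrM => a1 a2.
  have := ler_wpM2l (sqr_ge0 m) (lerD a2 a1); move: B E; clear => *; lra.
rewrite -(ler_pM2l m0) mulrDr (_ : m * ((p1 * P1 - Q1 * q1) / m) = p1 * P1 - Q1 * q1); last by field; rewrite gt_eqF.
move: X1 A1 A2 m1' m0; clear => *; lra.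
Qed.

End Trace.

(** * Existence of a Floquet solution below the threshold *)

Section FloquetExistence.
Variable R : realType.

(** A real matrix of determinant 1 and trace 2 C has the eigenvalue C - i S of modulus 1; the four
    reals are the real and imaginary parts of an eigenvector. *)
Lemma unimodular_eigenvector (a b c d C S : R) : a * d - b * c = 1 -> a + d = 2 * C -> C ^+ 2 + S ^+ 2 = 1 ->
  exists u1 u2 v1 v2 : R,
  [/\ ~ [/\ u1 = 0, u2 = 0, v1 = 0 & v2 = 0],
      C * (a * u1 + b * v1) - S * (a * u2 + b * v2) = u1,
      C * (a * u2 + b * v2) + S * (a * u1 + b * v1) = u2,
      C * (c * u1 + d * v1) - S * (c * u2 + d * v2) = v1 &
      C * (c * u2 + d * v2) + S * (c * u1 + d * v1) = v2].
Proof.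
move=> D T N.
have Ed : d = 2 * C - a by lra.
have Ebc : b * c = a * d - 1 by lra.
have ES : S ^+ 2 = 1 - C ^+ 2 by lra.
have [/andP[/eqP b0 /andP[/eqP S0 /eqP Ca]]|nz] := boolP ((b == 0) && ((S == 0) && (C == a))); last first.
  (* The eigenvector (b, C - i S - a), which serves unless it is zero; in that case the matrix fixes
     the second axis up to sign. *)
  exists b, 0, (C - a), (- S); split.
  - by move=> [b0 _ Ca S0]; move: nz; rewrite b0 eqxx /= -(oppr_eq0 S) S0 eqxx /= -subr_eq0 Ca eqxx.
  - have -> : C * (a * b + b * (C - a)) - S * (a * 0 + b * - S) = b * (C ^+ 2 + S ^+ 2) by ring.
    by rewrite N mulr1.
  - ring.
  - have -> : C * (c * b + d * (C - a)) - S * (c * 0 + d * - S) =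
      C * (b * c - a * d) + d * (C ^+ 2 + S ^+ 2) by ring.
    rewrite N Ebc; lra.
  have -> : C * (c * 0 + d * - S) + S * (c * b + d * (C - a)) = S * (b * c - a * d) by ring.
  rewrite Ebc; lra.
have C2 : C * C = 1 by move: N; rewrite S0 expr0n addr0 expr2.
have da : d = a by lra.
subst b S; rewrite da -Ca.
exists 0, 0, 1, 0; split; first by move=> [_ _ /eqP]; rewrite oner_eq0.
all: by rewrite ?mulr0 ?mul0r ?mulr1 ?addr0 ?add0r ?subr0 ?mulr0 ?C2.
Qed.

(** The trace D(s) of the rescaled monodromy is continuous, exceeds 2 at s = 0 and is at most -2 at
    [s1], so it takes the value 2 C for every phase. An eigenvector gives the Floquet relation at
    x0, and uniqueness extends it to all x. *)
Lemma floquet_exists (W : R -> R) (T m C S x0 s1 : R) :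
  (forall x, 0 < W x) -> continuous W -> (forall x, W (x + T) = m ^+ 2 * W x) ->
  0 < m < 1 -> C ^+ 2 + S ^+ 2 = 1 -> 0 <= s1 ->
  (forall p1 q1 p2 q2, sol s1 W p1 q1 -> p1 x0 = 1 -> q1 x0 = 0 ->
     sol s1 W p2 q2 -> p2 x0 = 0 -> q2 x0 = 1 ->
     p1 (x0 + T) / m + m * q2 (x0 + T) <= - 2) ->
  exists s p1 q1 p2 q2,
  [/\ 0 < s <= s1, sol s W p1 q1, sol s W p2 q2,
      forall x,
      [/\ C * p1 (x + T) - S * p2 (x + T) = m * p1 x,
          C * p2 (x + T) + S * p1 (x + T) = m * p2 x,
          m * (C * q1 (x + T) - S * q2 (x + T)) = q1 x &
          m * (C * q2 (x + T) + S * q1 (x + T)) = q2 x] &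
      ~ [/\ p1 0 = 0, q1 0 = 0, p2 0 = 0 & q2 0 = 0]].
Proof.
move=> W0 cW WT /andP[m0 m1] N s10 H.
have [P1 [Q1 [P2 [Q2 [Z1 Z2 cP cQ]]]]] := sol_from s1 x0 cW W0.
pose D s := P1 s (x0 + T) / m + m * Q2 s (x0 + T).
have cD : continuous D.
  by move=> s; apply: cvgD; [apply: cvgMr_tmp; exact: cP|apply: cvgMl_tmp; exact: cQ].
have D0 : D 0 = m^-1 + m.
  have [[h1 _] i1 _] := Z1 0; have [[_ h2] _ i2] := Z2 0.
  have z x : P1 0 x = 1.
    have h1' : primitive (P1 0) (fun=> 0) by apply: prim_eq h1 _ => t; rewrite mul0r oppr0 mul0r.
    by have /eqP := prim_unique h1' (prim_cst 0) x x0; rewrite i1 subrr subr_eq0 => /eqP.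
  have z' x : Q2 0 x = 1.
    have h2' : primitive (Q2 0) (fun=> 0) by apply: prim_eq h2 _ => t; rewrite !mul0r.
    by have /eqP := prim_unique h2' (prim_cst 0) x x0; rewrite i2 subrr subr_eq0 => /eqP.
  by rewrite /D z z' mulr1 div1r.
have [Hs1 i1 j1] := Z1 s1; have [Hs2 i2 j2] := Z2 s1.
have D1 : D s1 <= - 2 := H _ _ _ _ Hs1 i1 j1 Hs2 i2 j2.
have C1 : -1 <= C <= 1.
  rewrite -ler_norml -(@ler_pXn2r _ 2) ?nnegrE // expr1n real_normK ?num_real //.
  by rewrite -N lerDl sqr_ge0.
have m2 : 2 < m^-1 + m.
  have : 0 < (1 - m) ^+ 2 / m by rewrite divr_gt0 // exprn_gt0 // subr_gt0.
  have -> : (1 - m) ^+ 2 / m = m^-1 + m - 2 by field; rewrite gt_eqF.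
  by rewrite subr_gt0.
have [s /[!in_itv]/= /andP[s0 ss1] Ds] : exists2 s, s \in `[0, s1] & D s = 2 * C.
  apply: IVT => //; first exact: continuous_subspaceT.
  case/andP: C1 => c1 c2; rewrite ge_min le_max D0; apply/andP; split; apply/orP; [right|left]; lra.
have sp : 0 < s.
  rewrite lt_neqAle s0 andbT; apply/eqP => s00; move: Ds; rewrite -s00 D0.
  case/andP: C1; lra.
have [h1 a1 b1] := Z1 s; have [h2 a2 b2] := Z2 s.
have w := wronskian (x0 + T) x0 h1 h2.
rewrite a1 a2 b1 b2 mulr1 mul0r subr0 in w.
have mn : m != 0 by rewrite gt_eqF.
have [||//|u1 [u2 [v1 [v2 [nz F1 F2 F3 F4]]]]] :=
  @unimodular_eigenvector (P1 s (x0 + T) / m) (P2 s (x0 + T) / m) (m * Q1 s (x0 + T)) (m * Q2 s (x0 + T)) C S.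
- by rewrite -w; field.
- exact: Ds.
have k1 := sol_comb u1 v1 h1 h2; have k2 := sol_comb u2 v2 h1 h2.
set p1 := (fun x => u1 * _ + _) in k1; set q1 := (fun x => u1 * _ + _) in k1.
set p2 := (fun x => u2 * _ + _) in k2; set q2 := (fun x => u2 * _ + _) in k2.
have ini : [/\ p1 x0 = u1, q1 x0 = v1, p2 x0 = u2 & q2 x0 = v2].
  by rewrite /p1 /p2 /q1 /q2 a1 a2 b1 b2; split; ring.
exists s, p1, q1, p2, q2; split => //; first by rewrite sp.
  have [j1' j2' j3 j4] := ini.
  have r1 := sol_comb C (- S) (sol_shift mn WT k1) (sol_shift mn WT k2).
  have r2 := sol_comb C S (sol_shift mn WT k2) (sol_shift mn WT k1).
  have d1 := sol_comb 1 (-1) r1 k1; have d2 := sol_comb 1 (-1) r2 k2.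
  have z p q : sol s W p q -> p x0 = 0 -> q x0 = 0 -> forall x, p x = 0 /\ q x = 0.
    move=> hpq pz qz x; have [pz0 qz0] := sol_zero cW W0 hpq pz qz.
    have hz : sol s W (fun=> 0) (fun=> 0) by split; apply: prim_eq (prim_cst 0) _ => y; rewrite mulr0.
    by have [E1 E2] := sol_eq W0 cW hpq hz pz0 qz0.
  have y1 := z _ _ d1; have y2 := z _ _ d2.
  rewrite /= j1' j2' j3 j4 in y1 y2.
  have x1 : 1 * (C * (p1 (x0 + T) / m) + - S * (p2 (x0 + T) / m)) + -1 * u1 = 0.
    by rewrite -F1 /p1 /p2; field.
  have x2 : 1 * (C * (m * q1 (x0 + T)) + - S * (m * q2 (x0 + T))) + -1 * v1 = 0.
    by rewrite -F3 /q1 /q2; ring.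
  have x3 : 1 * (C * (p2 (x0 + T) / m) + S * (p1 (x0 + T) / m)) + -1 * u2 = 0.
    by rewrite -F2 /p1 /p2; field.
  have x4 : 1 * (C * (m * q2 (x0 + T)) + S * (m * q1 (x0 + T))) + -1 * v2 = 0.
    by rewrite -F4 /q1 /q2; ring.
  move=> x; have [X1 X2] := y1 x1 x2 x; have [X3 X4] := y2 x3 x4 x.
  move: (p1 (x + T)) (p2 (x + T)) (q1 (x + T)) (q2 (x + T)) X1 X2 X3 X4 => P' P'' Q' Q'' X1 X2 X3 X4.
  split.
  - apply/eqP; rewrite -subr_eq0; apply/eqP; rewrite -[RHS](mulr0 m) -X1; field.
    exact: mn.
  - apply/eqP; rewrite -subr_eq0; apply/eqP; rewrite -[RHS](mulr0 m) -X3; field.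
    exact: mn.
  - by move: X2; clear => *; lra.
  by move: X4; clear => *; lra.
move=> [pz1 qz1 pz2 qz2]; apply: nz.
have [pz _] := ini.
have hz : sol s W (fun=> 0) (fun=> 0) by split; apply: prim_eq (prim_cst 0) _ => y; rewrite mulr0.
have [E1 E2] := sol_eq W0 cW k1 hz pz1 qz1.
have [E3 E4] := sol_eq W0 cW k2 hz pz2 qz2.
by have [<- <- <- <-] := ini; rewrite E1 E2 E3 E4.
Qed.

End FloquetExistence.

(** * Shape of the potential well *)

Section SideEstimates.
Variable R : realType.
Notation T := (2 * pi : R).

Lemma continuous_near (f : R -> R) (a e : R) : continuous f -> 0 < e ->
  exists2 d, 0 < d & forall t, `|t - a| <= d -> `|f t - f a| <= e.
Proof.
move=> cf e0; have := cf a => /cvgrPdist_le /(_ e e0)/nbhs_ballP[d /= d0 H].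
exists (d / 2); first by rewrite divr_gt0.
move=> t td; rewrite distrC; apply: H; rewrite /ball /= distrC.
by apply: le_lt_trans td _; rewrite ltr_pdivrMr // ltr_pMr // ltr1n.
Qed.

(** Positivity to the right of the zero forces the nonzero derivative to be positive, and continuity
    keeps it above half its value nearby. *)
Lemma simple_zero_lower (f f1 : R -> R) (a b : R) : primitive f f1 -> continuous f1 -> a < b ->
  f a = 0 -> f1 a != 0 -> (forall t, a < t < b -> 0 < f t) ->
  exists d c, [/\ 0 < d, 0 < c, d < b - a & forall t, a <= t <= a + d -> c * (t - a) <= f t].
Proof.
move=> hf cf1 ab fa f1a fpos.
have n0 : 0 < `|f1 a| / 2 by rewrite divr_gt0 // normr_gt0.
have [d d0 H] := continuous_near a cf1 n0.
pose d' := Num.min d ((b - a) / 2).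
have ba : 0 < (b - a) / 2 by rewrite divr_gt0 // subr_gt0.
have d'0 : 0 < d' by rewrite lt_min d0.
have d'd : d' <= d by rewrite ge_min lexx.
have d'b : d' <= (b - a) / 2 by rewrite ge_min lexx orbT.
have near t x : a <= t <= a + x -> x <= d -> `|f1 t - f1 a| <= `|f1 a| / 2.
  move=> /andP[t1 t2] xd; apply: H; rewrite ger0_norm ?subr_ge0 //; lra.
have f1p : 0 < f1 a.
  rewrite lt_neqAle eq_sym f1a /= leNgt; apply/negP => neg.
  have ad : a <= a + d' by rewrite lerDl ltW.
  have := prim_nonincreasing hf ad; rewrite fa leNgt fpos; last by apply/andP; split; lra.
  suff K t : a <= t <= a + d' -> f1 t <= 0 by move=> /(_ K).
  move=> tt; have := near _ _ tt d'd; rewrite (ltr0_norm neg) => /ler_normlP[_ ?]; lra.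
exists d', (f1 a / 2); split=> //; [by rewrite divr_gt0|lra|].
move=> t /andP[t1 t2]; have := prim_le (primZ (f1 a / 2) (@prim_id R)) hf t1.
rewrite fa subr0 -mulrBr; apply=> x /andP[x1 x2].
have := near x d' ltac:(by rewrite x1 (le_trans x2 t2)) d'd.
rewrite (gtr0_norm f1p) => /ler_normlP[? _]; lra.
Qed.

(** Linear bounds near the two simple zeros, and a positive minimum in between by compactness. *)
Lemma two_zeros_lower (f f1 : R -> R) (a b : R) : primitive f f1 -> continuous f1 -> a < b ->
  f a = 0 -> f b = 0 -> f1 a != 0 -> f1 b != 0 -> (forall t, a < t < b -> 0 < f t) ->
  exists2 c, 0 < c & forall t, a <= t <= b -> c * ((t - a) * (b - t)) <= f t.
Proof.
move=> hf cf1 ab fa fb f1a f1b fpos.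
have [d [c [d0 c0 db H]]] := simple_zero_lower hf cf1 ab fa f1a fpos.
have hr : primitive (fun y => f (- y)) (fun y => - f1 (- y)).
  have := primN (prim_reflect hf); congr (primitive _ _); apply/funext => y; by rewrite ?opprK.
have cr : continuous (fun y => - f1 (- y)) by move=> y; apply: cvgN; exact: (cont_reflect cf1).
have ba' : - b < - a by rewrite ltrN2.
have [||t /andP[t1 t2]|d' [c' [d'0 c'0 db' H']]] := simple_zero_lower hr cr ba'.
- by rewrite opprK.
- by rewrite opprK oppr_eq0.
- by apply: fpos; rewrite ltrNr t2 ltrNl.
pose e := Num.min d d'.
have e0 : 0 < e by rewrite lt_min d0.
have ed : e <= d by rewrite ge_min lexx.
have ed' : e <= d' by rewrite ge_min lexx orbT.
have ab2 : 0 < b - a by rewrite subr_gt0.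
pose m := Num.min e ((b - a) / 2).
have m0 : 0 < m by rewrite lt_min e0 divr_gt0.
have me : m <= e by rewrite ge_min lexx.
have mb : m <= (b - a) / 2 by rewrite ge_min lexx orbT.
have cf := prim_continuous hf.
have mm : a + m <= b - m by lra.
have [t0 /andP[t1 t2] Hm] := max_on_segment (f := fun t => - f t) (fun x => cvgN (cf x)) mm.
have ft0 : 0 < f t0 by apply: fpos; apply/andP; split; move: t1 t2 m0; clear => *; lra.
pose q := Num.min (f t0 / (b - a) ^+ 2) (Num.min (c / (b - a)) (c' / (b - a))).
have q0 : 0 < q by rewrite !lt_min !divr_gt0 // exprn_gt0.
have q1 : q * (b - a) ^+ 2 <= f t0 by rewrite -ler_pdivlMr ?exprn_gt0 // ge_min lexx.
have q2 : q * (b - a) <= c by rewrite -ler_pdivlMr // !ge_min lexx orbT.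
have q3 : q * (b - a) <= c' by rewrite -ler_pdivlMr // !ge_min lexx !orbT.
exists q => // t /andP[ta tb].
have ta0 : 0 <= t - a by rewrite subr_ge0.
have tb0 : 0 <= b - t by rewrite subr_ge0.
have [s1|s1] := leP t (a + m).
  apply: le_trans (H t _); last by rewrite ta (le_trans s1) // lerD2l (le_trans me).
  rewrite mulrCA mulrC ler_wpM2r //; apply: le_trans q2; rewrite ler_pM2l //; move: ta0; clear => *; lra.
have [s2|s2] := leP (b - m) t.
  have Hb : c' * (- t + b) <= f t.
    by have := H' (- t); rewrite !opprK; apply; apply/andP; split; move: tb s2 me ed'; clear => *; lra.
  apply: le_trans Hb.
  by rewrite (addrC (- t)) mulrA ler_wpM2r //; apply: le_trans q3; rewrite ler_pM2l //; move: tb0; clear => *; lra.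
have := Hm t ltac:(by rewrite !ltW); rewrite lerN2; apply: le_trans; apply: le_trans q1.
rewrite ler_pM2l // expr2; apply: ler_pM => //; move: ta0 tb0; clear => *; lra.
Qed.

(* Nondegeneracy of the minimum a makes k = sqrt y comparable with a - xp. *)
Lemma side_estimates (c2 C2 c3 : R) : 0 < c2 -> 0 < C2 -> 0 < c3 ->
  exists c C : R, [/\ 0 < c, 0 < C &
  forall (G G1 : R -> R) (B a xp y k : R), primitive G G1 -> G a = 0 ->
  (forall t, B <= t <= a -> c2 * ((a - t) * (t - B)) <= - G1 t <= C2 * (a - t)) ->
  B + c3 <= xp <= a -> G xp = y -> 0 <= k -> k ^+ 2 = y ->
  [/\ c * k <= a - xp <= C * k,
      forall x, B <= x <= xp -> c * (xp - x) * (k + (xp - x)) <= G x - y &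
      forall x, xp <= x <= a -> c * k * (x - xp) <= y - G x <= C * k * (x - xp)]].
Proof.
move=> c20 C20 c30; pose be := c2 * c3.
have be0 : 0 < be by rewrite mulr_gt0.
have [K [K0 K1 K2]] : exists K : R, [/\ 1 <= K, C2 <= K ^+ 2 & 2 <= be * K ^+ 2].
  exists (1 + C2 + 2 / be).
  have b2 : 0 < 2 / be by rewrite divr_gt0.
  have K1 : 1 <= 1 + C2 + 2 / be by lra.
  have KK : 1 + C2 + 2 / be <= (1 + C2 + 2 / be) ^+ 2 by rewrite expr2 ler_peMl //; lra.
  split => //; first by apply: le_trans KK; lra.
  rewrite mulrC -ler_pdivrMr //; apply: le_trans KK; lra.
have K0' : 0 < K by exact: lt_le_trans K0.
exists (Num.min (K^-1) (be / 16 / K)), (C2 * K + K).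
have cp : 0 < Num.min (K^-1) (be / 16 / K) by rewrite lt_min invr_gt0 K0' !divr_gt0.
split => //; first by rewrite addr_gt0 // mulr_gt0.
move=> G G1 B a xp y k hG Ga HG1 /andP[xB xa] Gxp k0 ky.
set c := Num.min _ _ in cp *.
have cK : c <= K^-1 by rewrite ge_min lexx.
have cb : c <= be / 16 / K by rewrite ge_min lexx orbT.
set D := a - xp; have D0 : 0 <= D by rewrite subr_ge0.
have hG' := primN hG.
have sq b : primitive (fun t => - (b / 2 * (a - t) ^+ 2)) (fun t => b * (a - t)).
  have h := primB (prim_cst a) (@prim_id R).
  by apply: prim_eq (primN (primZ (b / 2) (primM h h))) _ => t; field.
have low t : B + c3 <= t -> t <= a -> be * (a - t) <= - G1 t.
  move=> t1 t2; have /andP[H _] := HG1 t ltac:(rewrite t2 andbT; lra).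
  apply: le_trans H; rewrite /be -mulrA ler_wpM2l ?(ltW c20) // mulrC ler_wpM2l ?subr_ge0 //; lra.
have up t : B + c3 <= t -> t <= a -> - G1 t <= C2 * (a - t).
  by move=> t1 t2; have /andP[_ H] := HG1 t ltac:(rewrite t2 andbT; lra).
have y1 : be / 2 * D ^+ 2 <= y.
  have := prim_le (sq be) hG' xa (fun t tt => ltac:(case/andP: tt => a1 a2; exact: (low t (le_trans xB a1) a2))).
  rewrite subrr expr0n mulr0 Ga Gxp /= !opprK oppr0 !add0r; exact.
have y2 : y <= C2 / 2 * D ^+ 2.
  have := prim_le hG' (sq C2) xa (fun t tt => ltac:(case/andP: tt => a1 a2; exact: (up t (le_trans xB a1) a2))).
  rewrite subrr expr0n mulr0 Ga Gxp /= !opprK oppr0 !add0r; exact.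
have D2 := sqr_ge0 D.
have kD : k <= K * D.
  apply: le_of_sqr; first by rewrite mulr_ge0 // ltW.
  rewrite ky exprMn; have := ler_wpM2r D2 K1; move: y2 (mulr_ge0 (ltW C20) D2); clear => *; lra.
have Dk : D <= K * k.
  apply: le_of_sqr; first by rewrite mulr_ge0 // ltW.
  have := ler_wpM2r D2 K2; have := ler_wpM2l (sqr_ge0 K) y1; rewrite exprMn ky; clear => *; lra.
have ckD : c * k <= D.
  apply: le_trans (ler_wpM2r k0 cK) _; rewrite mulrC ler_pdivrMr // mulrC; exact: kD.
have K16 : be / 16 / K <= be / 16 by rewrite ler_pdivrMr // ler_peMr // divr_ge0 // ltW.
split.
- by rewrite ckD /= (le_trans Dk) // ler_wpM2r // lerDr mulr_ge0 // ltW.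
- move=> x /andP[Bx xx]; set u := xp - x; have u0 : 0 <= u by rewrite subr_ge0.
  have neg t : B <= t -> t <= a -> 0 <= - G1 t.
    move=> t1 t2; have /andP[H _] := HG1 t ltac:(by rewrite t1 t2); apply: le_trans H.
    by rewrite !mulr_ge0 ?subr_ge0 // ltW.
  (* The lower bound on - G1 degenerates at [B]. It is used on the right half of [x, xp], where t -
     B >= c3 / 2; on the left half monotonicity suffices. *)
  have xh : x <= (x + xp) / 2 by lra.
  have xh2 : (x + xp) / 2 <= xp by lra.
  have S1 : G ((x + xp) / 2) <= G x.
    have := prim_nondecreasing hG' xh; rewrite lerN2; apply=> t /andP[t1 t2].
    by apply: neg; [exact: le_trans t1|lra].
  have S2 : be / 4 * ((a - (x + xp) / 2) ^+ 2 - D ^+ 2) <= G ((x + xp) / 2) - y.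
    have := prim_le (sq (be / 2)) hG' xh2; rewrite Gxp => H.
    have {H} := H (fun t tt => ltac:(case/andP: tt => a1 a2; have /andP[L _] := HG1 t ltac:(apply/andP; split; move: a1 a2 xh Bx xa; clear => *; lra);
      apply: le_trans L; rewrite /be (_ : c2 * c3 / 2 * (a - t) = c2 * ((a - t) * (c3 / 2)));
      [rewrite ler_wpM2l ?(ltW c20) // ler_wpM2l //; move: a1 a2 xh Bx xB xa; clear => *; lra|field])).
    rewrite /D; clear => *; lra.
  apply: (@le_trans _ _ (be / 16 * (u * (D + u)))).
    rewrite -mulrA (_ : c * (u * (k + u)) = u * (c * (k + u))); last by ring.
    rewrite [leRHS]mulrCA ler_wpM2l // mulrDr [leRHS]mulrDr; apply: lerD.
      apply: le_trans (ler_wpM2r k0 cb) _; rewrite -(mulrA (be / 16)) ler_wpM2l ?divr_ge0 ?(ltW be0) //.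
      by rewrite mulrC ler_pdivrMr // mulrC.
    by rewrite ler_wpM2r // (le_trans cb).
  have E : (a - (x + xp) / 2) ^+ 2 - D ^+ 2 = D * u + u ^+ 2 / 4 by rewrite /D /u; field.
  rewrite E in S2; have := mulr_ge0 (ltW be0) (mulr_ge0 D0 u0); have := mulr_ge0 (ltW be0) (sqr_ge0 u).
  move: S1 S2; rewrite expr2; clear => *; lra.
move=> x /andP[px xa2]; have x0 : 0 <= x - xp by rewrite subr_ge0.
apply/andP; split.
  have := prim_le (sq be) hG' px (fun t tt => ltac:(case/andP: tt => a1 a2; exact: (low t (le_trans xB a1) (le_trans a2 xa2)))).
  rewrite Gxp => H.
  apply: (@le_trans _ _ (be / 2 * ((x - xp) * (D + (a - x))))); last by move: H; rewrite /D; clear => *; lra.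
  have F : c * k <= be / 16 * D.
    apply: le_trans (ler_wpM2r k0 cb) _; rewrite -(mulrA (be / 16)) ler_wpM2l ?divr_ge0 ?(ltW be0) //.
    by rewrite mulrC ler_pdivrMr // mulrC.
  have := ler_wpM2r x0 F; have := mulr_ge0 (ltW be0) (mulr_ge0 x0 D0).
  have ax0 : 0 <= a - x by rewrite subr_ge0.
  have := mulr_ge0 (ltW be0) (mulr_ge0 x0 ax0); clear => *; lra.
have := prim_le hG' (primZ (C2 * D) (@prim_id R)) px.
rewrite Gxp opprK -mulrBr (addrC (- G x)) => H; apply: le_trans (H _) _.
  move=> t /andP[a1 a2]; rewrite mulr1; apply: le_trans (up t (le_trans xB a1) (le_trans a2 xa2)) _.
  by rewrite ler_wpM2l ?(ltW C20) // lerD2l lerN2.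
rewrite ler_wpM2r //; apply: (@le_trans _ _ (C2 * K * k)); first by rewrite -mulrA ler_wpM2l // ltW.
by rewrite ler_wpM2r // lerDl ltW.
Qed.

End SideEstimates.

(** * From the shape of Im g to the two half wells *)

Section WellGeometry.
Variable R : realType.
Notation T := (2 * pi : R).

(** What is used of Im g, in a form stable under the exchange of its minimum and its maximum. *)
Record profile (G G1 G2 : R -> R) (a b : R) : Prop := Profile {
  pf_prim : primitive G G1; pf_prim1 : primitive G1 G2; pf_cont : continuous G2;
  pf_per : periodic G T; pf_order : a < b < a + T;
  pf_min : G a = 0; pf_range : forall x, 0 <= G x <= G b; pf_pos : 0 < G b;
  pf_crit : G1 a = 0 /\ G1 b = 0;
  pf_up : forall x, a < x < b -> G1 x != 0; pf_down : forall x, b < x < a + T -> G1 x != 0;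
  pf_nondeg : G2 a != 0 /\ G2 b != 0 }.

Lemma prim_periodic (F f : R -> R) (t : R) : primitive F f -> periodic F t -> periodic f t.
Proof.
move=> H P x; have E : (fun y => F (y + t)) = F by apply/funext => y; exact: P.
by have := congr1 (@^~ x) (prim_derive1 (prim_shift t H)); rewrite /= E (prim_derive1 H).
Qed.

(** Reduces the values of Im z above the mean of Im g to those below it. *)
Lemma profile_swap G G1 G2 a b : profile G G1 G2 a b ->
  profile (fun x => G b - G x) (fun x => - G1 x) (fun x => - G2 x) b (a + T).
Proof.
move=> [h h1 c2 per /andP[ab ba] m r p [k1 k2] u d [n1 n2]].
have per1 := prim_periodic h per; have per2 := prim_periodic h1 per1.
split => //.
- by apply: prim_eq (primB (prim_cst (G b)) h) _ => x; rewrite sub0r.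
- exact: primN h1.
- by move=> x; apply: cvgN; exact: c2.
- by move=> x; rewrite per.
- by rewrite ba ltrD2r.
- by rewrite subrr.
- by move=> x; have /andP[x1 x2] := r x; rewrite per m subr0; apply/andP; split; lra.
- by rewrite per m subr0.
- by rewrite per1 k1 k2 oppr0.
- by move=> x xx; rewrite oppr_eq0 d.
- move=> x /andP[x1 x2]; rewrite oppr_eq0 -(subrK T x) per1; apply: u; apply/andP; split; lra.
by rewrite per2 !oppr_eq0.
Qed.

(** Without zeros inside, the sign is constant by the intermediate value theorem, and the increase
    of [F] decides which sign it is. *)
Lemma sign_between (f : R -> R) (F : R -> R) (a b : R) : primitive F f -> continuous f -> a < b -> F a < F b ->
  (forall x, a < x < b -> f x != 0) -> f a = 0 -> f b = 0 -> forall x, a < x < b -> 0 < f x.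
Proof.
move=> hF cf ab Fab nz fa fb x xx; rewrite lt_neqAle eq_sym nz //= leNgt; apply/negP => fx.
suff neg t : a <= t <= b -> f t <= 0.
  by have := prim_nonincreasing hF (ltW ab) neg; rewrite leNgt Fab.
move=> /andP[]; rewrite le_eqVlt => /orP[/eqP <- _|at0]; first by rewrite fa.
rewrite le_eqVlt => /orP[/eqP ->|tb]; first by rewrite fb.
rewrite leNgt; apply/negP => ft.
case/andP: xx => ax xb.
have [xt|tx] := leP x t.
  have [|s /[!in_itv]/= /andP[s1 s2] fs] := @IVT _ f x t 0 xt (continuous_subspaceT cf).
    by rewrite ge_min le_max (ltW fx) (ltW ft) orbT.
  by have := nz s; rewrite (lt_le_trans ax s1) (le_lt_trans s2 tb) fs eqxx => /(_ isT).
have [|s /[!in_itv]/= /andP[s1 s2] fs] := @IVT _ f t x 0 (ltW tx) (continuous_subspaceT cf).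
  by rewrite ge_min le_max (ltW fx) (ltW ft) orbT.
by have := nz s; rewrite (lt_le_trans at0 s1) (le_lt_trans s2 xb) fs eqxx => /(_ isT).
Qed.

Record well_shape (be : R -> R) (k c C x0 xp a : R) : Prop := WellShape {
  ws_out : forall x, x0 <= x <= xp -> be x <= - (c * (xp - x) * (k + (xp - x)));
  ws_in : forall x, xp <= x <= a -> c * k * (x - xp) <= be x <= C * k * (x - xp);
  ws_bottom : c * k <= a - xp <= C * k;
  ws_exit : c <= xp - x0 <= C }.

(** The window may extend to the left beyond the maximum [B]. There periodicity transfers the bound
    known to the right of [xm], and x + T - xm >= c' >= (c' / T) (xp - x) costs the factor (c' /
    T)^2. *)
Lemma out_shape (f : R -> R) (k c c' B x0 xp xm : R) : periodic f T -> 0 <= k -> 0 < c -> 0 < c' <= T ->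
  (forall x, B <= x <= xp -> c * (xp - x) * (k + (xp - x)) <= f x) ->
  (forall x, xm <= x <= B + T -> c * (x - xm) * (k + (x - xm)) <= f x) ->
  c' <= x0 + T - xm -> xp - x0 <= T ->
  forall x, x0 <= x <= xp -> c * (c' / T) ^+ 2 * (xp - x) * (k + (xp - x)) <= f x.
Proof.
move=> per k0 c0 /andP[c'0 c'T] H1 H2 d1 d2 x /andP[x1 x2].
have T0 := @two_pi_gt0 R.
have r0 : 0 <= c' / T by rewrite divr_ge0 // ltW.
have r1 : c' / T <= 1 by rewrite ler_pdivrMr // mul1r.
have u0 : 0 <= xp - x by rewrite subr_ge0.
have [xB|Bx] := ltP x B.
  rewrite -per; apply: le_trans (H2 (x + T) _); last by apply/andP; split; lra.
  set v := x + T - xm; have v0 : c' <= v by rewrite /v; lra.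
  have uv : c' / T * (xp - x) <= v.
    by apply: le_trans v0; rewrite mulrAC ler_pdivrMr // ler_wpM2l ?(ltW c'0) //; lra.
  have -> : c * (c' / T) ^+ 2 * (xp - x) * (k + (xp - x)) =
    c * ((c' / T * (xp - x)) * (c' / T * k + c' / T * (xp - x))) by ring.
  rewrite -(mulrA c) ler_wpM2l ?(ltW c0) //.
  have z1 : 0 <= c' / T * (xp - x) by rewrite mulr_ge0.
  have z2 : 0 <= c' / T * k by rewrite mulr_ge0.
  by apply: ler_pM => //; [exact: addr_ge0|apply: lerD => //; rewrite ler_piMl].
apply: le_trans (H1 x _); last by rewrite Bx.
have r2 : (c' / T) ^+ 2 <= 1 by rewrite expr_le1.
have z := mulr_ge0 (mulr_ge0 (ltW c0) u0) (addr_ge0 k0 u0).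
have := ler_wpM2r z r2; rewrite mul1r; apply: le_trans.
by rewrite le_eqVlt; apply/orP; left; apply/eqP; ring.
Qed.

(** [ga] is the mean of G minus y. The bound de <= ga keeps y away from the maximum, hence [xp] and
    [xm] away from the points where G1 degenerates at the top. The end x0 is where [Lam] is pi ga
    above its value at [a], half of its total drop over a period. *)
Lemma well_geometry (G G1 G2 : R -> R) (a b de : R) : profile G G1 G2 a b -> 0 < de ->
  exists c C : R, [/\ 0 < c, c <= 1, 1 <= C &
  forall (y k xp xm ga : R) (Lam : R -> R), 0 < k -> k ^+ 2 = y ->
  primitive Lam (fun x => y - G x) -> (forall x, Lam (x + T) = Lam x - T * ga) -> de <= ga ->
  b - T < xp < a -> a < xm < b -> G xp = y -> G xm = y ->
  k <= C /\ exists x0, [/\ well_shape (fun x => y - G x) k c C x0 xp a,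
    well_shape (fun x => y - G (- x)) k c C (- (x0 + T)) (- xm) (- a) & Lam x0 - Lam a = pi * ga]].
Proof.
move=> [h h1 c2 per /andP[ab ba] m r p [k1 k2] u d [n1 n2]] de0.
have per1 := prim_periodic h per; have per2 := prim_periodic h1 per1.
have T0 := @two_pi_gt0 R; have pi0 := @pi_gt0 R.
have c1 := prim_continuous h1; have cG := prim_continuous h.
have up := sign_between h c1 ab (_ : G a < G b) u k1 k2; rewrite m in up; have {}up := up p.
have hN := primN h; have h1N := primN h1.
have c1N : continuous (fun x => - G1 x) by move=> x; apply: cvgN; exact: c1.
have c2N : continuous (fun x => - G2 x) by move=> x; apply: cvgN; exact: c2.
have down x : b < x < a + T -> 0 < - G1 x.
  apply: (sign_between hN c1N ba) => [|t tt||].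
  - by rewrite per m oppr0 oppr_lt0.
  - by rewrite oppr_eq0 d.
  - by rewrite k2 oppr0.
  by rewrite per1 k1 oppr0.
have [cu cu0 Hu] := two_zeros_lower h1 c2 ab k1 k2 n1 n2 up.
have [||||cd cd0 Hd] := two_zeros_lower h1N c2N ba _ _ _ _ down.
- by rewrite k2 oppr0.
- by rewrite per1 k1 oppr0.
- by rewrite oppr_eq0.
- by rewrite per2 oppr_eq0.
have bTa : b - T <= b by rewrite gerBl ltW.
have [t1 _ Ht1] := max_on_segment (abs_cont c2) bTa.
pose C2 := `|G2 t1| + 1; have C20 : 0 < C2 by rewrite /C2 ltr_wpDl.
have HC2 t : b - T <= t <= b -> `|G2 t| <= C2 by move=> /Ht1 H; rewrite (le_trans H) // lerDl.
have [t3 _ Ht3] := max_on_segment (abs_cont c1) bTa.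
pose C1 := `|G1 t3| + 1; have C10 : 0 < C1 by rewrite /C1 ltr_wpDl.
have HC1 t : b - T <= t <= b -> `|G1 t| <= C1 by move=> /Ht3 H; rewrite (le_trans H) // lerDl.
(* [C1] is a Lipschitz constant of G, so a point where G is at least [de] below its maximum is at
   distance at least [c3] from the maximum. *)
pose c3 := de / C1; have c30 : 0 < c3 by rewrite divr_gt0.
pose cm := Num.min cu cd; have cm0 : 0 < cm by rewrite lt_min cu0.
have cmu : cm <= cu by rewrite ge_min lexx.
have cmd : cm <= cd by rewrite ge_min lexx orbT.
have [c4 [C4 [c40 C40 SE]]] := side_estimates cm0 C20 c30.
pose M := G b.
have [c' [c'0 c'T c'M]] : exists c', [/\ 0 < c', c' <= T & c' * M <= pi * de].
  exists (Num.min (pi * de / M) T); rewrite lt_min T0 andbT divr_gt0 ?mulr_gt0 // ge_min lexx orbT.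
  by split => //; rewrite -ler_pdivlMr // ge_min lexx.
pose cc := Num.min (Num.min 1 (c4 * (c' / T) ^+ 2)) (Num.min c4 c').
exists cc, (1 + C4 + T + M).
have cc0 : 0 < cc.
  by rewrite !lt_min ltr01 c40 c'0 andbT /= mulr_gt0 // exprn_gt0 // divr_gt0.
have cc1 : cc <= 1 by rewrite !ge_min lexx.
have cc2 : cc <= c4 * (c' / T) ^+ 2 by rewrite !ge_min lexx orbT.
have cc3 : cc <= c4 by rewrite !ge_min lexx !orbT.
have cc4 : cc <= c' by rewrite !ge_min lexx !orbT.
split => //; first by move: C40 T0 p; rewrite /M; clear => *; lra.
move=> y k xp xm ga Lam k0 ky hL LT deg /andP[xp1 xp2] /andP[xm1 xm2] Gp Gm.
(* The mean of G over a period is y + ga, hence at most the maximum. *)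
have yM : y + ga <= M.
  have := prim_le (primZ (y - M) (@prim_id R)) hL (_ : 0 <= T); rewrite -mulrBr subr0.
  move=> /(_ (ltW T0)) H; have {}H : (y - M) * T <= Lam T - Lam 0.
    apply: H => t _; rewrite mulr1 lerD2l lerN2; by have /andP[] := r t.
  have := LT 0; rewrite add0r => E; rewrite E in H.
  have : T * (y + ga - M) <= 0 by move: H; clear => *; lra.
  by rewrite pmulr_rle0 // subr_le0.
have y0 : 0 < y by rewrite -ky exprn_gt0.
split.
  have [k1'|k1'] := leP k 1; first by move: C40 T0 p k1'; rewrite /M; clear => *; lra.
  have : k <= k ^+ 2 by rewrite expr2 ler_peMl ?ltW.
  by rewrite ky; move: yM deg de0 C40 T0; clear => *; lra.
have top x t : b - T <= x <= b -> b - T <= t <= b -> x <= t -> G x - G t <= C1 * (t - x) /\ G t - G x <= C1 * (t - x).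
  move=> /andP[x1 x2] /andP[t1' t2] xt; rewrite mulrBr; split.
    have := prim_le hN (primZ C1 (@prim_id R)) xt; rewrite opprK (addrC _ (G x)); apply=> s /andP[s1 s2].
    by rewrite mulr1 (le_trans (ler_norm _)) // normrN HC1 // (le_trans x1) ?(le_trans s2).
  have := prim_le h (primZ C1 (@prim_id R)) xt; apply=> s /andP[s1 s2].
  by rewrite mulr1 (le_trans (ler_norm _)) // HC1 // (le_trans x1) ?(le_trans s2).
have GbT : G (b - T) = G b by rewrite -(per (b - T)) subrK.
have dp : b - T + c3 <= xp.
  have [H _] := top (b - T) xp ltac:(by rewrite lexx) ltac:(by rewrite (ltW xp1) (ltW (lt_trans xp2 ab))) (ltW xp1).
  rewrite GbT Gp in H.
  have : c3 <= xp - (b - T); last by clear => *; lra.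
  by rewrite /c3 ler_pdivrMr // mulrC; move: H yM deg; rewrite /M; clear => *; lra.
have dm : xm + c3 <= b.
  have [_ H] := top xm b ltac:(by rewrite (ltW xm2) (ltW (lt_trans xp1 (lt_trans xp2 xm1)))) ltac:(by rewrite lexx andbT) (ltW xm2).
  rewrite Gm in H.
  have : c3 <= b - xm; last by clear => *; lra.
  by rewrite /c3 ler_pdivrMr // mulrC; move: H yM deg; rewrite /M; clear => *; lra.
have slope t s : b - T <= t -> t <= s -> s <= b -> `|G1 s - G1 t| <= C2 * (s - t).
  move=> t1' ts sb; rewrite mulrBr ler_norml; apply/andP; split.
    have := prim_le (primZ (- C2) (@prim_id R)) h1 ts => H.
    have : - C2 * s - - C2 * t <= G1 s - G1 t.
      apply: H => q /andP[q1 q2]; have := HC2 q ltac:(by rewrite (le_trans t1') ?(le_trans q2)).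
      by rewrite mulr1 => /ler_normlP[]; clear => *; lra.
    by clear => *; lra.
  have := prim_le h1 (primZ C2 (@prim_id R)) ts; apply => q /andP[q1 q2].
  by rewrite mulr1 (le_trans (ler_norm _)) // HC2 // (le_trans t1') ?(le_trans q2).
have [L1 L2 L3] : [/\ c4 * k <= a - xp <= C4 * k,
      forall x, b - T <= x <= xp -> c4 * (xp - x) * (k + (xp - x)) <= G x - y &
      forall x, xp <= x <= a -> c4 * k * (x - xp) <= y - G x <= C4 * k * (x - xp)].
  apply: (SE G G1) => //; [|by rewrite dp ltW|exact: ltW].
  move=> t /andP[t1' t2']; apply/andP; split.
    have := Hd (t + T) ltac:(by rewrite -lerBlDr t1' lerD2r); rewrite per1; apply: le_trans.
    have -> : a + T - (t + T) = a - t by ring.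
    have -> : t - (b - T) = t + T - b by ring.
    rewrite (mulrC (t + T - b)) ler_wpM2r // mulr_ge0 ?subr_ge0 //; move: t1'; clear => *; lra.
  have := slope t a t1' t2' (ltW ab); rewrite k1 sub0r; apply: le_trans; exact: ler_norm.
have [R1 R2 R3] : [/\ c4 * k <= - a - - xm <= C4 * k,
      forall x, - b <= x <= - xm -> c4 * (- xm - x) * (k + (- xm - x)) <= G (- x) - y &
      forall x, - xm <= x <= - a -> c4 * k * (x - - xm) <= y - G (- x) <= C4 * k * (x - - xm)].
  apply: (SE (fun x => G (- x)) (fun x => - G1 (- x))) => //; rewrite ?opprK //; last 2 first.
  - by apply/andP; split; move: dm (ltW xm1); clear => *; lra.
  - exact: ltW.
  - rewrite (_ : (fun x => G (- x)) = (fun x => - - G (- x))); last by apply/funext => x; rewrite opprK.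
    exact: primN (prim_reflect h).
  move=> t /andP[t1' t2']; rewrite opprK; apply/andP; split.
    have := Hu (- t) ltac:(by rewrite lerNr t2' lerNl); apply: le_trans.
    have -> : (- t - a) * (b - - t) = (- a - t) * (t + b) by ring.
    by rewrite ler_wpM2r // mulr_ge0 ?subr_ge0 // -lerBlDr sub0r.
  have aT : b - T <= a by move: ba; clear => *; lra.
  have := slope a (- t) aT ltac:(by rewrite lerNr) ltac:(by rewrite lerNl).
  rewrite k1 subr0 => H; apply: le_trans (ler_norm _) _; apply: le_trans H _.
  by rewrite addrC.
have xmT : xm - T <= xp by move: xp1 xm2; clear => *; lra.
have LA : Lam xp <= Lam a.
  apply: (prim_nondecreasing hL (ltW xp2)) => t /andP[t1' t2']; have /andP[H _] := L3 t ltac:(by rewrite t1').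
  by apply: le_trans H; rewrite !mulr_ge0 ?(ltW c40) ?(ltW k0) // subr_ge0.
have LB : Lam a <= Lam xm.
  apply: (prim_nondecreasing hL (ltW xm1)) => t /andP[t1' t2'].
  have /andP[H _] := R3 (- t) ltac:(by rewrite !lerN2 t2' t1'); rewrite !opprK in H.
  by apply: le_trans H; rewrite !mulr_ge0 ?(ltW c40) ?(ltW k0) // addrC subr_ge0.
have LC : Lam (xm - T) = Lam xm + T * ga by have := LT (xm - T); rewrite subrK => ->; rewrite subrK.
have ga0 : 0 < ga by exact: lt_le_trans deg.
have pg : 0 < pi * ga by rewrite mulr_gt0.
(* Lam(xm - T) is at least Lam(a) + 2 pi ga while Lam(xp) is at most Lam(a), so the level Lam(a) +
   pi ga is attained in between. *)
have [|x0 /[!in_itv]/= /andP[x01 x02] Lx0] := @IVT _ Lam (xm - T) xp (Lam a + pi * ga) xmT (continuous_subspaceT (prim_continuous hL)).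
  rewrite ge_min le_max LC; apply/andP; split; apply/orP; [right|left]; move: LA LB pg; clear => *; lra.
have bound t s : t <= s -> Lam t - Lam s <= M * (s - t).
  move=> ts; have := prim_le (primN hL) (primZ M (@prim_id R)) ts; rewrite mulrBr opprK (addrC (- Lam s)); apply=> q _.
  by rewrite mulr1 opprB lerBlDr; have /andP[_ H] := r q; rewrite (le_trans H) // lerDl ltW.
have pdg : pi * de <= pi * ga by rewrite ler_pM2l.
have e1 : c' <= xp - x0.
  have := bound x0 xp x02; rewrite Lx0 => H.
  rewrite -(ler_pM2r p) (le_trans c'M) // (le_trans pdg) // [leRHS]mulrC; apply: le_trans H.
  by move: LA; clear => *; lra.
have e2 : c' <= x0 + T - xm.
  have := bound (xm - T) x0 x01; rewrite Lx0 LC => H.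
  rewrite -(ler_pM2r p) (le_trans c'M) // (le_trans pdg) // [leRHS]mulrC.
  have -> : x0 + T - xm = x0 - (xm - T) by ring.
  by apply: le_trans H; move: LB; clear => *; lra.
have C4C : C4 <= 1 + C4 + T + M by move: T0 p; rewrite /M; clear => *; lra.
have TC : T <= 1 + C4 + T + M by move: C40 p; rewrite /M; clear => *; lra.
have xpx0 : xp - x0 <= T by move: x01 xp2 xm1; clear => *; lra.
have per' : periodic (fun x => G x - y) T by move=> x; rewrite per.
have per'' : periodic (fun x => G (- x) - y) T by move=> x; rewrite opprD -(subrK T (- x)) per addrK.
exists x0; split; last by rewrite Lx0 addrC addKr.
- split.
  + move=> x xx.
    have := out_shape per' (ltW k0) c40 (_ : 0 < c' <= T) L2 (_ : forall x, xm <= x <= b - T + T -> _) e2 xpx0 xx.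
    rewrite c'0 c'T => /(_ isT) H.
    have u0 : 0 <= xp - x by rewrite subr_ge0; case/andP: xx.
    have {}H : c4 * (c' / T) ^+ 2 * (xp - x) * (k + (xp - x)) <= G x - y.
      apply: H => s /andP[s1 s2]; rewrite subrK in s2.
      have := R2 (- s) ltac:(by rewrite !lerN2 s1 s2).
      by rewrite !opprK (addrC (- xm)).
    rewrite -lerN2 opprK opprB; apply: le_trans H.
    by rewrite -!(mulrA _ (xp - x)) ler_wpM2r // mulr_ge0 // addr_ge0 // ltW.
  + move=> x xx; have /andP[a1 a2] := L3 x xx.
    have u0 : 0 <= x - xp by rewrite subr_ge0; case/andP: xx.
    by apply/andP; split; [apply: le_trans a1|apply: le_trans a2 _]; rewrite ler_wpM2r // ler_wpM2r // ltW.
  + case/andP: L1 => a1 a2; by apply/andP; split; [apply: le_trans a1|apply: le_trans a2 _]; rewrite ler_wpM2r // ltW.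
  by rewrite (le_trans cc4 e1) (le_trans xpx0 TC).
split.
- move=> x xx.
  have xmT' : - xm - - (x0 + T) <= T by move: x02 xp2 xm1; clear => *; lra.
  have e1' : c' <= - (x0 + T) + T - - xp by move: e1; clear => *; lra.
  have := out_shape per'' (ltW k0) c40 (_ : 0 < c' <= T) R2 (_ : forall x, - xp <= x <= - b + T -> _) e1' xmT' xx.
  rewrite c'0 c'T => /(_ isT) H.
  have u0 : 0 <= - xm - x by rewrite subr_ge0; case/andP: xx.
  have {}H : c4 * (c' / T) ^+ 2 * (- xm - x) * (k + (- xm - x)) <= G (- x) - y.
    apply: H => s /andP[s1 s2].
    have := L2 (- s) ltac:(by apply/andP; split; move: s1 s2; clear => *; lra).
    by rewrite !opprK (addrC xp).
  rewrite -lerN2 opprK opprB; apply: le_trans H.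
  by rewrite -!(mulrA _ (- xm - x)) ler_wpM2r // mulr_ge0 // addr_ge0 // ltW.
- move=> x xx; have /andP[a1 a2] := R3 x xx.
  have u0 : 0 <= x - - xm by rewrite subr_ge0; case/andP: xx.
  by apply/andP; split; [apply: le_trans a1|apply: le_trans a2 _]; rewrite ler_wpM2r // ler_wpM2r // ltW.
- case/andP: R1 => a1 a2; by apply/andP; split; [apply: le_trans a1|apply: le_trans a2 _]; rewrite ler_wpM2r // ltW.
have -> : - xm - - (x0 + T) = x0 + T - xm by ring.
rewrite (le_trans cc4 e2) (le_trans _ TC) //; move: x02 xp2 xm1; clear => *; lra.
Qed.

End WellGeometry.

(** * Concentration of the ground states *)

Section Concentration.
Variable R : realType.
Notation T := (2 * pi : R).

(** The relation [floquet] with free parameters, so that the exchange of p and q may replace [m] by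
    its inverse. *)
Definition quasi_periodic (m C S : R) (p1 p2 q1 q2 : R -> R) := forall x,
  [/\ C * p1 (x + T) - S * p2 (x + T) = m * p1 x,
      C * p2 (x + T) + S * p1 (x + T) = m * p2 x,
      m * (C * q1 (x + T) - S * q2 (x + T)) = q1 x &
      m * (C * q2 (x + T) + S * q1 (x + T)) = q2 x].

Lemma nrm_rotation (C S u v : R) : C ^+ 2 + S ^+ 2 = 1 -> nrm (C * u - S * v) (C * v + S * u) = nrm u v.
Proof.
move=> N; congr Num.sqrt; rewrite -[RHS]mul1r -N; ring.
Qed.

Lemma quasi_periodic_nrm m C S p1 p2 q1 q2 x : 0 < m -> C ^+ 2 + S ^+ 2 = 1 ->
  quasi_periodic m C S p1 p2 q1 q2 ->
  nrm (p1 (x + T)) (p2 (x + T)) = m * nrm (p1 x) (p2 x) /\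
  nrm (q1 x) (q2 x) = m * nrm (q1 (x + T)) (q2 (x + T)).
Proof.
move=> m0 N /(_ x) [E1 E2 E3 E4]; split.
  by rewrite -(nrm_rotation _ _ N) E1 E2 nrmZ gtr0_norm.
by rewrite -E3 -E4 nrmZ gtr0_norm // nrm_rotation.
Qed.

Lemma well_shape_half (lam be : R -> R) (h k sg c C x0 xp a : R) : primitive lam (fun x => be x / h) ->
  0 < h -> 0 < k -> 0 < sg -> sg ^+ 2 * k = h -> well_shape be k c C x0 xp a ->
  half_well lam be h k sg c C x0 xp a.
Proof. by move=> hl h0 k0 sg0 sk [H1 H2 H3 H4]; split. Qed.

(** The minimality of s enters here: [floquet_exists] yields a solution with parameter at most s1 =
    2 / sqrt (V Vo), so s <= s1, that is s^2 V Vo <= 4, the hypothesis of [pair_concentration]. *)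
Lemma concentration (G G1 G2 : R -> R) (a b de : R) : profile G G1 G2 a b -> 0 < de ->
  exists ka K : R, [/\ 0 < ka, 0 < K &
  forall (h sg k y xp xm ga m s C S : R) (lam p1 q1 p2 q2 : R -> R),
  0 < h -> 0 < k -> k ^+ 2 = y -> 0 < sg -> sg ^+ 2 * k = h -> sg <= ka * k ->
  primitive lam (fun x => (y - G x) / h) -> (forall x, lam (x + T) = lam x - T * ga / h) -> de <= ga ->
  m = expR (- (T * ga / h)) -> m <= sg -> m <= 100^-1 ->
  b - T < xp < a -> a < xm < b -> G xp = y -> G xm = y ->
  0 <= s -> sol s (wt lam) p1 q1 -> sol s (wt lam) p2 q2 ->
  C ^+ 2 + S ^+ 2 = 1 -> quasi_periodic m C S p1 p2 q1 q2 ->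
  (forall s' p1' q1' p2' q2', 0 < s' -> sol s' (wt lam) p1' q1' -> sol s' (wt lam) p2' q2' ->
     quasi_periodic m C S p1' p2' q1' q2' ->
     ~ [/\ p1' 0 = 0, q1' 0 = 0, p2' 0 = 0 & q2' 0 = 0] -> s <= s') ->
  (forall x, integ (fun x => nrm (p1 x) (p2 x) ^+ 2 * (wt lam x)^-1) x (x + T) = 1) ->
  (forall x, integ (fun x => nrm (q1 x) (q2 x) ^+ 2 * wt lam x) x (x + T) = 1) ->
  exists x0,
  [/\ 0 < s,
      integ (fun x => `|x - xp| * (nrm (p1 x) (p2 x) ^+ 2 * (wt lam x)^-1)) x0 (x0 + T) <= K * sg,
      integ (fun x => `|x - xm| * (nrm (q1 x) (q2 x) ^+ 2 * wt lam x)) x0 (x0 + T) <= K * sg &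
      nrm (p1 x0) (p2 x0) * nrm (q1 x0) (q2 x0) <= K * s * sg]].
Proof.
move=> HP de0; have [c [C [c0 c1 C1 HG]]] := well_geometry HP de0.
have [Y [K [Y1 K0 HC]]] := pair_concentration c0 c1 C1.
have [Y' Y1' HT] := fundamental_trace c0 c1 C1.
have T0 := @two_pi_gt0 R.
have kp := kap_gt0 C c0.
have kc : 0 < kap c C / c by rewrite divr_gt0.
have YY : 0 < Y + Y' + kap c C / c by rewrite !addr_gt0 // (lt_le_trans ltr01).
exists (kap c C / (Y + Y' + kap c C / c)), K; split => //; first by rewrite divr_gt0.
move=> h sg k y xp xm ga m s Co Si lam p1 q1 p2 q2 h0 k0 ky sg0 sk sgk hl lT dega Em ms m100 xpr xmr Gp Gm
  s0 hs1 hs2 N Q Hmin np nq.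
have hn : h != 0 by rewrite gt_eqF.
have hL : primitive (fun x => h * lam x) (fun x => y - G x).
  by apply: prim_eq (primZ h hl) _ => x; field.
have LT x : h * lam (x + T) = h * lam x - T * ga by rewrite lT; field.
have [kC [x0 [W1 W2 W3]]] := HG y k xp xm ga _ k0 ky hL LT dega xpr xmr Gp Gm.
have m0 : 0 < m by rewrite Em expR_gt0.
have lr : primitive (reflect_fun lam) (fun x => (y - G (- x)) / h).
  exact: prim_reflect hl.
have D : double_well lam (fun x => y - G x) h k sg c C x0 xp a xm (x0 + T) m.
  have l0 : lam x0 = lam a + pi * ga / h.
    have -> : lam x0 = h * lam x0 / h by field.
    by rewrite -(subrK (h * lam a) (h * lam x0)) W3; field.
  split => //; first exact: well_shape_half.
  - exact: well_shape_half.
  - by rewrite /wt l0 Em -expRD; congr expR; field.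
  by rewrite /wt lT l0 Em -expRD; congr expR; field.
pose yy := kap c C * k / sg.
have Ey : sg * yy = kap c C * k by rewrite /yy; field; rewrite gt_eqF.
have Yy : Y + Y' + kap c C / c <= yy.
  rewrite ler_pdivlMr // mulrC; move: sgk; rewrite mulrAC ler_pdivlMr //.
have Yy1 : Y <= yy by move: Yy Y1' kc; clear => *; lra.
have Yy2 : Y' <= yy by move: Yy Y1 kc; clear => *; lra.
pose VV := vol lam x0 a * vol (reflect_fun lam) (- (x0 + T)) (- a).
have cW := wt_cont hl; have W0 := wt_gt0 lam.
have dwl := dw_left D; have dwr := dw_right D.
have kapc : kap c C / c <= yy by move: Yy Y1 Y1'; clear => *; lra.
have VV0 : 0 < VV.
  have A1 := half_depth c0 c1 C1 dwl Ey kapc; have A2 := half_depth c0 c1 C1 dwr Ey kapc.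
  have yy0 : 0 < yy by rewrite divr_gt0 // mulr_gt0.
  have ky0 : 0 < k * yy by rewrite mulr_gt0.
  by rewrite mulr_gt0 //; [rewrite -(pmulr_lgt0 _ (W0 a))|rewrite -(pmulr_lgt0 _ (wt_gt0 (reflect_fun lam) (- a)))]; exact: lt_le_trans ky0 _.
pose s1 := 2 / Num.sqrt VV.
have sV0 : 0 < Num.sqrt VV by rewrite sqrtr_gt0.
have s10 : 0 <= s1 by rewrite divr_ge0 // ltW.
have Es1 : s1 ^+ 2 * VV = 4.
  by rewrite /s1 -[in X in _ * X = _](sqr_sqrtr (ltW VV0)); field; rewrite gt_eqF.
have WT x : wt lam (x + T) = m ^+ 2 * wt lam x.
  by rewrite /wt lT Em -expRM_natl -expRD; congr expR; field.
have m1 : 0 < m < 1.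
  by rewrite m0 (le_lt_trans m100) // invf_lt1 ?ltr0n // ltr1n.
have [s' [p1' [q1' [p2' [q2' [/andP[s'0 s's1] S1 S2 Q' nz]]]]]] := floquet_exists W0 cW WT m1 N s10
  (fun u1 v1 u2 v2 a1 a2 a3 a4 a5 a6 => HT _ _ _ _ _ _ _ _ _ _ _ _ _ _ _ _ _ D Ey Yy2 s10 Es1 a1 a2 a3 a4 a5 a6).
have ss1 : s <= s1 by apply: le_trans s's1; exact: Hmin S1 S2 Q' nz.
have sVV : s ^+ 2 * VV <= 4.
  by rewrite -Es1 ler_wpM2r ?(ltW VV0) // ler_sqr.
have [F1 F2] := quasi_periodic_nrm x0 m0 N Q.
by exists x0; apply: HC D Ey Yy1 s0 sVV hs1 hs2 F1 F2 (np x0) (nq x0).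
Qed.

End Concentration.

(** * From the ground states to p and q *)

Section GroundStates.
Variable R : realType.
Notation mu := (@lebesgue_measure R).
Notation T := (2 * pi : R).
Notation I := (`[0, 2 * pi : R]%classic).
Variables (g : R -> R[i]) (h : R) (z : R[i]).
Hypotheses (hg : csmooth_circle g) (h0 : 0 < h).
Notation A := (op_shift (P_op g h) z).
Notation W := (sq_weight g h z).

Lemma shift_scale (c : R[i]) u v : A u v -> A (fun x => c * u x) (fun x => c * v x).
Proof.
move=> [v1 [w Hw E1] E2]; exists (fun x => c * v1 x).
  exists (fun x => c * w x); first exact: weakD_scale.
  by apply/funext => x; rewrite E1; apply: cplx_eq; rewrite !cparts; ring.
by apply/funext => x; rewrite E2; apply: cplx_eq; rewrite !cparts; ring.
Qed.

Lemma L2normZ_sqr (c : R[i]) u : L2 u -> L2norm (fun x => c * u x) ^+ 2 = normc c ^+ 2 * L2norm u ^+ 2.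
Proof.
move=> Lu; have Lc := L2Z c Lu.
have := dotp_self Lc; rewrite dotpZl // dotpZr // (dotp_self Lu) -!L2norm_sqr // => /(congr1 (@complex.Re R)) /= <-.
by rewrite !cparts normc_sqr /=; ring.
Qed.

Lemma normc_conj (c : R[i]) : normc (conjc c) = normc c.
Proof. by case: c => a b; rewrite /normc /= sqrrN. Qed.

Lemma normc_real (x : R) : normc (x%:C) = `|x|.
Proof. by rewrite /normc /= expr0n addr0 sqrtr_sqr. Qed.

Lemma normc_cis (x : R) : normc (cos x +i* sin x) = 1.
Proof. by rewrite /normc cos2Dsin2 sqrtr1. Qed.

Lemma normc_e_of p1 p2 x : normc (e_of g h z p1 p2 x) ^+ 2 = nrm (p1 x) (p2 x) ^+ 2 * (W x)^-1.
Proof.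
rewrite /e_of !normcM normc_cis mul1r normc_real exprMn; congr (_ * _).
by rewrite ger0_norm ?expR_ge0 // /sq_weight -expRN -expRM_natl; congr expR; ring.
Qed.

Lemma normc_f_of q1 q2 x : normc (f_of g h z q1 q2 x) ^+ 2 = nrm (q1 x) (q2 x) ^+ 2 * W x.
Proof.
rewrite /f_of !normcM normc_cis mul1r normc_real.
have -> : normc (0 +i* 1 : R[i]) = 1 by rewrite /normc expr0n expr1n add0r sqrtr1.
rewrite mul1r exprMn; congr (_ * _).
by rewrite ger0_norm ?expR_ge0 // /sq_weight -expRM_natl; congr expR; ring.
Qed.

Lemma e_f_product p1 p2 q1 q2 x :
  e_of g h z p1 p2 x * conjc (f_of g h z q1 q2 x) =
  (p2 x * q1 x - p1 x * q2 x) +i* (- (p1 x * q1 x + p2 x * q2 x)).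
Proof.
have EE : expR (- lweight g h z x) * expR (lweight g h z x) = 1 by rewrite -expRD addNr expR0.
have N := cos2Dsin2 (phase g h z x).
rewrite /e_of /f_of; move: (expR (- lweight g h z x)) (expR (lweight g h z x)) (cos (phase g h z x)) (sin (phase g h z x)) EE N => E F c s EE N.
apply: cplx_eq; rewrite !cparts /=.
  transitivity ((c ^+ 2 + s ^+ 2) * (E * F) * (p2 x * q1 x - p1 x * q2 x)); first by ring.
  by rewrite N EE; ring.
transitivity ((c ^+ 2 + s ^+ 2) * (E * F) * (- (p1 x * q1 x + p2 x * q2 x))); first by ring.
by rewrite N EE; ring.
Qed.

Lemma integ_period (f : R -> R) (x : R) : continuous f -> periodic f T ->
  \int[mu]_(t in I) f t = integ f x (x + T).
Proof.
by move=> cf pf; rewrite (Rintegral_shift x (prim_integ x cf) cf pf) integ_aa // subr0.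
Qed.

Lemma dotp_real (f : R -> R) u v : (forall x, u x * conjc (v x) = (f x)%:C) ->
  dotp u v = (\int[mu]_(t in I) f t)%:C.
Proof.
move=> E; apply: cplx_eq => /=.
  by apply: eq_Rintegral => x _; rewrite E.
rewrite (@eq_Rintegral _ _ _ mu _ (fun _ => 0)) ?Rintegral_cst ?mul0r // => x _.
by rewrite E.
Qed.

Lemma smooth_circleM (chi : R -> R) F : smooth_circle chi -> csmooth_circle F ->
  csmooth_circle (fun x => (chi x)%:C * F x).
Proof.
move=> [pc sc] [[p1 s1] [p2 s2]]; split; split.
- by move=> x; rewrite !cparts /= pc p1 p2.
- rewrite (_ : (fun x => _) = fun x => chi x * complex.Re (F x)); first exact: smoothM.
  by apply/funext => x; rewrite !cparts /=; ring.
- by move=> x; rewrite !cparts /= pc p1 p2.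
rewrite (_ : (fun x => _) = fun x => chi x * complex.Im (F x)); first exact: smoothM.
by apply/funext => x; rewrite !cparts /=; ring.
Qed.

(** (P - z) e0 is an eigenfunction of the second operator for the same simple eigenvalue, so f0 is a
    multiple of it and the norms fix the modulus of the factor. The commutator is (P - z) chi - chi
    (P - z); moving P - z to the other side of the product gives t^2 times the masses of chi against
    |e|^2 and |f|^2. *)
Lemma ground_pair (t : R) (e0 f0 : R -> R[i]) : lweight g h z T != 0 -> 0 <= t ->
  lowest_simple_eigenvalue (Q_op g h z) (t ^+ 2) ->
  lowest_simple_eigenvalue (Qt_op g h z) (t ^+ 2) ->
  eigenfunction (Q_op g h z) (t ^+ 2) e0 -> L2norm e0 = 1 ->
  eigenfunction (Qt_op g h z) (t ^+ 2) f0 -> L2norm f0 = 1 ->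
  exists p1 q1 p2 q2 : R -> R,
  [/\ 0 < t /\ (sol (t / h) W p1 q1 /\ sol (t / h) W p2 q2 /\ floquet g h z p1 p2 q1 q2),
      forall s p1' q1' p2' q2', 0 < s -> sol s W p1' q1' -> sol s W p2' q2' -> floquet g h z p1' p2' q1' q2' ->
        ~ [/\ p1' 0 = 0, q1' 0 = 0, p2' 0 = 0 & q2' 0 = 0] -> t / h <= s,
      (forall x, integ (fun y => nrm (p1 y) (p2 y) ^+ 2 * (W y)^-1) x (x + T) = 1) /\
      (forall x, integ (fun y => nrm (q1 y) (q2 y) ^+ 2 * W y) x (x + T) = 1),
      normc (dotp e0 f0) = normc (dotp (e_of g h z p1 p2) (f_of g h z q1 q2)) &
      forall (chi : R -> R) w, smooth_circle chi -> op_comm (P_op g h) chi e0 w -> forall x,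
        normc (dotp w f0) = t * `|integ (fun y => chi y * (nrm (p1 y) (p2 y) ^+ 2 * (W y)^-1)
                                               - chi y * (nrm (q1 y) (q2 y) ^+ 2 * W y)) x (x + T)|].
Proof.
move=> lT t0 [_ Qmin _] [_ _ Qts] He ne Hf nf.
have [v [Lv Av Hv nv [D1 D2 Adj]]] := eigen_weak_pair hg h0 t0 He.
rewrite ne expr1n mulr1 in nv.
have [p1 [q1 [p2 [q2 [S1 S2 Fl ae1 ae2]]]]] := classical_pair hg h0 D1 D2.
exists p1, q1, p2, q2.
have sE := e_of_smooth hg S1 S2 Fl; have sF := f_of_smooth hg S1 S2 Fl.
set E := e_of g h z p1 p2 in ae1 sE *; set F := f_of g h z q1 q2 in ae2 sF *.
have cE := csmooth_cont sE; have cF := csmooth_cont sF.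
have LE := L2_cont cE; have LF := L2_cont cF.
have [Le _ _] := He; have [Lf0 _ _] := Hf.
have m0 : 0 < expR (lweight g h z T) by exact: expR_gt0.
have N := cos2Dsin2 (phase g h z T).
have nE : L2norm E = 1 by rewrite -ne; symmetry; exact: L2norm_eq_ae.
(* For t = 0 the functions p1 and p2 are constant, and a Floquet factor different from 1 forces them
   to vanish. *)
have tn : t != 0.
  apply/eqP => tz; have [[h1 _] [h2 _]] := (S1, S2).
  have cst p q : primitive p (fun x => - (t / h * W x) * q x) -> forall x, p (x + T) = p x.
    move=> hp x; apply/eqP; rewrite -subr_eq0; apply/eqP.
    have hp' : primitive p (fun=> 0) by apply: prim_eq hp _ => y; rewrite tz !mul0r oppr0 mul0r.
    by rewrite (prim_unique hp' (prim_cst 0) (x + T) x) subrr.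
  have z0 x : nrm (p1 x) (p2 x) = 0.
    have [+ _] := quasi_periodic_nrm x m0 N Fl; rewrite (cst _ _ h1) (cst _ _ h2).
    move=> /eqP; rewrite -subr_eq0 -{1}[nrm _ _]mul1r -mulrBl mulf_eq0 => /orP[|/eqP //].
    rewrite subr_eq0 => /eqP H; have := lT; rewrite (_ : lweight g h z T = 0) ?eqxx //.
    by apply: (@expR_inj R); rewrite -H expR0.
  have E0 : E = fun=> 0.
    apply/funext => x; rewrite /E /e_of; have [-> ->] := nrm0 (z0 x).
    by apply: cplx_eq; rewrite !cparts /=; ring.
  have := L2norm_sqr LE; rewrite nE expr1n E0.
  rewrite (@eq_Rintegral _ _ _ mu _ (fun _ => 0)) ?Rintegral_cst ?mul0r // => [/eqP|x _].
    by rewrite oner_eq0.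
  by rewrite normc0 expr0n.
have tp : 0 < t by rewrite lt_neqAle eq_sym tn.
have nvt : L2norm v = t.
  by apply/eqP; rewrite -(eqrXn2 (n := 2)) // ?L2norm_ge0 // nv.
have aev : aeq v (fun x => t%:C * F x).
  apply: ae_mono ae2 => x H xT; rewrite -(H xT) mulrA -realCM mulfV // mul1r; reflexivity.
have LtF := L2Z t%:C LF.
have nF : L2norm F = 1.
  have := L2norm_eq_ae Lv LtF aev; rewrite nvt => /(congr1 (fun r => r ^+ 2)).
  rewrite L2normZ_sqr; last exact: LF.
  rewrite normc_real real_normK; last exact: num_real.
  move=> E1; apply/eqP; rewrite -sqrp_eq1; last exact: L2norm_ge0.
  by rewrite -(inj_eq (mulfI (expf_neq0 2 tn))) mulr1 -E1.
have Qv : eigenfunction (Qt_op g h z) (t ^+ 2) v.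
  split; [exact: Lv|by rewrite nvt|].
  by exists (fun x => (t ^+ 2)%:C * e0 x); [exact: Adj|exact: shift_scale].
have [c c0] := Qts _ _ Qv Hf.
have Lcv := L2Z c Lv.
have aef : aeq f0 (fun x => c * v x).
  have := L2norm0_ae (L2B Lf0 Lcv) c0; apply: ae_mono => x H xT.
  by have /eqP := H xT; rewrite subr_eq0 => /eqP.
have ct : normc c * t = 1.
  have := L2norm_eq_ae Lf0 Lcv aef; rewrite nf => /(congr1 (fun r => r ^+ 2)).
  rewrite L2normZ_sqr // nvt expr1n -exprMn => /esym/eqP; rewrite sqrp_eq1; first by move/eqP.
  by rewrite mulr_ge0 // /normc; case: (c) => *; exact: sqrtr_ge0.
have cW : continuous W by exact: sq_weight_cont.
have W0 x : 0 < W x by exact: expR_gt0.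
have cWV : continuous (fun x => (W x)^-1).
  by move=> x; apply: cvgV; [rewrite gt_eqF|exact: cW].
have [[h1 k1] [h2 k2]] := (S1, S2).
have sqc (u : R -> R) : continuous u -> continuous (fun x => u x ^+ 2).
  move=> cu; rewrite (_ : (fun x => _) = fun x => u x * u x); first exact: mul_cont.
  by apply/funext => x; rewrite expr2.
have cep : continuous (fun x => nrm (p1 x) (p2 x) ^+ 2 * (W x)^-1).
  apply: mul_cont cWV; apply: (sqc (fun x => nrm (p1 x) (p2 x))).
  exact: nrm_cont (prim_continuous h1) (prim_continuous h2).
have cfq : continuous (fun x => nrm (q1 x) (q2 x) ^+ 2 * W x).
  apply: mul_cont cW; apply: (sqc (fun x => nrm (q1 x) (q2 x))).
  exact: nrm_cont (prim_continuous k1) (prim_continuous k2).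
have pep : periodic (fun x => nrm (p1 x) (p2 x) ^+ 2 * (W x)^-1) T.
  by move=> x; rewrite -!normc_e_of; case: cE => pE _ _; rewrite -/E pE.
have pfq : periodic (fun x => nrm (q1 x) (q2 x) ^+ 2 * W x) T.
  by move=> x; rewrite -!normc_f_of; case: cF => pF _ _; rewrite -/F pF.
split.
- by split.
- move=> s p1' q1' p2' q2' s0 S1' S2' Fl' nz.
  have hs : h * s / h = s by field; rewrite gt_eqF.
  have hs0 : 0 < h * s by rewrite mulr_gt0.
  have := @e_of_eigenfunction R g h z hg h0 (h * s) p1' q1' p2' q2' hs0; rewrite hs.
  move=> /(_ S1' S2' Fl' nz)/Qmin; rewrite ler_sqr ?nnegrE ?(ltW hs0) // => H.
  by rewrite ler_pdivrMr // mulrC.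
- split => x.
    rewrite -(integ_period x cep pep); transitivity (L2norm E ^+ 2); last by rewrite nE expr1n.
    rewrite L2norm_sqr //; by apply: eq_Rintegral => y _; rewrite -normc_e_of.
  rewrite -(integ_period x cfq pfq); transitivity (L2norm F ^+ 2); last by rewrite nF expr1n.
  rewrite L2norm_sqr //; by apply: eq_Rintegral => y _; rewrite -normc_f_of.
- rewrite (dotp_aer Le Lf0 Lcv aef) dotpZr // (dotp_aer Le Lv LtF aev) dotpZr // (dotp_ael Le LE LF ae1).
  by rewrite !normcM !normc_conj normc_real gtr0_norm // mulrA ct mul1r.
move=> chi w sc [v1 [v2 [Pv1 Pv2 ->]]] x.
have Au1 : A e0 (fun y => v1 y - z * e0 y) by exists v1.
have Au2 : A (fun y => (chi y)%:C * e0 y) (fun y => v2 y - z * ((chi y)%:C * e0 y)) by exists v2.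
set u1 := (fun y => v1 y - z * e0 y) in Au1; set u2 := (fun y => v2 y - _) in Au2.
have [_ Lu1] := shift_L2 hg Au1; have [Lce Lu2] := shift_L2 hg Au2.
have cc := csmooth_cont (real_csmooth sc).
have Lcu1 := L2M cc Lu1.
have -> : (fun y => v2 y - (chi y)%:C * v1 y) = fun y => u2 y - (chi y)%:C * u1 y.
  by apply/funext => y; rewrite /u1 /u2; apply: cplx_eq; rewrite !cparts /=; ring.
have Lw := L2B Lu2 Lcu1.
rewrite (dotp_aer Lw Lf0 Lcv aef) dotpZr // dotpBl //.
have LcE := L2M cc LE; have LcF := L2M cc LF.
have sCF := smooth_circleM sc sF.
have X1 : dotp u2 v = (t ^+ 2)%:C * (\int[mu]_(y in I) (chi y * (nrm (p1 y) (p2 y) ^+ 2 * (W y)^-1)))%:C.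
  rewrite (Hv _ _ Au2) dotpZr // conj_realC; congr (_ * _).
  have aec : aeq (fun y => (chi y)%:C * e0 y) (fun y => (chi y)%:C * E y).
    exact: (aeq_map (fun y a => (chi y)%:C * a) ae1).
  rewrite (dotp_ael Lce LcE Le aec) (dotp_aer LcE Le LE ae1).
  apply: dotp_real => y; rewrite -normc_e_of -/E normc_sqr; apply: cplx_eq; rewrite !cparts /=; ring.
have X2 : dotp (fun y => (chi y)%:C * u1 y) v = (t ^+ 2)%:C * (\int[mu]_(y in I) (chi y * (nrm (q1 y) (q2 y) ^+ 2 * W y)))%:C.
  (* [u1] and [v] both represent (P - z) e0; pairing with a smooth function through the formal
     adjoint identifies them. *)
  have e1 : dotp u1 (fun y => (chi y)%:C * F y) = dotp v (fun y => (chi y)%:C * F y).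
    by rewrite (shift_adjoint hg sCF Au1) (shift_adjoint hg sCF Av).
  have e2 : dotp v (fun y => (chi y)%:C * F y) = t%:C * dotp F (fun y => (chi y)%:C * F y).
    by rewrite (dotp_ael Lv LtF LcF aev) dotpZl.
  rewrite (dotp_aer Lcu1 Lv LtF aev) dotpZr // conj_realC dotp_move.
  rewrite (_ : (fun y => conjc (chi y)%:C * F y) = fun y => (chi y)%:C * F y); last first.
    by apply/funext => y; rewrite conj_realC.
  rewrite e1 e2 mulrA -realCM -expr2; congr (_ * _).
  apply: dotp_real => y; rewrite -normc_f_of -/F normc_sqr; apply: cplx_eq; rewrite !cparts /=; ring.
have [cchi pchi] : continuous chi /\ periodic chi T by case: sc => ? ?; split => //; exact: smooth_continuous.
have pce : periodic (fun y => chi y * (nrm (p1 y) (p2 y) ^+ 2 * (W y)^-1)) T by move=> y; rewrite pchi pep.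
have pcf : periodic (fun y => chi y * (nrm (q1 y) (q2 y) ^+ 2 * W y)) T by move=> y; rewrite pchi pfq.
have cce := mul_cont cchi cep; have ccf := mul_cont cchi cfq.
rewrite X1 X2 (integ_period x cce pce) (integ_period x ccf pcf).
have -> : integ (fun y => chi y * (nrm (p1 y) (p2 y) ^+ 2 * (W y)^-1)
   - chi y * (nrm (q1 y) (q2 y) ^+ 2 * W y)) x (x + T) =
   integ (fun y => chi y * (nrm (p1 y) (p2 y) ^+ 2 * (W y)^-1)) x (x + T)
   - integ (fun y => chi y * (nrm (q1 y) (q2 y) ^+ 2 * W y)) x (x + T).
  rewrite (integ_prim _ _ _ (primB (prim_integ x cce) (prim_integ x ccf))) ?integ_aa // ?subr0 ?subrr ?subr0 //.
  by move=> y; apply: cvgB; [exact: cce|exact: ccf].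
have X (u u' : R) : (t ^+ 2)%:C * u%:C - (t ^+ 2)%:C * u'%:C = (t ^+ 2 * (u - u'))%:C :> R[i].
  by apply: cplx_eq; rewrite !cparts /=; ring.
rewrite X normcM normc_conj normc_real normrM ger0_norm ?sqr_ge0 // mulrA expr2 mulrA ct mul1r; reflexivity.
Qed.

End GroundStates.

(** * First moments, mass of the cut-off and overlap over one period *)

Section Windows.
Variable R : realType.
Notation T := (2 * pi : R).

Lemma integB (f k : R -> R) (a b : R) : continuous f -> continuous k ->
  integ (fun x => f x - k x) a b = integ f a b - integ k a b.
Proof.
move=> cf ck; rewrite (integ_prim _ _ _ (primB (prim_integ a cf) (prim_integ a ck))) ?integ_aa //.
  by rewrite subrr subr0.
by move=> y; apply: cvgB; [exact: cf|exact: ck].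
Qed.

Lemma cont_shift_abs (b : R) : continuous (fun x : R => `|x - b|).
Proof. by apply: abs_cont => x; apply: cvgB; [exact: cvg_id|exact: cvg_cst]. Qed.

Lemma integ_abs_le (f k : R -> R) (a b : R) : continuous f -> continuous k -> a <= b ->
  (forall x, a <= x <= b -> `|f x| <= k x) -> `|integ f a b| <= integ k a b.
Proof.
move=> cf ck ab H; rewrite ler_norml; apply/andP; split.
  rewrite -mulN1r -integZ //; apply: integ_le => //.
    by move=> x; apply: cvgMl_tmp; exact: ck.
  by move=> x xx; rewrite mulN1r lerNl (le_trans _ (H x xx)) // -normrN ler_norm.
by apply: integ_le => // x xx; apply: le_trans (ler_norm _) (H x xx).
Qed.

Lemma moment_split (E : R -> R) (x0 x1 c K : R) : continuous E -> (forall x, 0 <= E x) -> x0 <= x1 ->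
  integ E x0 x1 = 1 -> integ (fun x => `|x - c| * E x) x0 x1 <= K ->
  `|integ (fun x => (x - x0) * E x) x0 x1 - (c - x0)| <= K.
Proof.
move=> cE E0 x01 E1 HK; apply: le_trans HK.
have c1 (b : R) : continuous (fun x : R => x - b) by move=> x; apply: cvgB; [exact: cvg_id|exact: cvg_cst].
have -> : integ (fun x => (x - x0) * E x) x0 x1 - (c - x0) = integ (fun x => (x - c) * E x) x0 x1.
  rewrite -[X in _ - X]mulr1 -E1 -integZ // -integB //; last first.
  - by move=> x; apply: cvgMl_tmp; exact: cE.
  - exact: mul_cont.
  by congr (integ _ _ _); apply/funext => x; ring.
apply: integ_abs_le => //; [exact: (mul_cont (c1 c) cE)|exact: (mul_cont (@cont_shift_abs c) cE)|].
by move=> x _; rewrite normrM (ger0_norm (E0 x)).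
Qed.

(** Markov's inequality: the mass of E at distance at least r from [xe] is at most K / r, and
    likewise for F around [xf]. *)
Lemma cutoff_mass (E F chi : R -> R) (x0 x1 xe xf K r M : R) : continuous E -> continuous F -> continuous chi ->
  (forall x, 0 <= E x) -> (forall x, 0 <= F x) -> x0 <= x1 -> integ F x0 x1 = 1 ->
  integ (fun x => `|x - xe| * E x) x0 x1 <= K -> integ (fun x => `|x - xf| * F x) x0 x1 <= K ->
  0 < r -> (forall x, `|chi x| <= M) ->
  (forall x, `|x - xf| < r -> chi x = 1) -> (forall x, `|x - xe| < r -> chi x = 0) ->
  `| `|integ (fun x => chi x * E x - chi x * F x) x0 x1| - 1| <= (1 + 2 * M) * K / r.
Proof.
move=> cE cF cc E0 F0 x01 F1 HE HF r0 HM H1 H0.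
have M0 : 0 <= M by exact: le_trans (HM 0).
have ccE := mul_cont cc cE; have ccF := mul_cont cc cF.
have cmE := mul_cont (@cont_shift_abs xe) cE; have cmF := mul_cont (@cont_shift_abs xf) cF.
have A : `|integ (fun x => chi x * E x) x0 x1| <= M / r * K.
  have cM : continuous (fun x => M / r * (`|x - xe| * E x)) by move=> x; apply: cvgMl_tmp; exact: cmE.
  apply: le_trans (integ_abs_le ccE cM x01 _) _; last first.
    by rewrite integZ // ler_wpM2l // divr_ge0 // ltW.
  move=> x _; rewrite normrM (ger0_norm (E0 x)) mulrA ler_wpM2r //.
  have [lt|le] := ltP `|x - xe| r; first by rewrite H0 // normr0 mulr_ge0 ?divr_ge0 // ltW.
  by rewrite (le_trans (HM x)) // mulrAC ler_pdivlMr // ler_wpM2l.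
have B : `|integ (fun x => chi x * F x) x0 x1 - 1| <= (1 + M) / r * K.
  have cM : continuous (fun x => (1 + M) / r * (`|x - xf| * F x)) by move=> x; apply: cvgMl_tmp; exact: cmF.
  have -> : integ (fun x => chi x * F x) x0 x1 - 1 = integ (fun x => chi x * F x - F x) x0 x1 by rewrite integB // F1.
  have cD : continuous (fun x => chi x * F x - F x) by move=> x; apply: cvgB; [exact: ccF|exact: cF].
  apply: le_trans (integ_abs_le cD cM x01 _) _; last first.
    by rewrite integZ // ler_wpM2l // divr_ge0 ?addr_ge0 // ltW.
  move=> x _; rewrite -[X in _ - X]mul1r -mulrBl normrM (ger0_norm (F0 x)) mulrA ler_wpM2r //.
  have [lt|le] := ltP `|x - xf| r; first by rewrite H1 // subrr normr0 mulr_ge0 ?divr_ge0 ?addr_ge0 // ltW.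
  have -> : (1 + M) / r * `|x - xf| = (1 + M) * (`|x - xf| / r) by ring.
  apply: (@le_trans _ _ (1 + M)).
    by apply: le_trans (ler_normB _ _) _; rewrite normr1 addrC lerD2l.
  by rewrite ler_peMr ?addr_ge0 // ler_pdivlMr // mul1r.
rewrite integB //.
set u := integ (fun x => chi x * E x) x0 x1 in A *; set v := integ (fun x => chi x * F x) x0 x1 in B *.
have -> : (1 + 2 * M) * K / r = M / r * K + (1 + M) / r * K by ring.
move: u v (M / r * K) ((1 + M) / r * K) A B; clear => u v al be A B.
have /ler_normlP[a1 a2] := A; have /ler_normlP[b1 b2] := B.
have n1 := ler_normB u v; have [e|e] := leP 0 v.
  rewrite (ger0_norm e) in n1.
  have n2 := ler_norm (- (u - v)); rewrite normrN in n2.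
  rewrite ler_norml; apply/andP; split; move: A a1 a2 b1 b2 n1 n2; clear => *; lra.
have n2 := ler_norm (- (u - v)); rewrite normrN in n2.
rewrite (ltr0_norm e) in n1.
rewrite ler_norml; apply/andP; split; move: A a1 a2 b1 b2 n1 n2 e; clear => *; lra.
Qed.

Lemma quasi_periodic_product (m C S : R) p1 p2 q1 q2 x : 0 < m -> C ^+ 2 + S ^+ 2 = 1 ->
  quasi_periodic m C S p1 p2 q1 q2 ->
  p1 (x + T) * q1 (x + T) + p2 (x + T) * q2 (x + T) = p1 x * q1 x + p2 x * q2 x.
Proof.
move=> m0 N /(_ x) [E1 E2 E3 E4]; rewrite -E3 -E4.
have -> : p1 x * (m * (C * q1 (x + T) - S * q2 (x + T))) + p2 x * (m * (C * q2 (x + T) + S * q1 (x + T))) =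
  (m * p1 x) * (C * q1 (x + T) - S * q2 (x + T)) + (m * p2 x) * (C * q2 (x + T) + S * q1 (x + T)) by ring.
rewrite -E1 -E2 -[LHS]mul1r -N; ring.
Qed.

(** [P] is minus the imaginary part of e conj(f), periodic with derivative s (E - F). By parts, its
    integral is T P(x0) plus s times the difference of the first moments of F and E. The real part
    is a Wronskian, hence constant. This constant and P(x0) are both bounded by |p(x0)| |q(x0)|,
    which is small. *)
Lemma overlap_window (W : R -> R) (s m C S x0 xe xf K : R) p1 q1 p2 q2 :
  (forall x, 0 < W x) -> continuous W -> 0 < m -> C ^+ 2 + S ^+ 2 = 1 -> 0 <= s ->
  sol s W p1 q1 -> sol s W p2 q2 -> quasi_periodic m C S p1 p2 q1 q2 ->
  integ (fun x => nrm (p1 x) (p2 x) ^+ 2 * (W x)^-1) x0 (x0 + T) = 1 ->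
  integ (fun x => nrm (q1 x) (q2 x) ^+ 2 * W x) x0 (x0 + T) = 1 ->
  integ (fun x => `|x - xe| * (nrm (p1 x) (p2 x) ^+ 2 * (W x)^-1)) x0 (x0 + T) <= K ->
  integ (fun x => `|x - xf| * (nrm (q1 x) (q2 x) ^+ 2 * W x)) x0 (x0 + T) <= K ->
  nrm (p1 x0) (p2 x0) * nrm (q1 x0) (q2 x0) <= K * s ->
  `|nrm (integ (fun x => p2 x * q1 x - p1 x * q2 x) x0 (x0 + T))
        (integ (fun x => p1 x * q1 x + p2 x * q2 x) x0 (x0 + T)) - s * `|xf - xe| | <= (2 * T + 2) * K * s.
Proof.
move=> W0 cW m0 N s0 S1 S2 Q e1 f1 em fm pq.
have [[h1 k1] [h2 k2]] := (S1, S2).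
have c1 := prim_continuous h1; have c2 := prim_continuous h2.
have d1 := prim_continuous k1; have d2 := prim_continuous k2.
have T0 := @two_pi_gt0 R.
have x01 : x0 <= x0 + T by rewrite lerDl ltW.
have cWV : continuous (fun x => (W x)^-1) by move=> x; apply: cvgV; [rewrite gt_eqF|exact: cW].
have sqc (u : R -> R) : continuous u -> continuous (fun x => u x ^+ 2).
  move=> cu; rewrite (_ : (fun x => _) = fun x => u x * u x); first exact: mul_cont.
  by apply/funext => x; rewrite expr2.
set E := fun x => nrm (p1 x) (p2 x) ^+ 2 * (W x)^-1 in e1 em *.
set F := fun x => nrm (q1 x) (q2 x) ^+ 2 * W x in f1 fm *.
have cE : continuous E := mul_cont (sqc (fun x => nrm (p1 x) (p2 x)) (nrm_cont c1 c2)) cWV.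
have cF : continuous F := mul_cont (sqc (fun x => nrm (q1 x) (q2 x)) (nrm_cont d1 d2)) cW.
have E0 x : 0 <= E x by rewrite mulr_ge0 ?sqr_ge0 // invr_ge0 ltW.
have F0 x : 0 <= F x by rewrite mulr_ge0 ?sqr_ge0 // ltW.
pose P x := p1 x * q1 x + p2 x * q2 x.
have cP : continuous P by move=> x; apply: cvgD; [exact: mul_cont|exact: mul_cont].
have hP : primitive P (fun x => s * (E x - F x)).
  apply: prim_eq (primD (primM h1 k1) (primM h2 k2)) _ => x.
  by rewrite /E /F !nrm_sqr; ring.
have cEF : continuous (fun x => E x - F x) by move=> x; apply: cvgB; [exact: cE|exact: cF].
have cx : continuous (fun x : R => x - x0) by move=> x; apply: cvgB; [exact: cvg_id|exact: cvg_cst].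
have hxP : primitive (fun x => (x - x0) * P x - s * integ (fun t => (t - x0) * (E t - F t)) x0 x) P.
  have hx := primB (@prim_id R) (prim_cst x0).
  have hi := prim_integ x0 (mul_cont cx cEF).
  by apply: prim_eq (primB (primM hx hP) (primZ s hi)) _ => x /=; ring.
have IP : integ P x0 (x0 + T) = T * P x0 - s * (integ (fun t => (t - x0) * E t) x0 (x0 + T)
    - integ (fun t => (t - x0) * F t) x0 (x0 + T)).
  rewrite (integ_prim _ _ cP hxP) integ_aa; last exact: mul_cont.
  have -> : P (x0 + T) = P x0 := quasi_periodic_product x0 m0 N Q.
  rewrite -integB; [|exact: mul_cont|exact: mul_cont].
  have -> : (fun t => (t - x0) * E t - (t - x0) * F t) = fun t => (t - x0) * (E t - F t).
    by apply/funext => t; rewrite mulrBr.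
  ring.
have IA : integ (fun x => p2 x * q1 x - p1 x * q2 x) x0 (x0 + T) = T * (p2 x0 * q1 x0 - p1 x0 * q2 x0).
  have cst x : p2 x * q1 x - p1 x * q2 x = p2 x0 * q1 x0 - p1 x0 * q2 x0 := wronskian x x0 S2 S1.
  rewrite (_ : (fun x => _) = fun=> p2 x0 * q1 x0 - p1 x0 * q2 x0); last by apply/funext => x; exact: cst.
  rewrite (integ_prim _ _ (fun x => cvg_cst _) (prim_eq (primZ _ (@prim_id R)) (fun x => mulr1 _))); ring.
have P0 : `|P x0| <= K * s.
  apply: le_trans pq; rewrite ler_norml lerNl; apply/andP; split; last exact: nrm_dot.
  by have := nrm_dot (- p1 x0) (- p2 x0) (q1 x0) (q2 x0); rewrite nrmN /P opprD !mulNr.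
have A0 : `|p2 x0 * q1 x0 - p1 x0 * q2 x0| <= K * s.
  apply: le_trans pq; rewrite ler_norml lerNl.
  have sw : nrm (p2 x0) (- p1 x0) = nrm (p1 x0) (p2 x0) by rewrite /nrm sqrrN addrC.
  have := nrm_dot (p2 x0) (- p1 x0) (q1 x0) (q2 x0); have := nrm_dot (- p2 x0) (- - p1 x0) (q1 x0) (q2 x0).
  by rewrite nrmN sw !mulNr opprK opprB => a1 a2; apply/andP; split => //; rewrite addrC.
have /ler_normlP[i1 i2] := moment_split cE E0 x01 e1 em.
have /ler_normlP[i3 i4] := moment_split cF F0 x01 f1 fm.
set al := integ _ x0 _ in IA *; set be := integ P x0 _ in IP *.
have N1 : `|be| <= nrm al be.
  by apply: le_of_sqr; rewrite ?nrm_ge0 // nrm_sqr real_normK ?num_real // lerDr sqr_ge0.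
have N2 : nrm al be <= `|al| + `|be|.
  have := nrmD al 0 0 be; rewrite addr0 add0r nrm_r0; congr (_ <= _ + _).
  by rewrite /nrm expr0n add0r sqrtr_sqr.
have Nal : `|al| <= T * (K * s) by rewrite IA normrM gtr0_norm // ler_wpM2l // ltW.
have Nbe : `|be - s * (xf - xe)| <= T * (K * s) + 2 * K * s.
  have -> : be - s * (xf - xe) = T * P x0 - s * ((integ (fun t => (t - x0) * E t) x0 (x0 + T) - (xe - x0))
     - (integ (fun t => (t - x0) * F t) x0 (x0 + T) - (xf - x0))) by rewrite IP; ring.
  apply: le_trans (ler_normB _ _) _; apply: lerD; first by rewrite normrM gtr0_norm // ler_wpM2l // ltW.
  rewrite normrM (ger0_norm s0) (mulrC _ s) ler_wpM2l //.
  by rewrite ler_norml; apply/andP; split; move: i1 i2 i3 i4; clear => *; lra.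
have Es : s * `|xf - xe| = `|s * (xf - xe)| by rewrite normrM ger0_norm.
have B1 := ler_normD (be - s * (xf - xe)) (s * (xf - xe)); rewrite subrK in B1.
have B2 := ler_normB be (be - s * (xf - xe)); rewrite subKr in B2.
rewrite Es ler_norml; apply/andP; split; move: N1 N2 Nal Nbe B1 B2; clear => *; lra.
Qed.

End Windows.

(** * Overlap and commutator, for Im z on either side of the mean *)

Section Overlap.
Variable R : realType.
Notation mu := (@lebesgue_measure R).
Notation T := (2 * pi : R).
Variables (g : R -> R[i]).
Hypothesis hg : csmooth_circle g.
Notation G := (fun x => complex.Im (g x)).

Lemma lweight_mean (h : R) (z : R[i]) : lweight g h z T = T * (complex.Im z - mean_Im g) / h.
Proof.
have T0 := @two_pi_gt0 R.
have [hl l0] := lweightP h z hg.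
have [_ _ cG] := g_cont hg.
have H := prim_Rintegral (primZ h^-1 (primB (primZ (complex.Im z) (@prim_id R)) (prim_integ 0 cG))).
have HG := prim_Rintegral (prim_integ 0 cG) cG (ltW T0).
rewrite integ_aa // subr0 in HG.
have -> : mean_Im g = T^-1 * integ G 0 T by rewrite /mean_Im HG.
have hl' : primitive (fun x => h^-1 * (complex.Im z * x - integ G 0 x)) (fun x => h^-1 * im_pot g z x).
  by apply: prim_eq (primZ h^-1 (primB (primZ (complex.Im z) (@prim_id R)) (prim_integ 0 cG))) _ => x; rewrite mulr1.
have := prim_unique hl hl' T 0; rewrite l0 subr0 integ_aa // mulr0 subrr mulr0 subr0 => ->.
have E : integ G 0 T = T * (T^-1 * integ G 0 T) by rewrite mulVKf // gt_eqF.
by rewrite {1}E; move: (T^-1 * _) => v; ring.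
Qed.

Lemma wt_opp (l : R -> R) x : wt (fun y => - l y) x = (wt l x)^-1.
Proof. by rewrite /wt mulrN expRN. Qed.

(** The map (p, q) -> (q, -p) inverts the weight without reflecting the line; it exchanges the roles
    of e and f. *)
Lemma sol_swap (s : R) (l p q : R -> R) : sol s (wt l) p q ->
  sol s (wt (fun y => - l y)) q (fun x => - p x).
Proof.
move=> [hp hq]; split.
  by apply: prim_eq hq _ => x; rewrite wt_opp; ring.
by apply: prim_eq (primN hp) _ => x; rewrite wt_opp invrK; ring.
Qed.

Lemma sol_unswap (s : R) (l p q : R -> R) : sol s (wt (fun y => - l y)) p q ->
  sol s (wt l) (fun x => - q x) p.
Proof.
move=> [hp hq]; split.
  by apply: prim_eq (primN hq) _ => x; rewrite wt_opp invrK; ring.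
by apply: prim_eq hp _ => x; rewrite wt_opp; ring.
Qed.

Lemma quasi_periodic_swap (m C S : R) p1 p2 q1 q2 : 0 < m -> quasi_periodic m C S p1 p2 q1 q2 ->
  quasi_periodic m^-1 C S q1 q2 (fun x => - p1 x) (fun x => - p2 x).
Proof.
move=> m0 Q x; have [E1 E2 E3 E4] := Q x; have mn : m != 0 by rewrite gt_eqF.
split.
- by rewrite -E3 mulKf.
- by rewrite -E4 mulKf.
- by rewrite -[p1 x](mulKf mn) -E1; ring.
by rewrite -[p2 x](mulKf mn) -E2; ring.
Qed.

Lemma quasi_periodic_unswap (m C S : R) p1 p2 q1 q2 : 0 < m -> quasi_periodic m^-1 C S p1 p2 q1 q2 ->
  quasi_periodic m C S (fun x => - q1 x) (fun x => - q2 x) p1 p2.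
Proof.
move=> m0 Q x; have [E1 E2 E3 E4] := Q x; have mn : m != 0 by rewrite gt_eqF.
split.
- by rewrite -E3 -[in RHS]mulrN mulVKf //; ring.
- by rewrite -E4 -[in RHS]mulrN mulVKf //; ring.
- by rewrite E1 mulVKf.
by rewrite E2 mulVKf.
Qed.

(** The conditional expression is |dS/dIm z|. The constant [K] also absorbs the factor 2 T + 2 of
    [overlap_window]. *)
Lemma overlap_estimate (G1 G2 : R -> R) (a b de : R) : profile G G1 G2 a b -> 0 < de ->
  exists ka K : R, [/\ 0 < ka, 0 < K &
  forall (h : R) (z : R[i]) (xp xm k sg t : R) (e0 f0 : R -> R[i]),
  let y := complex.Im z in let M0 := mean_Im g in
  0 < h -> de <= `|y - M0| -> 0 < k -> k ^+ 2 = (if y < M0 then y else G b - y) ->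
  0 < sg -> sg ^+ 2 * k = h -> sg <= ka * k ->
  expR (- (T * `|y - M0| / h)) <= sg -> expR (- (T * `|y - M0| / h)) <= 100^-1 ->
  b - T < xp < a -> a < xm < b -> G xp = y -> G xm = y ->
  0 <= t -> lowest_simple_eigenvalue (Q_op g h z) (t ^+ 2) ->
  lowest_simple_eigenvalue (Qt_op g h z) (t ^+ 2) ->
  eigenfunction (Q_op g h z) (t ^+ 2) e0 -> L2norm e0 = 1 ->
  eigenfunction (Qt_op g h z) (t ^+ 2) f0 -> L2norm f0 = 1 ->
  [/\ 0 < t,
      `|normc (dotp e0 f0) - t / h * (if y < M0 then xm - xp else T - (xm - xp))| <= K * sg * (t / h) &
      forall chi w r M, smooth_circle chi -> op_comm (P_op g h) chi e0 w -> 0 < r -> (forall x, `|chi x| <= M) ->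
        (forall x, `|x - xm| < r -> chi x = 1) -> (forall x, `|x - xp| < r -> chi x = 0) ->
        `|normc (dotp w f0) - t| <= t * ((1 + 2 * M) * (K * sg) / r)]].
Proof.
move=> HP de0.
have [ka1 [K1 [ka10 K10 CA]]] := concentration HP de0.
have [ka2 [K2 [ka20 K20 CB]]] := concentration (profile_swap HP) de0.
have T0 := @two_pi_gt0 R.
pose K := (2 * T + 3) * (K1 + K2).
have Kp : 0 < K by rewrite mulr_gt0 // addr_gt0 // mulr_gt0.
have KK1 : K1 <= K by rewrite /K; have := mulr_ge0 (ltW T0) (ltW K10); have := mulr_ge0 (ltW T0) (ltW K20); lra.
have KK2 : K2 <= K by rewrite /K; have := mulr_ge0 (ltW T0) (ltW K10); have := mulr_ge0 (ltW T0) (ltW K20); lra.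
have KT1 : (2 * T + 2) * K1 <= K by rewrite /K; have := mulr_ge0 (ltW T0) (ltW K10); have := mulr_ge0 (ltW T0) (ltW K20); lra.
have KT2 : (2 * T + 2) * K2 <= K by rewrite /K; have := mulr_ge0 (ltW T0) (ltW K10); have := mulr_ge0 (ltW T0) (ltW K20); lra.
exists (Num.min ka1 ka2), K; split; [by rewrite lt_min ka10|exact: Kp|].
move=> h z xp xm k sg t e0 f0 y M0 h0 dey k0 ky sg0 sk sgk ms m100 xpr xmr Gp Gm t0 Q1 Q2 He ne Hf nf.
have sgk1 : sg <= ka1 * k by apply: le_trans sgk _; rewrite ler_pM2r // ge_min lexx.
have sgk2 : sg <= ka2 * k by apply: le_trans sgk _; rewrite ler_pM2r // ge_min lexx orbT.
have hn : h != 0 by rewrite gt_eqF.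
have lT : lweight g h z T = T * (y - M0) / h := lweight_mean h z.
have lT0 : lweight g h z T != 0.
  rewrite lT; apply: mulf_neq0; last by rewrite invr_eq0.
  apply: mulf_neq0; first by rewrite gt_eqF.
  by rewrite -normr_eq0 gt_eqF // (lt_le_trans de0).
have [p1 [q1 [p2 [q2 [[tp [S1 [S2 Fl]]] Hmin [np nq] HB HA]]]]] := ground_pair hg h0 lT0 t0 Q1 Q2 He ne Hf nf.
have [hl _] := lweightP h z hg.
have lsh := lweight_shift h z hg.
set lam := lweight g h z in hl lsh lT lT0.
have N := cos2Dsin2 (phase g h z T).
set Co := cos _ in N; set Si := sin _ in N.
have m0 : 0 < expR (lam T) by exact: expR_gt0.
have Q : quasi_periodic (expR (lam T)) Co Si p1 p2 q1 q2 := Fl.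
have s0 : 0 <= t / h by rewrite divr_ge0 // ltW.
have cW : continuous (wt lam) by exact: sq_weight_cont.
have W0 x : 0 < wt lam x by exact: expR_gt0.
have [[h1 k1] [h2 k2]] := (S1, S2).
have c1 := prim_continuous h1; have c2 := prim_continuous h2.
have d1 := prim_continuous k1; have d2 := prim_continuous k2.
have cWV : continuous (fun x => (wt lam x)^-1) by move=> x; apply: cvgV; [rewrite gt_eqF|exact: cW].
have sqc (u v : R -> R) : continuous u -> continuous v -> continuous (fun x => nrm (u x) (v x) ^+ 2).
  move=> cu cv; have cn := nrm_cont cu cv.
  rewrite (_ : (fun x => _) = fun x => nrm (u x) (v x) * nrm (u x) (v x)); first exact: mul_cont.
  by apply/funext => x; rewrite expr2.
have cE := mul_cont (sqc _ _ c1 c2) cWV; have cF := mul_cont (sqc _ _ d1 d2) cW.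
have E0 x : 0 <= nrm (p1 x) (p2 x) ^+ 2 * (wt lam x)^-1 by rewrite mulr_ge0 ?sqr_ge0 // invr_ge0 ltW.
have F0 x : 0 <= nrm (q1 x) (q2 x) ^+ 2 * wt lam x by rewrite mulr_ge0 ?sqr_ge0 // ltW.

(* It is enough to know that |e|^2 concentrates at some xe and |f|^2 at some xf:
   the case Im z < <Im g> gives xe = xp, xf = xm, the other one xe = xp + 2 pi. *)
suff [x0 [xe [xf [L [em fm pq [KL El [je jf]]]]]]] : exists x0 xe xf L,
  [/\ integ (fun x => `|x - xe| * (nrm (p1 x) (p2 x) ^+ 2 * (wt lam x)^-1)) x0 (x0 + T) <= L * sg,
      integ (fun x => `|x - xf| * (nrm (q1 x) (q2 x) ^+ 2 * wt lam x)) x0 (x0 + T) <= L * sg,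
      nrm (p1 x0) (p2 x0) * nrm (q1 x0) (q2 x0) <= L * (t / h) * sg &
      [/\ (2 * T + 2) * L <= K /\ L <= K,
      `|xf - xe| = (if y < M0 then xm - xp else T - (xm - xp)) &
      (xe = xp \/ xe = xp + T) /\ xf = xm]].
  have x01 : x0 <= x0 + T by rewrite lerDl ltW.
  split => //.
  - have pq' : nrm (p1 x0) (p2 x0) * nrm (q1 x0) (q2 x0) <= L * sg * (t / h).
      by apply: le_trans pq _; rewrite mulrAC.
    have := overlap_window W0 cW m0 N s0 S1 S2 Q (np x0) (nq x0) em fm pq'.
    rewrite El HB => H.
    have -> : normc (dotp (e_of g h z p1 p2) (f_of g h z q1 q2)) =
      nrm (integ (fun x => p2 x * q1 x - p1 x * q2 x) x0 (x0 + T)) (integ (fun x => p1 x * q1 x + p2 x * q2 x) x0 (x0 + T)).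
      have cA : continuous (fun x => p2 x * q1 x - p1 x * q2 x).
        by move=> x; apply: cvgB; [exact: (mul_cont c2 d1)|exact: (mul_cont c1 d2)].
      have cP : continuous (fun x => p1 x * q1 x + p2 x * q2 x).
        by move=> x; apply: cvgD; [exact: (mul_cont c1 d1)|exact: (mul_cont c2 d2)].
      have cNP : continuous (fun x => - (p1 x * q1 x + p2 x * q2 x)) by move=> x; apply: cvgN; exact: cP.
      have sE := e_of_smooth hg S1 S2 Fl; have sF := f_of_smooth hg S1 S2 Fl.
      have [pE _ _] := csmooth_cont sE; have [pF _ _] := csmooth_cont sF.
      have pr x : e_of g h z p1 p2 (x + T) * conjc (f_of g h z q1 q2 (x + T)) =
        e_of g h z p1 p2 x * conjc (f_of g h z q1 q2 x) by rewrite pE pF.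
      have pA : periodic (fun x => p2 x * q1 x - p1 x * q2 x) T.
        by move=> x; have := congr1 (@complex.Re R) (pr x); rewrite !e_f_product.
      have pNP : periodic (fun x => - (p1 x * q1 x + p2 x * q2 x)) T.
        by move=> x; have := congr1 (@complex.Im R) (pr x); rewrite !e_f_product.
      have EN : integ (fun x => - (p1 x * q1 x + p2 x * q2 x)) x0 (x0 + T) =
          - integ (fun x => p1 x * q1 x + p2 x * q2 x) x0 (x0 + T).
        by rewrite -mulN1r -integZ //; congr (integ _ _ _); apply/funext => x; rewrite mulN1r.
      transitivity (nrm (integ (fun x => p2 x * q1 x - p1 x * q2 x) x0 (x0 + T))
          (- integ (fun x => p1 x * q1 x + p2 x * q2 x) x0 (x0 + T))); last by rewrite /nrm sqrrN.
      rewrite -EN -(integ_period x0 cA pA) -(integ_period x0 cNP pNP) /nrm /dotp /cint /normc.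
      congr (Num.sqrt (_ ^+ 2 + _ ^+ 2)); apply: eq_Rintegral => x _; by rewrite e_f_product.
    apply: le_trans H _; rewrite ler_wpM2r // mulrA ler_wpM2r ?(ltW sg0) //; by case: KL.
  move=> chi w r M sc Hw r0 HM H1 H2.
  have [cchi pchi] : continuous chi /\ periodic chi T by case: sc => ? ?; split => //; exact: smooth_continuous.
  rewrite (HA chi w sc Hw x0).
  have H2' x : `|x - xe| < r -> chi x = 0.
    case: je => -> H; first exact: H2.
    rewrite -(subrK T x) pchi; apply: H2; by rewrite addrAC -addrA -opprD.
  rewrite jf in fm.
  have B := cutoff_mass cE cF cchi E0 F0 x01 (nq x0) em fm r0 HM H1 H2'.
  have M0' : 0 <= M by exact: le_trans (HM 0).
  rewrite -[X in _ - X]mulr1 -mulrBr normrM (ger0_norm t0) ler_wpM2l //; apply: le_trans B _.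
  rewrite ler_wpM2r ?invr_ge0 ?(ltW r0) // ler_wpM2l ?addr_ge0 ?mulr_ge0 // ler_wpM2r ?(ltW sg0) //; by case: KL.
have [yM|yM] := ltP y M0.
  rewrite yM in ky.
  have an : `|y - M0| = M0 - y by rewrite ltr0_norm ?opprB // subr_lt0.
  rewrite an in dey ms m100.
  have Em : expR (lam T) = expR (- (T * (M0 - y) / h)) by rewrite lT; congr expR; ring.
  have hl' : primitive lam (fun x => (y - G x) / h) by apply: prim_eq hl _ => x; rewrite mulrC.
  have lT' x : lam (x + T) = lam x - T * (M0 - y) / h by rewrite lsh lT; ring.
  rewrite -Em in ms m100.
  have [x0 [_ A1 A2 A3]] := CA h sg k y xp xm (M0 - y) _ (t / h) Co Si lam p1 q1 p2 q2 h0 k0 ky sg0 sk sgk1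
    hl' lT' dey Em ms m100 xpr xmr Gp Gm s0 S1 S2 N Q Hmin np nq.
  exists x0, xp, xm, K1; split => //; split => //; last by split; [left|].
  by rewrite ger0_norm // subr_ge0; case/andP: xpr => _ ?; case/andP: xmr => ? _; apply: ltW; apply: lt_trans _; eassumption.
(* Im z above the mean: G is replaced by G b - G with minimum at [b], the roots around [b] are [xm]
   and [xp + T], and q takes the place of p. *)
rewrite ltNge yM /= in ky.
have an : `|y - M0| = y - M0 by rewrite ger0_norm // subr_ge0.
rewrite an in dey ms m100.
have Em : (expR (lam T))^-1 = expR (- (T * (y - M0) / h)) by rewrite -expRN lT.
have hl' : primitive (fun x => - lam x) (fun x => ((G b - y) - (G b - G x)) / h).
  by apply: prim_eq (primN hl) _ => x; rewrite /im_pot -/y; ring.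
have lT' x : - lam (x + T) = - lam x - T * (y - M0) / h by rewrite lsh lT; ring.
rewrite -Em in ms m100.
have r1 : a + T - T < xm < b by rewrite addrK.
have r2 : b < xp + T < a + T by rewrite -ltrBlDr ltrD2r.
have [_ _ _ per _ _ _ _ _ _ _ _] := HP.
have G1' : G b - G xm = G b - y by rewrite Gm.
have G2' : G b - G (xp + T) = G b - y by rewrite per Gp.
have Hm' : forall s' p1' q1' p2' q2', 0 < s' -> sol s' (wt (fun x => - lam x)) p1' q1' -> sol s' (wt (fun x => - lam x)) p2' q2' ->
     quasi_periodic (expR (lam T))^-1 Co Si p1' p2' q1' q2' ->
     ~ [/\ p1' 0 = 0, q1' 0 = 0, p2' 0 = 0 & q2' 0 = 0] -> t / h <= s'.
  move=> s' p1' q1' p2' q2' sp Z1 Z2 Z3 nz.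
  apply: (Hmin s' _ _ _ _ sp (sol_unswap Z1) (sol_unswap Z2) (quasi_periodic_unswap m0 Z3)).
  by move=> [/eqP a1 a2 /eqP a3 a4]; apply: nz; move: a1 a3; rewrite !oppr_eq0 => /eqP a1 /eqP a3.
have np' x : integ (fun x => nrm (q1 x) (q2 x) ^+ 2 * (wt (fun x => - lam x) x)^-1) x (x + T) = 1.
  by rewrite -[RHS](nq x); congr (integ _ _ _); apply/funext => u; rewrite wt_opp invrK.
have nq' x : integ (fun x => nrm (- p1 x) (- p2 x) ^+ 2 * wt (fun x => - lam x) x) x (x + T) = 1.
  by rewrite -[RHS](np x); congr (integ _ _ _); apply/funext => u; rewrite wt_opp nrmN.
have [x0 [_ A1 A2 A3]] := CB h sg k (G b - y) xm (xp + T) (y - M0) _ (t / h) Co Si (fun x => - lam x) q1 _ q2 _ h0 k0 ky sg0 sk sgk2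
    hl' lT' dey Em ms m100 r1 r2 G1' G2' s0 (sol_swap S1) (sol_swap S2) N (quasi_periodic_swap m0 Q) Hm' np' nq'.
exists x0, (xp + T), xm, K2; split.
- by apply: le_trans A2; rewrite le_eqVlt; apply/orP; left; apply/eqP; congr (integ _ _ _); apply/funext => u; rewrite wt_opp nrmN.
- by apply: le_trans A1; rewrite le_eqVlt; apply/orP; left; apply/eqP; congr (integ _ _ _); apply/funext => u; rewrite wt_opp invrK.
- by move: A3; rewrite nrmN mulrC.
split => //; last by split; [right|].
have -> : xm - (xp + T) = - (T - (xm - xp)) by ring.
rewrite normrN ger0_norm //; case/andP: xpr => u1 _; case/andP: xmr => _ u2.
by rewrite subr_ge0; apply: ltW; rewrite ltrBlDr; apply: lt_trans u2 _; rewrite -ltrBlDl.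
Qed.

End Overlap.

(** * The range of the symbol and the action *)

Section Levels.
Variable R : realType.
Notation T := (2 * pi : R).

(** G vanishes to second order at [a], so G(xp) = O((a - xp)^2). The lemma serves to compare [sg]
    with the width xm - xp. *)
Lemma level_width (G G1 G2 : R -> R) (a b : R) : profile G G1 G2 a b ->
  exists2 K : R, 0 < K & forall k xp xm, b - T < xp < a -> a < xm < b -> 0 < k -> k ^+ 2 = G xp ->
    k <= K * (xm - xp).
Proof.
move=> [h h1 c2 per /andP[ab ba] m r p [k1 k2] u d n].
have T0 := @two_pi_gt0 R.
have bTa : b - T <= a by lra.
have [t1 _ Ht1] := max_on_segment (abs_cont c2) bTa.
pose C2 := `|G2 t1|.
have C20 : 0 <= C2 by exact: normr_ge0.
exists (1 + C2); first by rewrite ltr_pwDl.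
move=> k xp xm /andP[xp1 xp2] /andP[xm1 xm2] k0 ky.
set w := a - xp; have w0 : 0 < w by rewrite subr_gt0.
have B t : xp <= t <= a -> - G1 t <= C2 * w.
  move=> /andP[x1 x2]; have := prim_le h1 (primZ C2 (@prim_id R)) x2; rewrite k1 sub0r -mulrBr => H.
  apply: le_trans (H _) _; last by rewrite ler_wpM2l // lerD2l lerN2.
  move=> s /andP[s1 s2]; rewrite mulr1; apply: le_trans (ler_norm _) (Ht1 s _); apply/andP; split; lra.
have := prim_le (primN h) (primZ (C2 * w) (@prim_id R)) (ltW xp2) => /(_ _)H.
have {}H : G xp <= C2 * w * w.
  have := H (fun t tt => ltac:(rewrite mulr1; exact: B)); rewrite m -mulrBr oppr0 opprK add0r; exact.
have kw : k <= (1 + C2) * w.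
  apply: le_of_sqr; first exact: mulr_ge0 (addr_ge0 ler01 C20) (ltW w0).
  rewrite ky; apply: le_trans H _; rewrite exprMn -mulrA -expr2 ler_wpM2r ?sqr_ge0 //.
  have := sqr_ge0 C2; rewrite !expr2; lra.
apply: le_trans kw _; by apply: ler_wpM2l; [exact: addr_ge0|rewrite /w; lra].
Qed.

Lemma int_between (k : int) : 0 < (k%:~R : R) -> (k%:~R : R) < 1 -> False.
Proof.
rewrite -[0]/(0%:~R) -[1]/(1%:~R) !ltr_int => k0 k1.
by move: k0; rewrite ltNge -ltzD1 add0r k1.
Qed.

Lemma lattice_gap (a b x : R) (j : int) : a < b < a + T -> x = a + T * j%:~R \/ x = b + T * j%:~R ->
  (a < x < b -> False) /\ (b < x < a + T -> False).
Proof.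
have T0 := @two_pi_gt0 R; have E : (j + 1)%:~R = j%:~R + 1 :> R by rewrite intrD.
move: (@int_between j) (@int_between (j + 1)); rewrite E; move: (j%:~R : R) => J H0 H1.
move: T0; move: (T) => t T0 /andP[ab ba] [] ->; split => /andP[x1 x2].
- by apply: H0; [rewrite -(pmulr_rgt0 _ T0)|rewrite -(ltr_pM2l T0) mulr1]; move: ab ba x1 x2; clear => *; lra.
- by apply: H0; [rewrite -(pmulr_rgt0 _ T0)|rewrite -(ltr_pM2l T0) mulr1]; move: ab ba x1 x2; clear => *; lra.
- by apply: H1; [rewrite -(pmulr_rgt0 _ T0)|rewrite -(ltr_pM2l T0) mulr1]; rewrite mulrDr mulr1; move: ab ba x1 x2; clear => *; lra.
by apply: H0; [rewrite -(pmulr_rgt0 _ T0)|rewrite -(ltr_pM2l T0) mulr1]; move: ab ba x1 x2; clear => *; lra.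
Qed.

Lemma admissible_profile (g : R -> R[i]) (a b : R) : admissible_symbol g a b ->
  let G := fun x => complex.Im (g x) in profile G (derive1 G) (derive1n 2 G) a b.
Proof.
move=> [[_ [pG sG]] ordr crit [m [p r]] [n1 n2]] G.
have T0 := @two_pi_gt0 R.
have h1 := smooth_primitive sG; have s1 := smooth_derive1 sG.
have h2 := smooth_primitive s1; have s2 := smooth_derive1 s1.
split.
- exact: h1.
- exact: h2.
- exact: smooth_continuous.
- exact: pG.
- exact: ordr.
- exact: m.
- by move=> x; have := r x; rewrite m.
- exact: p.
- split; apply/crit; exists 0; rewrite mulr0z mulr0 !addr0; [by left|by right].
- by move=> x xx; apply/eqP => /crit[j] /(lattice_gap ordr)[H _]; exact: H.
- by move=> x xx; apply/eqP => /crit[j] /(lattice_gap ordr)[_ H]; exact: H.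
exact: (conj n1 n2).
Qed.

(** [xp] and [xm] are arbitrary lifts from the circle. A common translation brings [xm] into one
    period after [a], and the signs of G1 then place both points around [a]. *)
Lemma normalized_roots (G G1 G2 : R -> R) (a b xp xm : R) : profile G G1 G2 a b ->
  G1 xp < 0 -> 0 < G1 xm -> xm - T < xp < xm ->
  exists j : int, b - T < xp + T * j%:~R < a /\ a < xm + T * j%:~R < b.
Proof.
move=> [h h1 c2 per /andP[ab ba] m r p [k1 k2] u d n] np nm /andP[x1 x2].
have T0 := @two_pi_gt0 R.
have per1 := prim_periodic h per.
have c1 := prim_continuous h1.
have up := sign_between h c1 ab (_ : G a < G b) u k1 k2; rewrite m in up; have {}up := up p.
have c1N : continuous (fun x => - G1 x) by move=> x; apply: cvgN; exact: c1.
have down x : b < x < a + T -> 0 < - G1 x.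
  apply: (sign_between (primN h) c1N ba) => [|t tt||].
  - by rewrite per m oppr0 oppr_lt0.
  - by rewrite oppr_eq0 d.
  - by rewrite k2 oppr0.
  by rewrite per1 k1 oppr0.
have [j /andP[j1 j2]] := periodic_reduce (xm - a).
have pj x : G1 (x + T * j%:~R) = G1 x.
  by rewrite (@periodic_int R G1 j per1 x).
exists j; set U := xp + _; set V := xm + _.
have V1 : a <= V by move: j1; rewrite /V; lra.
have V2 : V < a + T by move: j2; rewrite /V; lra.
have nV : 0 < G1 V by rewrite pj.
have nU : G1 U < 0 by rewrite pj.
have UV : V - T < U < V by rewrite /U /V; apply/andP; split; lra.
have aV : a < V.
  by rewrite lt_neqAle V1 andbT; apply/eqP => E; move: nV; rewrite -E k1 ltxx.
have Vb : V < b.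
  rewrite ltNge le_eqVlt; apply/negP => /orP[/eqP E|bV]; first by move: nV; rewrite -E k2 ltxx.
  by have := down V; rewrite bV V2 => /(_ isT); rewrite oppr_gt0 ltNge (ltW nV).
case/andP: UV => u1 u2.
have Ua : U < a.
  rewrite ltNge le_eqVlt; apply/negP => /orP[/eqP E|aU]; first by move: nU; rewrite -E k1 ltxx.
  by have := up U; rewrite aU (lt_trans u2 Vb) => /(_ isT); rewrite ltNge (ltW nU).
split; last by rewrite aV.
rewrite Ua andbT ltNge; apply/negP => Ub.
have : 0 <= G1 (U + T).
  have : U + T <= b by lra.
  rewrite le_eqVlt => /orP[/eqP ->|Ub']; first by rewrite k2.
  by apply/ltW/up; rewrite Ub' andbT; lra.
by rewrite per1 leNgt nU.
Qed.

End Levels.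

(** * The range of the symbol is a horizontal strip *)

Section Strip.
Variable R : realType.
Notation T := (2 * pi : R).
Implicit Types z w : R[i].

Lemma nbhs_normc (z : R[i]^o) (A : set R[i]^o) : nbhs z A ->
  exists2 r : R, 0 < r & forall w, normc (z - w) < r -> A w.
Proof.
move=> /nbhs_ballP[[e e'] /= e0 H].
(* The radius is itself a complex number; being positive means having zero imaginary part and
   positive real part. *)
have := e0; rewrite ltcE /= => /andP[/eqP E er].
exists e => // w zw; apply: H; rewrite /ball /= normc_def ltcE /= E eqxx /=.
by move: zw; rewrite /normc; case: (z - w).
Qed.

Lemma normc_nbhs (z : R[i]^o) (A : set R[i]^o) (r : R) : 0 < r ->
  (forall w, normc (z - w) < r -> A w) -> nbhs z A.
Proof.
move=> r0 H; apply/nbhs_ballP; exists (r%:C); first by rewrite /= ltcR.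
move=> w; rewrite /ball /= normc_def ltcR => zw; apply: H.
by move: zw; rewrite /normc; case: (z - w).
Qed.

Lemma Im_le_normc z : `|complex.Im z| <= normc z.
Proof.
case: z => x y /=; rewrite -sqrtr_sqr ler_sqrt ?addr_ge0 ?sqr_ge0 //.
by rewrite lerDr sqr_ge0.
Qed.

Lemma normc_ge0 z : 0 <= normc z. Proof. by case: z => x y; exact: sqrtr_ge0. Qed.

Lemma normc_imag (y : R) : normc (0 +i* y) = `|y|.
Proof. by rewrite /normc expr0n add0r sqrtr_sqr. Qed.
Variables (g : R -> R[i]) (a b : R).
Hypothesis hg : admissible_symbol g a b.
Notation G := (fun x => complex.Im (g x)).

Lemma strip_Sigma (z : R[i]^o) : 0 <= complex.Im z <= G b -> Sigma g z.
Proof.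
move=> zz; apply: subset_closure => /=.
have [h _ _ _ /andP[ab _] m _ p _ _ _ _] := admissible_profile hg.
have [|x _ Gx] := @IVT _ G a b (complex.Im z) (ltW ab) (continuous_subspaceT (prim_continuous h)).
  have GG : G a <= G b by rewrite m ltW.
  by rewrite min_l // max_r // m.
exists x, (complex.Re z - complex.Re (g x)).
by apply: cplx_eq; rewrite /symbol ?ReD ?ImD /= ?Gx; ring.
Qed.

Lemma Sigma_strip (z : R[i]^o) : Sigma g z -> 0 <= complex.Im z <= G b.
Proof.
have [_ _ _ _ _ _ r _ _ _ _ _] := admissible_profile hg.
have near (w u : R[i]) : `|complex.Im u - complex.Im w| <= normc (u - w).
  by have := Im_le_normc (u - w); rewrite ImD ImN.
move=> cz; apply/andP; split; rewrite leNgt; apply/negP => zn.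
  have [w [[x [xi ->]] zw]] := cz _ (@normc_nbhs z (fun w => normc (z - w) < - complex.Im z) (- complex.Im z)
    ltac:(by rewrite oppr_gt0) (fun _ => id)).
  have /ler_normlP[n1 _] := near (symbol g x xi) z.
  have /andP[r1 _] := r x; move: n1 zw; rewrite /symbol ImD /= add0r; move: r1; lra.
have d0 : 0 < complex.Im z - G b by rewrite subr_gt0.
have [w [[x [xi ->]] zw]] := cz _ (@normc_nbhs z (fun w => normc (z - w) < complex.Im z - G b) _ d0 (fun _ => id)).
have /ler_normlP[_ n1] := near (symbol g x xi) z.
have /andP[_ r1] := r x; move: n1 zw; rewrite /symbol ImD /= add0r; move: r1; lra.
Qed.

Lemma Sigma_interior (z : R[i]^o) : (Sigma g)° z -> 0 < complex.Im z < G b.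
Proof.
rewrite /interior => /nbhs_normc[r r0 H].
have step (y : R) : `|y| < r -> 0 <= complex.Im z + y <= G b.
  move=> yr; have := H (z + (0 +i* y)); rewrite opprD addNKr.
  have -> : - (0 +i* y) = (0 +i* (- y)) :> R[i] by apply: cplx_eq; rewrite /= ?oppr0.
  rewrite normc_imag normrN => /(_ yr)/Sigma_strip; by rewrite ImD.
have r2 : `|r / 2| < r by rewrite gtr0_norm ?divr_gt0 // ltr_pdivrMr // ltr_pMr // ltr1n.
have /andP[_ a1] := step _ r2; have /andP[a2 _] := step (- (r / 2)) ltac:(by rewrite normrN).
apply/andP; split; lra.
Qed.

Lemma interior_Sigma (z : R[i]^o) : 0 < complex.Im z < G b -> (Sigma g)° z.
Proof.
move=> /andP[z1 z2]; pose r := Num.min (complex.Im z) (G b - complex.Im z).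
have r0 : 0 < r by rewrite lt_min z1 subr_gt0.
apply: (normc_nbhs r0) => w zw; apply: strip_Sigma.
have := Im_le_normc (z - w); rewrite ImD ImN => /le_lt_trans /(_ zw).
rewrite lt_min => /andP[/ltr_normlP[_ n1] /ltr_normlP[n2 _]]; apply/andP; split; lra.
Qed.

Lemma edge_boundary (z : R[i]^o) : complex.Im z = 0 \/ complex.Im z = G b -> boundary (Sigma g) z.
Proof.
have [_ _ _ _ _ _ _ p _ _ _ _] := admissible_profile hg.
move=> E; split.
  by apply: subset_closure; apply: strip_Sigma; case: E => ->; rewrite lexx ?(ltW p).
by move/Sigma_interior; case: E => ->; rewrite ltxx ?andbF.
Qed.

(** [dist_bd] is defined through [fine], so the distance must be shown finite; the points of the two
    edges straight below and above z bound it. *)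
Lemma domain_facts (Om : set R[i]^o) (r : R) (z : R[i]^o) : 0 <= r -> closure Om `<=` Sigma g ->
  (r%:E < set_dist Om (boundary (Sigma g)))%E -> Om z ->
  [/\ (Sigma g)° z, r < dist_bd g z, dist_bd g z <= complex.Im z & dist_bd g z <= G b - complex.Im z].
Proof.
move=> r0 sub rd Oz.
have zS : Sigma g z by apply: sub; exact: subset_closure.
have zint : (Sigma g)° z.
  apply: contrapT => nz.
  have zb : boundary (Sigma g) z by split => //; exact: subset_closure.
  have : (set_dist Om (boundary (Sigma g)) <= 0%:E)%E.
    by apply: ereal_inf_lbound; exists z => //; exists z => //; rewrite subrr normc0.
  by move=> /(lt_le_trans rd); rewrite lte_fin ltNge r0.
have /andP[z1 z2] := Sigma_interior zint.
have rz : (r%:E < set_dist [set z] (boundary (Sigma g)))%E.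
  apply: lt_le_trans rd _; apply: ereal_inf_le_tmp => x [u -> [w Bw <-]].
  by exists z => //; exists w.
have le1 : (set_dist [set z] (boundary (Sigma g)) <= (complex.Im z)%:E)%E.
  apply: ge_ereal_inf; exists ((normc (z - (complex.Re z +i* 0)))%:E).
    by exists z; [reflexivity|exists (complex.Re z +i* 0); [apply: edge_boundary; left|reflexivity]].
  have -> : z - (complex.Re z +i* 0) = 0 +i* complex.Im z.
    by apply: cplx_eq; rewrite ?ReD ?ImD ?ReN ?ImN /=; ring.
  by rewrite normc_imag gtr0_norm.
have le2 : (set_dist [set z] (boundary (Sigma g)) <= (G b - complex.Im z)%:E)%E.
  apply: ge_ereal_inf; exists ((normc (z - (complex.Re z +i* G b)))%:E).
    by exists z; [reflexivity|exists (complex.Re z +i* G b); [apply: edge_boundary; right|reflexivity]].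
  have -> : z - (complex.Re z +i* G b) = 0 +i* (complex.Im z - G b).
    by apply: cplx_eq; rewrite ?ReD ?ImD ?ReN ?ImN /=; ring.
  by rewrite normc_imag ltr0_norm ?subr_lt0 // opprB.
rewrite /dist_bd; case: (set_dist [set z] _) rz le1 le2 => [d| |] //=.
Qed.

End Strip.

(** * The derivative of the action *)

Section Action.
Variable R : realType.
Notation T := (2 * pi : R).

Lemma profile_monotone (G G1 G2 : R -> R) (a b : R) : profile G G1 G2 a b ->
  (forall u v, a <= u -> u < v -> v <= b -> G u < G v) /\
  (forall u v, b - T <= u -> u < v -> v <= a -> G v < G u).
Proof.
move=> [h h1 c2 per /andP[ab ba] m r p [k1 k2] up0 d n].
have per1 := prim_periodic h per.
have c1 := prim_continuous h1.
have up := sign_between h c1 ab (_ : G a < G b) up0 k1 k2; rewrite m in up; have {}up := up p.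
have c1N : continuous (fun x => - G1 x) by move=> x; apply: cvgN; exact: c1.
have down x : b < x < a + T -> 0 < - G1 x.
  apply: (sign_between (primN h) c1N ba) => [|t tt||].
  - by rewrite per m oppr0 oppr_lt0.
  - by rewrite oppr_eq0 d.
  - by rewrite k2 oppr0.
  by rewrite per1 k1 oppr0.
split => u v u1 uv v1.
  by apply: (prim_increasing h uv) => t /andP[t1 t2]; apply: up; rewrite (le_lt_trans u1 t1) (lt_le_trans t2 v1).
apply: (prim_decreasing h uv) => t /andP[t1 t2]; rewrite -oppr_gt0 -(per1 t); apply: down.
by rewrite ltrD2r (lt_le_trans t2 v1) andbT -ltrBlDr (le_lt_trans u1 t1).
Qed.

(** The function t' x - F(x) is largest on ]a, b[ at the root V' of G = t', and smallest on ]b - T,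
    a[ at U'. The resulting inequality replaces the differentiation of the roots with respect to
    t. *)
Lemma action_envelope (G G1 G2 F : R -> R) (a b t' U V U' V' : R) : profile G G1 G2 a b -> primitive F G ->
  b - T < U < a -> a < V < b -> b - T < U' < a -> a < V' < b ->
  G U' = t' -> G V' = t' ->
  t' * (V - U) - (F V - F U) <= t' * (V' - U') - (F V' - F U').
Proof.
move=> HP hF /andP[U1 U2] /andP[V1 V2] /andP[U1' U2'] /andP[V1' V2'] GU GV.
have [inc dec] := profile_monotone HP.
pose H x := t' * x - F x.
have hH : primitive H (fun x => t' - G x).
  by apply: prim_eq (primB (primZ t' (@prim_id R)) hF) _ => x; rewrite mulr1.
have HV : H V <= H V'.
  have [le|lt] := leP V V'.
    apply: (prim_nondecreasing hH le) => x /andP[x1 x2]; rewrite subr_ge0 -GV.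
    by move: x2; rewrite le_eqVlt => /orP[/eqP -> //|x2]; apply/ltW/inc => //; [exact: le_trans (ltW V1) x1|exact: ltW].
  apply: (prim_nonincreasing hH (ltW lt)) => x /andP[x1 x2]; rewrite subr_le0 -GV.
  by move: x1; rewrite le_eqVlt => /orP[/eqP -> //|x1]; apply/ltW/inc => //; [exact: ltW|exact: le_trans x2 (ltW V2)].
have HU : H U' <= H U.
  have [le|lt] := leP U U'.
    apply: (prim_nonincreasing hH le) => x /andP[x1 x2]; rewrite subr_le0 -GU.
    by move: x2; rewrite le_eqVlt => /orP[/eqP -> //|x2]; apply/ltW/dec => //; [exact: le_trans (ltW U1) x1|exact: ltW].
  apply: (prim_nondecreasing hH (ltW lt)) => x /andP[x1 x2]; rewrite subr_ge0 -GU.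
  by move: x1; rewrite le_eqVlt => /orP[/eqP -> //|x1]; apply/ltW/dec => //; [exact: ltW|exact: le_trans x2 (ltW U2)].
move: HV HU; rewrite /H; clear => *; lra.
Qed.

Lemma envelope_rearrange (t t' w f s : R) : t' * w - f <= s -> (t' - t) * w <= s - (t * w - f).
Proof. by lra. Qed.

Lemma width_continuous (G G1 G2 : R -> R) (a b t U V e : R) : profile G G1 G2 a b ->
  b - T < U < a -> a < V < b -> G U = t -> G V = t -> 0 < e ->
  exists2 d, 0 < d & forall t' U' V', `|t' - t| < d -> b - T < U' < a -> a < V' < b ->
    G U' = t' -> G V' = t' -> `|(V' - U') - (V - U)| <= e.
Proof.
move=> HP /andP[U1 U2] /andP[V1 V2] GU GV e0.
have [inc dec] := profile_monotone HP.
pose q := Num.min (e / 2) (Num.min (Num.min ((V - a) / 2) ((b - V) / 2)) (Num.min ((U - (b - T)) / 2) ((a - U) / 2))).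
have q0 : 0 < q by rewrite !lt_min !divr_gt0 // subr_gt0.
have q1 : q <= e / 2 by rewrite ge_min lexx.
have q2 : q <= (V - a) / 2 by rewrite !ge_min lexx !orbT.
have q3 : q <= (b - V) / 2 by rewrite !ge_min lexx !orbT.
have q4 : q <= (U - (b - T)) / 2 by rewrite !ge_min lexx !orbT.
have q5 : q <= (a - U) / 2 by rewrite !ge_min lexx !orbT.
move: q q0 q1 q2 q3 q4 q5 => q q0 q1 q2 q3 q4 q5.
have g1 : G (V - q) < t by rewrite -GV; apply: inc; move: q0 q2 V1 V2; clear => *; lra.
have g2 : t < G (V + q) by rewrite -GV; apply: inc; move: q0 q3 V1 V2; clear => *; lra.
have g3 : t < G (U - q) by rewrite -GU; apply: dec; move: q0 q4 U1 U2; clear => *; lra.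
have g4 : G (U + q) < t by rewrite -GU; apply: dec; move: q0 q5 U1 U2; clear => *; lra.
pose d := Num.min (Num.min (t - G (V - q)) (G (V + q) - t)) (Num.min (G (U - q) - t) (t - G (U + q))).
exists d; first by rewrite !lt_min !subr_gt0 g1 g2 g3 g4.
move=> t' U' V'; rewrite /d !lt_min => /andP[/andP[n1 n2] /andP[n3 n4]] /andP[U1' U2'] /andP[V1' V2'] GU' GV'.
have {}n1 : G (V - q) < t' by move/ltr_normlP: n1 => [n1 _]; move: n1; clear => *; lra.
have {}n2 : t' < G (V + q) by move/ltr_normlP: n2 => [_ n2]; move: n2; clear => *; lra.
have {}n3 : t' < G (U - q) by move/ltr_normlP: n3 => [_ n3]; move: n3; clear => *; lra.
have {}n4 : G (U + q) < t' by move/ltr_normlP: n4 => [n4 _]; move: n4; clear => *; lra.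
have a1 : V - q <= V'.
  rewrite leNgt; apply/negP => lt; move: n1; rewrite ltNge -GV'.
  by move/negP; apply; apply/ltW/inc => //; move: q0 V2 V1'; clear => *; lra.
have a2 : V' <= V + q.
  rewrite leNgt; apply/negP => lt; move: n2; rewrite ltNge -GV'.
  by move/negP; apply; apply/ltW/inc => //; move: q0 V1 V2'; clear => *; lra.
have a3 : U - q <= U'.
  rewrite leNgt; apply/negP => lt; move: n3; rewrite ltNge -GU'.
  by move/negP; apply; apply/ltW/dec => //; move: q0 U2 U1'; clear => *; lra.
have a4 : U' <= U + q.
  rewrite leNgt; apply/negP => lt; move: n4; rewrite ltNge -GU'.
  by move/negP; apply; apply/ltW/dec => //; move: q0 U1 U2'; clear => *; lra.
rewrite ler_norml; apply/andP; split; move: a1 a2 a3 a4 q1; clear => *; lra.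
Qed.

Lemma shift_bounds (s y M : R) : `|s| < y -> `|s| < M - y -> 0 < s + y < M.
Proof. by move=> /ltr_normlP[? ?] /ltr_normlP[? ?]; apply/andP; split; lra. Qed.
Variables (g : R -> R[i]) (a b : R) (xp xm : R[i] -> R).
Hypotheses (hg : admissible_symbol g a b) (hx : base_points g xp xm).
Notation G := (fun x => complex.Im (g x)).
Notation M0 := (mean_Im g).

Let HP : profile G (derive1 G) (derive1n 2 G) a b := admissible_profile hg.
Let cG : continuous G. Proof. by have [h _ _ _ _ _ _ _ _ _ _ _] := HP; exact: prim_continuous h. Qed.
Notation F := (integ G 0).

Let hF : primitive F G. Proof. exact: prim_integ. Qed.

Lemma integ_mean_shift (x : R) (j : int) : F (x + T * j%:~R) = F x + M0 * (T * j%:~R).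
Proof.
have T0 := @two_pi_gt0 R.
have [_ _ _ per _ _ _ _ _ _ _ _] := HP.
have E : T * M0 = F T.
  rewrite /mean_Im mulVKf ?gt_eqF // (prim_Rintegral hF cG (ltW T0)) integ_aa //.
  by rewrite subr0.
have hs y : F (y + T) = F y + T * M0.
  have := prim_periodic_shift hF per y 0; rewrite add0r integ_aa // subr0 -E => H.
  by rewrite -H; ring.
have P : periodic (fun y => F y - M0 * y) T by move=> y; rewrite hs; ring.
have := @periodic_int R (fun y => F y - M0 * y) j P x => /= H.
by rewrite -[LHS](subrK (M0 * (x + T * j%:~R))) H; ring.
Qed.

Lemma level_roots (z : R[i]^o) : 0 < complex.Im z < G b ->
  exists U V j, [/\ U = xp z + T * j%:~R, V = xm z + T * j%:~R, b - T < U < a, a < V < b &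
    G U = complex.Im z /\ G V = complex.Im z].
Proof.
move=> zz; have [e1 e2 d1 d2 dd] := hx (interior_Sigma hg zz).
have [_ _ _ per _ _ _ _ _ _ _ _] := HP.
have [j [j1 j2]] := normalized_roots HP d1 d2 dd.
exists (xp z + T * j%:~R), (xm z + T * j%:~R), j; split => //.
by rewrite !(@periodic_int R G j per).
Qed.

(** The two integrals in the definition of the action differ by T (Im z - mean), so the sign of this
    number decides the minimum. *)
Lemma action_formula (z : R[i]^o) : 0 < complex.Im z < G b ->
  action g xp xm z = complex.Im z * (xm z - xp z) - (F (xm z) - F (xp z)) -
    (if complex.Im z < M0 then 0 else T * (complex.Im z - M0)).
Proof.
move=> zz; have [e1 e2 d1 d2 /andP[x1 x2]] := hx (interior_Sigma hg zz).
have cz : continuous (fun x => complex.Im z - G x).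
  by move=> x; apply: cvgB; [exact: cvg_cst|exact: cG].
have hz : primitive (fun x => complex.Im z * x - F x) (fun x => complex.Im z - G x).
  by apply: prim_eq (primB (primZ (complex.Im z) (@prim_id R)) hF) _ => x; rewrite mulr1.
have Ez u v : u <= v -> complex.Im (cint `[u, v] (fun y => z - g y)) =
    (complex.Im z * v - F v) - (complex.Im z * u - F u).
  move=> uv; rewrite /cint -(prim_Rintegral hz cz uv) /=.
  by apply: eq_Rintegral => x _; rewrite ImD ImN.
have x1' : (xp z <= xm z - T) = false by rewrite leNgt x1.
rewrite /action /oriented_int (ltW x2) x1' ImN !Ez ?(ltW x2) ?(ltW x1) //.
have E : F (xm z - T) = F (xm z) - M0 * T.
  have := integ_mean_shift (xm z) (-1); rewrite intrN mulrN1 => ->; ring.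
rewrite E; have T0 := @two_pi_gt0 R.
set S := complex.Im z * xm z - F (xm z) - (complex.Im z * xp z - F (xp z)).
have -> : - (complex.Im z * xp z - F (xp z) - (complex.Im z * (xm z - T) - (F (xm z) - M0 * T))) =
  S - T * (complex.Im z - M0) by rewrite /S; ring.
have -> : complex.Im z * (xm z - xp z) - (F (xm z) - F (xp z)) = S by rewrite /S; ring.
have [lt|le] := ltP (complex.Im z) M0.
  rewrite subr0 min_l // lerDl oppr_ge0 mulr_ge0_le0 ?(ltW T0) // subr_le0; exact: ltW.
by rewrite min_r // gerDl oppr_le0 mulr_ge0 ?(ltW T0) // subr_ge0.
Qed.

(** Applied in both directions, [action_envelope] squeezes the difference quotient of S between the
    widths at the two levels, and the width is continuous. *)
Lemma dIm_action_width (z : R[i]^o) : 0 < complex.Im z < G b -> complex.Im z != M0 ->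
  dIm_action g xp xm z = (xm z - xp z) - (if complex.Im z < M0 then 0 else T).
Proof.
move=> zz zM; set y := complex.Im z in zz zM *.
pose ze t := complex.Re z +i* t : R[i]^o.
have Ey : ze y = z by rewrite /ze /y; case: (z).
pose S t := t * (xm (ze t) - xp (ze t)) - (F (xm (ze t)) - F (xp (ze t))).
pose l t := xm (ze t) - xp (ze t).
case/andP: (zz) => z1 z2.
have T0 := @two_pi_gt0 R.
have normal t U V j : U = xp (ze t) + T * j%:~R -> V = xm (ze t) + T * j%:~R ->
    l t = V - U /\ S t = t * (V - U) - (F V - F U).
  move=> -> ->; rewrite /S /l !integ_mean_shift; split; ring.
have env t t' : 0 < t < G b -> 0 < t' < G b -> (t' - t) * l t <= S t' - S t.
  move=> tt tt'.
  have [U [V [j [EU EV U1 V1 [GU GV]]]]] := level_roots (z := ze t) tt.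
  have [U' [V' [j' [EU' EV' U1' V1' [GU' GV']]]]] := level_roots (z := ze t') tt'.
  have [-> ->] := normal _ _ _ _ EU EV; have [_ ->] := normal _ _ _ _ EU' EV'.
  exact: envelope_rearrange (action_envelope HP hF U1 V1 U1' V1' GU' GV').
have lc e : 0 < e -> exists2 d, 0 < d & forall t, `|t - y| < d -> 0 < t < G b -> `|l t - l y| <= e.
  move=> e0; have [U [V [j [EU EV U1 V1 [GU GV]]]]] := level_roots (z := ze y) zz.
  have [d d0 H] := width_continuous HP U1 V1 GU GV e0.
  exists d => // t td tt.
  have [U' [V' [j' [EU' EV' U1' V1' [GU' GV']]]]] := level_roots (z := ze t) tt.
  have [-> _] := normal _ _ _ _ EU EV; have [-> _] := normal _ _ _ _ EU' EV'.
  exact: H td U1' V1' GU' GV'.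
pose L := if y < M0 then 0 else T.
have act t : 0 < t < G b -> (t < M0) = (y < M0) -> action g xp xm (ze t) = S t - (if y < M0 then 0 else T * (t - M0)).
  by move=> tt E; rewrite (action_formula (z := ze t) tt) /= E.
have -> : xm z - xp z = l y by rewrite /l Ey.
rewrite /dIm_action -/y -/L.
apply: cvg_lim => //; apply/cvgrPdist_le => e e0.
have [d d0 Hd] := lc e e0.
(* The radius keeps the level inside the strip and on the same side of the mean, so that a single
   branch of the minimum is differentiated. *)
pose r := Num.min d (Num.min `|y - M0| (Num.min y (G b - y))).
have r0 : 0 < r by rewrite !lt_min d0 z1 subr_gt0 z2 !andbT normr_gt0 subr_eq0.
apply/nbhs_ballP; exists r => // s; rewrite /ball /= sub0r normrN !lt_min => /andP[sd /andP[sM /andP[s1 s2]]] sn.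
have tt : 0 < s + y < G b by exact: shift_bounds.
have side : (s + y < M0) = (y < M0).
  have n1 := ler_norm s; have n2 := ler_norm (- s); rewrite normrN in n2.
  have [lt|le] := ltP y M0.
    have sM' : `|s| < M0 - y by rewrite (lt_le_trans sM) // ltr0_norm ?opprB ?subr_lt0.
    by apply/idP; rewrite -ltrBrDr; exact: le_lt_trans n1 sM'.
  have sM' : `|s| < y - M0 by rewrite (lt_le_trans sM) // ger0_norm ?subr_ge0.
  by apply/negbTE; rewrite -leNgt -lerBlDr; have := ltW (le_lt_trans n2 sM'); rewrite lerNl opprB.
have E : action g xp xm (ze (s + y)) - action g xp xm (ze y) = S (s + y) - S y - s * L.
  rewrite (act _ tt side) (act _ zz erefl) /L; case: ifP => _; ring.
rewrite -/(ze _) -/(ze _) E.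
have e1 := env y (s + y) zz tt; have e2 := env (s + y) y tt zz.
have lb := Hd (s + y) ltac:(by rewrite addrK) tt.
have -> : l y - L - s^-1 *: (S (s + y) - S y - s * L) = l y - (S (s + y) - S y) / s.
  by rewrite /GRing.scale /=; field.
apply: le_trans lb.
set D := S (s + y) - S y in e1 *.
have e1' : s * l y <= D by move: e1; rewrite addrK.
have e2' : D <= s * l (s + y) by move: e2; rewrite opprD addrCA subrr addr0 mulNr lerNl opprB.
have [s0|s0|s0] := ltgtP s 0; last by move/eqP: sn.
  have b1 : D / s <= l y by rewrite ler_ndivrMr // mulrC.
  have b2 : l (s + y) <= D / s by rewrite ler_ndivlMr // mulrC.
  by rewrite (distrC (l (s + y))) !ger0_norm ?subr_ge0 ?(le_trans b2) // lerD2l lerN2.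
have b1 : l y <= D / s by rewrite ler_pdivlMr // mulrC.
have b2 : D / s <= l (s + y) by rewrite ler_pdivrMr // mulrC.
by rewrite (distrC (l y)) !ger0_norm ?subr_ge0 ?(le_trans b1) // lerD2r.
Qed.

End Action.

(** * Error terms *)

Section Comparison.
Variable R : realType.

(** [b] is the rescaled overlap, [A] the modulus of the commutator pairing, both within relative
    error e of t, and [N] is [A] with an additive error n. The cross term is split by 2 n N <= eta
    N^2 + n^2 / eta, so part of the error is relative and part additive. *)
Lemma relative_estimate (t b A N n e eta r r2 r3 : R) : 0 < t -> 0 <= N -> 0 <= n -> 0 < eta ->
  0 <= e <= 16^-1 -> `|b - t| <= e * t -> `|A - t| <= e * t -> `|A - N| <= n ->
  `|r| <= e -> `|r2| <= e -> `|r3| <= e ->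
  let Z := N ^+ 2 / (1 + r2) * (1 + r3) in
  0 <= Z /\ `|b ^+ 2 * (1 + r) - Z| <= (16 * e + 3 * eta) * Z + 3 * (n ^+ 2 * (1 + eta^-1)).
Proof.
move=> t0 N0 n0 eta0 /andP[e0 e1] /ler_normlP[b1 b2] /ler_normlP[a1 a2] /ler_normlP[n1 n2]
  /ler_normlP[r1' r1''] /ler_normlP[s1 s2] /ler_normlP[u1 u2] Z.
have N2 := sqr_ge0 N.
have d2 : 0 < 1 + r2 by move: s1 e1; clear => *; lra.
have d3 : 0 < 1 + r3 by move: u1 e1; clear => *; lra.
have EZ : Z * (1 + r2) = N ^+ 2 * (1 + r3) by rewrite /Z; field; rewrite gt_eqF.
have Z0 : 0 <= Z by rewrite mulr_ge0 ?divr_ge0 ?(ltW d2) ?(ltW d3).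
split => //; move: Z EZ Z0 => Z EZ Z0.
have NZ : N ^+ 2 <= 114 / 100 * Z.
  have : N ^+ 2 * (15 / 16) <= Z * (17 / 16).
    apply: (@le_trans _ _ (N ^+ 2 * (1 + r3))); first by rewrite ler_wpM2l //; move: u1 e1; clear => *; lra.
    by rewrite -EZ ler_wpM2l //; move: s2 e1; clear => *; lra.
  move: Z0 N2; clear => *; lra.
have E3 : `|Z - N ^+ 2| <= e * (Z + N ^+ 2).
  have -> : Z - N ^+ 2 = N ^+ 2 * r3 - Z * r2 by move: EZ; clear => *; lra.
  apply: le_trans (ler_normB _ _) _; rewrite (normrM (N ^+ 2)) (normrM Z) (ger0_norm N2) (ger0_norm Z0) mulrDr addrC.
  apply: lerD; rewrite mulrC ler_wpM2r //; by rewrite ler_norml; apply/andP; split; move: s1 s2 u1 u2; clear => *; lra.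
have E2 : `|A ^+ 2 - N ^+ 2| <= eta * N ^+ 2 + n ^+ 2 * (1 + eta^-1).
  have -> : A ^+ 2 - N ^+ 2 = (A - N) * (A + N) by ring.
  rewrite normrM.
  apply: (@le_trans _ _ (n * (2 * N + n))).
    apply: ler_pM => //; first by rewrite ler_norml; apply/andP; split; move: n1 n2; clear => *; lra.
    by rewrite ler_norml; apply/andP; split; move: n1 n2 N0 n0; clear => *; lra.
  have Q : 0 <= (eta * N - n) ^+ 2 / eta by rewrite divr_ge0 ?sqr_ge0 // ltW.
  rewrite -subr_ge0 (_ : _ - _ = (eta * N - n) ^+ 2 / eta) //; by field; rewrite gt_eqF.
have E1 : `|b ^+ 2 * (1 + r) - A ^+ 2| <= 10 * e * A ^+ 2.
  have bl : (1 - e) * t <= b by move: b1; clear => *; lra.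
  have bu : b <= (1 + e) * t by move: b2; clear => *; lra.
  have al : (1 - e) * t <= A by move: a1; clear => *; lra.
  have au : A <= (1 + e) * t by move: a2; clear => *; lra.
  have e1' : 0 <= 1 - e by move: e1; clear => *; lra.
  have e2' : 0 <= 1 + e by move: e0; clear => *; lra.
  have l0 : 0 <= (1 - e) * t by rewrite mulr_ge0 // ltW.
  have u0 : 0 <= (1 + e) * t by rewrite mulr_ge0 // ltW.
  have b0 : 0 <= b by exact: le_trans bl.
  have A0 : 0 <= A by exact: le_trans al.
  have q1 : ((1 - e) * t) ^+ 2 <= b ^+ 2 by rewrite ler_sqr ?nnegrE.
  have q2 : b ^+ 2 <= ((1 + e) * t) ^+ 2 by rewrite ler_sqr ?nnegrE.
  have q3 : ((1 - e) * t) ^+ 2 <= A ^+ 2 by rewrite ler_sqr ?nnegrE.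
  have q4 : A ^+ 2 <= ((1 + e) * t) ^+ 2 by rewrite ler_sqr ?nnegrE.
  have t2 : 0 <= t ^+ 2 by exact: sqr_ge0.
  have w1 : 0 <= 1 + r by move: r1' e1; clear => *; lra.
  have w2 : 0 <= 1 - 10 * e by move: e1; clear => *; lra.
  have w3 : 0 <= 1 + 10 * e by move: e0; clear => *; lra.
  have up : b ^+ 2 * (1 + r) <= (1 + 10 * e) * A ^+ 2.
    apply: (@le_trans _ _ (((1 + e) * t) ^+ 2 * (1 + e))).
      by apply: ler_pM; rewrite ?sqr_ge0 //; move: r1''; clear => *; lra.
    apply: (@le_trans _ _ ((1 + 10 * e) * ((1 - e) * t) ^+ 2)); last by rewrite ler_wpM2l.
    rewrite -subr_ge0 (_ : _ - _ = t ^+ 2 * (e * (5 - 22 * e + 9 * e ^+ 2))); last by ring.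
    rewrite mulr_ge0 // mulr_ge0 //; have := sqr_ge0 e; move: e1; clear => *; lra.
  have lo : (1 - 10 * e) * A ^+ 2 <= b ^+ 2 * (1 + r).
    apply: (@le_trans _ _ (((1 - e) * t) ^+ 2 * (1 - e))); last first.
      by apply: ler_pM; rewrite ?sqr_ge0 //; move: r1'; clear => *; lra.
    apply: (@le_trans _ _ ((1 - 10 * e) * ((1 + e) * t) ^+ 2)); first by rewrite ler_wpM2l.
    rewrite -subr_ge0 (_ : _ - _ = t ^+ 2 * (e * (5 + 22 * e + 9 * e ^+ 2))); last by ring.
    rewrite mulr_ge0 // mulr_ge0 //; have := sqr_ge0 e; move: e0; clear => *; lra.
  rewrite ler_norml; apply/andP; split; move: up lo; clear => *; lra.
have X0 : 0 <= n ^+ 2 * (1 + eta^-1) by rewrite mulr_ge0 ?sqr_ge0 // addr_ge0 // invr_ge0 ltW.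
move: (n ^+ 2 * (1 + eta^-1)) X0 E2 => X X0 E2.
move: (N ^+ 2) (A ^+ 2) (b ^+ 2 * (1 + r)) N2 NZ E1 E2 E3 => N2 A2 b2' N20 NZ E1 E2 E3.
have eZ : 0 <= e * Z by rewrite mulr_ge0.
have eN := ler_wpM2l e0 NZ.
have etN := ler_wpM2l (ltW eta0) NZ.
have etZ : 0 <= eta * Z by rewrite mulr_ge0 // ltW.
have A2b : e * A2 <= e * N2 + (eta * N2 + X) / 16.
  have h1 : A2 <= N2 + (eta * N2 + X) by move/ler_normlP: E2; clear => -[_ ?]; lra.
  have h2 := ler_wpM2l e0 h1.
  have h3 : 0 <= eta * N2 + X by rewrite addr_ge0 // mulr_ge0 // ltW.
  have := ler_wpM2r h3 e1; move: h2; clear => *; lra.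
have -> : b2' - Z = (b2' - A2) + (A2 - N2) - (Z - N2) by ring.
apply: le_trans (ler_normB _ _) _; apply: le_trans (lerD (ler_normD _ _) (lexx _)) _.
move: E1 E2 E3 A2b eN etN eZ etZ X0 NZ; clear => *; lra.
Qed.

(** u, v and dl stand for d^(1/4), h^(1/2) and delta. Up to constants the left side is dl^2 v^-14
    (u^-2 + u / v). The bound dl <= v^10 leaves v^6 (u^-2 + u / v) = v^5 (v / u^2 + u), and v <= u^2
    turns this into a multiple of u^5. *)
Lemma absorbed_error (u v dl n K L Lm U0 : R) : 0 < u -> 0 < v <= 1 -> 0 < dl -> dl <= v ^+ 10 ->
  v <= u ^+ 2 -> u <= U0 -> 0 <= n -> 0 <= K -> n <= K * (u^-1 * (v ^+ 5)^-1 * dl ^+ 2) -> 0 <= L <= Lm ->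
  (L / v ^+ 2) ^+ 2 / dl ^+ 2 * (n ^+ 2 * (1 + (v / u ^+ 3)^-1)) <= Lm ^+ 2 * K ^+ 2 * (1 + U0) * U0 ^+ 5 * u ^+ 5.
Proof.
move=> u0 /andP[v0 v1] dl0 dlv vu uU n0 K0 nK /andP[L0 LLm].
have un : u != 0 by rewrite gt_eqF.
have vn : v != 0 by rewrite gt_eqF.
have dn : dl != 0 by rewrite gt_eqF.
have U00 : 0 <= U0 by exact: le_trans (ltW u0) uU.
have n2 : n ^+ 2 <= (K * (u^-1 * (v ^+ 5)^-1 * dl ^+ 2)) ^+ 2.
  by rewrite ler_sqr // nnegrE ?(le_trans n0).
have L2 : L ^+ 2 <= Lm ^+ 2 by rewrite ler_sqr // nnegrE ?(le_trans L0).
have w0 : 0 <= 1 + (v / u ^+ 3)^-1 by rewrite addr_ge0 // invr_ge0 divr_ge0 ?exprn_ge0 // ltW.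
apply: (@le_trans _ _ (Lm ^+ 2 / v ^+ 4 / dl ^+ 2 * ((K * (u^-1 * (v ^+ 5)^-1 * dl ^+ 2)) ^+ 2 * (1 + (v / u ^+ 3)^-1)))).
  apply: ler_pM.
  - by rewrite divr_ge0 ?sqr_ge0.
  - by rewrite mulr_ge0 // sqr_ge0.
  - rewrite ler_wpM2r ?invr_ge0 ?sqr_ge0 // exprMn (_ : (v ^+ 2)^-1 ^+ 2 = (v ^+ 4)^-1); last by field.
    by rewrite ler_wpM2r // invr_ge0 exprn_ge0 // ltW.
  by rewrite ler_wpM2r.
rewrite (_ : _ * _ = Lm ^+ 2 * K ^+ 2 * (dl ^+ 2 / v ^+ 14 * (u ^- 2 * (1 + u ^+ 3 / v)))); last by field; rewrite un vn dn.
have dl2 : dl ^+ 2 / v ^+ 14 <= v ^+ 6.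
  rewrite ler_pdivrMr ?exprn_gt0 // -exprD (_ : v ^+ (6 + 14) = (v ^+ 10) ^+ 2); last by rewrite -exprM.
  by rewrite ler_sqr // nnegrE ?exprn_ge0 // ltW.
have v5 : v ^+ 6 * (u ^- 2 * (1 + u ^+ 3 / v)) <= (1 + U0) * v ^+ 5.
  rewrite (_ : _ * _ = v ^+ 5 * (v / u ^+ 2 + u)); last by field; rewrite un vn.
  rewrite mulrC ler_wpM2r ?exprn_ge0 ?(ltW v0) //; apply: lerD => //.
  by rewrite ler_pdivrMr ?exprn_gt0 // mul1r.
have v10 : v ^+ 5 <= U0 ^+ 5 * u ^+ 5.
  apply: (@le_trans _ _ ((u ^+ 2) ^+ 5)); first by rewrite lerXn2r ?nnegrE ?sqr_ge0 // ltW.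
  rewrite (_ : (u ^+ 2) ^+ 5 = u ^+ 5 * u ^+ 5); last by rewrite -exprM -exprD.
  by rewrite ler_wpM2r ?exprn_ge0 ?(ltW u0) // lerXn2r // nnegrE ltW.
have z0 : 0 <= u ^- 2 * (1 + u ^+ 3 / v) by rewrite mulr_ge0 ?invr_ge0 ?sqr_ge0 // addr_ge0 // divr_ge0 ?exprn_ge0 // ltW.
rewrite [leRHS](_ : _ = Lm ^+ 2 * K ^+ 2 * ((1 + U0) * (U0 ^+ 5 * u ^+ 5))); last by ring.
apply: ler_wpM2l; first by rewrite mulr_ge0 // sqr_ge0.
apply: le_trans (ler_wpM2r z0 dl2) _; apply: le_trans v5 _.
by apply: ler_wpM2l => //; rewrite addr_ge0.
Qed.

(** The discrepancy is shared between the relative and the additive error in the proportion a Z :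
    M. *)
Lemma split_error (Y Z a M : R) : 0 <= Z -> 0 <= a -> 0 < M -> `|Y - Z| <= a * Z + M ->
  let e1 := a * (Y - Z) / (a * Z + M) in let e2 := M * (Y - Z) / (a * Z + M) in
  [/\ `|e1| <= a, `|e2| <= M & Y = Z * (1 + e1) + e2].
Proof.
move=> Z0 a0 M0 H.
have d0 : 0 < a * Z + M by rewrite ltr_wpDl // mulr_ge0.
have q : `|(Y - Z) / (a * Z + M)| <= 1.
  by rewrite normrM [X in _ * X]gtr0_norm ?invr_gt0 // ler_pdivrMr // mul1r.
split.
- by rewrite -mulrA normrM (ger0_norm a0) ler_piMr.
- by rewrite -mulrA normrM (gtr0_norm M0) ler_piMr // ltW.
by field; rewrite gt_eqF.
Qed.

End Comparison.

(** * Powers of d and h, and the size of the coupling constant *)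

Section Asymptotics.
Variable R : realType.
Notation T := (2 * pi : R).

Lemma powR_fraction (x : R) (n m : nat) : 0 <= x -> x `^ (n%:R / m%:R) = (x `^ (1 / m%:R)) ^+ n.
Proof. by move=> x0; rewrite -powR_mulrn ?powR_ge0 // -powRrM div1r mulrC. Qed.

Lemma expRN_le_inv (x : R) : 0 < x -> expR (- x) <= x^-1.
Proof.
move=> x0; rewrite expRN lef_pV2 ?posrE ?expR_gt0 //.
by apply: le_trans (expR_ge1Dx x); rewrite lerDr.
Qed.

(** This is where the exponent 2/3 matters: d^(3/2) exceeds a constant times h ln(1/h), so the
    square h d^(-3/2) of the error is at most a constant over ln(1/h). *)
Lemma small_parameter (COm eps : R) : 0 < COm -> 0 < eps -> \forall h \near (0 : R)^'+,
  forall d, COm * (h * ln h^-1) `^ (2 / 3) < d -> d `^ (- (3 / 4)) * h `^ (1 / 2) <= eps.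
Proof.
move=> C0 e0.
pose c3 := COm `^ (3 / 2); have c30 : 0 < c3 by exact: powR_gt0.
pose N := (eps ^+ 2 * c3)^-1; have N0 : 0 < N by rewrite invr_gt0 mulr_gt0 // exprn_gt0.
near=> h => d dh.
have h0 : 0 < h by near: h; exact: nbhs_right_gt.
have hN : h < expR (- N) by near: h; apply: nbhs_right_lt; exact: expR_gt0.
have lN : N <= ln h^-1.
  by rewrite lnV ?posrE // lerNr -[leRHS](expRK (- N)) ler_ln ?posrE ?expR_gt0 // ltW.
have X0 : 0 < h * ln h^-1 by rewrite mulr_gt0 // (lt_le_trans N0).
have d0 : 0 < d by apply: le_lt_trans dh; rewrite mulr_ge0 ?powR_ge0 // ltW.
have dp : c3 * (h * ln h^-1) <= (d `^ (3 / 4)) ^+ 2.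
  have -> : (d `^ (3 / 4)) ^+ 2 = d `^ (3 / 2).
    by rewrite -powR_mulrn ?powR_ge0 // -powRrM; congr (_ `^ _); field.
  have -> : c3 * (h * ln h^-1) = (COm * (h * ln h^-1) `^ (2 / 3)) `^ (3 / 2).
    rewrite powRM ?powR_ge0 ?(ltW C0) // -powRrM.
    by rewrite (_ : 2 / 3 * (3 / 2) = 1 :> R) ?powRr1 ?(ltW X0) //; field.
  apply: ge0_ler_powR; rewrite ?nnegrE ?divr_ge0 ?(ltW d0) ?(ltW dh) //.
  by rewrite mulr_ge0 ?powR_ge0 // ltW.
have v2 : (h `^ (1 / 2)) ^+ 2 = h.
  by rewrite -powR_mulrn ?powR_ge0 // -powRrM (_ : 1 / 2 * 2%:R = 1 :> R) ?powRr1 ?(ltW h0) //; field.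
apply: le_of_sqr; first exact: ltW.
rewrite exprMn v2 powRN exprVn mulrC ler_pdivrMr; last by rewrite exprn_gt0 // powR_gt0.
apply: (@le_trans _ _ (eps ^+ 2 * (c3 * (h * ln h^-1)))); last by rewrite ler_wpM2l // sqr_ge0.
have -> : eps ^+ 2 * (c3 * (h * ln h^-1)) = h * (eps ^+ 2 * c3 * ln h^-1) by ring.
rewrite ler_peMr ?(ltW h0) //.
have EN : eps ^+ 2 * c3 * N = 1 by rewrite /N mulfV // gt_eqF // mulr_gt0 // exprn_gt0.
by rewrite -EN ler_wpM2l // mulr_ge0 ?sqr_ge0 // ltW.
Unshelve. all: by end_near. Qed.

(** For kappa >= 5 the exponential is at most h^(9/2), and the prefactor sqrt h brings delta below
    h^5, written as a power of h^(1/2) for [absorbed_error]. *)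
Lemma coupling_bound (kappa C3 h : R) (eps0 : R -> R) : 5 <= kappa -> 1 <= C3 -> 0 < h < 1 ->
  (kappa - 2^-1) * h * ln h^-1 + C3 * h <= eps0 h ->
  0 < coupling eps0 h <= (h `^ (1 / 2)) ^+ 10.
Proof.
move=> k5 C31 /andP[h0 h1] He.
have l0 : 0 < ln h^-1 by rewrite ln_gt0 // invf_gt1.
rewrite /coupling mulr_gt0 ?sqrtr_gt0 ?expR_gt0 //=.
have vE : Num.sqrt h = h `^ (1 / 2).
  by rewrite -powR12_sqrt ?(ltW h0) // div1r.
rewrite vE exprS ler_wpM2l ?powR_ge0 //.
have -> : (h `^ (1 / 2)) ^+ 9 = expR (- (9 / 2 * ln h^-1)).
  by rewrite /powR gt_eqF // -expRM_natl lnV ?posrE //; congr expR; field.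
rewrite ler_expR mulNr lerN2 ler_pdivlMr //.
apply: le_trans He; have hl : 0 < h * ln h^-1 by rewrite mulr_gt0.
have := ler_wpM2r (ltW hl) k5; have := ler_wpM2r (ltW h0) C31.
move: h0 hl; clear => *; lra.
Qed.

Lemma normcN (c : R[i]) : normc (- c) = normc c.
Proof. by case: c => p q; rewrite /= !sqrrN. Qed.

Lemma normcD (x y : R[i]) : normc (x + y) <= normc x + normc y.
Proof. by case: x => a b; case: y => c d; exact: nrmD. Qed.

End Asymptotics.

(** * Comparison of Psi_2 with Theta *)

Theorem proposition2p16 (R : realType) (g : R -> R[i]) (a b : R)
    (hg : admissible_symbol g a b)
    (xp xm : R[i] -> R) (hx : base_points g xp xm)
    (Om : R -> set R[i]^o) (COm : R) (hCOm : 0 < COm)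
    (hOm : admissible_domain g Om COm) :
  exists2 kappa0 : R, 0 < kappa0 &
  forall kappa : R, kappa0 <= kappa ->
  exists2 C30 : R, 0 < C30 &
  forall C3 : R, C30 <= C3 ->
  forall eps0 : R -> R, coupling_exponent g xp xm kappa C3 eps0 ->
  forall (t0 : R -> R[i] -> R) (e0 f0 : R -> R[i] -> R -> R[i])
    (chi : R -> R -> R) (Psi2 Theta : R -> R[i] -> R),
  ground_states g Om t0 e0 f0 ->
  cutoff g xp xm Om chi ->
  Psi2_form g Om e0 f0 (coupling eps0) Psi2 ->
  Theta_form g Om chi e0 f0 (coupling eps0) Theta ->
  exists2 C0 : R, 0 < C0 &
  forall C : R, C0 <= C ->
  let OmC : R -> set R[i]^o := fun h =>
    [set z | Om h z /\ C^-1 < `|complex.Im z - mean_Im g|] in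
  exists r1 r2 : R -> R[i] -> R,
  [/\ unif_O OmC r1 (fun h z => dist_bd g z `^ (- (3 / 4)) * h `^ (1 / 2)),
      unif_O OmC r2 (fun h z => dist_bd g z `^ (5 / 4)) &
      \forall h \near 0^'+, forall z, OmC h z ->
        Psi2 h z * expR (- Theta h z) =
          (`|dIm_action g xp xm z| ^+ 2 / h ^+ 2 * Theta h z * (1 + r1 h z)
             + r2 h z) * expR (- Theta h z)].
Proof.
exists 5 => // kappa hkappa; exists 1 => // C3 hC3 eps0 [heps _] t0 e0 f0 chi Psi2 Theta HGS Hcut.
move=> [r [[Kr Kr0 Hr] HPsi]] [r1 [r2 [r3 [rt [[K1 K10 Hr1] Hr2 [Kt Kt0 Hrt] [K3 K30 Hr3] HTh]]]]].
have F1 (B h t L : R) : L != 0 -> h != 0 -> B * h / L - t = (B - t / h * L) * (h / L).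
  by move=> L0 h0; field; rewrite L0 h0.
have F2 (K sg h t L : R) : L != 0 -> h != 0 -> K * sg * (t / h) * (h / L) = sg * (K * t / L).
  by move=> L0 h0; field; rewrite L0 h0.
have F3 (et N K t L : R) : L != 0 -> et * (N * L) * (K * t / L) = K * N * (et * t).
  by move=> L0; field.
exists 1 => // C hC OmC.
(* The first order of the O(h^infinity) error is enough, since h is at most U0^3 d^(-3/4) h^(1/2)
   for small h. *)
have [K2 K20 Hr2'] := Hr2 1%N.
have [M [c [c0 Hchi]]] := Hcut.
have hgs : csmooth_circle g by case: hg.
have HP := admissible_profile hg.
set G := fun x : R => complex.Im (g x) in HP.
have C0 : 0 < C by exact: lt_le_trans hC.
have de0 : 0 < C^-1 by rewrite invr_gt0.
have [ka [K [ka0 K0 HO]]] := overlap_estimate hgs HP de0.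
have [Kw Kw0 HW] := level_width HP.
have [Kw' Kw'0 HW'] := level_width (profile_swap HP).
have [_ _ _ per /andP[ab ba] mG rG Gb0 _ _ _ _] := HP.
have T0 := @two_pi_gt0 R.
set T : R := 2 * pi in T0.
set M0 := mean_Im g.
pose d z := dist_bd g z.
pose eta h z := d z `^ (- (3 / 4)) * h `^ (1 / 2).
pose Z h z := `|dIm_action g xp xm z| ^+ 2 / h ^+ 2 * Theta h z.
pose U0 := 1 + G b.
have U01 : 1 <= U0 by rewrite lerDl ltW.
have U00 : 0 < U0 by exact: lt_le_trans U01.
pose M' := `|M|.
have M'0 : 0 <= M' by exact: normr_ge0.
(* The five sources of relative error: the overlap, the cut-off, and the remainders [r], [r2],
   [r3]. *)
pose Ke := K * (Kw + Kw') + (1 + 2 * M') * K / c + Kr + K2 * U0 ^+ 3 + K3 * Kt.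
have k1 : 0 < K * (Kw + Kw') by rewrite mulr_gt0 // addr_gt0.
have k2 : 0 < (1 + 2 * M') * K / c by rewrite divr_gt0 // mulr_gt0 // ltr_pwDl // mulr_ge0.
have k3 : 0 < K2 * U0 ^+ 3 by rewrite mulr_gt0 // exprn_gt0.
have k4 : 0 < K3 * Kt by rewrite mulr_gt0.
have [KeE [e1 e2 e3 e4 e5]] : Ke = Ke /\ [/\ K * (Kw + Kw') <= Ke, (1 + 2 * M') * K / c <= Ke, Kr <= Ke,
    K2 * U0 ^+ 3 <= Ke & K3 * Kt <= Ke].
  split => //; rewrite /Ke; move: (K * (Kw + Kw')) ((1 + 2 * M') * K / c) (K2 * U0 ^+ 3) (K3 * Kt) k1 k2 k3 k4 Kr0; clear => *.
  by split; lra.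
have Ke0 : 0 < Ke by exact: lt_le_trans k1 e1.
move: Ke {KeE} e1 e2 e3 e4 e5 Ke0 => Ke e1 e2 e3 e4 e5 Ke0.
pose Kf := 16 * Ke + 3 + 3 * (T ^+ 2 * K1 ^+ 2 * (1 + U0) * U0 ^+ 5).
have k5 : 0 <= T ^+ 2 * K1 ^+ 2 * (1 + U0) * U0 ^+ 5.
  exact: mulr_ge0 (mulr_ge0 (mulr_ge0 (sqr_ge0 _) (sqr_ge0 _)) (addr_ge0 ler01 (ltW U00))) (exprn_ge0 _ (ltW U00)).
have Kf0 : 0 < Kf.
  by rewrite /Kf; move: (T ^+ 2 * K1 ^+ 2 * (1 + U0) * U0 ^+ 5) k5 Ke0; clear => *; lra.
(* All the analysis goes into this one inequality; the two errors of the statement are separated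
   afterwards by [split_error]. *)
have claim : \forall h \near 0^'+, forall z, OmC h z ->
    [/\ 0 <= eta h z, 0 < d z `^ (5 / 4), 0 <= Z h z &
      `|Psi2 h z - Z h z| <= Kf * eta h z * Z h z + Kf * d z `^ (5 / 4)].
  (* The bound by [ka] yields sg <= ka k, and the bound by 16^-1 / Ke is the smallness asked by
     [relative_estimate]. *)
  pose s1 := Num.min (Num.min ka 1) (16^-1 / Ke).
  have s10 : 0 < s1 by rewrite !lt_min ka0 ltr01 divr_gt0 // invr_gt0.
  have small := small_parameter hCOm s10.
  (* This ensures h^(1/2) <= T C^-1 / U0; the Floquet factor, at most h / (T C^-1), is then below
     [sg]. *)
  pose s2 := Num.min (T * C^-1 / U0) 1.
  have s20 : 0 < s2 by rewrite lt_min ltr01 andbT divr_gt0 // mulr_gt0.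
  near=> h => z [Oz Cz].
  have h0 : 0 < h by near: h; exact: nbhs_right_gt.
  have h1 : h < 1 by near: h; exact: nbhs_right_lt.
  have hs : h <= s2 ^+ 2 by near: h; apply: nbhs_right_le; exact: exprn_gt0.
  have hT : h <= T * C^-1 / 100 by near: h; apply: nbhs_right_le; apply: divr_gt0; [exact: mulr_gt0|rewrite ltr0n].
  have [_ _ Osub Odist] : [/\ open (Om h), compact (closure (Om h)), closure (Om h) `<=` Sigma g &
    ((COm * (h * ln h^-1) `^ (2 / 3))%:E < set_dist (Om h) (boundary (Sigma g)))%E] by near: h; exact: hOm.
  have [GS _ _] : [/\ forall z, Om h z ->
      [/\ 0 <= t0 h z,
          lowest_simple_eigenvalue (Q_op g h z) (t0 h z ^+ 2),
          lowest_simple_eigenvalue (Qt_op g h z) (t0 h z ^+ 2),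
          eigenfunction (Q_op g h z) (t0 h z ^+ 2) (e0 h z) /\
            L2norm (e0 h z) = 1 &
          eigenfunction (Qt_op g h z) (t0 h z ^+ 2) (f0 h z) /\
            L2norm (f0 h z) = 1],
      smooth_L2_family (Om h) (e0 h) &
      smooth_L2_family (Om h) (f0 h)] by near: h; exact: HGS.
  have [chis chiM chiz] : [/\ smooth_circle (chi h), forall x, `|chi h x| <= M &
      forall z x, Om h z ->
        (`|x - xm z| < c * Num.sqrt (dist_bd g z) -> chi h x = 1) /\
        (`|x - xp z| < c * Num.sqrt (dist_bd g z) -> chi h x = 0)] by near: h; exact: Hchi.
  have hr : forall z, Om h z -> `|r h z| <= Kr * (dist_bd g z `^ (- (3 / 4)) * h `^ (1 / 2)) by near: h; exact: Hr.
  have hPsi : forall z, Om h z -> Psi2 h z =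
      (coupling eps0 h) ^- 2 * normc (dotp (e0 h z) (f0 h z)) ^+ 2 * (1 + r h z) by near: h; exact: HPsi.
  have hr1 : forall z, Om h z -> `|normc (r1 h z)| <= K1 * (dist_bd g z `^ (- (1 / 4)) * h `^ (- (5 / 2)) * coupling eps0 h ^+ 2)
    by near: h; exact: Hr1.
  have hr2 : forall z, Om h z -> `|r2 h z| <= K2 * h ^+ 1 by near: h; exact: Hr2'.
  have hrt : forall z, Om h z -> Kt^-1 * dist_bd g z `^ (3 / 2) <= rt h z <= Kt * dist_bd g z `^ (3 / 2) by near: h; exact: Hrt.
  have hr3 : forall z, Om h z -> `|r3 h z| <= K3 * expR (- rt h z / h) by near: h; exact: Hr3.
  have hTh : forall z, Om h z -> exists2 w, op_comm (P_op g h) (chi h) (e0 h z) w &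
          Theta h z = normc (dotp w (f0 h z) + r1 h z) ^+ 2
                      / (coupling eps0 h ^+ 2 * (1 + r2 h z)) * (1 + r3 h z) by near: h; exact: HTh.
  have he : (kappa - 2^-1) * h * ln h^-1 + C3 * h <= eps0 h by near: h; exact: heps.
  have hsm : forall d, COm * (h * ln h^-1) `^ (2 / 3) < d -> d `^ (- (3 / 4)) * h `^ (1 / 2) <= s1 by near: h; exact: small.
  have [t00 Q1 Q2 [He ne] [Hf nf]] := GS z Oz.
  have [w Hw ETh] := hTh z Oz.
  have r00 : 0 <= COm * (h * ln h^-1) `^ (2 / 3) by rewrite mulr_ge0 ?powR_ge0 // ltW.
  have [zint dlow dy1 dy2] := domain_facts hg r00 Osub Odist Oz.
  have etas := hsm _ dlow.
  have h01 : 0 < h < 1 by rewrite h0.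
  have /andP[dl0 dlv] := coupling_bound hkappa hC3 h01 he.
  set y := complex.Im z in dy1 dy2 Cz *; set t := t0 h z in t00 Q1 Q2 He Hf *.
  have zz : 0 < y < G b := Sigma_interior hg zint.
  pose dz := dist_bd g z; have d0 : 0 < dz by exact: le_lt_trans dlow.
  (* In terms of u = d^(1/4) and v = h^(1/2) all fractional powers become integral ones. *)
  pose u := dz `^ (1 / 4); pose v := h `^ (1 / 2).
  have u0 : 0 < u by exact: powR_gt0.
  have v0 : 0 < v by exact: powR_gt0.
  have dE : dz = u ^+ 4 by rewrite -powR_fraction ?(ltW d0) // mulfV ?powRr1 ?(ltW d0).
  have hE : h = v ^+ 2 by rewrite -powR_fraction ?(ltW h0) // mulfV ?powRr1 ?(ltW h0).
  have p34 : dz `^ (- (3 / 4)) = (u ^+ 3)^-1 by rewrite powRN powR_fraction // ltW.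
  have p54 : dz `^ (5 / 4) = u ^+ 5 by rewrite powR_fraction // ltW.
  have p14 : dz `^ (- (1 / 4)) = u^-1 by rewrite powRN.
  have p52 : h `^ (- (5 / 2)) = (v ^+ 5)^-1 by rewrite powRN powR_fraction // ltW.
  have p32 : dz `^ (3 / 2) = u ^+ 6.
    by rewrite -powR_fraction ?(ltW d0) //; congr (_ `^ _); field.
  have etaE : eta h z = v / u ^+ 3 by rewrite /eta -/dz p34 mulrC.
  have etaE' : dz `^ (- (3 / 4)) * h `^ (1 / 2) = v / u ^+ 3 := etaE.
  rewrite -/dz etaE' in etas.
  set et := v / u ^+ 3 in etaE etaE' etas.
  have u3 : 0 < u ^+ 3 by rewrite exprn_gt0.
  have et0 : 0 < et by rewrite divr_gt0.
  have [et1 et2 et3] : [/\ et <= ka, et <= 1 & Ke * et <= 16^-1].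
    move: etas; rewrite /s1 !le_min => /andP[/andP[q1 q2] q3]; split => //.
    by rewrite mulrC -ler_pdivlMr.
  have [vs v1] : v <= T * C^-1 / U0 /\ v <= 1.
    have : v <= s2 by apply: le_of_sqr; [exact: ltW|rewrite -hE].
    by rewrite /s2 le_min => /andP[].
  have small4 (x : R) : 0 <= x -> x ^+ 4 <= G b -> x <= U0.
    move=> x0 xG; have [x1|/ltW x1] := leP x 1; first exact: le_trans x1 U01.
    have : x <= x ^+ 4 by rewrite exprS ler_peMr // exprn_ege1.
    by move=> /le_trans; apply; apply: le_trans xG _; rewrite lerDr.
  have yG : y <= G b by case/andP: zz => _ /ltW.
  have uU : u <= U0 by apply: small4; [exact: ltW|rewrite -dE; exact: le_trans dy1 yG].
  have vu3 : v <= u ^+ 3 by rewrite -[u ^+ 3]mul1r -ler_pdivrMr.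
  have vu : v <= u ^+ 2.
    have [x1|/ltW x1] := leP u 1; last by apply: le_trans v1 _; exact: exprn_ege1.
    by apply: le_trans vu3 _; rewrite exprS ler_piMl // sqr_ge0.
  (* The distance of Im z to the edge of the strip on its side of the mean; it is at least d, so
     k^(1/2) >= u. *)
  pose yy := if y < M0 then y else G b - y.
  have dyy : dz <= yy by rewrite /yy; case: ifP.
  have yy0 : 0 < yy by exact: lt_le_trans dyy.
  have yyG : yy <= G b by rewrite /yy; case: ifP => // _; rewrite gerBl ltW //; case/andP: zz.
  pose k := Num.sqrt yy; pose ks := Num.sqrt k.
  have kk0 : 0 < k by rewrite sqrtr_gt0.
  have ks0 : 0 < ks by rewrite sqrtr_gt0.
  have k2E : k ^+ 2 = yy by rewrite sqr_sqrtr // ltW.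
  have ksE : ks ^+ 2 = k by rewrite sqr_sqrtr // ltW.
  have ks4 : ks ^+ 4 = yy by rewrite -k2E -ksE -exprM.
  have uks : u <= ks.
    by rewrite -(@ler_pXn2r _ 4) ?nnegrE ?(ltW u0) ?(ltW ks0) // ks4 -dE.
  have ksU : ks <= U0 by apply: small4; [exact: ltW|rewrite ks4].
  pose sg := v / ks; have sg0 : 0 < sg by rewrite divr_gt0.
  have un : u != 0 by rewrite gt_eqF.
  have vn : v != 0 by rewrite gt_eqF.
  have ksn : ks != 0 by rewrite gt_eqF.
  have sgE : sg ^+ 2 * k = h by rewrite -ksE hE /sg; field.
  (* sg / k = v / k^(3/2) is at most v / u^3: this is the origin of the error d^(-3/4) h^(1/2). *)
  have sgk : sg <= et * k.
    rewrite -ksE /sg /et ler_pdivrMr // (_ : v / u ^+ 3 * ks ^+ 2 * ks = v * (ks ^+ 3 / u ^+ 3)); last by field.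
    by rewrite ler_peMr ?(ltW v0) // ler_pdivlMr // mul1r lerXn2r // nnegrE ltW.
  have sgka : sg <= ka * k by apply: le_trans sgk _; rewrite ler_pM2r.
  have dey : C^-1 <= `|y - M0| by exact: ltW.
  have q0 : 0 < `|y - M0| by exact: lt_le_trans de0 dey.
  have TC0 : 0 < T * C^-1 by rewrite mulr_gt0.
  have expb : expR (- (T * `|y - M0| / h)) <= h / (T * C^-1).
    have Tq : 0 < T * `|y - M0| by exact: mulr_gt0.
    apply: le_trans (expRN_le_inv _) _; first exact: divr_gt0.
    rewrite invf_div; apply: (ler_wpM2l (ltW h0)); rewrite lef_pV2 ?posrE //.
    exact: (ler_wpM2l (ltW T0) dey).
  have m1 : expR (- (T * `|y - M0| / h)) <= sg.
    apply: le_trans expb _; rewrite hE /sg ler_pdivrMr // mulrAC ler_pdivlMr //.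
    rewrite expr2 -mulrA ler_wpM2l ?(ltW v0) //.
    apply: le_trans (ler_wpM2l (ltW v0) ksU) _.
    by rewrite -ler_pdivlMr.
  have m2 : expR (- (T * `|y - M0| / h)) <= 100^-1.
    by apply: le_trans expb _; rewrite ler_pdivrMr // mulrC.
  have [U [V [j [EU EV U1 V1 [GU GV]]]]] := level_roots hg hx zz.
  have [tp HB HA] := HO h z U V k sg t (e0 h z) (f0 h z) h0 dey kk0 k2E sg0 sgE sgka m1 m2 U1 V1 GU GV t00 Q1 Q2 He ne Hf nf.
  rewrite -/y -/M0 in HB.
  set L := (if y < M0 then V - U else T - (V - U)) in HB.
  have [L0 LT kL] : [/\ 0 < L, L <= T & k <= (Kw + Kw') * L].
    have UV : 0 < V - U by rewrite subr_gt0; case/andP: U1 => _ u2; case/andP: V1 => v1' _; exact: lt_trans u2 v1'.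
    have VUT : V - U < T by rewrite -/T in U1; move: (andP U1) (andP V1); clear => -[? _] [_ ?]; lra.
    rewrite /L; have [lt|le] := ltP y M0.
      split => //; first exact: ltW.
      have kU : k ^+ 2 = G U by rewrite k2E /yy lt; symmetry; exact: GU.
      apply: le_trans (HW k U V U1 V1 kk0 kU) _; by rewrite ler_wpM2r ?(ltW UV) // lerDl ltW.
    have TVU : 0 < T - (V - U) by rewrite subr_gt0.
    split => //; first by rewrite gerBl ltW.
    have kV : k ^+ 2 = G b - G V by rewrite k2E /yy ltNge le /=; congr (_ - _); symmetry; exact: GV.
    have c1 : a + T - T < V < b by rewrite addrK.
    have c2 : b < U + T < a + T by rewrite -ltrBlDr ltrD2r.
    have := HW' k V (U + T) c1 c2 kk0 kV.
    have -> : U + T - V = T - (V - U) by ring.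
    by move=> /le_trans; apply; rewrite ler_wpM2r ?(ltW TVU) // lerDr ltW.
  have dL : `|dIm_action g xp xm z| = L.
    have yM : y != M0 by rewrite -subr_eq0 -normr_eq0 gt_eqF.
    rewrite (dIm_action_width hg hx zz yM) -/M0 -/y.
    have -> : xm z - xp z = V - U by rewrite EU EV; ring.
    move: L0; rewrite /L; case: ifP => _ L0; first by rewrite subr0 gtr0_norm.
    by rewrite distrC gtr0_norm.
  have sqd : Num.sqrt dz = u ^+ 2.
    have -> : dz = (u ^+ 2) ^+ 2 by rewrite dE -exprM.
    by rewrite sqrtr_sqr ger0_norm // sqr_ge0.
  have u2 : 0 < u ^+ 2 by rewrite exprn_gt0.
  have r0 : 0 < c * u ^+ 2 by rewrite mulr_gt0.
  (* U and V are translates of [xp z] and [xm z] by the same multiple of the period, so the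
     properties of the cut-off are carried over by periodicity. *)
  have pchi (x : R) : chi h (x - T * j%:~R) = chi h x.
    have [pc _] := chis.
    have e : x = x - T * j%:~R + T * j%:~R by rewrite subrK.
    by rewrite [RHS](congr1 (chi h) e); symmetry; exact: periodic_int.
  have cm x : `|x - V| < c * u ^+ 2 -> chi h x = 1.
    have [H _] := chiz z (x - T * j%:~R) Oz; rewrite -/dz sqd pchi in H.
    by move=> xV; apply: H; have -> : x - T * j%:~R - xm z = x - V by rewrite EV opprD addrA addrAC.
  have cp x : `|x - U| < c * u ^+ 2 -> chi h x = 0.
    have [_ H] := chiz z (x - T * j%:~R) Oz; rewrite -/dz sqd pchi in H.
    by move=> xV; apply: H; have -> : x - T * j%:~R - xp z = x - U by rewrite EU opprD addrA addrAC.
  have chiM' x : `|chi h x| <= M' by apply: le_trans (chiM x) (ler_norm _).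
  have HA' := HA (chi h) w (c * u ^+ 2) M' chis Hw r0 chiM' cm cp.
  move: HA' => {}HA.
  set A := normc (dotp w (f0 h z)) in HA.
  set B := normc (dotp (e0 h z) (f0 h z)) in HB.
  set dl := coupling eps0 h in dl0 dlv.
  have dln : dl != 0 by rewrite gt_eqF.
  have Ln : L != 0 by rewrite gt_eqF.
  have hn : h != 0 by rewrite gt_eqF.
  have e0' : 0 <= Ke * et <= 16^-1 by rewrite et3 mulr_ge0 // ltW.
  (* The overlap rescaled so as to be compared with t, as is [A]. *)
  pose bb := B * h / L.
  have Hb : `|bb - t| <= Ke * et * t.
    rewrite /bb F1 //.
    rewrite normrM [X in _ * X]gtr0_norm ?divr_gt0 //.
    have hL : 0 <= h / L by rewrite divr_ge0 // ltW.
    apply: le_trans (ler_wpM2r hL HB) _.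
    rewrite F2 //.
    have KtL : 0 <= K * t / L by rewrite divr_ge0 ?mulr_ge0 // ltW.
    have sgL : sg <= et * ((Kw + Kw') * L) by apply: le_trans sgk _; rewrite ler_wpM2l // ltW.
    apply: le_trans (ler_wpM2r KtL sgL) _.
    rewrite F3 //.
    by rewrite -(mulrA Ke) ler_wpM2r // mulr_ge0 // ltW.
  have HA1 : `|A - t| <= Ke * et * t.
    apply: le_trans HA _; rewrite mulrC ler_wpM2r //.
    have sgu : sg / u ^+ 2 <= et.
      rewrite /sg /et -mulrA -invfM ler_wpM2l ?(ltW v0) // lef_pV2 ?posrE ?mulr_gt0 //.
      by rewrite exprS ler_wpM2r // ltW.
    rewrite (_ : _ / _ = (1 + 2 * M') * K / c * (sg / u ^+ 2)); last by field; rewrite un gt_eqF.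
    apply: le_trans (ler_wpM2l (ltW k2) sgu) _.
    by rewrite ler_wpM2r // ltW.
  have b1 : `|r h z| <= Ke * et.
    by apply: le_trans (hr z Oz) _; rewrite -/dz etaE' ler_wpM2r // ltW.
  have b2 : `|r2 h z| <= Ke * et.
    apply: le_trans (hr2 z Oz) _; rewrite expr1 hE.
    apply: (@le_trans _ _ (K2 * U0 ^+ 3 * et)); last by rewrite ler_wpM2r // ltW.
    rewrite -mulrA ler_wpM2l ?(ltW K20) // /et mulrA ler_pdivlMr // mulrC.
    apply: ler_pM; rewrite ?exprn_ge0 ?(ltW u0) ?(ltW v0) //.
      by rewrite lerXn2r // nnegrE ltW.
    by rewrite expr2 ler_piMl // ltW.
  have b3 : `|r3 h z| <= Ke * et.
    apply: le_trans (hr3 z Oz) _; have /andP[rl _] := hrt z Oz; rewrite -/dz p32 in rl.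
    have rt0 : 0 < Kt^-1 * u ^+ 6 by rewrite mulr_gt0 ?invr_gt0 // exprn_gt0.
    (* The inequality e^(-x) <= 1 / x turns the exponentially small error into a multiple of h /
       d^(3/2), the square of [et]. *)
    have ex : expR (- rt h z / h) <= Kt * et.
      apply: (@le_trans _ _ (expR (- (Kt^-1 * u ^+ 6 / h)))).
        by rewrite ler_expR mulNr lerN2 ler_wpM2r // invr_ge0 ltW.
      apply: le_trans (expRN_le_inv _) _; first by rewrite divr_gt0.
      have -> : (Kt^-1 * u ^+ 6 / h)^-1 = Kt * (et * et).
        by rewrite hE /et; field; rewrite un vn gt_eqF.
      by rewrite ler_wpM2l ?(ltW Kt0) // ler_piMl // ltW.
    apply: le_trans (ler_wpM2l (ltW K30) ex) _; by rewrite mulrA ler_wpM2r // ltW.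
  set n := normc (r1 h z).
  have n0 : 0 <= n by exact: normc_ge0.
  have nb : n <= K1 * (u^-1 * (v ^+ 5)^-1 * dl ^+ 2).
    by apply: le_trans (ler_norm _) _; apply: le_trans (hr1 z Oz) _; rewrite -/dz p14 p52.
  set N := normc (dotp w (f0 h z) + r1 h z) in ETh.
  have AN : `|A - N| <= n.
    rewrite ler_norml; apply/andP; split.
      by have := normcD (dotp w (f0 h z)) (r1 h z); rewrite -/A -/N -/n; clear; move: N A n => *; lra.
    have := normcD (dotp w (f0 h z) + r1 h z) (- r1 h z); rewrite addrK normcN -/A -/N -/n; clear; move: N A n => *; lra.
  have [Z0 RE] := relative_estimate tp (normc_ge0 _) n0 et0 e0' Hb HA1 AN b1 b2 b3.
  rewrite -/N in Z0 RE; set Z' := N ^+ 2 / _ * _ in Z0 RE.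
  have L0T : 0 <= L <= T by rewrite LT ltW.
  have v01 : 0 < v <= 1 by rewrite v0.
  have AE := absorbed_error u0 v01 dl0 dlv vu uU n0 (ltW K10) nb L0T.
  rewrite -/et in AE.
  set X := (L / v ^+ 2) ^+ 2 / dl ^+ 2 in AE.
  have X0 : 0 <= X by rewrite divr_ge0 ?sqr_ge0.
  have r2n : 1 + r2 h z != 0.
    rewrite gt_eqF //; move/ler_normlP: b2 => [b2 _]; move: b2 et3; clear => *; lra.
  have EPsi : Psi2 h z = X * (bb ^+ 2 * (1 + r h z)).
    rewrite (hPsi z Oz) -/B -/dl /X /bb hE; field.
    by rewrite vn dln Ln.
  have EZ : Z h z = X * Z'.
    rewrite /Z dL ETh -/dl /X /Z' hE; field.
    by rewrite -hE r2n vn dln.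
  have d54 : d z `^ (5 / 4) = u ^+ 5 := p54.
  rewrite [X in Kf * X * _]etaE [X in 0 <= X]etaE d54 EZ EPsi; split.
  - exact: ltW.
  - by rewrite exprn_gt0.
  - exact: mulr_ge0.
  rewrite -mulrBr normrM (ger0_norm X0).
  apply: le_trans (ler_wpM2l X0 RE) _.
  move: AE k5 (mulr_ge0 (ltW et0) (mulr_ge0 X0 Z0)) (exprn_ge0 5 (ltW u0)) (ltW Ke0); rewrite /Kf.
  move: (n ^+ 2 * (1 + et^-1)) (T ^+ 2 * K1 ^+ 2 * (1 + U0) * U0 ^+ 5) (u ^+ 5); clear.
  move=> Y Q u5 AE Q0 XZ u50 Ke0.
  have := mulr_ge0 Q0 XZ; have := mulr_ge0 Ke0 u50; move: AE XZ u50.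
  clear Q0 Ke0; move: Z' X et Ke => z' x e k; clear => *.
  lra.
pose D h z := Kf * eta h z * Z h z + Kf * d z `^ (5 / 4).
exists (fun h z => Kf * eta h z * (Psi2 h z - Z h z) / D h z), (fun h z => Kf * d z `^ (5 / 4) * (Psi2 h z - Z h z) / D h z).
have split_claim h z : [/\ 0 <= eta h z, 0 < d z `^ (5 / 4), 0 <= Z h z &
      `|Psi2 h z - Z h z| <= Kf * eta h z * Z h z + Kf * d z `^ (5 / 4)] ->
    [/\ `|Kf * eta h z * (Psi2 h z - Z h z) / D h z| <= Kf * eta h z,
        `|Kf * d z `^ (5 / 4) * (Psi2 h z - Z h z) / D h z| <= Kf * d z `^ (5 / 4) &
        Psi2 h z = Z h z * (1 + Kf * eta h z * (Psi2 h z - Z h z) / D h z) + Kf * d z `^ (5 / 4) * (Psi2 h z - Z h z) / D h z].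
  move=> [E0 D0 Z0 H].
  exact: split_error Z0 (mulr_ge0 (ltW Kf0) E0) (mulr_gt0 Kf0 D0) H.
split.
- exists Kf => //; apply: filterS claim => h H z Hz.
  by have [] := split_claim h z (H z Hz).
- exists Kf => //; apply: filterS claim => h H z Hz.
  by have [] := split_claim h z (H z Hz).
apply: filterS claim => h H z Hz; have [_ _ E] := split_claim h z (H z Hz).
by rewrite {1}E.
Unshelve. all: by end_near. Qed.
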